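(* Let $C\subset\mathbb{R}^3$ be a bounded domain with regular (smooth) boundary which is strictly convex (principal curvatures of $\partial C$ with respect to the inward unit normal are positive everywhere), and let $K\subset\partial C$ be a connected compact set. Then for each $\varepsilon>0$ there exists a complete proper minimal immersion $\psi:\mathbb{D}\to C$ such that $\delta^H(\psi(\partial\mathbb{D}),K)<\varepsilon$.
   Context: Proper: preimages of compact subsets of $C$ are compact. Complete: the induced metric on $\mathbb{D}$ is complete. The limit set is $\psi(\partial\mathbb{D}):=\overline{\psi(\mathbb{D})}\setminus\psi(\mathbb{D})$. For nonempty compact sets $A,B\subset\mathbb{R}^3$, $\delta^H(A,B)=\max\{\sup_{x\in A}\inf_{y\in B}\|x-y\|,\ \sup_{y\in B}\inf_{x\in A}\|x-y\|\}$ is the Hausdorff distance. *)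

(* Defs.v *)
From Stdlib Require Import Reals List.
From Coquelicot Require Import Coquelicot.
Open Scope R_scope.

Definition R2 : Type := (R * R)%type.
Definition R3 : Type := (R * R * R)%type.

Definition x1 (p : R3) : R := fst (fst p).
Definition x2 (p : R3) : R := snd (fst p).
Definition x3 (p : R3) : R := snd p.
Definition mk3 (a b c : R) : R3 := (a, b, c).

Definition dot3 (a b : R3) : R := x1 a * x1 b + x2 a * x2 b + x3 a * x3 b.
Definition cross3 (a b : R3) : R3 :=
  mk3 (x2 a * x3 b - x3 a * x2 b) (x3 a * x1 b - x1 a * x3 b) (x1 a * x2 b - x2 a * x1 b).
Definition norm3 (a : R3) : R := sqrt (dot3 a a).
Definition dist3 (a b : R3) : R := norm3 (mk3 (x1 a - x1 b) (x2 a - x2 b) (x3 a - x3 b)).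

Definition dirs2 : list R2 := (1, 0) :: (0, 1) :: nil.
Definition e3_1 : R3 := mk3 1 0 0.
Definition e3_2 : R3 := mk3 0 1 0.
Definition e3_3 : R3 := mk3 0 0 1.
Definition dirs3 : list R3 := e3_1 :: e3_2 :: e3_3 :: nil.

Definition pd {V : NormedModule R_AbsRing} (e : V) (f : V -> R) (x : V) : R :=
  Derive (fun t => f (plus x (scal t e))) 0.

Fixpoint Ck {V : NormedModule R_AbsRing} (dirs : list V) (n : nat)
  (U : V -> Prop) (f : V -> R) : Prop :=
  match n with
  | O => forall x, U x -> continuous f x
  | S m => (forall x, U x -> continuous f x) /\
      List.Forall (fun e => (forall x, U x -> ex_derive (fun t => f (plus x (scal t e))) 0)
                       /\ Ck dirs m U (pd e f)) dirs
  end.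

Definition smooth {V : NormedModule R_AbsRing} (dirs : list V) (U : V -> Prop) (f : V -> R) :=
  forall n, Ck dirs n U f.

Definition compact_set {T : UniformSpace} (S : T -> Prop) : Prop :=
  forall (I : Type) (U : I -> T -> Prop), (forall i, open (U i)) ->
    (forall x, S x -> exists i, U i x) ->
    exists l : list I, forall x, S x -> exists i, In i l /\ U i x.

Definition connected_set {T : UniformSpace} (S : T -> Prop) : Prop :=
  forall U V : T -> Prop, open U -> open V ->
    (forall x, S x -> U x \/ V x) ->
    (forall x, S x -> U x -> V x -> False) ->
    (exists x, S x /\ U x) -> (exists x, S x /\ V x) -> False.

Definition closure3 (S : R3 -> Prop) (x : R3) : Prop :=
  forall eps, 0 < eps -> exists y, S y /\ dist3 x y < eps.

Definition boundary3 (S : R3 -> Prop) (x : R3) : Prop := closure3 S x /\ ~ S x.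

Definition bounded3 (S : R3 -> Prop) : Prop := exists M, forall x, S x -> norm3 x <= M.

Definition bounded_domain (C : R3 -> Prop) : Prop :=
  open C /\ connected_set C /\ (exists x, C x) /\ bounded3 C.

Definition grad3 (rho : R3 -> R) (x : R3) : R3 :=
  mk3 (pd e3_1 rho x) (pd e3_2 rho x) (pd e3_3 rho x).
Definition hess3 (rho : R3 -> R) (x v : R3) : R :=
  let c := fun i => match i with 1%nat => x1 v | 2%nat => x2 v | _ => x3 v end in
  let e := fun i => match i with 1%nat => e3_1 | 2%nat => e3_2 | _ => e3_3 end in
  let h := fun i j => c i * c j * pd (e i) (pd (e j) rho) x in
  h 1%nat 1%nat + h 1%nat 2%nat + h 1%nat 3%nat
  + h 2%nat 1%nat + h 2%nat 2%nat + h 2%nat 3%nat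
  + h 3%nat 1%nat + h 3%nat 2%nat + h 3%nat 3%nat.

(* C has smooth (regular) boundary, and is strictly convex: near each boundary
   point, C is the sublevel set {rho < 0} of a smooth local defining function rho
   with nonvanishing gradient, and the second fundamental form of the boundary
   w.r.t. the inward normal -grad rho/|grad rho|, namely Hess rho (v,v)/|grad rho|
   on tangent vectors v, is positive definite (all principal curvatures > 0). *)
Definition smooth_strictly_convex_boundary (C : R3 -> Prop) : Prop :=
  forall p, boundary3 C p ->
    exists r, 0 < r /\ exists rho : R3 -> R,
      smooth dirs3 (fun x => dist3 p x < r) rho /\
      (forall x, dist3 p x < r -> (C x <-> rho x < 0)) /\
      (forall x, dist3 p x < r -> grad3 rho x <> mk3 0 0 0) /\
      (forall x, dist3 p x < r -> rho x = 0 ->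
         forall v : R3, v <> mk3 0 0 0 -> dot3 v (grad3 rho x) = 0 ->
           0 < hess3 rho x v).

Definition disk (p : R2) : Prop := fst p ^ 2 + snd p ^ 2 < 1.

Definition pdv (e : R2) (psi : R2 -> R3) (p : R2) : R3 :=
  mk3 (pd e (fun q => x1 (psi q)) p) (pd e (fun q => x2 (psi q)) p) (pd e (fun q => x3 (psi q)) p).
Definition pdv2 (e e' : R2) (psi : R2 -> R3) (p : R2) : R3 :=
  mk3 (pd e (pd e' (fun q => x1 (psi q))) p) (pd e (pd e' (fun q => x2 (psi q))) p)
      (pd e (pd e' (fun q => x3 (psi q))) p).

Definition eu : R2 := (1, 0).
Definition ev : R2 := (0, 1).

Definition smooth_map (psi : R2 -> R3) : Prop :=
  smooth dirs2 disk (fun q => x1 (psi q)) /\ smooth dirs2 disk (fun q => x2 (psi q)) /\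
  smooth dirs2 disk (fun q => x3 (psi q)).

(* smooth immersion with vanishing mean curvature:
   H = (e G - 2 f F + g E) / (2 (E G - F^2)) with e,f,g computed against the
   (unnormalized) normal psi_u x psi_v; H = 0 iff the numerator vanishes. *)
Definition minimal_immersion (psi : R2 -> R3) : Prop :=
  smooth_map psi /\
  (forall p, disk p -> cross3 (pdv eu psi p) (pdv ev psi p) <> mk3 0 0 0) /\
  (forall p, disk p ->
     let Xu := pdv eu psi p in let Xv := pdv ev psi p in
     let N := cross3 Xu Xv in
     let E := dot3 Xu Xu in let F := dot3 Xu Xv in let G := dot3 Xv Xv in
     let e := dot3 (pdv2 eu eu psi p) N in
     let f := dot3 (pdv2 eu ev psi p) N in
     let g := dot3 (pdv2 ev ev psi p) N in
     e * G - 2 * f * F + g * E = 0).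

Definition C1_curve_in_disk (gamma : R -> R2) : Prop :=
  (forall t, ex_derive (fun s => fst (gamma s)) t /\ ex_derive (fun s => snd (gamma s)) t) /\
  (forall t, continuous (Derive (fun s => fst (gamma s))) t /\
             continuous (Derive (fun s => snd (gamma s))) t) /\
  (forall t, 0 <= t <= 1 -> disk (gamma t)).

Definition induced_length (psi : R2 -> R3) (gamma : R -> R2) : R :=
  RInt (fun t => norm3 (mk3 (Derive (fun s => x1 (psi (gamma s))) t)
                            (Derive (fun s => x2 (psi (gamma s))) t)
                            (Derive (fun s => x3 (psi (gamma s))) t))) 0 1.

Definition induced_dist_lt (psi : R2 -> R3) (p q : R2) (r : R) : Prop :=
  exists gamma, C1_curve_in_disk gamma /\ gamma 0 = p /\ gamma 1 = q /\
    induced_length psi gamma < r.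

Definition complete_immersion (psi : R2 -> R3) : Prop :=
  forall u : nat -> R2, (forall n, disk (u n)) ->
    (forall eps, 0 < eps -> exists N, forall m n, (N <= m)%nat -> (N <= n)%nat ->
        induced_dist_lt psi (u m) (u n) eps) ->
    exists p, disk p /\ forall eps, 0 < eps -> exists N, forall n, (N <= n)%nat ->
        induced_dist_lt psi (u n) p eps.

Definition proper_into (psi : R2 -> R3) (C : R3 -> Prop) : Prop :=
  forall K : R3 -> Prop, (forall x, K x -> C x) -> compact_set K ->
    compact_set (fun p => disk p /\ K (psi p)).

Definition image_disk (psi : R2 -> R3) (x : R3) : Prop := exists p, disk p /\ psi p = x.

(* limit set psi(dD) := closure(psi(D)) \ psi(D) *)
Definition limit_set (psi : R2 -> R3) (x : R3) : Prop :=
  closure3 (image_disk psi) x /\ ~ image_disk psi x.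

Definition hausdorff_lt (A B : R3 -> Prop) (eps : R) : Prop :=
  exists r, r < eps /\
    (forall x, A x -> forall s, r < s -> exists y, B y /\ dist3 x y < s) /\
    (forall y, B y -> forall s, r < s -> exists x, A x /\ dist3 x y < s).

(* Main.v *)
(* The surfaces are real parts of polynomial null curves [F] on the closed unit disk, in spinor form
   [F' = th (a, b) = (a^2 - b^2, i (a^2 + b^2), 2 a b)]; the induced metric has conformal factor [|a|^2 + |b|^2]. Replacing
   [(a, b)] by [(a, b) + sqrt (2N+1) z^N (c, e)] adds [z^(2N+1) th (c, e) + O(1 / sqrt N)] to [F] uniformly on the disk:
   compact parts of the open disk hardly move, each boundary point moves along a circle of radius [|c|^2 + |e|^2] in the
   real plane of [th (c, e)], and crossing a thin annulus near the boundary costs intrinsic length about [|c|^2 + |e|^2].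

   The plane can be taken nearly orthogonal to any continuous vector field along the boundary circle. If it is orthogonal
   to the displacement made so far, [n] repetitions add up like [sqrt n] in space (Pythagoras) but like [n] in intrinsic
   length, so that the intrinsic diameter grows by 1 with an arbitrarily small displacement. If it is orthogonal to the
   normal at the nearest boundary point of the domain, strict convexity turns a tangential displacement of size
   [sqrt (r0 t)] into a decrease of the depth [t] by a fixed factor; the depths of the boundary curve then decay
   geometrically and the displacements are summable. Finally, [(c, e)] can be concentrated at a point of the circle, which
   drags this point in any direction and leaves the rest in place; starting from a tiny disk and using that [K] is
   connected, this makes the boundary curve visit a net of [K] while the surface stays near [K]. Alternating depth
   reduction and lengthening from there, the limit surface is complete, proper, and close to [K] at the boundary. *)

Require Import Defs.
From Stdlib Require Import Reals List Lra Lia Classical ClassicalEpsilon.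
From Coquelicot Require Import Coquelicot.
Open Scope R_scope.

(** Coefficient lists are used because one number, the sum of [Cmod c_k * r^k], bounds a polynomial
    and, on smaller disks, its derivatives; stages that are close in this norm on growing disks
    converge together with all derivatives, and nullity passes to the limit. Spinors make nullity
    automatic, since their squares parametrize the null cone; what must be guarded is the immersion
    property, the absence of common zeros. An oscillation could create one only at a zero of the
    determinant [a e - b c], so it suffices that this does not vanish identically and that [N] is
    large. The order of choices carries the proof: direction field and amplitude, then an annulus
    where they are accurate, then [N], and, once the new surface is known, a tolerance for all later
    stages that is a fraction of its least depth. Length gained in an annulus survives because later
    stages multiply the conformal factor by at least [1 - eta] on the disks already treated. The
    direction fields are merely continuous; Bernstein approximation makes them trigonometric, and
    the negative powers of [z] are removed by a factor of modulus one on the circle. *)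

(** * Vectors in space *)

Definition vadd (a b : R3) : R3 := mk3 (x1 a + x1 b) (x2 a + x2 b) (x3 a + x3 b).
Definition vsub (a b : R3) : R3 := mk3 (x1 a - x1 b) (x2 a - x2 b) (x3 a - x3 b).
Definition vscal (k : R) (a : R3) : R3 := mk3 (k * x1 a) (k * x2 a) (k * x3 a).

Ltac vunf := unfold vadd, vsub, vscal, dot3, mk3, x1, x2, x3 in *; simpl in *.

Lemma R3_ext (a b : R3) : x1 a = x1 b -> x2 a = x2 b -> x3 a = x3 b -> a = b.
Proof. destruct a as [[? ?] ?], b as [[? ?] ?]; vunf; intros; subst; auto. Qed.

Lemma dot3_pos a : 0 <= dot3 a a.
Proof. unfold dot3; nra. Qed.

Lemma norm3_pos a : 0 <= norm3 a.
Proof. apply sqrt_pos. Qed.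

Lemma norm3_sqr a : norm3 a * norm3 a = dot3 a a.
Proof. apply sqrt_sqrt, dot3_pos. Qed.

Lemma norm3_le_sqr a r : 0 <= r -> dot3 a a <= r * r -> norm3 a <= r.
Proof. intros; pose proof (norm3_sqr a); pose proof (norm3_pos a); nra. Qed.

Lemma norm3_lt_sqr a r : 0 <= r -> dot3 a a < r * r -> norm3 a < r.
Proof. intros; pose proof (norm3_sqr a); pose proof (norm3_pos a); nra. Qed.

Lemma dot3_cauchy a b : Rabs (dot3 a b) <= norm3 a * norm3 b.
Proof.
  apply Rsqr_incr_0_var; [|apply Rmult_le_pos; apply norm3_pos].
  rewrite <- Rsqr_abs. unfold Rsqr.
  replace (norm3 a * norm3 b * (norm3 a * norm3 b))
    with ((norm3 a * norm3 a) * (norm3 b * norm3 b)) by ring.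
  rewrite !norm3_sqr. unfold dot3.
  generalize (x1 a), (x2 a), (x3 a), (x1 b), (x2 b), (x3 b); intros.
  (* Lagrange's identity: the two sides differ by the sum of these three squares. *)
  pose proof (pow2_ge_0 (r * r3 - r0 * r2)). pose proof (pow2_ge_0 (r * r4 - r1 * r2)).
  pose proof (pow2_ge_0 (r0 * r4 - r1 * r3)). lra.
Qed.

Lemma dot3_le a b : dot3 a b <= norm3 a * norm3 b.
Proof. eapply Rle_trans; [apply Rle_abs | apply dot3_cauchy]. Qed.

Lemma dot3_ge a b : - (norm3 a * norm3 b) <= dot3 a b.
Proof. pose proof (dot3_cauchy a b). unfold Rabs in H; destruct (Rcase_abs _); lra. Qed.

Lemma norm3_triangle a b : norm3 (vadd a b) <= norm3 a + norm3 b.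
Proof.
  pose proof (norm3_pos a); pose proof (norm3_pos b).
  apply norm3_le_sqr; [lra|].
  pose proof (dot3_le a b); pose proof (norm3_sqr a); pose proof (norm3_sqr b).
  replace (dot3 (vadd a b) (vadd a b)) with (dot3 a a + dot3 b b + 2 * dot3 a b) by (vunf; ring).
  nra.
Qed.

Lemma norm3_scal k a : norm3 (vscal k a) = Rabs k * norm3 a.
Proof.
  unfold norm3. replace (dot3 (vscal k a) (vscal k a)) with (k * k * dot3 a a) by (vunf; ring).
  rewrite sqrt_mult; [|nra|apply dot3_pos]. f_equal. apply sqrt_Rsqr_abs.
Qed.

Lemma norm3_sub_sym a b : norm3 (vsub a b) = norm3 (vsub b a).
Proof. unfold norm3; f_equal; vunf; ring. Qed.

Lemma dist3_norm a b : dist3 a b = norm3 (vsub a b).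
Proof. reflexivity. Qed.

Lemma dist3_sym a b : dist3 a b = dist3 b a.
Proof. apply norm3_sub_sym. Qed.

Lemma dist3_refl a : dist3 a a = 0.
Proof.
  rewrite dist3_norm. unfold norm3.
  replace (dot3 (vsub a a) (vsub a a)) with 0 by (vunf; ring). apply sqrt_0.
Qed.

Lemma dist3_triangle a b c : dist3 a c <= dist3 a b + dist3 b c.
Proof.
  rewrite !dist3_norm. replace (vsub a c) with (vadd (vsub a b) (vsub b c)).
  apply norm3_triangle. apply R3_ext; vunf; ring.
Qed.

Lemma dist3_pos a b : 0 <= dist3 a b.
Proof. apply norm3_pos. Qed.

Lemma dist3_add a v : dist3 (vadd a v) a = norm3 v.
Proof. rewrite dist3_norm; f_equal; apply R3_ext; vunf; ring. Qed.

Lemma norm3_coord a : Rabs (x1 a) <= norm3 a /\ Rabs (x2 a) <= norm3 a /\ Rabs (x3 a) <= norm3 a.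
Proof.
  pose proof (norm3_sqr a); pose proof (norm3_pos a). unfold dot3 in H.
  repeat split; apply Rabs_le; split; nra.
Qed.

Lemma norm3_sum a : norm3 a <= Rabs (x1 a) + Rabs (x2 a) + Rabs (x3 a).
Proof.
  pose proof (Rabs_pos (x1 a)); pose proof (Rabs_pos (x2 a)); pose proof (Rabs_pos (x3 a)).
  apply norm3_le_sqr; [lra|]. unfold dot3.
  pose proof (Rsqr_abs (x1 a)); pose proof (Rsqr_abs (x2 a)); pose proof (Rsqr_abs (x3 a)).
  unfold Rsqr in *. nra.
Qed.

Lemma norm3_0 a : norm3 a = 0 -> a = mk3 0 0 0.
Proof.
  intros H. pose proof (norm3_coord a) as (A & B & D). rewrite H in *.
  pose proof (Rabs_pos (x1 a)); pose proof (Rabs_pos (x2 a)); pose proof (Rabs_pos (x3 a)).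
  apply R3_ext; [change (x1 (mk3 0 0 0)) with 0|change (x2 (mk3 0 0 0)) with 0|change (x3 (mk3 0 0 0)) with 0];
  apply Rabs_eq_0; lra.
Qed.

Lemma dist3_0 a b : dist3 a b = 0 -> a = b.
Proof.
  rewrite dist3_norm. intros H%norm3_0.
  pose proof (f_equal x1 H); pose proof (f_equal x2 H); pose proof (f_equal x3 H).
  apply R3_ext; vunf; lra.
Qed.

(** The balls of the product uniform structure are cubes. The factor 3 comes from bounding the norm
    by the sum of the coordinates; together with the next lemma this lets Euclidean distances
    replace cubes in the topological arguments below. *)
Lemma ball3_dist (x y : R3) e : ball x e y -> dist3 x y < 3 * e.
Proof.
  intros [[A B] D]. change (Rabs (x1 y - x1 x) < e) in A. change (Rabs (x2 y - x2 x) < e) in B.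
  change (Rabs (x3 y - x3 x) < e) in D.
  rewrite dist3_sym, dist3_norm.
  eapply Rle_lt_trans; [apply norm3_sum|]. vunf. lra.
Qed.

Lemma dist3_ball (x y : R3) e : dist3 x y < e -> ball x e y.
Proof.
  rewrite dist3_sym, dist3_norm. intros H. pose proof (norm3_coord (vsub y x)) as (A & B & D).
  split; [split|]; [change (Rabs (x1 (vsub y x)) < e)|change (Rabs (x2 (vsub y x)) < e)|change (Rabs (x3 (vsub y x))
    < e)]; lra.
Qed.

Lemma open3_dist (U : R3 -> Prop) : open U <-> (forall x, U x -> exists e, 0 < e /\ forall y, dist3 x y < e -> U y).
Proof.
  split.
  - intros H x Ux. destruct (H x Ux) as [e He]. exists e. split; [apply cond_pos|].
    intros y Hy. apply He, dist3_ball, Hy.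
  - intros H x Ux. destruct (H x Ux) as (e & e0 & He).
    assert (0 < e / 3) by lra. exists (mkposreal _ H0). intros y Hy. apply He.
    apply ball3_dist in Hy. simpl in Hy. lra.
Qed.

(** * Polynomials as coefficient lists *)

Open Scope C_scope.

Fixpoint pev (p : list C) (z : C) : C :=
  match p with nil => 0 | c :: p => c + z * pev p z end.
Fixpoint padd (p q : list C) : list C :=
  match p, q with
  | nil, _ => q
  | _, nil => p
  | c :: p, d :: q => (c + d) :: padd p q
  end.
Definition pscal (k : C) (p : list C) : list C := map (Cmult k) p.
Fixpoint pmul (p q : list C) : list C :=
  match p with nil => nil | c :: p => padd (pscal c q) (RtoC 0 :: pmul p q) end.
Fixpoint pshift (n : nat) (p : list C) : list C :=
  match n with O => p | S n => RtoC 0 :: pshift n p end.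
Fixpoint pder (p : list C) : list C :=
  match p with nil => nil | c :: p => padd p (RtoC 0 :: pder p) end.
(* The coefficients of [z^-(k+1)] times the primitive of [z^k * p]. *)
Fixpoint pint (k : nat) (p : list C) : list C :=
  match p with nil => nil | c :: p => (c / RtoC (INR (S k))) :: pint (S k) p end.
Definition psub (p q : list C) := padd p (pscal (- (1)) q).

Lemma pev_padd p q z : pev (padd p q) z = pev p z + pev q z.
Proof. revert q; induction p; intros [|d q]; simpl; try ring. rewrite IHp; ring. Qed.
Lemma pev_pscal k p z : pev (pscal k p) z = k * pev p z.
Proof. induction p; simpl; [ring|]. fold (pscal k p). rewrite IHp; ring. Qed.
Lemma pev_psub p q z : pev (psub p q) z = pev p z - pev q z.
Proof. unfold psub. rewrite pev_padd, pev_pscal; ring. Qed.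
Lemma pev_pmul p q z : pev (pmul p q) z = pev p z * pev q z.
Proof. induction p; simpl; [ring|]. rewrite pev_padd, pev_pscal; simpl. rewrite IHp; ring. Qed.
Lemma pev_pshift n p z : pev (pshift n p) z = z ^ n * pev p z.
Proof. induction n; simpl; [ring|]. rewrite IHn; ring. Qed.
Lemma pev_pder_padd p q z : pev (pder (padd p q)) z = pev (pder p) z + pev (pder q) z.
Proof.
  revert q; induction p; intros [|d q]; simpl; try ring.
  rewrite !pev_padd; cbn [pev]. rewrite IHp; ring.
Qed.
Lemma pev_pder_pscal k p z : pev (pder (pscal k p)) z = k * pev (pder p) z.
Proof.
  induction p; simpl; [ring|]. fold (pscal k p). rewrite !pev_padd, pev_pscal; simpl.
  rewrite IHp; ring.
Qed.
Lemma pev_pder_psub p q z : pev (pder (psub p q)) z = pev (pder p) z - pev (pder q) z.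
Proof. unfold psub. rewrite pev_pder_padd, pev_pder_pscal; ring. Qed.
Lemma pev_pder_pshift n p z :
  pev (pder (pshift (S n) p)) z = z ^ n * (RtoC (INR (S n)) * pev p z + z * pev (pder p) z).
Proof.
  induction n.
  - simpl. rewrite pev_padd; simpl. ring.
  - change (pshift (S (S n)) p) with (RtoC 0 :: pshift (S n) p). cbn [pder]. rewrite pev_padd.
    cbn [pev]. rewrite IHn, pev_pshift. rewrite (S_INR (S n)), RtoC_plus. simpl Cpow. ring.
Qed.
Lemma INR_C_neq k : RtoC (INR (S k)) <> 0.
Proof. intros H. apply RtoC_inj in H. pose proof (lt_0_INR (S k) ltac:(lia)). lra. Qed.
Lemma pev_pint k p z : RtoC (INR (S k)) * pev (pint k p) z + z * pev (pder (pint k p)) z = pev p z.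
Proof.
  revert k; induction p; intros k; cbn [pint pev pder]; [ring|].
  rewrite pev_padd. cbn [pev]. rewrite <- (IHp (S k)).
  rewrite (S_INR (S k)), RtoC_plus. field. apply INR_C_neq.
Qed.
Lemma pev_pder_shift_int n p z : pev (pder (pshift (S n) (pint n p))) z = z ^ n * pev p z.
Proof. rewrite pev_pder_pshift, pev_pint; auto. Qed.

Close Scope C_scope.

(** The value at [r] of the majorant, with all coefficients replaced by their moduli. Being computed
    by recursion on the list, it allows differentiation and integration to be estimated coefficient
    by coefficient. *)
Fixpoint nrm (r : R) (p : list C) : R :=
  match p with nil => 0 | c :: p => Cmod c + r * nrm r p end.
(* [nrmd1] and [nrmd2] majorize the first and second derivatives. *)
Fixpoint nrmd1 (r : R) (p : list C) : R :=
  match p with nil => 0 | c :: p => nrm r p + r * nrmd1 r p end.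
Fixpoint nrmd2 (r : R) (p : list C) : R :=
  match p with nil => 0 | c :: p => 2 * nrmd1 r p + r * nrmd2 r p end.

Lemma nrm_pos r p : 0 <= r -> 0 <= nrm r p.
Proof. intros; induction p; simpl; [lra|]. pose proof (Cmod_ge_0 a). nra. Qed.
Lemma nrmd1_pos r p : 0 <= r -> 0 <= nrmd1 r p.
Proof. intros; induction p; simpl; [lra|]. pose proof (nrm_pos r p H). nra. Qed.
Lemma nrmd2_pos r p : 0 <= r -> 0 <= nrmd2 r p.
Proof. intros; induction p; simpl; [lra|]. pose proof (nrmd1_pos r p H). nra. Qed.
Lemma nrm_mono r s p : 0 <= r <= s -> nrm r p <= nrm s p.
Proof. intros; induction p; simpl; [lra|]. pose proof (nrm_pos r p). nra. Qed.
Lemma pev_le r p z : Cmod z <= r -> Cmod (pev p z) <= nrm r p.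
Proof.
  intros Hz. pose proof (Cmod_ge_0 z). induction p; simpl; [rewrite Cmod_0; lra|].
  eapply Rle_trans; [apply Cmod_triangle|]. rewrite Cmod_mult.
  pose proof (Cmod_ge_0 (pev p z)). pose proof (nrm_pos r p). nra.
Qed.
Lemma nrm_padd r p q : 0 <= r -> nrm r (padd p q) <= nrm r p + nrm r q.
Proof.
  intros Hr; revert q; induction p; intros [|d q]; simpl; try lra.
  pose proof (Cmod_triangle a d). specialize (IHp q). nra.
Qed.
Lemma nrm_pscal r k p : nrm r (pscal k p) = Cmod k * nrm r p.
Proof. induction p; simpl; [ring|]. fold (pscal k p). rewrite IHp, Cmod_mult; ring. Qed.
Lemma nrm_psub r p q : 0 <= r -> nrm r (psub p q) <= nrm r p + nrm r q.
Proof. intros. unfold psub. eapply Rle_trans; [apply nrm_padd; auto|]. rewrite nrm_pscal, Cmod_m1; lra. Qed.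
Lemma nrm_pshift r n p : nrm r (pshift n p) = r ^ n * nrm r p.
Proof. induction n; simpl; [ring|]. rewrite IHn, Cmod_0; ring. Qed.
Lemma nrm_pint r k p : 0 <= r -> nrm r (pint k p) <= nrm r p / INR (S k).
Proof.
  intros Hr; revert k; induction p; intros k; cbn [pint nrm].
  - unfold Rdiv; lra.
  - rewrite Cmod_div by apply INR_C_neq. rewrite Cmod_R, (Rabs_pos_eq (INR _)) by apply pos_INR.
    assert (0 < INR (S k)) by (apply lt_0_INR; lia).
    assert (INR (S k) <= INR (S (S k))) by (apply le_INR; lia).
    assert (nrm r p / INR (S (S k)) <= nrm r p / INR (S k)).
    { apply Rmult_le_compat_l; [apply nrm_pos; auto|]. apply Rinv_le_contravar; auto. }
    specialize (IHp (S k)). unfold Rdiv in *. rewrite Rmult_plus_distr_r.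
    apply Rplus_le_compat_l. rewrite Rmult_assoc. apply Rmult_le_compat_l; lra.
Qed.

Lemma pev_lip r p z w : Cmod z <= r -> Cmod w <= r ->
  Cmod (pev p z - pev p w) <= nrmd1 r p * Cmod (z - w).
Proof.
  intros Hz Hw. pose proof (Cmod_ge_0 z) as Z0. induction p; cbn [pev nrmd1].
  - replace (0 - 0)%C with (RtoC 0) by ring. rewrite Cmod_0; lra.
  - replace (a + z * pev p z - (a + w * pev p w))%C
      with (z * (pev p z - pev p w) + (z - w) * pev p w)%C by ring.
    eapply Rle_trans; [apply Cmod_triangle|]. rewrite !Cmod_mult.
    pose proof (pev_le r p w Hw). pose proof (Cmod_ge_0 (z - w)). pose proof (Cmod_ge_0 (pev p z - pev p w)).
    pose proof (nrmd1_pos r p ltac:(lra)).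
    assert (Cmod z * Cmod (pev p z - pev p w) <= r * (nrmd1 r p * Cmod (z - w))) by (apply Rmult_le_compat; lra).
    nra.
Qed.

(** Induction along Horner's rule; the recursion of [nrmd2] mirrors the product rule
    [(z q)'' = 2 q' + z q'']. *)
Lemma pev_taylor r p z h : Cmod z <= r -> Cmod (z + h) <= r ->
  Cmod (pev p (z + h) - pev p z - h * pev (pder p) z)%C <= nrmd2 r p * (Cmod h * Cmod h).
Proof.
  intros Hz Hw. pose proof (Cmod_ge_0 z) as Z0. induction p; cbn [pev nrmd2 pder].
  - replace (0 - 0 - h * 0)%C with (RtoC 0) by ring. rewrite Cmod_0; lra.
  - rewrite pev_padd. cbn [pev].
    replace (a + (z + h) * pev p (z + h) - (a + z * pev p z) - h * (pev p z + (0 + z * pev (pder p) z)))%C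
      with (z * (pev p (z + h) - pev p z - h * pev (pder p) z) + h * (pev p (z + h) - pev p z))%C by ring.
    eapply Rle_trans; [apply Cmod_triangle|]. rewrite !Cmod_mult.
    pose proof (pev_lip r p (z + h) z Hw Hz) as L.
    replace (z + h - z)%C with h in L by ring.
    pose proof (Cmod_ge_0 h). pose proof (nrmd1_pos r p ltac:(lra)). pose proof (nrmd2_pos r p ltac:(lra)).
    pose proof (Cmod_ge_0 (pev p (z + h) - pev p z - h * pev (pder p) z)).
    assert (Cmod z * Cmod (pev p (z + h) - pev p z - h * pev (pder p) z) <= r * (nrmd2 r p * (Cmod h * Cmod h))) by
      (apply Rmult_le_compat; lra).
    assert (Cmod h * Cmod (pev p (z + h) - pev p z) <= Cmod h * (nrmd1 r p * Cmod h)) by (apply Rmult_le_compat_l;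
      lra).
    assert (0 <= nrmd1 r p * (Cmod h * Cmod h)) by (apply Rmult_le_pos; nra).
    lra.
Qed.

Lemma nrm_pder r p : 0 <= r -> nrm r (pder p) <= nrmd1 r p.
Proof.
  intros Hr; induction p; simpl; [lra|]. eapply Rle_trans; [apply nrm_padd; auto|]. simpl.
  rewrite Cmod_0. nra.
Qed.

(** [nrmd1] is the derivative of [nrm] in [r], and [nrm] is convex in [r] because its coefficients
    are nonnegative, so the slope at [r] is at most the chord slope up to [s]. This plays the part
    of Cauchy's estimate: a derivative costs only a slightly larger radius. *)
Lemma nrmd1_le r s p : 0 <= r < s -> (s - r) * nrmd1 r p <= nrm s p - nrm r p.
Proof.
  intros Hr; induction p; simpl; [lra|].
  pose proof (nrm_mono r s p). pose proof (nrm_pos r p). nra.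
Qed.

Lemma nrmd2_le r s p : 0 <= r < s -> (s - r) * nrmd2 r p <= nrmd1 s p - nrmd1 r p.
Proof.
  intros Hr; induction p; simpl; [lra|].
  pose proof (nrmd1_le r s p Hr). pose proof (nrmd1_pos r p).
  pose proof (nrmd2_pos r p ltac:(lra)).
  assert (nrmd1 r p <= nrmd1 s p) by nra. nra.
Qed.

Lemma nrm_pder_le r s p : 0 <= r < s -> nrm r (pder p) <= nrm s p / (s - r).
Proof.
  intros. apply (Rmult_le_reg_l (s - r)); [lra|].
  pose proof (nrmd1_le r s p H). pose proof (nrm_pder r p ltac:(lra)). pose proof (nrm_pos r p ltac:(lra)).
  replace ((s - r) * (nrm s p / (s - r))) with (nrm s p) by (field; lra). nra.
Qed.

(** With [k = 0] this is the majorant of the derivative at radius 1. The moving weight [k] is what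
    the induction in [pint_scaled] needs. *)
Fixpoint wnrm (k : nat) (p : list C) : R :=
  match p with nil => 0 | c :: p => INR k * Cmod c + wnrm (S k) p end.

(** Integrating [z^n] times a fixed polynomial acts to first order on the fast factor alone: the
    quotient [(n+1) / (n+k+1)] of denominators differs from 1 by [k / (n+k+1)]. *)
Lemma pint_scaled n k p z : Cmod z <= 1 ->
  Cmod (RtoC (INR (S n)) * pev (pint (n + k) p) z - pev p z)%C <= wnrm k p / INR (S n).
Proof.
  intros Hz; revert k; induction p; intros k; cbn [pint pev wnrm].
  - replace (INR (S n) * 0 - 0)%C with (RtoC 0) by ring. rewrite Cmod_0. unfold Rdiv; lra.
  - assert (P : 0 < INR (S n)) by (apply lt_0_INR; lia).
    assert (Q : 0 < INR (S (n + k))) by (apply lt_0_INR; lia).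
    replace (INR (S n) * (a / INR (S (n + k)) + z * pev (pint (S (n + k)) p) z) - (a + z * pev p z))%C
      with (a * RtoC (INR (S n) / INR (S (n + k)) - 1) + z * (INR (S n) * pev (pint (n + S k) p) z - pev p z))%C.
    2:{ rewrite RtoC_minus, RtoC_div by lra. replace (n + S k)%nat with (S (n + k))%nat by lia. unfold Cdiv; ring. }
    eapply Rle_trans; [apply Cmod_triangle|]. rewrite !Cmod_mult.
    specialize (IHp (S k)). pose proof (Cmod_ge_0 (INR (S n) * pev (pint (n + S k) p) z - pev p z)).
    assert (Cmod (INR (S n) / INR (S (n + k)) - 1)%R <= INR k / INR (S n)).
    { rewrite Cmod_R. replace (INR (S (n + k))) with (INR (S n) + INR k) in * by (rewrite <- plus_INR; f_equal; lia).
      pose proof (pos_INR k).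
      replace (INR (S n) / (INR (S n) + INR k) - 1) with (- (INR k / (INR (S n) + INR k))) by (field; lra).
      rewrite Rabs_Ropp, Rabs_pos_eq.
      - apply Rmult_le_compat_l; auto. apply Rinv_le_contravar; lra.
      - apply Rmult_le_pos; auto. left; apply Rinv_0_lt_compat; lra. }
    pose proof (Cmod_ge_0 a). pose proof (Cmod_ge_0 z).
    replace ((INR k * Cmod a + wnrm (S k) p) / INR (S n)) with (Cmod a * (INR k / INR (S n)) + wnrm (S k) p / INR (S
      n)) by (field; lra).
    apply Rplus_le_compat; [apply Rmult_le_compat_l; auto|].
    eapply Rle_trans; [|apply IHp]. nra.
Qed.

(** Synthetic division by [z - al]: the coefficients of the quotient are the values at [al] of the
    successive tails. Constants are split off so that the length drops by one, which is the measure
    of the induction in [poly_roots]. *)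
Fixpoint pquo (al : C) (p : list C) : list C :=
  match p with
  | nil => nil
  | c :: p => match p with nil => nil | _ => pev p al :: pquo al p end
  end.

Lemma pev_pquo al p z : pev p z = (pev p al + (z - al) * pev (pquo al p) z)%C.
Proof.
  induction p; [simpl; ring|]. destruct p as [|d p]; [simpl; ring|].
  change (pquo al (a :: d :: p)) with (pev (d :: p) al :: pquo al (d :: p)).
  remember (d :: p) as q. cbn [pev]. rewrite IHp at 1. ring.
Qed.

Lemma length_pquo al p : length (pquo al p) = pred (length p).
Proof. induction p; auto. destruct p; auto. simpl in *. rewrite IHp; auto. Qed.

Lemma poly_roots p : (forall z, pev p z = 0%C) \/ exists l, forall z, pev p z = 0%C -> In z l.
Proof.
  remember (length p) as n eqn:E. revert p E; induction n; intros p E.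
  - destruct p; [left; auto|discriminate].
  - destruct (classic (exists al, pev p al = 0%C)) as [[al Hal]|H].
    + destruct (IHn (pquo al p)) as [Z|[l Hl]].
      * rewrite length_pquo, <- E; auto.
      * left; intros z. rewrite (pev_pquo al p z), Hal, Z. ring.
      * right; exists (al :: l). intros z Hz. rewrite (pev_pquo al p z), Hal in Hz.
        destruct (classic (z = al)) as [->|N]; [left; auto|right]. apply Hl.
        assert (z - al <> 0)%C. { intros A. apply N. replace z with (z - al + al)%C by ring. rewrite A; ring. }
        assert (((z - al) * pev (pquo al p) z)%C = 0%C) by (rewrite <- Hz; ring).
        apply (f_equal Cmod) in H0. rewrite Cmod_mult, Cmod_0 in H0.
        apply Cmod_gt_0 in H. apply Cmod_eq_0.
        apply Rmult_integral in H0. destruct H0; [lra|auto].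
    + right; exists nil. intros z Hz. elim H; eauto.
Qed.

(** * Compactness *)

(** Lebesgue number argument for predicates that get weaker as [d] shrinks: finitely many of the
    local radii suffice, and their minimum works everywhere. Many of the uniform constants below
    come from it. *)
Lemma compact_unif {T : UniformSpace} (S : T -> Prop) (P : T -> R -> Prop) :
  compact_set S -> (forall y d d', 0 < d' <= d -> P y d -> P y d') ->
  (forall x, S x -> exists e, 0 < e /\ forall y, ball x e y -> S y -> P y e) ->
  exists e, 0 < e /\ forall y, S y -> P y e.
Proof.
  intros HS Hm Hl.
  set (I := {t : T * R | 0 < snd t /\ forall y, ball (fst t) (snd t) y -> S y -> P y (snd t)}).
  (* Interiors of balls are used, since balls of a general uniform space need not be open. *)
  destruct (HS I (fun i y => locally y (ball (fst (proj1_sig i)) (snd (proj1_sig i))))) as [l Hl'].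
  - intros i x Hx. apply locally_locally, Hx.
  - intros x Sx. destruct (Hl x Sx) as (e & e0 & He).
    exists (exist _ (x, e) (conj e0 He)). simpl. exists (mkposreal e e0). auto.
  - assert (M : exists e, 0 < e /\ forall i, In i l -> e <= snd (proj1_sig i)).
    { clear Hl'. induction l as [|i l IH].
      - exists 1; split; [lra|]. intros i [].
      - destruct IH as (e & e0 & He). destruct i as [[x d] [d0 Hd]] eqn:Ei. simpl in *.
        exists (Rmin e d); split; [apply Rmin_pos; auto|].
        intros j [<-|Hj]; [apply Rmin_r|]. eapply Rle_trans; [apply Rmin_l|]. auto. }
    destruct M as (e & e0 & He). exists e; split; auto.
    intros y Sy. destruct (Hl' y Sy) as (i & Hi & Li).
    specialize (He i Hi). destruct i as [[x d] [d0 Hd]]; simpl in *.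
    apply (Hm y d e); [lra|]. apply Hd; auto. apply locally_singleton in Li. auto.
Qed.

Lemma compact_pos_min {T : UniformSpace} (S : T -> Prop) (f : T -> R) :
  compact_set S -> (forall x, S x -> continuous f x) -> (forall x, S x -> 0 < f x) ->
  exists m, 0 < m /\ forall x, S x -> m <= f x.
Proof.
  intros HS Hc Hp. apply (compact_unif S (fun y d => d <= f y) HS); [intros; lra|].
  intros x Sx. specialize (Hp x Sx).
  assert (E : 0 < f x / 2) by lra.
  destruct (proj1 (filterlim_locally _ _) (Hc x Sx) (mkposreal _ E)) as [d Hd].
  exists (Rmin d (f x / 2)). split; [apply Rmin_pos; auto; apply cond_pos|].
  intros y By _. eapply Rle_trans; [apply Rmin_r|].
  assert (ball x d y) by (eapply ball_le; [apply Rmin_l|exact By]).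
  specialize (Hd y H). change (Rabs (f y - f x) < f x / 2) in Hd.
  apply Rabs_def2 in Hd. lra.
Qed.

Lemma compact_bounded {T : UniformSpace} (S : T -> Prop) (f : T -> R) :
  compact_set S -> (forall x, S x -> continuous f x) ->
  exists M, 0 < M /\ forall x, S x -> f x <= M.
Proof.
  intros HS Hc.
  (* An upper bound for [f] is a positive lower bound for [exp (- f)]. *)
  assert (Hc' : forall x, S x -> continuous (fun y => exp (- f y)) x).
  { intros x Sx. apply (continuous_comp (fun y => - f y) exp).
    - apply (continuous_opp (V := R_NormedModule)); auto.
    - apply continuity_pt_filterlim, derivable_continuous_pt, derivable_pt_exp. }
  destruct (compact_pos_min S _ HS Hc') as (m & m0 & Hm).
  { intros; apply exp_pos. }
  exists (Rmax 1 (- ln m)). split; [pose proof (Rmax_l 1 (- ln m)); lra|].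
  intros x Sx. eapply Rle_trans; [|apply Rmax_r]. specialize (Hm x Sx).
  assert (ln m <= ln (exp (- f x))).
  { destruct Hm as [Hm|Hm]; [left; apply ln_increasing; auto|right; rewrite Hm; auto]. }
  rewrite ln_exp in H; lra.
Qed.

(** If the infimum [- m] were not attained, [f + m] would be positive on [S], hence bounded away
    from 0, contradicting the choice of [m]. *)
Lemma compact_min_attained {T : UniformSpace} (S : T -> Prop) (f : T -> R) :
  compact_set S -> (forall x, S x -> continuous f x) -> (exists x, S x) -> (forall x, 0 <= f x) ->
  exists x, S x /\ forall y, S y -> f x <= f y.
Proof.
  intros HS Hc [x0 S0] Hp. apply NNPP. intros N.
  destruct (completeness (fun r => exists x, S x /\ r = - f x)) as [m [U L]].
  { exists 0. intros r (x & _ & ->). specialize (Hp x); lra. }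
  { exists (- f x0), x0; auto. }
  destruct (compact_pos_min S (fun x => f x + m) HS) as (d & d0 & Hd).
  - intros x Sx. apply (continuous_plus (V := R_NormedModule)); [auto|apply continuous_const].
  - intros x Sx. assert (- f x <= m) by (apply U; exists x; auto).
    destruct (Rle_lt_or_eq_dec _ _ H); [lra|].
    elim N. exists x; split; auto. intros y Sy.
    assert (- f y <= m) by (apply U; exists y; auto). lra.
  - assert (m <= m - d); [|lra]. apply L. intros r (x & Sx & ->). specialize (Hd x Sx). lra.
Qed.

Lemma compact_cluster {T : UniformSpace} (S : T -> Prop) (u : nat -> T) :
  compact_set S -> (forall n, S (u n)) ->
  exists x, S x /\ forall e, 0 < e -> forall N, exists n, (N <= n)%nat /\ ball x e (u n).
Proof.
  intros HS Hu. apply NNPP. intros N0.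
  (* The predicate says that the sequence avoids [y] from index [1 / d] on; with one [d] for all
     [y], a late term of the sequence would have to avoid itself. *)
  destruct (compact_unif S (fun y d => forall n, 1 <= INR n * d -> u n <> y) HS) as (e & e0 & He).
  - intros y d d' Hd H n Hn. apply H. pose proof (pos_INR n). nra.
  - intros x Sx. assert (exists e, 0 < e /\ exists N, forall n, (N <= n)%nat -> ~ ball x e (u n)).
    { apply NNPP. intros A. apply N0. exists x; split; auto. intros e e0 N. apply NNPP. intros B.
      apply A. exists e; split; auto. exists N. intros n Hn Hb. apply B; eauto. }
    destruct H as (e & e0 & N & HN).
    exists (Rmin e (/ INR (N + 1))). assert (0 < INR (N + 1)) by (apply lt_0_INR; lia). split.
    { apply Rmin_pos; auto. apply Rinv_0_lt_compat; auto. }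
    intros y By Sy n Hn E. subst y. apply (HN n).
    + apply INR_le. assert (INR N < INR (N + 1)) by (apply lt_INR; lia).
      pose proof (Rmin_r e (/ INR (N + 1))). pose proof (pos_INR n).
      assert (1 <= INR n * / INR (N + 1)) by nra.
      apply (Rmult_le_compat_r (INR (N + 1))) in H3; [|lra].
      rewrite Rmult_assoc, Rinv_l in H3 by lra. lra.
    + eapply ball_le; [apply Rmin_l|eauto].
  - destruct (archimed_cor1 e e0) as (n & Hn & n0).
    apply (He (u n) (Hu n) n); auto.
    apply Rmult_le_reg_l with (/ INR n). apply Rinv_0_lt_compat, lt_0_INR; auto.
    rewrite <- Rmult_assoc, Rinv_l by (apply not_0_INR; lia). lra.
Qed.

Lemma compact_closed_sub {T : UniformSpace} (A S : T -> Prop) :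
  compact_set A -> (forall x, S x -> A x) -> open (fun x => ~ S x) -> compact_set S.
Proof.
  intros HA Hs Ho I U HU Hc.
  destruct (HA (option I) (fun i => match i with Some i => U i | None => fun x => ~ S x end)) as [l Hl].
  - intros [i|]; auto.
  - intros x _. destruct (classic (S x)) as [Sx|N]; [|exists None; auto].
    destruct (Hc x Sx) as [i Hi]. exists (Some i); auto.
  - exists (flat_map (fun i => match i with Some i => i :: nil | None => nil end) l).
    intros x Sx. destruct (Hl x (Hs x Sx)) as ([i|] & Hi & Ux); [|tauto].
    exists i; split; auto. apply in_flat_map. exists (Some i); simpl; auto.
Qed.

Lemma compact_interval (a b : R) : compact_set (T := R_UniformSpace) (fun x => a <= x <= b).
Proof.
  intros I U HU Hc.
  destruct (Rlt_dec b a) as [L|L]; [exists nil; intros; lra|].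
  set (E := fun x => a <= x <= b /\ exists l : list I, forall y, a <= y <= x -> exists i, In i l /\ U i y).
  assert (Ea : E a).
  { split; [lra|]. destruct (Hc a ltac:(lra)) as [i Hi]. exists (i :: nil). intros y Hy.
    exists i; split; [left; auto|]. replace y with a by lra. auto. }
  destruct (completeness E) as [m [Um Lm]].
  { exists b. intros x [? _]; lra. } { exists a; auto. }
  assert (am : a <= m <= b).
  { split; [apply Um; auto|]. apply Lm. intros x [? _]; lra. }
  destruct (Hc m am) as [i Hi]. destruct (HU i m Hi) as [e He].
  assert (exists x, E x /\ m - e < x).
  { apply NNPP. intros N. assert (m <= m - e); [|pose proof (cond_pos e); lra].
    apply Lm. intros x Ex. destruct (Rle_dec x (m - e)); auto. elim N. exists x; split; auto; lra. }
  destruct H as (x & (Hx & l & Hl) & Hxe).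
  assert (x <= m) by (apply Um; split; eauto).
  assert (Em : E (Rmin b (m + e / 2))).
  { pose proof (cond_pos e). split; [split; [apply Rmin_glb; lra|apply Rmin_l]|].
    exists (i :: l). intros y Hy. destruct (Rle_dec y x) as [Y|Y].
    - destruct (Hl y ltac:(lra)) as (j & ? & ?). exists j; split; simpl; auto.
    - exists i; split; [left; auto|]. apply He. change (Rabs (y - m) < e).
      pose proof (Rmin_r b (m + e/2)). apply Rabs_def1; lra. }
  pose proof (Um _ Em). pose proof (cond_pos e).
  unfold Rmin in *. destruct (Rle_dec b (m + e / 2)); [|lra].
  destruct Em as [_ [l' Hl']]. exists l'. intros y Hy. apply Hl'. lra.
Qed.

(** Tube lemma: every point of [A] has a ball whose product with [B] is covered by finitely many
    members, and finitely many such balls cover [A]. *)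
Lemma compact_prod {T1 T2 : UniformSpace} (A : T1 -> Prop) (B : T2 -> Prop) :
  compact_set A -> compact_set B -> compact_set (T := prod_UniformSpace T1 T2) (fun p => A (fst p) /\ B (snd p)).
Proof.
  intros HA HB I U HU Hc.
  set (J := {t : T1 * R | 0 < snd t /\ exists l : list I, forall x y, ball (fst t) (snd t) x -> B y -> exists i,
    In i l /\ U i (x, y)}).
  destruct (HA J (fun j y => locally y (ball (fst (proj1_sig j)) (snd (proj1_sig j))))) as [l Hl].
  - intros j x Hx. apply locally_locally, Hx.
  - intros x Ax.
    destruct (HB {t : T2 * R * I | 0 < snd (fst t) /\ forall x' y', ball x (snd (fst t)) x' ->
      ball (fst (fst t)) (snd (fst t)) y' -> U (snd t) (x', y')}
      (fun j y => locally y (ball (fst (fst (proj1_sig j))) (snd (fst (proj1_sig j)))))) as [l Hl].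
    + intros j y Hy. apply locally_locally, Hy.
    + intros y By. destruct (Hc (x, y) (conj Ax By)) as [i Hi]. destruct (HU i _ Hi) as [e He].
      assert (Q : 0 < e /\ forall x' y', ball x e x' -> ball y e y' -> U i (x', y')).
      { split; [apply cond_pos|]. intros. apply He. split; auto. }
      exists (exist _ (y, pos e, i) Q). simpl. exists e; auto.
    + assert (M : exists e, 0 < e /\ forall i, In i l -> e <= snd (fst (proj1_sig i))).
      { clear Hl. induction l as [|i l IH].
        - exists 1; split; [lra|]. intros i [].
        - destruct IH as (e & e0 & He). destruct i as [[[x' d] i0] [d0 Hd]] eqn:Ei. simpl in *.
          exists (Rmin e d); split; [apply Rmin_pos; auto|].
          intros j [<-|Hj]; [apply Rmin_r|]. eapply Rle_trans; [apply Rmin_l|]. auto. }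
      destruct M as (e & e0 & He).
      assert (Q : 0 < e /\ exists l : list I, forall x' y, ball x e x' -> B y -> exists i, In i l /\ U i (x', y)).
      { split; auto. exists (map (fun j => snd (proj1_sig j)) l). intros x' y Bx By.
        destruct (Hl y By) as (j & Hj & Lj). specialize (He j Hj).
        exists (snd (proj1_sig j)); split; [apply (in_map (fun j => snd (proj1_sig j))); auto|].
        destruct j as [[[y' d] i] [d0 Hd]]; simpl in *. apply Hd.
        - eapply ball_le; eauto. - apply locally_singleton in Lj; auto. }
      exists (exist _ (x, e) Q). simpl. exists (mkposreal e e0); auto.
  - assert (M : exists L : list I, forall j, In j l -> forall x y, ball (fst (proj1_sig j)) (snd (proj1_sig j)) x ->
      B y -> exists i, In i L /\ U i (x, y)).
    { clear Hl. induction l as [|j l [L IH]].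
      - exists nil. intros j [].
      - destruct j as [[x d] [d0 [L' HL']]] eqn:Ej. exists (L' ++ L). intros k [<-|Hk] x' y Hx Hy.
        + destruct (HL' x' y Hx Hy) as (i & ? & ?). exists i; split; auto. apply in_or_app; auto.
        + destruct (IH k Hk x' y Hx Hy) as (i & ? & ?). exists i; split; auto. apply in_or_app; auto. }
    destruct M as [L HL]. exists L. intros [x y] [Ax By]. simpl in *.
    destruct (Hl x Ax) as (j & Hj & Lj). apply (HL j Hj); auto. apply locally_singleton in Lj; auto.
Qed.

Lemma compact_R3 (S : R3 -> Prop) : bounded3 S -> open (fun x => ~ S x) -> compact_set S.
Proof.
  intros [M HM] Ho.
  apply (compact_closed_sub (fun p : R3 => ((- M <= fst (fst p) <= M) /\ (- M <= snd (fst p) <= M)) /\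
    (- M <= snd p <= M))).
  - apply (compact_prod (T1 := prod_UniformSpace R_UniformSpace R_UniformSpace) (T2 := R_UniformSpace)
      (fun p => (- M <= fst p <= M) /\ (- M <= snd p <= M)) (fun x => - M <= x <= M)).
    + apply (compact_prod (T1 := R_UniformSpace) (T2 := R_UniformSpace) (fun x => - M <= x <= M) (fun x => - M <= x
        <= M)); apply compact_interval.
    + apply compact_interval.
  - intros x Sx. specialize (HM x Sx). pose proof (norm3_coord x) as (A & B & D).
    unfold x1, x2, x3 in *. split; [split|]; apply Rabs_le_between; lra.
  - auto.
Qed.

Lemma compact_R2 (S : R2 -> Prop) M : (forall x, S x -> Cmod x <= M) -> open (fun x => ~ S x) -> compact_set S.
Proof.
  intros HM Ho.
  apply (compact_closed_sub (fun p : R2 => (- M <= fst p <= M) /\ (- M <= snd p <= M))).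
  - apply (compact_prod (T1 := R_UniformSpace) (T2 := R_UniformSpace) (fun x => - M <= x <= M) (fun x => - M <= x <=
      M)); apply compact_interval.
  - intros x Sx. specialize (HM x Sx). pose proof (Rmax_Cmod x).
    pose proof (Rmax_l (Rabs (fst x)) (Rabs (snd x))). pose proof (Rmax_r (Rabs (fst x)) (Rabs (snd x))).
    split; apply Rabs_le_between; eapply Rle_trans; eauto; eapply Rle_trans; eauto.
  - auto.
Qed.

(** [R2] and [C] are the same type of pairs, so [Cmod] serves as the Euclidean norm of the plane.
    Product balls are squares, whence the factor 2, an upper bound for [sqrt 2]. *)
Lemma ball2_Cmod (z w : R2) e : ball z e w -> Cmod (w - z) < 2 * e.
Proof.
  intros [A B]. change (Rabs (fst w - fst z) < e) in A. change (Rabs (snd w - snd z) < e) in B.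
  eapply Rle_lt_trans; [apply (Cmod_2Rmax (w - z)%C)|].
  assert (Rmax (Rabs (fst (w - z)%C)) (Rabs (snd (w - z)%C)) < e) by (apply Rmax_lub_lt; auto).
  assert (sqrt 2 < 2). { pose proof sqrt2_neq_0. pose proof (sqrt_sqrt 2 ltac:(lra)). pose proof (sqrt_pos 2). nra. }
  pose proof (sqrt_pos 2). pose proof (Rmax_l (Rabs (fst (w - z)%C)) (Rabs (snd (w - z)%C))).
  pose proof (Rabs_pos (fst (w - z)%C)). nra.
Qed.

Lemma Cmod_ball2 (z w : R2) e : Cmod (w - z) < e -> ball z e w.
Proof.
  intros H. pose proof (Rmax_Cmod (w - z)%C).
  pose proof (Rmax_l (Rabs (fst (w - z)%C)) (Rabs (snd (w - z)%C))).
  pose proof (Rmax_r (Rabs (fst (w - z)%C)) (Rabs (snd (w - z)%C))).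
  split; [change (Rabs (fst (w - z)%C) < e)|change (Rabs (snd (w - z)%C) < e)]; lra.
Qed.

Lemma open_R2 (U : R2 -> Prop) : open U <-> (forall x, U x -> exists e, 0 < e /\ forall y, Cmod (y - x) < e -> U y).
Proof.
  split.
  - intros H x Ux. destruct (H x Ux) as [e He]. exists e. split; [apply cond_pos|].
    intros y Hy. apply He, Cmod_ball2, Hy.
  - intros H x Ux. destruct (H x Ux) as (e & e0 & He).
    assert (0 < e / 2) by lra. exists (mkposreal _ H0). intros y Hy. apply He.
    apply ball2_Cmod in Hy. simpl in Hy. lra.
Qed.

Lemma continuous_R2 (f : R2 -> R) z : continuous f z <->
  (forall e, 0 < e -> exists d, 0 < d /\ forall w, Cmod (w - z) < d -> Rabs (f w - f z) < e).
Proof.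
  split.
  - intros H e e0. destruct (proj1 (filterlim_locally _ _) H (mkposreal _ e0)) as [d Hd].
    exists d; split; [apply cond_pos|]. intros w Hw. apply (Hd w (Cmod_ball2 _ _ _ Hw)).
  - intros H. apply filterlim_locally. intros e. destruct (H e (cond_pos e)) as (d & d0 & Hd).
    assert (0 < d / 2) by lra. exists (mkposreal _ H0). intros w Hw. apply Hd.
    apply ball2_Cmod in Hw. simpl in Hw. lra.
Qed.

Lemma continuous_R3 (f : R3 -> R) z : continuous f z <->
  (forall e, 0 < e -> exists d, 0 < d /\ forall w, dist3 z w < d -> Rabs (f w - f z) < e).
Proof.
  split.
  - intros H e e0. destruct (proj1 (filterlim_locally _ _) H (mkposreal _ e0)) as [d Hd].
    exists d; split; [apply cond_pos|]. intros w Hw. apply (Hd w (dist3_ball _ _ _ Hw)).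
  - intros H. apply filterlim_locally. intros e. destruct (H e (cond_pos e)) as (d & d0 & Hd).
    assert (0 < d / 3) by lra. exists (mkposreal _ H0). intros w Hw. apply Hd.
    apply ball3_dist in Hw. simpl in Hw. lra.
Qed.

Lemma Cmod_sub_sym z w : Cmod (z - w) = Cmod (w - z).
Proof. rewrite <- (Cmod_opp (z - w)). f_equal. ring. Qed.

Lemma Cmod_diff z w : Rabs (Cmod z - Cmod w) <= Cmod (z - w).
Proof.
  pose proof (Cmod_triangle (z - w) w). pose proof (Cmod_triangle (w - z) z).
  replace (z - w + w)%C with z in H by ring. replace (w - z + z)%C with w in H0 by ring.
  rewrite (Cmod_sub_sym w z) in H0. apply Rabs_le; lra.
Qed.

Lemma open_Cmod_gt r : open (fun z : R2 => r < Cmod z).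
Proof.
  apply open_R2. intros x H. exists (Cmod x - r); split; [lra|]. intros y Hy.
  pose proof (Cmod_diff y x). apply Rabs_le_between in H0. lra.
Qed.

Lemma compact_closed_disk r : compact_set (fun z : R2 => Cmod z <= r).
Proof.
  apply (compact_R2 _ r); auto. eapply open_ext; [|apply (open_Cmod_gt r)]. intros; simpl. lra.
Qed.

Lemma compact_circle : compact_set (fun z : R2 => Cmod z = 1).
Proof.
  apply (compact_R2 _ 1); [intros; lra|]. apply open_R2. intros x H.
  exists (Rabs (Cmod x - 1)). split; [apply Rabs_pos_lt; lra|]. intros y Hy E.
  pose proof (Cmod_diff x y). rewrite (Cmod_sub_sym x y), E in H0. lra.
Qed.

Lemma Cmod_normalize z : 0 < Cmod z ->
  Cmod (z / Cmod z) = 1 /\ Cmod (z - z / Cmod z) = Rabs (1 - Cmod z).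
Proof.
  intros H. assert (N : RtoC (Cmod z) <> 0%C) by (intros E; apply RtoC_inj in E; lra). split.
  - rewrite Cmod_div, Cmod_R, Rabs_pos_eq by (auto; lra). field; lra.
  - replace (z - z / Cmod z)%C with (z / Cmod z * (Cmod z - 1))%C by (field; auto).
    rewrite Cmod_mult, Cmod_div, Cmod_R, Rabs_pos_eq by (auto; lra).
    rewrite <- RtoC_minus, Cmod_R, Rabs_minus_sym. field; lra.
Qed.

Lemma circle_uniform (P : C -> C -> Prop) :
  (forall z, Cmod z = 1 -> exists e, 0 < e /\ forall y w, Cmod y = 1 -> Cmod (y - z) < e -> Cmod (w - z) < e ->
    P y w) ->
  exists e, 0 < e /\ forall y w, Cmod y = 1 -> Cmod (w - y) < e -> P y w.
Proof.
  intros H.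
  destruct (compact_unif (fun z : R2 => Cmod z = 1) (fun y d => forall w, Cmod (w - y) < d ->
    P y w) compact_circle) as (e & e0 & He).
  - intros y d d' Hd Hy w Hw. apply Hy; lra.
  - intros x Hx. destruct (H x Hx) as (e & e0 & He). exists (e / 4); split; [lra|].
    intros y By Hy w Hw. apply ball2_Cmod in By. apply He; auto; [lra|].
    replace (w - x)%C with ((w - y) + (y - x))%C by ring.
    eapply Rle_lt_trans; [apply Cmod_triangle|]. lra.
  - exists e; split; auto.
Qed.

Lemma circle_nbhd (P : C -> Prop) :
  (forall z, Cmod z = 1 -> exists e, 0 < e /\ forall w, Cmod (w - z) < e -> P w) ->
  exists r, 0 < r < 1 /\ forall z, r <= Cmod z <= 1 -> P z.
Proof.
  intros H. destruct (circle_uniform (fun _ w => P w)) as (e & e0 & He).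
  { intros z Hz. destruct (H z Hz) as (e & e0 & He). exists e; split; auto. }
  exists (1 - Rmin e 1 / 2). pose proof (Rmin_l e 1). pose proof (Rmin_r e 1).
  assert (0 < Rmin e 1) by (apply Rmin_pos; lra). split; [lra|].
  intros z Hz. destruct (Cmod_normalize z ltac:(lra)) as [A B].
  (* The circle point is the radial projection of [z], at distance [1 - Cmod z]. *)
  apply (He (z / Cmod z)%C); auto. rewrite B, Rabs_pos_eq; lra.
Qed.

(** * First hitting times *)

Lemma first_hit (g : R -> R) a b r : a <= b -> (forall t, a <= t <= b -> continuous g t) ->
  g a <= r -> r <= g b ->
  exists c, a <= c <= b /\ g c = r /\ forall t, a <= t <= c -> g t <= r.
Proof.
  intros Hab Hc Ha Hb.
  set (E := fun x => a <= x <= b /\ forall t, a <= t <= x -> g t <= r).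
  assert (Ea : E a). { split; [lra|]. intros t Ht. replace t with a by lra; auto. }
  destruct (completeness E) as [m [Um Lm]].
  { exists b. intros x [? _]; lra. } { exists a; auto. }
  assert (am : a <= m <= b). { split; [apply Um; auto|]. apply Lm. intros x [? _]; lra. }
  assert (Hlt : forall t, a <= t < m -> g t <= r).
  { intros t Ht. apply NNPP; intros N. assert (m <= t); [|lra]. apply Lm. intros x [Hx Hx'].
    destruct (Rle_dec x t); auto. elim N. apply Hx'. lra. }
  assert (Hm : g m <= r).
  { apply Rnot_lt_le. intros L.
    destruct (Req_dec a m) as [->|Nam]; [lra|].
    assert (E0 : 0 < g m - r) by lra.
    destruct (proj1 (filterlim_locally _ _) (Hc m am) (mkposreal _ E0)) as [d Hd].
    pose proof (cond_pos d). set (t := Rmax a (m - d / 2)).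
    assert (a <= t < m). { unfold t; split; [apply Rmax_l|]. apply Rmax_lub_lt; lra. }
    assert (m - d / 2 <= t) by apply Rmax_r.
    assert (ball m d t) by (change (Rabs (t - m) < d); apply Rabs_def1; lra).
    specialize (Hd t H2). change (Rabs (g t - g m) < g m - r) in Hd. apply Rabs_def2 in Hd.
    specialize (Hlt t H0). lra. }
  assert (Hle : forall t, a <= t <= m -> g t <= r).
  { intros t Ht. destruct (Rlt_dec t m); [apply Hlt; lra|]. replace t with m by lra; auto. }
  exists m. repeat split; try lra; auto.
  destruct (Req_dec m b) as [->|Nb]; [lra|].
  apply Rle_antisym; auto. apply Rnot_lt_le. intros L.
  assert (E0 : 0 < r - g m) by lra.
  destruct (proj1 (filterlim_locally _ _) (Hc m am) (mkposreal _ E0)) as [d Hd].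
  pose proof (cond_pos d). set (t := Rmin b (m + d / 2)).
  assert (m < t). { unfold t. apply Rmin_glb_lt; lra. }
  assert (E t); [|specialize (Um t H1); lra].
  split; [split; [lra|apply Rmin_l]|]. intros s Hs.
  destruct (Rle_dec s m); [apply Hle; lra|].
  assert (s <= m + d / 2) by (eapply Rle_trans; [apply Hs|apply Rmin_r]).
  assert (ball m d s) by (change (Rabs (s - m) < d); apply Rabs_def1; lra).
  specialize (Hd s H2). change (Rabs (g s - g m) < r - g m) in Hd. apply Rabs_def2 in Hd. lra.
Qed.

Lemma last_exit (g : R -> R) a b r : a <= b -> (forall t, a <= t <= b -> continuous g t) ->
  g a <= r -> r <= g b ->
  exists c, a <= c <= b /\ g c = r /\ forall t, c <= t <= b -> r <= g t.
Proof.
  intros Hab Hc Ha Hb.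
  destruct (first_hit (fun t => - g (- t)) (- b) (- a) (- r)) as (c & H1 & H2 & H3).
  - lra.
  - intros t Ht. apply (continuous_opp (V := R_NormedModule)). apply (continuous_comp Ropp g).
    + apply (continuous_opp (V := R_NormedModule)), continuous_id.
    + apply Hc; lra.
  - rewrite Ropp_involutive; lra.
  - rewrite Ropp_involutive; lra.
  - exists (- c). repeat split; try lra. intros t Ht. specialize (H3 (- t)). rewrite Ropp_involutive in H3.
    assert (- g t <= - r) by (apply H3; lra). lra.
Qed.

(** * Locally uniform limits of harmonic polynomials *)

(** Locally uniform convergence on the open disk, expressed by majorants. Since [r < 1] is
    arbitrary, differentiating the terms preserves it at the expense of a larger radius. *)
Definition summ (q : nat -> list C) := forall r, 0 <= r < 1 -> ex_series (fun k => nrm r (q k)).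
Definition hser (q : nat -> list C) (z : R2) : R := Series (fun k => Re (pev (q k) z)).

Lemma disk_Cmod (z : R2) : disk z <-> Cmod z < 1.
Proof.
  unfold disk, Cmod. split; intros H.
  - rewrite <- sqrt_1. apply sqrt_lt_1_alt. split; [nra|auto].
  - rewrite <- sqrt_1 in H. apply sqrt_lt_0_alt in H. auto.
Qed.

Lemma Re_le_Cmod z : Rabs (Re z) <= Cmod z.
Proof. apply re_le_Cmod. Qed.

Lemma ex_series_major (a b : nat -> R) : (forall n, Rabs (a n) <= b n) -> ex_series b -> ex_series a.
Proof. intros H. apply (ex_series_le (K := R_AbsRing) (V := R_CompleteNormedModule)). exact H. Qed.

Lemma ex_series_scalR (c : R) (a : nat -> R) : ex_series a -> ex_series (fun n => c * a n).
Proof. intros H. apply (ex_series_scal (K := R_AbsRing) (V := R_NormedModule) c a H). Qed.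

Lemma summ_pder q : summ q -> summ (fun k => pder (q k)).
Proof.
  intros H r Hr. apply (ex_series_major _ (fun k => nrm ((r + 1) / 2) (q k) * / ((r + 1) / 2 - r))).
  - intros n. rewrite Rabs_pos_eq by (apply nrm_pos; lra). apply nrm_pder_le. lra.
  - apply ex_series_scal_r. apply H; lra.
Qed.

Lemma summ_pscal c q : summ q -> summ (fun k => pscal c (q k)).
Proof.
  intros H r Hr. apply (ex_series_ext (fun k => Cmod c * nrm r (q k))).
  - intros; rewrite nrm_pscal; auto.
  - apply ex_series_scalR. auto.
Qed.

Lemma summ_ex q z : summ q -> Cmod z < 1 -> ex_series (fun k => Re (pev (q k) z)).
Proof.
  intros H Hz. apply (ex_series_major _ (fun k => nrm (Cmod z) (q k))).
  - intros n. eapply Rle_trans; [apply Re_le_Cmod|]. apply pev_le; lra.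
  - apply H. pose proof (Cmod_ge_0 z); lra.
Qed.

Lemma summ_nrmd1 q r : summ q -> 0 <= r < 1 -> ex_series (fun k => nrmd1 r (q k)).
Proof.
  intros H Hr. apply (ex_series_major _ (fun k => nrm ((r + 1) / 2) (q k) * / ((r + 1) / 2 - r))).
  - intros n. rewrite Rabs_pos_eq by (apply nrmd1_pos; lra).
    apply (Rmult_le_reg_l ((r + 1) / 2 - r)); [lra|].
    pose proof (nrmd1_le r ((r + 1) / 2) (q n) ltac:(lra)). pose proof (nrm_pos r (q n) ltac:(lra)).
    replace (((r + 1) / 2 - r) * (nrm ((r + 1) / 2) (q n) * / ((r + 1) / 2 - r))) with (nrm ((r + 1) / 2) (q n)) by
      (field; lra). lra.
  - apply ex_series_scal_r. apply H; lra.
Qed.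

Lemma summ_nrmd2 q r : summ q -> 0 <= r < 1 -> ex_series (fun k => nrmd2 r (q k)).
Proof.
  intros H Hr. apply (ex_series_major _ (fun k => nrmd1 ((r + 1) / 2) (q k) * / ((r + 1) / 2 - r))).
  - intros n. rewrite Rabs_pos_eq by (apply nrmd2_pos; lra).
    apply (Rmult_le_reg_l ((r + 1) / 2 - r)); [lra|].
    pose proof (nrmd2_le r ((r + 1) / 2) (q n) ltac:(lra)). pose proof (nrmd1_pos r (q n) ltac:(lra)).
    replace (((r + 1) / 2 - r) * (nrmd1 ((r + 1) / 2) (q n) * / ((r + 1) / 2 - r))) with (nrmd1 ((r + 1) / 2) (q n))
      by (field; lra). lra.
  - apply ex_series_scal_r. apply summ_nrmd1; auto; lra.
Qed.

Lemma plus_scal_C (z e : R2) (t : R) : plus z (scal t e) = (z + RtoC t * e)%C.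
Proof.
  destruct z, e. apply injective_projections; simpl.
  - unfold plus, scal; simpl; unfold mult; simpl. ring.
  - unfold plus, scal; simpl; unfold mult; simpl. ring.
Qed.

(** Summing the termwise Taylor bounds gives a quadratic remainder in all real directions at once.
    The linear term is again a series of the same kind, so partial derivatives, the chain rule and
    smoothness can be derived from this one estimate. *)
Lemma hser_taylor q (z : R2) : summ q -> Cmod z < 1 -> exists M d, 0 < d /\
  forall h : R2, Cmod h < d ->
    Rabs (hser q (z + h)%C - hser q z - hser (fun k => pscal h (pder (q k))) z) <= M * (Cmod h * Cmod h).
Proof.
  intros Hq Hz. pose proof (Cmod_ge_0 z) as Z0.
  set (r := (Cmod z + 1) / 2).
  assert (Hr : 0 <= r < 1) by (unfold r; lra).
  exists (Series (fun k => nrmd2 r (q k))), (r - Cmod z). split; [unfold r; lra|].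
  intros h Hh.
  assert (Hzt : Cmod (z + h) <= r) by (eapply Rle_trans; [apply Cmod_triangle|]; lra).
  unfold hser.
  assert (X1 : ex_series (fun k => Re (pev (q k) (z + h)))) by (apply summ_ex; auto; lra).
  assert (X2 : ex_series (fun k => Re (pev (q k) z))) by (apply summ_ex; auto).
  assert (X3 : ex_series (fun k => Re (pev (pscal h (pder (q k))) z))).
  { apply (summ_ex (fun k => pscal h (pder (q k)))); auto. apply summ_pscal, summ_pder; auto. }
  rewrite <- (Series_minus _ _ X1 X2).
  assert (X4 : ex_series (fun k => Re (pev (q k) (z + h)) - Re (pev (q k) z))) by apply (ex_series_minus (V :=
    R_NormedModule) _ _ X1 X2).
  rewrite <- (Series_minus _ _ X4 X3).
  assert (B : forall k, Rabs (Re (pev (q k) (z + h)) - Re (pev (q k) z) - Re (pev (pscal h (pder (q k))) z))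
     <= nrmd2 r (q k) * (Cmod h * Cmod h)).
  { intros k. pose proof (pev_taylor r (q k) z h ltac:(unfold r; lra) Hzt) as T.
    eapply Rle_trans; [|apply T]. eapply Rle_trans; [|apply Re_le_Cmod]. right. f_equal.
    rewrite pev_pscal. reflexivity. }
  eapply Rle_trans; [apply Series_Rabs|].
  - apply (ex_series_major _ (fun k => nrmd2 r (q k) * (Cmod h * Cmod h))).
    + intros. rewrite Rabs_Rabsolu. apply B.
    + apply ex_series_scal_r, summ_nrmd2; auto.
  - rewrite <- Series_scal_r. apply Series_le.
    + intros n; split; [apply Rabs_pos|apply B].
    + apply ex_series_scal_r, summ_nrmd2; auto.
Qed.

Lemma hser_linear q (z h : R2) : summ q -> Cmod z < 1 ->
  hser (fun k => pscal h (pder (q k))) z =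
  fst h * hser (fun k => pscal eu (pder (q k))) z + snd h * hser (fun k => pscal ev (pder (q k))) z.
Proof.
  intros Hq Hz. unfold hser. rewrite <- !Series_scal_l.
  assert (E : forall e : R2, ex_series (fun k => Re (pev (pscal e (pder (q k))) z))).
  { intros e. apply (summ_ex (fun k => pscal e (pder (q k)))); auto. apply summ_pscal, summ_pder; auto. }
  rewrite <- Series_plus by (apply ex_series_scalR; apply E).
  apply Series_ext. intros n. rewrite !pev_pscal. unfold eu, ev, Re; simpl. ring.
Qed.

Lemma is_derive_0_squeeze (E G : R -> R) t : locally t (fun s => Rabs (E s) <= G s) ->
  G t = 0 -> is_derive G t 0 -> is_derive E t 0.
Proof.
  intros HE HG HD. apply is_derive_Reals in HD. apply is_derive_Reals. intros e e0.
  destruct (HD e e0) as [d Hd]. destruct HE as [d' Hd'].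
  assert (P : 0 < Rmin d d') by (apply Rmin_pos; apply cond_pos).
  assert (Et : E t = 0).
  { specialize (Hd' t (ball_center _ _)). rewrite HG in Hd'. pose proof (Rabs_pos (E t)).
    apply Rabs_eq_0; lra. }
  exists (mkposreal _ P). intros h h0 Hh. simpl in Hh.
  assert (Hh1 : Rabs h < d) by (eapply Rlt_le_trans; [apply Hh|apply Rmin_l]).
  assert (Hh2 : Rabs h < d') by (eapply Rlt_le_trans; [apply Hh|apply Rmin_r]).
  specialize (Hd h h0 Hh1). rewrite HG in Hd. rewrite Et.
  assert (B : ball t d' (t + h)).
  { change (Rabs (t + h - t) < d'). replace (t + h - t) with h by ring. auto. }
  specialize (Hd' _ B). rewrite !Rminus_0_r in *. eapply Rle_lt_trans; [|apply Hd].
  unfold Rdiv. rewrite !Rabs_mult. apply Rmult_le_compat_r; [apply Rabs_pos|].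
  eapply Rle_trans; [apply Hd'|apply Rle_abs].
Qed.

Lemma is_derive_ball (g : R -> R) t l e : is_derive g t l -> 0 < e -> locally t (fun s => Rabs (g s - g t) < e).
Proof.
  intros D e0. assert (C0 : continuous g t) by (apply (ex_derive_continuous (K := R_AbsRing) (V := R_NormedModule));
    eexists; eauto).
  exact (proj1 (filterlim_locally _ _) C0 (mkposreal e e0)).
Qed.

Lemma Cmod_le_sum (z : C) : Cmod z <= Rabs (fst z) + Rabs (snd z).
Proof.
  pose proof (Rabs_pos (fst z)). pose proof (Rabs_pos (snd z)).
  apply Rsqr_incr_0_var; [|lra]. unfold Rsqr.
  replace (Cmod z * Cmod z) with (Cmod z ^ 2) by ring. rewrite Cmod2_alt. unfold Re, Im.
  pose proof (Rsqr_abs (fst z)) as A. pose proof (Rsqr_abs (snd z)) as B. unfold Rsqr in *. nra.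
Qed.

Lemma is_derive_lin2 (f g : R -> R) t l1 l2 X Y : is_derive f t l1 -> is_derive g t l2 ->
  is_derive (fun s => (f s - f t) * X + (g s - g t) * Y) t (l1 * X + l2 * Y).
Proof.
  intros D1 D2. auto_derive; [repeat split; eexists; eauto|].
  apply is_derive_unique in D1. apply is_derive_unique in D2. rewrite <- D1, <- D2. change (fun x : R => f x) with f.
  change (fun x : R => g x) with g. ring.
Qed.

Lemma is_derive_sq2 (f g : R -> R) t l1 l2 M : is_derive f t l1 -> is_derive g t l2 ->
  is_derive (fun s => M * ((f s - f t) * (f s - f t) + (g s - g t) * (g s - g t))) t 0.
Proof.
  intros D1 D2. auto_derive; [repeat split; eexists; eauto|]. ring.
Qed.

Lemma hser_chain q (g : R -> R2) t l1 l2 : summ q -> Cmod (g t) < 1 ->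
  is_derive (fun s => fst (g s)) t l1 -> is_derive (fun s => snd (g s)) t l2 ->
  is_derive (fun s => hser q (g s)) t
    (l1 * hser (fun k => pscal eu (pder (q k))) (g t) + l2 * hser (fun k => pscal ev (pder (q k))) (g t)).
Proof.
  intros Hq Hz D1 D2. destruct (hser_taylor q (g t) Hq Hz) as (M & d & d0 & H).
  set (X := hser (fun k => pscal eu (pder (q k))) (g t)) in *.
  set (Y := hser (fun k => pscal ev (pder (q k))) (g t)) in *.
  set (A := fun s => (fst (g s) - fst (g t)) * X + (snd (g s) - snd (g t)) * Y).
  (* [G] is [M] times the squared modulus of [g s - g t], that is, the bound on the remainder; it is
     stationary at [t], so the error of the linear part [A] has derivative 0. *)
  set (G := fun s => M * ((fst (g s) - fst (g t)) * (fst (g s) - fst (g t)) + (snd (g s) - snd (g t)) * (snd (g s) -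
    snd (g t)))).
  assert (DA : is_derive A t (l1 * X + l2 * Y)).
  { apply (is_derive_lin2 (fun s => fst (g s)) (fun s => snd (g s))); auto. }
  assert (DG : is_derive G t 0).
  { apply (is_derive_sq2 (fun s => fst (g s)) (fun s => snd (g s)) t l1 l2); auto. }
  assert (DE : is_derive (fun s => hser q (g s) - hser q (g t) - A s) t 0).
  { apply (is_derive_0_squeeze _ G); auto; [|unfold G; ring].
    assert (d2 : 0 < d / 2) by lra.
    generalize (filter_and _ _ (is_derive_ball _ _ _ _ D1 d2) (is_derive_ball _ _ _ _ D2 d2)).
    apply filter_imp. intros s [B1 B2].
    set (h := (g s - g t)%C : R2).
    assert (Hh : Cmod h < d).
    { eapply Rle_lt_trans; [apply Cmod_le_sum|]. unfold h; simpl. unfold Rminus in *. lra. }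
    specialize (H h Hh). rewrite (hser_linear q (g t) h Hq Hz) in H. fold X Y in H.
    replace (g t + h)%C with (g s) in H by (unfold h; apply injective_projections; simpl; ring).
    replace (Cmod h * Cmod h) with (Cmod h ^ 2) in H by ring. rewrite Cmod2_alt in H.
    unfold A, G. unfold Re, Im, h in H; simpl in H. unfold Rminus in *. rewrite !Rmult_1_r in H. exact H. }
  apply (is_derive_ext (fun s => (hser q (g s) - hser q (g t) - A s) + A s + hser q (g t))).
  { intros s. simpl. ring. }
  evar_last. apply (is_derive_plus (V := R_NormedModule)); [apply (is_derive_plus (V := R_NormedModule));
    [exact DE|exact DA]|apply (is_derive_const (V := R_NormedModule))].
  unfold plus, zero; simpl. ring.
Qed.

Lemma is_derive_affine (c e t : R) : is_derive (fun s : R => c + s * e) t e.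
Proof. auto_derive; auto. ring. Qed.

Lemma hser_derive q (z e : R2) : summ q -> Cmod z < 1 ->
  is_derive (fun t => hser q (plus z (scal t e))) 0 (hser (fun k => pscal e (pder (q k))) z).
Proof.
  intros Hq Hz. rewrite hser_linear by auto.
  assert (E : plus z (scal 0 e) = z).
  { rewrite plus_scal_C. apply injective_projections; simpl; ring. }
  pose proof (hser_chain q (fun t : R => plus z (scal t e)) 0 (fst e) (snd e) Hq) as H.
  cbv beta in H. rewrite E in H. apply H; auto.
  - apply is_derive_affine.
  - apply is_derive_affine.
Qed.

Lemma hser_continuous q (z : R2) : summ q -> Cmod z < 1 -> continuous (hser q) z.
Proof.
  intros Hq Hz. pose proof (Cmod_ge_0 z) as Z0. apply continuous_R2. intros e e0.
  set (r := (Cmod z + 1) / 2).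
  assert (Hr : 0 <= r < 1) by (unfold r; lra).
  set (L := Series (fun k => nrmd1 r (q k))).
  assert (L0 : 0 <= L).
  { unfold L. replace 0 with (Series (fun k => 0 * nrmd1 r (q k))) by (rewrite Series_scal_l; ring).
    apply Series_le; [|apply summ_nrmd1; auto]. intros n. pose proof (nrmd1_pos r (q n)). lra. }
  exists (Rmin (r - Cmod z) (e / (L + 1))). split.
  { apply Rmin_pos; [unfold r; lra|]. apply Rdiv_lt_0_compat; lra. }
  intros w Hw.
  assert (Hw1 : Cmod (w - z) < r - Cmod z) by (eapply Rlt_le_trans; [apply Hw|apply Rmin_l]).
  assert (Hw2 : Cmod (w - z) < e / (L + 1)) by (eapply Rlt_le_trans; [apply Hw|apply Rmin_r]).
  assert (Hwr : Cmod w <= r). { pose proof (Cmod_triangle (w - z) z).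
  assert (Wz : (w - z + z)%C = w) by (apply injective_projections; simpl; ring); rewrite Wz in H. lra. }
  unfold hser. rewrite <- Series_minus by (apply summ_ex; auto; lra).
  assert (B : forall k, Rabs (Re (pev (q k) w) - Re (pev (q k) z)) <= nrmd1 r (q k) * Cmod (w - z)).
  { intros k. eapply Rle_trans; [|apply (pev_lip r (q k) w z); unfold r; auto; lra].
    eapply Rle_trans; [|apply Re_le_Cmod]. right. reflexivity. }
  eapply Rle_lt_trans; [apply Series_Rabs|].
  - apply (ex_series_major _ (fun k => nrmd1 r (q k) * Cmod (w - z))).
    + intros. rewrite Rabs_Rabsolu. apply B.
    + apply ex_series_scal_r, summ_nrmd1; auto.
  - apply Rle_lt_trans with (L * Cmod (w - z)).
    + unfold L. rewrite <- Series_scal_r. apply Series_le.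
      * intros n; split; [apply Rabs_pos|apply B].
      * apply ex_series_scal_r, summ_nrmd1; auto.
    + pose proof (Cmod_ge_0 (w - z)). apply (Rmult_lt_compat_r (L + 1)) in Hw2; [|lra].
      unfold Rdiv in Hw2. rewrite Rmult_assoc, Rinv_l, Rmult_1_r in Hw2 by lra. nra.
Qed.

Lemma locally_disk (z : R2) : disk z -> locally z disk.
Proof.
  intros H. apply disk_Cmod in H.
  assert (E : 0 < (1 - Cmod z) / 2) by lra.
  exists (mkposreal _ E). intros y Hy. apply ball2_Cmod in Hy. simpl in Hy. apply disk_Cmod.
  pose proof (Cmod_triangle (y - z) z).
  assert (Wz : (y - z + z)%C = y) by (apply injective_projections; simpl; ring); rewrite Wz in H0. lra.
Qed.

Lemma locally_line (z e : R2) : disk z -> locally 0 (fun t : R => disk (plus z (scal t e))).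
Proof.
  intros H. apply disk_Cmod in H. pose proof (Cmod_ge_0 e).
  assert (E : 0 < (1 - Cmod z) / (Cmod e + 1)) by (apply Rdiv_lt_0_compat; lra).
  exists (mkposreal _ E). intros t Ht. change (Rabs (t - 0) < (1 - Cmod z) / (Cmod e + 1)) in Ht.
  rewrite Rminus_0_r in Ht. apply disk_Cmod. rewrite plus_scal_C.
  eapply Rle_lt_trans; [apply Cmod_triangle|]. rewrite Cmod_mult, Cmod_R.
  apply (Rmult_lt_compat_r (Cmod e + 1)) in Ht; [|lra]. unfold Rdiv in Ht.
  rewrite Rmult_assoc, Rinv_l, Rmult_1_r in Ht by lra. pose proof (Rabs_pos t). nra.
Qed.

Lemma pd_hser (f : R2 -> R) q (z e : R2) : summ q -> (forall w, disk w -> f w = hser q w) -> disk z ->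
  ex_derive (fun t => f (plus z (scal t e))) 0 /\ pd e f z = hser (fun k => pscal e (pder (q k))) z.
Proof.
  intros Hq Hf Hz.
  assert (D : is_derive (fun t => f (plus z (scal t e))) 0 (hser (fun k => pscal e (pder (q k))) z)).
  { apply (is_derive_ext_loc (fun t => hser q (plus z (scal t e)))).
    - eapply filter_imp; [|apply (locally_line z e Hz)]. intros t Ht. symmetry. apply Hf, Ht.
    - apply hser_derive; auto. apply disk_Cmod, Hz. }
  split; [eexists; apply D|]. apply is_derive_unique, D.
Qed.

(** The functions that agree on the disk with some [hser] form a class closed under partial
    derivatives. Agreement is asked on the disk only, because that is all that is known of the
    iterated derivatives. *)
Lemma hser_Ck n : forall (f : R2 -> R) q, summ q -> (forall w, disk w -> f w = hser q w) -> Ck dirs2 n disk f.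
Proof.
  assert (Hc : forall (f : R2 -> R) q z, summ q -> (forall w, disk w -> f w = hser q w) -> disk z -> continuous f z).
  { intros f q z Hq Hf Hz. apply (continuous_ext_loc f (hser q) z).
    - eapply filter_imp; [|apply (locally_disk z Hz)]. intros; symmetry; auto.
    - apply hser_continuous; auto. apply disk_Cmod, Hz. }
  induction n; intros f q Hq Hf; simpl.
  - intros x Hx. apply (Hc f q); auto.
  - split; [intros x Hx; apply (Hc f q); auto|].
    repeat constructor.
    + intros x Hx. apply (pd_hser f q); auto.
    + apply (IHn _ (fun k => pscal (1, 0) (pder (q k)))); [apply summ_pscal, summ_pder; auto|].
      intros w Hw. apply (pd_hser f q); auto.
    + intros x Hx. apply (pd_hser f q); auto.
    + apply (IHn _ (fun k => pscal (0, 1) (pder (q k)))); [apply summ_pscal, summ_pder; auto|].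
      intros w Hw. apply (pd_hser f q); auto.
Qed.

(** Differences of consecutive stages: the partial sums are the stages themselves, so closeness of
    consecutive surfaces becomes a bound on the terms of a series whose sum is the limit surface. *)
Definition tele (F : nat -> list C) (k : nat) : list C :=
  match k with O => F O | S k => psub (F (S k)) (F k) end.

Lemma sum_n_tele (F : nat -> list C) (g : list C -> R) n :
  (forall p q, g (psub p q) = g p - g q) -> sum_n (fun k => g (tele F k)) n = g (F n).
Proof.
  intros Hg. induction n.
  - rewrite sum_O; auto.
  - rewrite sum_Sn, IHn. unfold plus; simpl. rewrite Hg. ring.
Qed.

Lemma Series_lim_tele (F : nat -> list C) (g : list C -> R) :
  (forall p q, g (psub p q) = g p - g q) -> ex_series (fun k => g (tele F k)) ->
  is_lim_seq (fun n => g (F n)) (Series (fun k => g (tele F k))).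
Proof.
  intros Hg Hex. apply Series_correct in Hex. unfold is_series in Hex.
  apply (is_lim_seq_ext (sum_n (fun k => g (tele F k)))).
  - intros n. apply sum_n_tele; auto.
  - exact Hex.
Qed.

Lemma Re_minus z w : Re (z - w) = Re z - Re w.
Proof. reflexivity. Qed.
Lemma Im_minus z w : Im (z - w) = Im z - Im w.
Proof. reflexivity. Qed.

Lemma hser_lim F z : summ (tele F) -> Cmod z < 1 -> is_lim_seq (fun n => Re (pev (F n) z)) (hser (tele F) z).
Proof.
  intros H Hz. apply (Series_lim_tele F (fun p => Re (pev p z))).
  - intros. rewrite pev_psub. apply Re_minus.
  - apply (summ_ex (tele F)); auto.
Qed.

Lemma hser_lim_u F z : summ (tele F) -> Cmod z < 1 ->
  is_lim_seq (fun n => Re (pev (pder (F n)) z)) (hser (fun k => pscal eu (pder (tele F k))) z).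
Proof.
  intros H Hz. unfold hser.
  assert (E : forall p, Re (pev (pscal eu (pder p)) z) = Re (pev (pder p) z)).
  { intros p. rewrite pev_pscal. unfold eu, Re; simpl. ring. }
  rewrite (Series_ext _ (fun k => Re (pev (pder (tele F k)) z))) by (intros; apply E).
  apply (Series_lim_tele F (fun p => Re (pev (pder p) z))).
  - intros. rewrite pev_pder_psub. apply Re_minus.
  - apply (summ_ex (fun k => pder (tele F k))); auto. apply summ_pder; auto.
Qed.

Lemma hser_lim_v F z : summ (tele F) -> Cmod z < 1 ->
  is_lim_seq (fun n => - Im (pev (pder (F n)) z)) (hser (fun k => pscal ev (pder (tele F k))) z).
Proof.
  intros H Hz. unfold hser.
  assert (E : forall p, Re (pev (pscal ev (pder p)) z) = - Im (pev (pder p) z)).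
  { intros p. rewrite pev_pscal. unfold ev, Re, Im; simpl. ring. }
  rewrite (Series_ext _ (fun k => - Im (pev (pder (tele F k)) z))) by (intros; apply E).
  apply (Series_lim_tele F (fun p => - Im (pev (pder p) z))).
  - intros. rewrite pev_pder_psub, Im_minus. ring.
  - apply (ex_series_ext _ _ (fun k => E (tele F k))).
    apply (summ_ex (fun k => pscal ev (pder (tele F k)))); auto. apply summ_pscal, summ_pder; auto.
Qed.

(** * Null curves, conformality and minimality *)

Definition null3 (a b c : C) := (a * a + b * b + c * c)%C = 0%C.

(** The real part of a holomorphic [F] has partial derivatives [Re F'] and [- Im F']; for a null
    [F'] these are therefore orthogonal and of equal length, which is conformality. *)
Lemma null3_real a b c : null3 a b c ->
  Re a * Re a + Re b * Re b + Re c * Re c = Im a * Im a + Im b * Im b + Im c * Im c /\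
  Re a * Im a + Re b * Im b + Re c * Im c = 0.
Proof.
  unfold null3. intros H. pose proof (f_equal fst H) as H1. pose proof (f_equal snd H) as H2.
  destruct a, b, c. unfold Re, Im. simpl in *. split; lra.
Qed.

Definition psi_lim (F1 F2 F3 : nat -> list C) (z : R2) : R3 :=
  mk3 (hser (tele F1) z) (hser (tele F2) z) (hser (tele F3) z).

Section Limit.
Variables (F1 F2 F3 : nat -> list C) (lam : nat -> C -> R).
Hypotheses (S1 : summ (tele F1)) (S2 : summ (tele F2)) (S3 : summ (tele F3)).
Hypothesis Hnull : forall n z, null3 (pev (pder (F1 n)) z) (pev (pder (F2 n)) z) (pev (pder (F3 n)) z).
Hypothesis Hlam : forall n z, lam n z =
  norm3 (mk3 (Re (pev (pder (F1 n)) z)) (Re (pev (pder (F2 n)) z)) (Re (pev (pder (F3 n)) z))).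
Let psi := psi_lim F1 F2 F3.

Lemma pdv_psi_lim z e : disk z -> pdv e psi z =
  mk3 (hser (fun k => pscal e (pder (tele F1 k))) z) (hser (fun k => pscal e (pder (tele F2 k))) z)
      (hser (fun k => pscal e (pder (tele F3 k))) z).
Proof.
  intros Hz. apply R3_ext.
  - exact (proj2 (pd_hser (hser (tele F1)) (tele F1) z e S1 (fun w _ => eq_refl) Hz)).
  - exact (proj2 (pd_hser (hser (tele F2)) (tele F2) z e S2 (fun w _ => eq_refl) Hz)).
  - exact (proj2 (pd_hser (hser (tele F3)) (tele F3) z e S3 (fun w _ => eq_refl) Hz)).
Qed.

Lemma psi_lim_conformal z : disk z ->
  dot3 (pdv eu psi z) (pdv eu psi z) = dot3 (pdv ev psi z) (pdv ev psi z) /\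
  dot3 (pdv eu psi z) (pdv ev psi z) = 0 /\
  is_lim_seq (fun n => lam n z) (norm3 (pdv eu psi z)).
Proof.
  intros Hz. rewrite !pdv_psi_lim by auto. apply disk_Cmod in Hz.
  pose proof (hser_lim_u F1 z S1 Hz) as U1. pose proof (hser_lim_u F2 z S2 Hz) as U2.
  pose proof (hser_lim_u F3 z S3 Hz) as U3.
  pose proof (hser_lim_v F1 z S1 Hz) as V1. pose proof (hser_lim_v F2 z S2 Hz) as V2.
  pose proof (hser_lim_v F3 z S3 Hz) as V3.
  revert U1 U2 U3 V1 V2 V3.
  generalize (hser (fun k => pscal eu (pder (tele F1 k))) z) (hser (fun k => pscal eu (pder (tele F2 k))) z) (hser
    (fun k => pscal eu (pder (tele F3 k))) z)
    (hser (fun k => pscal ev (pder (tele F1 k))) z) (hser (fun k => pscal ev (pder (tele F2 k))) z) (hser (fun k =>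
      pscal ev (pder (tele F3 k))) z).
  intros a1 a2 a3 b1 b2 b3 U1 U2 U3 V1 V2 V3.
  assert (P : forall (u v u' v' u'' v'' : nat -> R) a b a' b' a'' b'', is_lim_seq u (Finite a) ->
    is_lim_seq v (Finite b) ->
    is_lim_seq u' (Finite a') -> is_lim_seq v' (Finite b') -> is_lim_seq u'' (Finite a'') ->
      is_lim_seq v'' (Finite b'') ->
    is_lim_seq (fun n => u n * v n + u' n * v' n + u'' n * v'' n) (a * b + a' * b' + a'' * b'')).
  { intros. apply is_lim_seq_plus'; [apply is_lim_seq_plus'|]; apply is_lim_seq_mult'; auto. }
  pose proof (P _ _ _ _ _ _ _ _ _ _ _ _ U1 U1 U2 U2 U3 U3) as E.
  pose proof (P _ _ _ _ _ _ _ _ _ _ _ _ V1 V1 V2 V2 V3 V3) as G.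
  pose proof (P _ _ _ _ _ _ _ _ _ _ _ _ U1 V1 U2 V2 U3 V3) as K.
  unfold dot3, mk3, x1, x2, x3; simpl. split; [|split].
  - apply is_lim_seq_unique in E. apply is_lim_seq_unique in G.
    assert (Q : forall n, Re (pev (pder (F1 n)) z) * Re (pev (pder (F1 n)) z) + Re (pev (pder (F2 n)) z) * Re (pev
      (pder (F2 n)) z) + Re (pev (pder (F3 n)) z) * Re (pev (pder (F3 n)) z)
      = - Im (pev (pder (F1 n)) z) * - Im (pev (pder (F1 n)) z) + - Im (pev (pder (F2 n)) z) * - Im (pev (pder (F2
        n)) z) + - Im (pev (pder (F3 n)) z) * - Im (pev (pder (F3 n)) z)).
    { intros n. destruct (null3_real _ _ _ (Hnull n z)) as [A _]. lra. }
    rewrite (Lim_seq_ext _ _ Q), G in E. injection E; auto.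
  - apply is_lim_seq_unique in K. rewrite (Lim_seq_ext _ (fun _ => 0)) in K.
    + rewrite Lim_seq_const in K. injection K; auto.
    + intros n; simpl. destruct (null3_real _ _ _ (Hnull n z)) as [_ B]. lra.
  - apply (is_lim_seq_ext (fun n => sqrt (Re (pev (pder (F1 n)) z) * Re (pev (pder (F1 n)) z) + Re (pev (pder (F2 n))
      z) * Re (pev (pder (F2 n)) z) + Re (pev (pder (F3 n)) z) * Re (pev (pder (F3 n)) z)))).
    + intros n. rewrite Hlam. reflexivity.
    + apply (is_lim_seq_continuous sqrt _ (a1 * a1 + a2 * a2 + a3 * a3)); [|exact E].
      apply continuity_pt_sqrt. nra.
Qed.

(** Each coordinate is harmonic: differentiating twice in the direction [ev] multiplies the second
    complex derivative by the square of [Ci], which is -1. The arbitrary [N] fits the shape of the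
    mean curvature numerator. *)
Lemma psi_lim_lap z : disk z -> forall N,
  dot3 (pdv2 eu eu psi z) N + dot3 (pdv2 ev ev psi z) N = 0.
Proof.
  intros Hz N.
  assert (H : forall F, summ (tele F) -> pd ev (pd ev (hser (tele F))) z = - pd eu (pd eu (hser (tele F))) z).
  { intros F SF.
    rewrite (proj2 (pd_hser (pd ev (hser (tele F))) (fun k => pscal ev (pder (tele F k))) z ev
      (summ_pscal _ _ (summ_pder _ SF)) (fun w Hw => proj2 (pd_hser (hser (tele F)) (tele F) w ev SF (fun w _ =>
        eq_refl) Hw)) Hz)).
    rewrite (proj2 (pd_hser (pd eu (hser (tele F))) (fun k => pscal eu (pder (tele F k))) z eu
      (summ_pscal _ _ (summ_pder _ SF)) (fun w Hw => proj2 (pd_hser (hser (tele F)) (tele F) w eu SF (fun w _ =>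
        eq_refl) Hw)) Hz)).
    unfold hser. rewrite <- Series_opp. apply Series_ext. intros n.
    rewrite !pev_pscal, !pev_pder_pscal. unfold ev, eu, Re; simpl. ring. }
  pose proof (H F1 S1) as A1. pose proof (H F2 S2) as A2. pose proof (H F3 S3) as A3.
  change (pd eu (pd eu (hser (tele F1))) z * x1 N + pd eu (pd eu (hser (tele F2))) z * x2 N + pd eu (pd eu (hser
    (tele F3))) z * x3 N
    + (pd ev (pd ev (hser (tele F1))) z * x1 N + pd ev (pd ev (hser (tele F2))) z * x2 N + pd ev (pd ev (hser (tele
        F3))) z * x3 N) = 0).
  rewrite A1, A2, A3. ring.
Qed.

(** In conformal coordinates [E = G] and [F = 0], so the numerator of the mean curvature is [E]
    times the Laplacian paired with the normal, and the squared length of the cross product is the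
    square of [E]. *)
Lemma psi_lim_minimal : (forall z, disk z -> 0 < norm3 (pdv eu psi z)) -> minimal_immersion psi.
Proof.
  intros Hpos. split; [|split].
  - repeat split; intros n; [apply (hser_Ck n _ (tele F1))|apply (hser_Ck n _ (tele F2))|apply (hser_Ck n _ (tele
      F3))]; auto.
  - intros z Hz E. destruct (psi_lim_conformal z Hz) as (A & B & _). specialize (Hpos z Hz).
    pose proof (norm3_sqr (pdv eu psi z)) as Q.
    set (X := pdv eu psi z) in *. set (Y := pdv ev psi z) in *.
    assert (L : dot3 (cross3 X Y) (cross3 X Y) = dot3 X X * dot3 Y Y - dot3 X Y * dot3 X Y).
    { unfold cross3, dot3, mk3, x1, x2, x3; simpl. ring. }
    rewrite E, B, <- A, <- Q in L. unfold dot3, mk3, x1, x2, x3 in L; simpl in L.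
    assert (0 < (norm3 X * norm3 X) * (norm3 X * norm3 X)) by (apply Rmult_lt_0_compat; nra). lra.
  - intros z Hz. cbv zeta. destruct (psi_lim_conformal z Hz) as (A & B & _).
    rewrite B, <- A. pose proof (psi_lim_lap z Hz (cross3 (pdv eu psi z) (pdv ev psi z))). nra.
Qed.
End Limit.

(** * Lengths of curves crossing an annulus *)

Definition vel (g : R -> R2) (t : R) : C := (Derive (fun s => fst (g s)) t, Derive (fun s => snd (g s)) t).

Definition C1_curve (g : R -> R2) : Prop :=
  (forall t, ex_derive (fun s => fst (g s)) t /\ ex_derive (fun s => snd (g s)) t) /\
  (forall t, continuous (Derive (fun s => fst (g s))) t /\ continuous (Derive (fun s => snd (g s))) t).

Definition length_on (lam : R2 -> R) (g : R -> R2) a b := RInt (fun t => lam (g t) * Cmod (vel g t)) a b.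

(** The parameter interval is arbitrary, so that arcs cut out at hitting times are again admissible
    without reparametrization. *)
Definition crossing (lam : R2 -> R) r R L := forall g a b, C1_curve g -> a <= b ->
  (forall t, a <= t <= b -> Cmod (g t) < 1) -> Cmod (g a) <= r -> R <= Cmod (g b) ->
  L <= length_on lam g a b.

Definition metric (lam : R2 -> R) := forall z, Cmod z < 1 -> continuous lam z /\ 0 <= lam z.

Lemma continuous_Cmod_comp (f g : R -> R) t : continuous f t -> continuous g t -> continuous (fun s => Cmod (f s,
  g s)) t.
Proof.
  intros Hf Hg. unfold Cmod; simpl.
  apply (continuous_comp (fun s => f s * (f s * 1) + g s * (g s * 1)) sqrt).
  - apply (continuous_plus (V := R_NormedModule)).
    + apply (continuous_mult (K := R_AbsRing)); auto. apply (continuous_mult (K := R_AbsRing)); auto.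
      apply continuous_const.
    + apply (continuous_mult (K := R_AbsRing)); auto. apply (continuous_mult (K := R_AbsRing)); auto.
      apply continuous_const.
  - apply continuous_sqrt.
Qed.

Lemma C1_continuous g t : C1_curve g -> continuous (fun s => fst (g s)) t /\ continuous (fun s => snd (g s)) t.
Proof.
  intros [H _]. destruct (H t). split; apply (ex_derive_continuous (K := R_AbsRing) (V := R_NormedModule)); auto.
Qed.

Lemma C1_continuous_comp (f : R2 -> R) g t : C1_curve g -> continuous f (g t) -> continuous (fun s => f (g s)) t.
Proof.
  intros Hg Hf. destruct (C1_continuous g t Hg) as [A B].
  intros P HP. specialize (Hf P HP).
  destruct Hf as [e He].
  assert (A' := proj1 (filterlim_locally _ _) A e). assert (B' := proj1 (filterlim_locally _ _) B e).
  change (locally t (fun s => P (f (g s)))). generalize (filter_and _ _ A' B'). apply filter_imp. intros s [U V].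
  apply He. split; auto.
Qed.

Lemma C1_continuous_Cmod g t : C1_curve g -> continuous (fun s => Cmod (g s)) t.
Proof.
  intros Hg. destruct (C1_continuous g t Hg).
  apply (continuous_ext (fun s => Cmod (fst (g s), snd (g s)))); [intros s; destruct (g s); auto|].
  apply continuous_Cmod_comp; auto.
Qed.

Lemma vel_continuous g t : C1_curve g -> continuous (fun s => Cmod (vel g s)) t.
Proof. intros [_ H]. destruct (H t). apply continuous_Cmod_comp; auto. Qed.

Lemma length_continuous lam g t : metric lam -> C1_curve g -> Cmod (g t) < 1 ->
  continuous (fun s => lam (g s) * Cmod (vel g s)) t.
Proof.
  intros Hl Hg Ht. apply (continuous_mult (K := R_AbsRing)).
  - apply C1_continuous_comp; auto. apply Hl; auto.
  - apply vel_continuous; auto.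
Qed.

Lemma length_ex lam g a b : metric lam -> C1_curve g -> a <= b -> (forall t, a <= t <= b -> Cmod (g t) < 1) ->
  ex_RInt (fun t => lam (g t) * Cmod (vel g t)) a b.
Proof.
  intros Hl Hg Hab Hd. apply (ex_RInt_continuous (V := R_CompleteNormedModule)). intros t Ht.
  rewrite Rmin_left, Rmax_right in Ht by lra. apply length_continuous; auto.
Qed.

Lemma length_pos lam g a b : metric lam -> C1_curve g -> a <= b -> (forall t, a <= t <= b -> Cmod (g t) < 1) ->
  0 <= length_on lam g a b.
Proof.
  intros Hl Hg Hab Hd. apply RInt_ge_0; auto. apply length_ex; auto.
  intros t Ht. apply Rmult_le_pos; [apply Hl, Hd; lra|apply Cmod_ge_0].
Qed.

Lemma length_Chasles lam g a b c : metric lam -> C1_curve g -> a <= b <= c -> (forall t, a <= t <= c ->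
  Cmod (g t) < 1) ->
  length_on lam g a c = length_on lam g a b + length_on lam g b c.
Proof.
  intros Hl Hg Hab Hd. symmetry.
  apply (RInt_Chasles (V := R_CompleteNormedModule)); apply length_ex; auto; try lra; intros; apply Hd; lra.
Qed.

Lemma length_sub lam g a b c d : metric lam -> C1_curve g -> a <= b -> b <= c -> c <= d ->
  (forall t, a <= t <= d -> Cmod (g t) < 1) -> length_on lam g b c <= length_on lam g a d.
Proof.
  intros Hl Hg Hab Hbc Hcd Hd.
  rewrite (length_Chasles lam g a b d), (length_Chasles lam g b c d); auto; try lra; [|intros; apply Hd; lra].
  assert (0 <= length_on lam g a b) by (apply length_pos; auto; intros; apply Hd; lra).
  assert (0 <= length_on lam g c d) by (apply length_pos; auto; intros; apply Hd; lra). lra.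
Qed.

Lemma crossing_mono lam r R L r' R' L' : r' <= r -> R <= R' -> L' <= L ->
  crossing lam r R L -> crossing lam r' R' L'.
Proof. intros A B D H g a b Hg Hab Hd Ha Hb. eapply Rle_trans; [apply D|]. apply H; auto; lra. Qed.

Lemma crossing_concat lam r R R' L L' : metric lam -> R <= R' -> r <= R ->
  crossing lam r R L -> crossing lam R R' L' -> crossing lam r R' (L + L').
Proof.
  intros Hl HR Hr H1 H2 g a b Hg Hab Hd Ha Hb.
  destruct (first_hit (fun t => Cmod (g t)) a b R Hab) as (c & Hc & Ec & _); try lra.
  { intros; apply C1_continuous_Cmod; auto. }
  rewrite (length_Chasles lam g a c b); auto. apply Rplus_le_compat.
  - apply H1; auto; try lra. intros; apply Hd; lra.
  - apply H2; auto; try lra. intros; apply Hd; lra.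
Qed.

(** The metrics are compared only up to radius [R], since the curve may be cut when it first reaches
    [R]. This is how gained length survives later deformations, which control the metric only on a
    smaller disk. *)
Lemma crossing_scale lam lam' r R L k : metric lam -> metric lam' -> r <= R -> 0 <= k ->
  (forall z, Cmod z <= R -> Cmod z < 1 -> k * lam z <= lam' z) ->
  crossing lam r R L -> crossing lam' r R (k * L).
Proof.
  intros Hl Hl' Hr Hk Hkl H g a b Hg Hab Hd Ha Hb.
  destruct (first_hit (fun t => Cmod (g t)) a b R Hab) as (c & Hc & Ec & Hc'); try lra.
  { intros; apply C1_continuous_Cmod; auto. }
  apply Rle_trans with (length_on lam' g a c); [|apply length_sub; auto; lra].
  assert (L <= length_on lam g a c) by (apply H; auto; try lra; intros; apply Hd; lra).
  apply Rle_trans with (k * length_on lam g a c); [apply Rmult_le_compat_l; auto|].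
  unfold length_on. rewrite <- (RInt_scal (V := R_CompleteNormedModule)).
  2: apply length_ex; auto; try lra; intros; apply Hd; lra.
  apply RInt_le; try lra.
  - apply (ex_RInt_scal (V := R_CompleteNormedModule)). apply length_ex; auto; try lra; intros; apply Hd; lra.
  - apply length_ex; auto; try lra; intros; apply Hd; lra.
  - intros t Ht. unfold scal; simpl; unfold mult; simpl. rewrite <- Rmult_assoc.
    apply Rmult_le_compat_r; [apply Cmod_ge_0|]. apply Hkl; [apply Hc'; lra|apply Hd; lra].
Qed.

Lemma FTC_le (h : R -> R) (f : R -> R) a b : a <= b ->
  (forall t, ex_derive h t) -> (forall t, continuous (Derive h) t) ->
  ex_RInt f a b -> (forall t, a <= t <= b -> Derive h t <= f t) -> h b - h a <= RInt f a b.
Proof.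
  intros Hab Hd Hc Hf Hle. rewrite <- (RInt_Derive h a b) by auto.
  apply RInt_le; auto.
  - apply (ex_RInt_continuous (V := R_CompleteNormedModule)); auto.
  - intros; apply Hle; lra.
Qed.

Lemma dot2_le_Cmod (a b c d : R) : a * c + b * d <= Cmod (a, b) * Cmod (c, d).
Proof.
  unfold Cmod; simpl. rewrite <- sqrt_mult by nra.
  apply Rle_trans with (Rabs (a * c + b * d)); [apply Rle_abs|].
  rewrite <- sqrt_Rsqr_abs. apply sqrt_le_1_alt. unfold Rsqr. pose proof (pow2_ge_0 (a * d - b * c)). nra.
Qed.

Lemma is_derive_sqr_pow (f g f' g' : R -> R) N k : (forall t, is_derive f t (f' t)) -> (forall t,
  is_derive g t (g' t)) ->
  forall t, is_derive (fun t => k * (f t * f t + g t * g t) ^ S N) t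
    (k * (INR (S N) * (2 * (f t * f' t + g t * g' t)) * (f t * f t + g t * g t) ^ N)).
Proof.
  intros Hf Hg t. specialize (Hf t). specialize (Hg t). auto_derive.
  - repeat split; eexists; eauto.
  - apply is_derive_unique in Hf. apply is_derive_unique in Hg.
    change (fun x : R => f x) with f. change (fun x : R => g x) with g. rewrite <- Hf, <- Hg.
    simpl pow. destruct N; simpl; ring.
Qed.

Lemma Cmod_sqr (z : C) : Cmod z * Cmod z = fst z * fst z + snd z * snd z.
Proof. replace (Cmod z * Cmod z) with (Cmod z ^ 2) by ring. rewrite Cmod2_alt. unfold Re, Im. ring. Qed.

(* The potential [k |z|^(2N+2)] has gradient at most [lam] on the annulus. *)
Lemma crossing_potential lam r ro N k : metric lam -> 0 <= r <= ro -> ro < 1 -> 0 <= k ->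
  (forall z, r <= Cmod z <= ro -> k * (2 * INR (S N) * Cmod z ^ (2 * N)) <= lam z) ->
  crossing lam r ro (k * (ro ^ (2 * S N) - r ^ (2 * S N))).
Proof.
  intros Hl Hr HR Hk Hlam g a b Hg Hab Hd Ha Hb.
  (* From the last exit from radius [r] to the next arrival at [ro] the curve lies in the annulus,
     the only place where [lam] is bounded below by the gradient. *)
  destruct (last_exit (fun t => Cmod (g t)) a b r Hab) as (c & Hc & Ec & Hc'); try lra.
  { intros; apply C1_continuous_Cmod; auto. }
  destruct (first_hit (fun t => Cmod (g t)) c b ro) as (d & Hd1 & Ed & Hd'); try lra.
  { intros; apply C1_continuous_Cmod; auto. }
  apply Rle_trans with (length_on lam g c d); [|apply length_sub; auto; lra].
  assert (Sq : forall t n, (fst (g t) * fst (g t) + snd (g t) * snd (g t)) ^ n = Cmod (g t) ^ (2 * n)).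
  { intros t n. rewrite <- Cmod_sqr, pow_mult. f_equal. simpl; ring. }
  assert (D := is_derive_sqr_pow (fun s => fst (g s)) (fun s => snd (g s)) _ _ N k
    (fun t => Derive_correct _ _ (proj1 (proj1 Hg t))) (fun t => Derive_correct _ _ (proj2 (proj1 Hg t)))).
  set (h := fun t => k * (fst (g t) * fst (g t) + snd (g t) * snd (g t)) ^ S N).
  replace (k * (ro ^ (2 * S N) - r ^ (2 * S N))) with (h d - h c).
  2:{ unfold h. rewrite !Sq, Ec, Ed. ring. }
  apply (FTC_le h); try lra.
  - intros t. eexists. apply D.
  - intros t. apply (continuous_ext (fun t => k * (INR (S N) * (2 * (fst (g t) * Derive (fun s => fst (g s)) t + snd
      (g t) * Derive (fun s => snd (g s)) t)) * (fst (g t) * fst (g t) + snd (g t) * snd (g t)) ^ N))).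
    { intros s. symmetry. apply is_derive_unique, D. }
    destruct (C1_continuous g t Hg) as [A B]. destruct (proj2 Hg t) as [A' B'].
    assert (M : forall u v : R -> R, continuous u t -> continuous v t ->
      continuous (fun s => u s * v s) t) by (intros; apply (continuous_mult (K := R_AbsRing)); auto).
    assert (P : forall u v : R -> R, continuous u t -> continuous v t ->
      continuous (fun s => u s + v s) t) by (intros; apply (continuous_plus (V := R_NormedModule)); auto).
    assert (K : forall c : R, continuous (fun _ : R => c) t) by (intros; apply continuous_const).
    assert (W : forall (u : R -> R) n, continuous u t -> continuous (fun s => u s ^ n) t).
    { intros u n Hu; induction n; simpl; [apply K|apply M; auto]. }
    auto 12.
  - apply length_ex; auto; try lra. intros; apply Hd; lra.
  - intros t Ht. rewrite (is_derive_unique h _ _ (D t)). cbv beta. rewrite Sq.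
    assert (r <= Cmod (g t) <= ro) by (split; [apply Hc'; lra|apply Hd'; lra]).
    pose proof (dot2_le_Cmod (fst (g t)) (snd (g t)) (Derive (fun s => fst (g s)) t) (Derive (fun s => snd (g s)) t))
      as Q.
    replace (fst (g t), snd (g t)) with (g t) in Q by (destruct (g t); auto).
    fold (vel g t) in Q. pose proof (Cmod_ge_0 (vel g t)). pose proof (pos_INR (S N)).
    assert (0 <= Cmod (g t) ^ (2 * N)) by (apply pow_le, Cmod_ge_0).
    assert (Q' : fst (g t) * Derive (fun s => fst (g s)) t + snd (g t) * Derive (fun s => snd (g s)) t <= Cmod (vel g
      t)) by nra.
    eapply Rle_trans; [|apply Rmult_le_compat_r; [auto|apply Hlam; auto]].
    replace (k * (2 * INR (S N) * Cmod (g t) ^ (2 * N)) * Cmod (vel g t)) with (k * (INR (S N) * (2 * Cmod (vel g t))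
      * Cmod (g t) ^ (2 * N))) by ring.
    apply Rmult_le_compat_l; auto. apply Rmult_le_compat_r; auto. apply Rmult_le_compat_l; [lra|].
    apply Rmult_le_compat_l; [lra|exact Q'].
Qed.

(** * Completeness *)

Section Complete.
Variables (psi : R2 -> R3) (Lam : R2 -> R).
Hypothesis Hspeed : forall g t, C1_curve g -> Cmod (g t) < 1 ->
  norm3 (mk3 (Derive (fun s => x1 (psi (g s))) t) (Derive (fun s => x2 (psi (g s))) t) (Derive (fun s => x3 (psi (g
    s))) t))
  = Lam (g t) * Cmod (vel g t).
Hypothesis Hmet : metric Lam.
Hypothesis Hpos : forall z, Cmod z < 1 -> 0 < Lam z.
Hypothesis Hcross : forall r, r < 1 -> exists R, r < R < 1 /\ crossing Lam r R 1.

Lemma induced_length_on g : C1_curve_in_disk g -> induced_length psi g = length_on Lam g 0 1.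
Proof.
  intros (A & B & D). unfold induced_length, length_on. apply RInt_ext. intros t Ht.
  rewrite Rmin_left, Rmax_right in Ht by lra. apply Hspeed; [split; auto|]. apply disk_Cmod, D; lra.
Qed.

Lemma induced_segment ro : ro < 1 -> exists M, 0 < M /\ forall p q e, Cmod p <= ro -> Cmod q <= ro ->
  M * Cmod (q - p) < e -> induced_dist_lt psi p q e.
Proof.
  intros HR. destruct (compact_bounded (fun z : R2 => Cmod z <= ro) Lam (compact_closed_disk ro)) as (M & M0 & HM).
  { intros z Hz. apply Hmet. lra. }
  exists M; split; auto. intros p q e Hp Hq He.
  set (g := fun t : R => (fst p + t * (fst q - fst p), snd p + t * (snd q - snd p)) : R2).
  assert (D1 : forall t, is_derive (fun s => fst (g s)) t (fst q - fst p)) by (intros; apply is_derive_affine).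
  assert (D2 : forall t, is_derive (fun s => snd (g s)) t (snd q - snd p)) by (intros; apply is_derive_affine).
  assert (HgR : forall t, 0 <= t <= 1 -> Cmod (g t) <= ro).
  { intros t Ht. replace (g t) with (RtoC (1 - t) * p + RtoC t * q)%C by (apply injective_projections; simpl; ring).
    eapply Rle_trans; [apply Cmod_triangle|]. rewrite !Cmod_mult, !Cmod_R, !Rabs_pos_eq by lra. nra. }
  assert (Hg : C1_curve g).
  { split; intros t; split.
    - eexists; apply D1. - eexists; apply D2.
    - apply (continuous_ext (fun _ => fst q - fst p)); [|apply continuous_const].
      intros; symmetry; apply is_derive_unique, D1.
    - apply (continuous_ext (fun _ => snd q - snd p)); [|apply continuous_const].
      intros; symmetry; apply is_derive_unique, D2. }
  assert (Hgd : C1_curve_in_disk g).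
  { destruct Hg as [A B]. split; [|split]; auto. intros t Ht. apply disk_Cmod. specialize (HgR t Ht). lra. }
  exists g. split; [auto|split; [|split]].
  - apply injective_projections; simpl; ring.
  - apply injective_projections; simpl; ring.
  - rewrite induced_length_on by auto. eapply Rle_lt_trans; [|apply He].
    replace (M * Cmod (q - p)) with (RInt (fun _ => M * Cmod (q - p)) 0 1).
    2:{ rewrite RInt_const. unfold scal; simpl; unfold mult; simpl. ring. }
    apply RInt_le; try lra.
    + apply length_ex; auto; try lra. intros t Ht. specialize (HgR t Ht). lra.
    + apply ex_RInt_const.
    + intros t Ht.
      assert (V : vel g t = (q - p)%C).
      { apply injective_projections; [exact (is_derive_unique _ _ _ (D1 t))|exact (is_derive_unique _ _ _ (D2 t))]. }
      rewrite V. apply Rmult_le_compat; [apply Hmet|apply Cmod_ge_0| |lra].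
      * specialize (HgR t ltac:(lra)). lra.
      * apply HM, HgR. lra.
Qed.

(** Both coordinates are estimated separately along the curve, which accounts for the factor 2. *)
Lemma short_euclid ro m g : ro < 1 -> 0 < m -> (forall z, Cmod z <= ro -> m <= Lam z) -> C1_curve g ->
  (forall t, 0 <= t <= 1 -> Cmod (g t) <= ro) -> m * Cmod (g 1 - g 0) <= 2 * length_on Lam g 0 1.
Proof.
  intros HR m0 Hm Hg HgR.
  assert (B : forall h : R -> R, (forall t, ex_derive h t) -> (forall t, continuous (Derive h) t) ->
    (forall t, Rabs (Derive h t) <= Cmod (vel g t)) -> m * Rabs (h 1 - h 0) <= length_on Lam g 0 1).
  { intros h Hd Hc Hle.
    assert (forall k, Rabs k = 1 -> m * (k * (h 1 - h 0)) <= length_on Lam g 0 1).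
    { intros k Hk. replace (m * (k * (h 1 - h 0))) with (m * k * h 1 - m * k * h 0) by ring.
      assert (Dk : forall t, is_derive (fun t => m * k * h t) t (m * k * Derive h t)).
      { intros t. apply is_derive_scal. apply Derive_correct; auto. }
      apply (FTC_le (fun t => m * k * h t)); try lra.
      - intros t. eexists. apply Dk.
      - intros t. apply (continuous_ext (fun t => m * k * Derive h t)); [intros s; symmetry; apply is_derive_unique,
          Dk|].
        apply (continuous_mult (K := R_AbsRing)); [apply continuous_const|auto].
      - apply length_ex; auto; try lra. intros t Ht; specialize (HgR t Ht); lra.
      - intros t Ht. eapply Rle_trans; [right; exact (is_derive_unique _ _ _ (Dk t))|]. specialize (Hle t).
        specialize (HgR t Ht). specialize (Hm _ HgR).
        pose proof (Rle_abs (k * Derive h t)). rewrite Rabs_mult, Hk in H. pose proof (Cmod_ge_0 (vel g t)).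
        rewrite Rmult_assoc. apply Rle_trans with (m * Cmod (vel g t)); [apply Rmult_le_compat_l;
          lra|apply Rmult_le_compat_r; lra]. }
    unfold Rabs at 1. destruct (Rcase_abs (h 1 - h 0)).
    - specialize (H (Ropp 1)). rewrite Rabs_Ropp, Rabs_R1 in H. specialize (H eq_refl). lra.
    - specialize (H 1 Rabs_R1). lra. }
  destruct Hg as [G1 G2].
  assert (Hx := B (fun s => fst (g s)) (fun t => proj1 (G1 t)) (fun t => proj1 (G2 t))).
  assert (Hy := B (fun s => snd (g s)) (fun t => proj2 (G1 t)) (fun t => proj2 (G2 t))).
  assert (V : forall t, Rabs (fst (vel g t)) <= Cmod (vel g t) /\ Rabs (snd (vel g t)) <= Cmod (vel g t)).
  { intros t. pose proof (Rmax_Cmod (vel g t)). split; (eapply Rle_trans; [|apply H]); [apply Rmax_l|apply Rmax_r]. }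
  specialize (Hx (fun t => proj1 (V t))). specialize (Hy (fun t => proj2 (V t))). cbv beta in *.
  pose proof (Cmod_le_sum (g 1 - g 0)%C). simpl in H.
  unfold Rminus in Hx, Hy. apply Rle_trans with (m * (Rabs (fst (g 1) + - fst (g 0)) + Rabs (snd (g 1) + - snd (g
    0)))); [apply Rmult_le_compat_l; lra|lra].
Qed.

(* A Cauchy sequence stays in a compact disk, because leaving large disks costs length 1; there the induced distance
   is comparable to the Euclidean one. *)
Lemma complete_of_crossing : complete_immersion psi.
Proof.
  intros u Hu Hc.
  destruct (Hc 1 ltac:(lra)) as [N0 HN0].
  destruct (Hcross (Cmod (u N0)) (proj1 (disk_Cmod _) (Hu N0))) as (R1 & HR1 & Cr1).
  assert (Hb : forall n, (N0 <= n)%nat -> Cmod (u n) <= R1).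
  { intros n Hn. apply Rnot_lt_le. intros L. destruct (HN0 N0 n (le_n _) Hn) as (g & Hg & g0 & g1 & Hl).
    rewrite induced_length_on in Hl by auto. destruct Hg as (A & B & D).
    assert (1 <= length_on Lam g 0 1); [|lra].
    apply Cr1; try lra; [split; auto|intros t Ht; apply disk_Cmod, D, Ht|rewrite g0; lra|rewrite g1; lra]. }
  (* A second radius is needed: the terms stay within [R1], but the curves joining them are confined
     only to [R2], and the metric must be bounded below along these. *)
  destruct (Hcross R1 ltac:(lra)) as (R2 & HR2 & Cr2).
  destruct (compact_pos_min (fun z : Defs.R2 => Cmod z <= R2) Lam (compact_closed_disk R2)) as (m & m0 & Hm).
  { intros z Hz. apply Hmet; lra. } { intros z Hz; apply Hpos; lra. }
  assert (Heu : forall e, 0 < e -> exists N, (N0 <= N)%nat /\ forall i j, (N <= i)%nat -> (N <= j)%nat ->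
    Cmod (u j - u i) < e).
  { intros e e0. assert (E0 : 0 < Rmin 1 (m * e / 2)) by (apply Rmin_pos; nra).
    destruct (Hc _ E0) as [N HN]. exists (Nat.max N N0). split; [lia|]. intros i j Hi Hj.
    destruct (HN i j ltac:(lia) ltac:(lia)) as (g & Hg & g0 & g1 & Hl).
    rewrite induced_length_on in Hl by auto. destruct Hg as (A & B & D).
    assert (Hg : C1_curve g) by (split; auto).
    assert (Hl1 : length_on Lam g 0 1 < 1) by (eapply Rlt_le_trans; [apply Hl|apply Rmin_l]).
    assert (Hl2 : length_on Lam g 0 1 < m * e / 2) by (eapply Rlt_le_trans; [apply Hl|apply Rmin_r]).
    assert (Hin : forall t, 0 <= t <= 1 -> Cmod (g t) <= R2).
    { intros t Ht. apply Rnot_lt_le. intros L.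
      assert (1 <= length_on Lam g 0 t).
      { apply Cr2; auto; try lra. - intros s Hs; apply disk_Cmod, D; lra. - rewrite g0. apply Hb; lia. }
      assert (length_on Lam g 0 t <= length_on Lam g 0 1); [|lra].
      apply length_sub; auto; try lra. intros s Hs; apply disk_Cmod, D; lra. }
    pose proof (short_euclid R2 m g ltac:(lra) m0 Hm Hg Hin) as Q. rewrite g0, g1 in Q.
    apply (Rmult_lt_reg_l m); auto. lra. }
  destruct (compact_cluster (fun z : Defs.R2 => Cmod z <= R1) (fun n => u (N0 + n)%nat) (compact_closed_disk R1)) as
    (p & Hp & Hcl).
  { intros n. apply Hb. lia. }
  exists p. split; [apply disk_Cmod; lra|]. intros e e0.
  destruct (induced_segment R1 ltac:(lra)) as (M & M0 & HM).
  assert (d0 : 0 < e / (4 * M)) by (apply Rdiv_lt_0_compat; lra).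
  destruct (Heu _ d0) as (N & HN & HN'). exists N. intros n Hn. apply HM; auto; [apply Hb; lia|].
  destruct (Hcl _ d0 N) as (k & Hk & Bk). apply ball2_Cmod in Bk.
  specialize (HN' n (N0 + k)%nat Hn ltac:(lia)).
  replace (p - u n)%C with ((u (N0 + k)%nat - u n) + (p - u (N0 + k)%nat))%C by ring.
  apply Rle_lt_trans with (M * (Cmod (u (N0 + k)%nat - u n) + Cmod (p - u (N0 + k)%nat))).
  { apply Rmult_le_compat_l; [lra|apply Cmod_triangle]. }
  rewrite (Cmod_sub_sym p). apply Rlt_le_trans with (M * (e / (4 * M) + 2 * (e / (4 * M)))).
  { apply Rmult_lt_compat_l; lra. }
  replace (M * (e / (4 * M) + 2 * (e / (4 * M)))) with (3 / 4 * e) by (field; lra). lra.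
Qed.
End Complete.

Section LimitComplete.
Variables (F1 F2 F3 : nat -> list C).
Hypotheses (S1 : summ (tele F1)) (S2 : summ (tele F2)) (S3 : summ (tele F3)).
Hypothesis Hnull : forall n z, null3 (pev (pder (F1 n)) z) (pev (pder (F2 n)) z) (pev (pder (F3 n)) z).
Let psi := psi_lim F1 F2 F3.

(** By conformality the first fundamental form is a multiple of the Euclidean one, so speeds are
    scaled by the conformal factor in every direction. *)
Lemma psi_lim_speed g t : C1_curve g -> Cmod (g t) < 1 ->
  norm3 (mk3 (Derive (fun s => x1 (psi (g s))) t) (Derive (fun s => x2 (psi (g s))) t) (Derive (fun s => x3 (psi (g
    s))) t))
  = norm3 (pdv eu psi (g t)) * Cmod (vel g t).
Proof.
  intros [Hg _] Ht. destruct (Hg t) as [G1 G2]. apply Derive_correct in G1. apply Derive_correct in G2.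
  assert (D1 := hser_chain (tele F1) g t _ _ S1 Ht G1 G2).
  assert (D2 := hser_chain (tele F2) g t _ _ S2 Ht G1 G2).
  assert (D3 := hser_chain (tele F3) g t _ _ S3 Ht G1 G2).
  apply is_derive_unique in D1. apply is_derive_unique in D2. apply is_derive_unique in D3.
  set (V := vel g t).
  assert (E : mk3 (Derive (fun s => x1 (psi (g s))) t) (Derive (fun s => x2 (psi (g s))) t) (Derive (fun s => x3 (psi
    (g s))) t)
    = mk3 (fst V * hser (fun k => pscal eu (pder (tele F1 k))) (g t) + snd V * hser (fun k => pscal ev (pder (tele F1
      k))) (g t))
          (fst V * hser (fun k => pscal eu (pder (tele F2 k))) (g t) + snd V * hser (fun k => pscal ev (pder (tele F2
            k))) (g t))
          (fst V * hser (fun k => pscal eu (pder (tele F3 k))) (g t) + snd V * hser (fun k => pscal ev (pder (tele F3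
            k))) (g t))).
  { apply R3_ext; [exact D1|exact D2|exact D3]. }
  rewrite E. clear E D1 D2 D3. destruct V as [p q].
  destruct (psi_lim_conformal F1 F2 F3 (fun n z => norm3 (mk3 (Re (pev (pder (F1 n)) z)) (Re (pev (pder (F2 n)) z))
    (Re (pev (pder (F3 n)) z)))) S1 S2 S3 Hnull (fun _ _ => eq_refl) (g t) (proj2 (disk_Cmod _) Ht)) as (A & B & _).
  fold psi in A, B. rewrite !(pdv_psi_lim F1 F2 F3) in * by (auto; apply disk_Cmod; auto).
  revert A B.
  generalize (hser (fun k => pscal eu (pder (tele F1 k))) (g t)) (hser (fun k => pscal eu (pder (tele F2 k))) (g t))
    (hser (fun k => pscal eu (pder (tele F3 k))) (g t))
    (hser (fun k => pscal ev (pder (tele F1 k))) (g t)) (hser (fun k => pscal ev (pder (tele F2 k))) (g t)) (hser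
      (fun k => pscal ev (pder (tele F3 k))) (g t)).
  intros a1 a2 a3 b1 b2 b3. unfold norm3, Cmod, dot3, mk3, x1, x2, x3; simpl. intros A B.
  rewrite <- sqrt_mult by nra. f_equal.
  transitivity (p * p * (a1 * a1 + a2 * a2 + a3 * a3) + q * q * (b1 * b1 + b2 * b2 + b3 * b3) + 2 * p * q * (a1 * b1
    + a2 * b2 + a3 * b3)); [ring|].
  rewrite B, <- A. ring.
Qed.

Lemma psi_lim_metric : metric (fun z => norm3 (pdv eu psi z)).
Proof.
  intros z Hz. split; [|apply norm3_pos].
  assert (A : forall F, summ (tele F) -> continuous (hser (fun k => pscal eu (pder (tele F k)))) z).
  { intros F HF. apply hser_continuous; auto. apply summ_pscal, summ_pder; auto. }
  apply (continuous_ext_loc _ (fun z => sqrt (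
    hser (fun k => pscal eu (pder (tele F1 k))) z * hser (fun k => pscal eu (pder (tele F1 k))) z +
    hser (fun k => pscal eu (pder (tele F2 k))) z * hser (fun k => pscal eu (pder (tele F2 k))) z +
    hser (fun k => pscal eu (pder (tele F3 k))) z * hser (fun k => pscal eu (pder (tele F3 k))) z))).
  - eapply filter_imp; [|apply (locally_disk z), disk_Cmod, Hz]. intros w Hw.
    unfold psi. rewrite pdv_psi_lim; auto.
  - apply (continuous_comp _ sqrt); [|apply continuous_sqrt].
    apply (continuous_plus (V := R_NormedModule)); [apply (continuous_plus (V := R_NormedModule))|];
    apply (continuous_mult (K := R_AbsRing)); apply A; auto.
Qed.
End LimitComplete.

(** * Trigonometric approximation on the circle *)

(** The Bernstein polynomial of [g] at [X], as the expectation of [g] at the number of successes in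
    [n] independent trials of probability [X], conditioned on one trial at a time. In this form
    monotonicity and linearity are immediate inductions. *)
Fixpoint bern (n : nat) (X : R) (g : nat -> R) : R :=
  match n with O => g O | S n => X * bern n X (fun i => g (S i)) + (1 - X) * bern n X g end.

Lemma bern_mono n X g h : 0 <= X <= 1 -> (forall i, (i <= n)%nat -> g i <= h i) -> bern n X g <= bern n X h.
Proof.
  intros HX; revert g h; induction n; intros g h H; simpl; [apply H; lia|].
  assert (bern n X (fun i => g (S i)) <= bern n X (fun i => h (S i))) by (apply IHn; intros; apply H; lia).
  assert (bern n X g <= bern n X h) by (apply IHn; intros; apply H; lia). nra.
Qed.

Lemma bern_lin n X g h a b : bern n X (fun i => a * g i + b * h i) = a * bern n X g + b * bern n X h.
Proof.
  revert g h; induction n; intros; simpl; auto.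
  rewrite (IHn (fun i => g (S i)) (fun i => h (S i))), IHn. ring.
Qed.

Lemma bern_const n X c : bern n X (fun _ => c) = c.
Proof. induction n; simpl; auto. rewrite IHn. ring. Qed.

Lemma bern_ext n X g h : (forall i, g i = h i) -> bern n X g = bern n X h.
Proof. revert g h; induction n; intros g h H; simpl; auto. rewrite (IHn g h), (IHn _ (fun i => h (S i))); auto. Qed.

(** Second moment of the binomial law about the point [- c]: squared mean plus variance. The shift
    [c] is free because the recursion moves it by one. *)
Lemma bern_var n X c : bern n X (fun i => (INR i + c) ^ 2) = (INR n * X + c) ^ 2 + INR n * X * (1 - X).
Proof.
  revert c; induction n; intros c; [simpl; ring|]. cbn [bern].
  rewrite IHn, (bern_ext n X _ (fun i => (INR i + (1 + c)) ^ 2)) by (intros i; rewrite S_INR; ring).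
  rewrite IHn, S_INR. ring.
Qed.

Definition bern2 n X Y (G : R -> R -> R) := bern n X (fun i => bern n Y (fun j => G (INR i / INR n) (INR j / INR n))).

Lemma bern2_approx G M X Y eta del n : 0 <= X <= 1 -> 0 <= Y <= 1 -> 0 < del -> (0 < n)%nat ->
  (forall X Y, Rabs (G X Y) <= M) ->
  (forall X' Y', Rabs (X' - X) < del -> Rabs (Y' - Y) < del -> Rabs (G X' Y' - G X Y) <= eta) ->
  Rabs (bern2 n X Y G - G X Y) <= eta + M / (del * del * INR n).
Proof.
  intros HX HY Hd Hn HM HG.
  assert (M0 : 0 <= M) by (eapply Rle_trans; [apply Rabs_pos|apply (HM 0 0)]).
  assert (n0 : 0 < INR n) by (apply lt_0_INR; auto).
  (* Chebyshev's argument: far from the point the oscillation [2 * M] is dominated by [K] times the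
     squared distance, and the variances, at most [/ (4 * INR n)] in each variable, turn this into
     [M / (del * del * INR n)]. *)
  set (K := 2 * M / (del * del)).
  assert (K0 : 0 <= K) by (apply Rmult_le_pos; [lra|left; apply Rinv_0_lt_compat; nra]).
  assert (e0 : 0 <= eta).
  { eapply Rle_trans; [apply Rabs_pos|apply (HG X Y)]; rewrite Rminus_diag, Rabs_R0; auto. }
  assert (B : forall X' Y', Rabs (G X' Y' - G X Y) <= eta + K * ((X' - X) ^ 2 + (Y' - Y) ^ 2)).
  { intros X' Y'. pose proof (pow2_ge_0 (X' - X)). pose proof (pow2_ge_0 (Y' - Y)).
    assert (Far : forall u, del <= Rabs u -> 2 * M <= K * u ^ 2).
    { intros u Hu. assert (del * del <= u ^ 2) by (rewrite <- (pow2_abs u); nra).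
      unfold K. replace (2 * M) with (2 * M / (del * del) * (del * del)) at 1 by (field; lra).
      apply Rmult_le_compat_l; auto. }
    assert (T : Rabs (G X' Y' - G X Y) <= 2 * M).
    { eapply Rle_trans; [apply Rabs_triang|]. rewrite Rabs_Ropp. pose proof (HM X' Y'). pose proof (HM X Y). lra. }
    destruct (Rlt_dec (Rabs (X' - X)) del) as [A|A].
    - destruct (Rlt_dec (Rabs (Y' - Y)) del) as [A'|A'].
      + specialize (HG X' Y' A A'). nra.
      + pose proof (Far (Y' - Y) ltac:(lra)). nra.
    - pose proof (Far (X' - X) ltac:(lra)). nra. }
  assert (V : bern n X (fun i => bern n Y (fun j => 1 * eta + K * ((INR i / INR n - X) ^ 2 + (INR j / INR n - Y) ^
    2)))
     <= eta + M / (del * del * INR n)).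
  { assert (V1 : forall Z, 0 <= Z <= 1 -> bern n Z (fun i => (INR i / INR n - Z) ^ 2) <= / (4 * INR n)).
    { intros Z HZ. rewrite (bern_ext _ _ _ (fun i => (/ INR n ^ 2) * (INR i + (- (INR n * Z))) ^ 2 + 0 * 0)) by
        (intros; field; lra).
      rewrite bern_lin, bern_var. replace (/ INR n ^ 2 * ((INR n * Z + - (INR n * Z)) ^ 2 + INR n * Z * (1 - Z)) + 0
        * bern n Z (fun _ => 0)) with (Z * (1 - Z) / INR n) by (field; lra).
      apply (Rmult_le_reg_r (4 * INR n)); [lra|]. rewrite Rinv_l by lra.
      replace (Z * (1 - Z) / INR n * (4 * INR n)) with (4 * (Z * (1 - Z))) by (field; lra).
      pose proof (pow2_ge_0 (2 * Z - 1)). nra. }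
    rewrite (bern_ext n X _ (fun i => 1 * (eta + K * bern n Y (fun j => (INR j / INR n - Y) ^ 2)) + K * (INR i / INR
      n - X) ^ 2)).
    2:{ intros i. rewrite (bern_ext n Y _ (fun j => 1 * (eta + K * (INR i / INR n - X) ^ 2) + K * (INR j / INR n - Y)
      ^ 2)) by (intros; ring).
        rewrite bern_lin, bern_const. ring. }
    rewrite bern_lin, bern_const. pose proof (V1 X HX). pose proof (V1 Y HY).
    replace (M / (del * del * INR n)) with (K * / (4 * INR n) + K * / (4 * INR n)) by (unfold K; field; lra).
    nra. }
  apply Rabs_le. split.
  - assert (Q : bern n X (fun i => bern n Y (fun j => 1 * G X Y + (-1) * (1 * eta + K * ((INR i / INR n - X) ^ 2 +
      (INR j / INR n - Y) ^ 2)))) <= bern2 n X Y G).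
    { apply bern_mono; auto. intros i _. apply bern_mono; auto. intros j _.
      specialize (B (INR i / INR n) (INR j / INR n)).
      apply Rabs_le_between in B. lra. }
    rewrite (bern_ext n X _ (fun i => 1 * G X Y + (-1) * bern n Y (fun j => 1 * eta + K * ((INR i / INR n - X) ^ 2 +
      (INR j / INR n - Y) ^ 2)))) in Q.
    2:{ intros i. rewrite (bern_lin n Y (fun _ => G X Y)), bern_const. auto. }
    rewrite (bern_lin n X (fun _ => G X Y)), bern_const in Q. lra.
  - assert (Q : bern2 n X Y G <= bern n X (fun i => bern n Y (fun j => 1 * G X Y + 1 * (1 * eta + K * ((INR i / INR n
      - X) ^ 2 + (INR j / INR n - Y) ^ 2))))).
    { apply bern_mono; auto. intros i _. apply bern_mono; auto. intros j _.
      specialize (B (INR i / INR n) (INR j / INR n)).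
      apply Rabs_le_between in B. lra. }
    rewrite (bern_ext n X _ (fun i => 1 * G X Y + 1 * bern n Y (fun j => 1 * eta + K * ((INR i / INR n - X) ^ 2 +
      (INR j / INR n - Y) ^ 2)))) in Q.
    2:{ intros i. rewrite (bern_lin n Y (fun _ => G X Y)), bern_const. auto. }
    rewrite (bern_lin n X (fun _ => G X Y)), bern_const in Q. lra.
Qed.

(** A Laurent polynomial on the unit circle, given by a polynomial after clearing the pole at 0. On
    the circle [Re z] and [Im z] are of this kind, hence so are all polynomials in the two real
    coordinates. *)
Definition laurent (f : C -> C) := exists p M, forall z, Cmod z = 1 -> (z ^ M * f z)%C = pev p z.

Lemma laurent_const c : laurent (fun _ => c).
Proof. exists (c :: nil), O. intros; simpl; ring. Qed.
Lemma laurent_plus f g : laurent f -> laurent g -> laurent (fun z => f z + g z)%C.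
Proof.
  intros (p & M & Hp) (q & N & Hq). exists (padd (pshift N p) (pshift M q)), (M + N)%nat.
  intros z Hz. rewrite pev_padd, !pev_pshift, <- Hp, <- Hq, Cpow_add_r by auto. ring.
Qed.
Lemma laurent_mult f g : laurent f -> laurent g -> laurent (fun z => f z * g z)%C.
Proof.
  intros (p & M & Hp) (q & N & Hq). exists (pmul p q), (M + N)%nat.
  intros z Hz. rewrite pev_pmul, <- Hp, <- Hq, Cpow_add_r by auto. ring.
Qed.
Lemma laurent_ext f g : (forall z, Cmod z = 1 -> f z = g z) -> laurent f -> laurent g.
Proof. intros E (p & M & Hp). exists p, M. intros. rewrite <- E; auto. Qed.

Lemma Cmod1_sqr z : Cmod z = 1 -> fst z * fst z + snd z * snd z = 1.
Proof. intros H. pose proof (Cmod_sqr z). rewrite H in H0. lra. Qed.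

(** On the circle [z * Re z] is [(1 + z^2) / 2]; for the lemma that follows, [z * Im z] is
    [i (1 - z^2) / 2]. *)
Lemma laurent_Re : laurent (fun z => RtoC (fst z)).
Proof.
  exists (RtoC (/ 2) :: RtoC 0 :: RtoC (/ 2) :: nil), 1%nat. intros z Hz. pose proof (Cmod1_sqr z Hz).
  destruct z as [x y]; simpl in *. apply injective_projections; simpl; nra.
Qed.
Lemma laurent_Im : laurent (fun z => RtoC (snd z)).
Proof.
  exists (((0, / 2) : C) :: RtoC 0 :: ((0, - / 2) : C) :: nil), 1%nat. intros z Hz. pose proof (Cmod1_sqr z Hz).
  destruct z as [x y]; simpl in *. apply injective_projections; simpl; nra.
Qed.

Lemma laurent_bern n (X : C -> R) (g : C -> nat -> R) : laurent (fun z => RtoC (X z)) ->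
  (forall i, laurent (fun z => RtoC (g z i))) -> laurent (fun z => RtoC (bern n (X z) (g z))).
Proof.
  intros HX; revert g; induction n; intros g Hg; cbn [bern]; [apply Hg|].
  apply (laurent_ext (fun z => RtoC (X z) * RtoC (bern n (X z) (fun i => g z (S i))) + (RtoC 1 + RtoC (Ropp 1) * RtoC
    (X z)) * RtoC (bern n (X z) (g z)))%C).
  { intros z _. rewrite RtoC_plus, !RtoC_mult, RtoC_minus, RtoC_opp. ring. }
  assert (H1 := IHn (fun z i => g z (S i)) (fun i => Hg (S i))). cbv beta in H1.
  apply laurent_plus; apply laurent_mult; auto.
  apply laurent_plus; [apply laurent_const|apply laurent_mult; [apply laurent_const|auto]].
Qed.

Section Cont.
Context {T : UniformSpace}.
Implicit Types f g : T -> R.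
Lemma continuous_add f g x : continuous f x -> continuous g x -> continuous (fun y => f y + g y) x.
Proof. intros; apply (continuous_plus (V := R_NormedModule)); auto. Qed.
Lemma continuous_sub f g x : continuous f x -> continuous g x -> continuous (fun y => f y - g y) x.
Proof. intros; apply (continuous_minus (V := R_NormedModule)); auto. Qed.
Lemma continuous_neg f x : continuous f x -> continuous (fun y => - f y) x.
Proof. intros; apply (continuous_opp (V := R_NormedModule)); auto. Qed.
Lemma continuous_mul f g x : continuous f x -> continuous g x -> continuous (fun y => f y * g y) x.
Proof. intros; apply (continuous_mult (K := R_AbsRing)); auto. Qed.
Lemma continuous_sqrt_fun f x : continuous f x -> continuous (fun y => sqrt (f y)) x.
Proof. intros; apply (continuous_comp f sqrt); auto. apply continuous_sqrt. Qed.
Lemma continuous_inv_fun f x : continuous f x -> f x <> 0 -> continuous (fun y => / f y) x.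
Proof. intros; apply (continuous_comp f Rinv); auto. apply continuous_Rinv; auto. Qed.
Lemma continuous_cst (c : R) (x : T) : continuous (fun _ : T => c) x.
Proof. apply continuous_const. Qed.
End Cont.

Ltac cont := repeat lazymatch goal with
  | |- continuous (fun _ => ?c) _ => apply continuous_cst
  | |- continuous (fun y => Rplus (@?f y) (@?g y)) _ => apply (continuous_add f g)
  | |- continuous (fun y => Rminus (@?f y) (@?g y)) _ => apply (continuous_sub f g)
  | |- continuous (fun y => Rmult (@?f y) (@?g y)) _ => apply (continuous_mul f g)
  | |- continuous (fun y => Ropp (@?f y)) _ => apply (continuous_neg f)
  | |- continuous (fun y => sqrt (@?f y)) _ => apply (continuous_sqrt_fun f)
  end; try assumption.

Lemma cont_fst (z : R2) : continuous (fun z : R2 => fst z) z.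
Proof. apply (continuous_fst (U := R_UniformSpace) (V := R_UniformSpace)). Qed.
Lemma cont_snd (z : R2) : continuous (fun z : R2 => snd z) z.
Proof. apply (continuous_snd (U := R_UniformSpace) (V := R_UniformSpace)). Qed.

Lemma bern_continuous n (X : R2 -> R) (g : R2 -> nat -> R) z : continuous X z ->
  (forall i, continuous (fun z => g z i) z) -> continuous (fun z => bern n (X z) (g z)) z.
Proof.
  intros HX; revert g; induction n; intros g Hg; cbn [bern]; [apply Hg|].
  cont; [apply (IHn (fun z i => g z (S i))); intros; apply Hg|apply IHn; auto].
Qed.

(** The function to be approximated is controlled only near the circle, while the Bernstein operator
    samples a whole square; truncation bounds it there and changes nothing on the circle. *)
Definition clip M x := Rmax (- M) (Rmin M x).
Lemma clip_bound M x : 0 <= M -> Rabs (clip M x) <= M.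
Proof.
  intros. unfold clip, Rmax, Rmin. apply Rabs_le.
  destruct (Rle_dec M x); destruct (Rle_dec _ _); lra.
Qed.
Lemma clip_id M x : Rabs x <= M -> clip M x = x.
Proof.
  intros H. apply Rabs_le_between in H. unfold clip, Rmax, Rmin.
  destruct (Rle_dec M x); destruct (Rle_dec _ _); lra.
Qed.
Lemma clip_lip M x y : 0 <= M -> Rabs (clip M x - clip M y) <= Rabs (x - y).
Proof.
  intros. unfold clip, Rmax, Rmin. pose proof (Rle_abs (x - y)). pose proof (Rle_abs (- (x - y))).
  rewrite Rabs_Ropp in H1. pose proof (Rabs_pos (x - y)). apply Rabs_le.
  repeat destruct (Rle_dec _ _); lra.
Qed.

Lemma circle_bound (f : R2 -> R) : (forall z, Cmod z = 1 -> continuous f z) ->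
  exists M, 0 < M /\ forall z, Cmod z = 1 -> Rabs (f z) <= M.
Proof.
  intros Hf. destruct (compact_bounded _ f compact_circle Hf) as (M & M0 & HM).
  destruct (compact_bounded _ (fun z => - f z) compact_circle) as (M' & M0' & HM').
  { intros; apply continuous_neg; auto. }
  exists (M + M'). split; [lra|]. intros z Hz. specialize (HM z Hz). specialize (HM' z Hz). apply Rabs_le; lra.
Qed.

Lemma trig_approx (f : R2 -> R) eta : (forall z, Cmod z = 1 -> continuous f z) -> 0 < eta ->
  exists h : R2 -> R, laurent (fun z => RtoC (h z)) /\ (forall z, continuous h z) /\
    forall z, Cmod z = 1 -> Rabs (h z - f z) <= eta.
Proof.
  intros Hf He. destruct (circle_bound f Hf) as (M & M0 & HM).
  destruct (circle_uniform (fun y w => Rabs (f w - f y) <= eta / 2)) as (del & d0 & Hdel).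
  { intros z Hz. assert (E4 : 0 < eta / 4) by lra.
    destruct (proj1 (continuous_R2 f z) (Hf z Hz) _ E4) as (d & d0 & Hd). exists d; split; auto.
    intros y w _ Hy Hw. specialize (Hd y Hy) as A. specialize (Hd w Hw) as B.
    apply Rabs_def2 in A. apply Rabs_def2 in B. apply Rabs_le. lra. }
  (* Applied at scale [del / 4], the Chebyshev term is [16 M / (del^2 n)], which this choice brings
     below [eta / 2]. The scale leaves room for the doubling of lengths between the unit square and
     the square of side 2 around the circle. *)
  destruct (archimed_cor1 (eta / (32 * M / (del * del)))) as (n & Hn & n0).
  { apply Rdiv_lt_0_compat; auto. apply Rdiv_lt_0_compat; nra. }
  set (G := fun X Y => clip M (f (2 * X - 1, 2 * Y - 1))).
  exists (fun z => bern2 n ((1 + fst z) / 2) ((1 + snd z) / 2) G).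
  assert (LX : laurent (fun z => RtoC ((1 + fst z) / 2))).
  { apply (laurent_ext (fun z => RtoC (/ 2) + RtoC (/ 2) * RtoC (fst z))%C).
    - intros z _. rewrite <- RtoC_mult, <- RtoC_plus. f_equal. field.
    - apply laurent_plus; [apply laurent_const|apply laurent_mult; [apply laurent_const|apply laurent_Re]]. }
  assert (LY : laurent (fun z => RtoC ((1 + snd z) / 2))).
  { apply (laurent_ext (fun z => RtoC (/ 2) + RtoC (/ 2) * RtoC (snd z))%C).
    - intros z _. rewrite <- RtoC_mult, <- RtoC_plus. f_equal. field.
    - apply laurent_plus; [apply laurent_const|apply laurent_mult; [apply laurent_const|apply laurent_Im]]. }
  split; [|split].
  - apply (laurent_bern n (fun z => (1 + fst z) / 2)); auto. intros i.
    apply (laurent_bern n (fun z => (1 + snd z) / 2)); auto. intros j. apply laurent_const.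
  - intros z. apply (bern_continuous n (fun z => (1 + fst z) / 2)).
    + unfold Rdiv. cont. apply cont_fst.
    + intros i. apply (bern_continuous n (fun z => (1 + snd z) / 2)).
      * unfold Rdiv. cont. apply cont_snd.
      * intros; apply continuous_cst.
  - intros z Hz. pose proof (Rmax_Cmod z) as Q. rewrite Hz in Q.
    assert (Q1 : Rabs (fst z) <= 1) by (eapply Rle_trans; [|apply Q]; apply Rmax_l).
    assert (Q2 : Rabs (snd z) <= 1) by (eapply Rle_trans; [|apply Q]; apply Rmax_r).
    apply Rabs_le_between in Q1. apply Rabs_le_between in Q2.
    assert (EG : G ((1 + fst z) / 2) ((1 + snd z) / 2) = f z).
    { unfold G. replace (2 * ((1 + fst z) / 2) - 1, 2 * ((1 + snd z) / 2) - 1) with z.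
      - apply clip_id; auto. - apply injective_projections; simpl; field. }
    rewrite <- EG. eapply Rle_trans.
    + apply (bern2_approx G M _ _ (eta / 2) (del / 4) n); try lra; auto.
      * intros; apply clip_bound; lra.
      * intros X Y HX HY. rewrite EG. unfold G.
        replace (f z) with (clip M (f z)) by (apply clip_id; auto).
        eapply Rle_trans; [apply clip_lip; lra|]. apply Hdel; auto.
        eapply Rle_lt_trans; [apply Cmod_le_sum|]. simpl.
        replace (2 * X - 1 + - fst z) with (2 * (X - (1 + fst z) / 2)) by field.
        replace (2 * Y - 1 + - snd z) with (2 * (Y - (1 + snd z) / 2)) by field.
        rewrite !Rabs_mult, (Rabs_pos_eq 2) by lra. lra.
    + assert (n1 : 0 < INR n) by (apply lt_0_INR; auto).
      replace (M / (del / 4 * (del / 4) * INR n)) with (16 * M / (del * del) * / INR n) by (field; lra).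
      assert (16 * M / (del * del) * / INR n <= 16 * M / (del * del) * (eta / (32 * M / (del * del)))).
      { apply Rmult_le_compat_l; [|lra]. left. apply Rdiv_lt_0_compat; nra. }
      replace (16 * M / (del * del) * (eta / (32 * M / (del * del)))) with (eta / 2) in H by (field; lra). lra.
Qed.

(** * Null directions orthogonal to a vector field along the circle *)

(* [th1], [th2], [th3] parametrize the null vectors of C^3 by spinors. *)
Definition th1 (s1 s2 : C) : C := (s1 * s1 - s2 * s2)%C.
Definition th2 (s1 s2 : C) : C := (Ci * (s1 * s1 + s2 * s2))%C.
Definition th3 (s1 s2 : C) : C := (2 * s1 * s2)%C.
Definition sq2 (s1 s2 : C) : R := Cmod s1 * Cmod s1 + Cmod s2 * Cmod s2.
Definition rot (w s1 s2 : C) : R3 := mk3 (Re (w * th1 s1 s2)) (Re (w * th2 s1 s2)) (Re (w * th3 s1 s2)).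

Lemma th_null s1 s2 : null3 (th1 s1 s2) (th2 s1 s2) (th3 s1 s2).
Proof. unfold null3, th1, th2, th3. destruct s1, s2. apply injective_projections; simpl; ring. Qed.

Lemma sq2_pos s1 s2 : 0 <= sq2 s1 s2.
Proof. unfold sq2. pose proof (Cmod_ge_0 s1). pose proof (Cmod_ge_0 s2). nra. Qed.

Lemma norm3_rot w s1 s2 : norm3 (rot w s1 s2) = Cmod w * sq2 s1 s2.
Proof.
  pose proof (sq2_pos s1 s2). pose proof (Cmod_ge_0 w).
  rewrite <- (sqrt_Rsqr (Cmod w * sq2 s1 s2)) by nra. unfold norm3. f_equal. unfold Rsqr.
  replace (Cmod w * sq2 s1 s2 * (Cmod w * sq2 s1 s2)) with (Cmod w * Cmod w * (sq2 s1 s2 * sq2 s1 s2)) by ring.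
  unfold sq2. rewrite !Cmod_sqr. unfold rot, th1, th2, th3, dot3, mk3, x1, x2, x3, Re.
  destruct w, s1, s2; simpl. ring.
Qed.

Lemma Cmod_th s1 s2 : Cmod (th1 s1 s2) <= sq2 s1 s2 /\ Cmod (th2 s1 s2) <= sq2 s1 s2 /\ Cmod (th3 s1 s2) <= sq2 s1 s2.
Proof.
  unfold th1, th2, th3, sq2. repeat split.
  - eapply Rle_trans; [apply Cmod_triangle|]. rewrite Cmod_opp, !Cmod_mult. lra.
  - rewrite Cmod_mult, Cmod_Ci, Rmult_1_l. eapply Rle_trans; [apply Cmod_triangle|]. rewrite !Cmod_mult. lra.
  - rewrite !Cmod_mult, Cmod_R, Rabs_pos_eq by lra. pose proof (pow2_ge_0 (Cmod s1 - Cmod s2)). lra.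
Qed.

(** The complex bilinear product of a null vector with a real one. Its modulus bounds the component
    along the real vector of every [rot w] with [w] of modulus one, so its smallness makes the whole
    circle nearly orthogonal to that vector. *)
Definition dotC (s1 s2 : C) (d1 d2 d3 : R) : C := (th1 s1 s2 * d1 + th2 s1 s2 * d2 + th3 s1 s2 * d3)%C.

Lemma dot_rot w s1 s2 d : Rabs (dot3 (rot w s1 s2) d) <= Cmod w * Cmod (dotC s1 s2 (x1 d) (x2 d) (x3 d)).
Proof.
  rewrite <- Cmod_mult. eapply Rle_trans; [|apply Re_le_Cmod]. right. f_equal.
  unfold rot, dotC, dot3, mk3, x1, x2, x3, Re. simpl. ring.
Qed.

Lemma Cmod_mult_diff a b a' b' B t : Cmod a <= B -> Cmod b <= B -> Cmod (a' - a) <= t -> Cmod (b' - b) <= t ->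
  t <= 1 ->
  Cmod (a' * b' - a * b) <= t * (2 * B + 1).
Proof.
  intros Ha Hb Ha' Hb' Ht. replace (a' * b' - a * b)%C with ((a' - a) * b + a * (b' - b) + (a' - a) * (b' - b))%C by
    ring.
  eapply Rle_trans; [apply Cmod_triangle|]. eapply Rle_trans; [apply Rplus_le_compat_r, Cmod_triangle|].
  rewrite !Cmod_mult. pose proof (Cmod_ge_0 a). pose proof (Cmod_ge_0 b).
  pose proof (Cmod_ge_0 (a' - a)). pose proof (Cmod_ge_0 (b' - b)). nra.
Qed.

Lemma th_diff s1 s2 r1 r2 B t : Cmod s1 <= B -> Cmod s2 <= B -> Cmod (r1 - s1) <= t -> Cmod (r2 - s2) <= t ->
  t <= 1 ->
  Cmod (th1 r1 r2 - th1 s1 s2) <= 2 * (t * (2 * B + 1)) /\ Cmod (th2 r1 r2 - th2 s1 s2) <= 2 * (t * (2 * B + 1)) /\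
  Cmod (th3 r1 r2 - th3 s1 s2) <= 2 * (t * (2 * B + 1)).
Proof.
  intros H1 H2 H3 H4 Ht.
  pose proof (Cmod_mult_diff s1 s1 r1 r1 B t H1 H1 H3 H3 Ht).
  pose proof (Cmod_mult_diff s2 s2 r2 r2 B t H2 H2 H4 H4 Ht).
  pose proof (Cmod_mult_diff s1 s2 r1 r2 B t H1 H2 H3 H4 Ht).
  unfold th1, th2, th3. repeat split.
  - replace (r1 * r1 - r2 * r2 - (s1 * s1 - s2 * s2))%C with ((r1 * r1 - s1 * s1) + - (r2 * r2 - s2 * s2))%C by ring.
    eapply Rle_trans; [apply Cmod_triangle|]. rewrite Cmod_opp. lra.
  - replace (Ci * (r1 * r1 + r2 * r2) - Ci * (s1 * s1 + s2 * s2))%C with (Ci * ((r1 * r1 - s1 * s1) + (r2 * r2 - s2 *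
      s2)))%C by ring.
    rewrite Cmod_mult, Cmod_Ci, Rmult_1_l.
    eapply Rle_trans; [apply Cmod_triangle|]. lra.
  - replace (2 * r1 * r2 - 2 * s1 * s2)%C with (2 * (r1 * r2 - s1 * s2))%C by ring.
    rewrite Cmod_mult, Cmod_R, Rabs_pos_eq by lra. lra.
Qed.

Lemma sq2_diff s1 s2 r1 r2 B t : Cmod s1 <= B -> Cmod s2 <= B -> Cmod (r1 - s1) <= t -> Cmod (r2 - s2) <= t ->
  t <= 1 ->
  Rabs (sq2 r1 r2 - sq2 s1 s2) <= 2 * (t * (2 * B + 1)).
Proof.
  intros H1 H2 H3 H4 Ht. unfold sq2.
  assert (P : forall s r, Cmod s <= B -> Cmod (r - s) <= t -> Rabs (Cmod r * Cmod r - Cmod s * Cmod s) <= t * (2 * B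
    + 1)).
  { intros s r Hs Hr. rewrite <- !Cmod_mult. eapply Rle_trans; [apply Cmod_diff|]. apply Cmod_mult_diff; auto. }
  pose proof (P _ _ H1 H3) as A. pose proof (P _ _ H2 H4) as A'.
  apply Rabs_le_between in A. apply Rabs_le_between in A'. apply Rabs_le. lra.
Qed.

Lemma avoid_list (l : list R) e : 0 < e -> exists t, 0 < t <= e /\ ~ In t l.
Proof.
  intros He. assert (exists t, 0 < t <= e /\ forall s, 0 < s <= t -> ~ In s l).
  { induction l as [|a l (t & Ht & H)]; [exists e; split; [lra|simpl; auto]|].
    destruct (Rlt_dec 0 a) as [P|N].
    - exists (Rmin t (a / 2)). assert (0 < Rmin t (a / 2)) by (apply Rmin_pos; lra).
      pose proof (Rmin_l t (a / 2)). pose proof (Rmin_r t (a / 2)).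
      split; [lra|]. intros s Hs [E|I]; [lra|]. apply (H s); auto; lra.
    - exists t; split; auto. intros s Hs [E|I]; [lra|]. apply (H s); auto. }
  destruct H as (t & Ht & H). exists t; split; auto. apply H; lra.
Qed.

(* Unless it vanishes identically, [h2] has finitely many zeros on the circle, and a small shift of [h1] avoids
   vanishing at those. *)
Lemma planar_shift (h1 h2 : R2 -> R) e : laurent (fun z => RtoC (h2 z)) -> 0 < e ->
  exists t1 t2, Rabs t1 <= e /\ Rabs t2 <= e /\ forall z, Cmod z = 1 -> 0 < (h1 z + t1) * (h1 z + t1) + (h2 z + t2) *
    (h2 z + t2).
Proof.
  intros (p & M & Hp) He. destruct (poly_roots p) as [Z|[l Hl]].
  - exists 0, e. rewrite Rabs_R0, Rabs_pos_eq by lra. repeat split; try lra. intros z Hz.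
    assert (h2 z = 0).
    { specialize (Hp z Hz). rewrite Z in Hp. apply (f_equal Cmod) in Hp.
      rewrite Cmod_mult, Cmod_pow, Hz, pow1, Rmult_1_l, Cmod_0, Cmod_R in Hp. apply Rabs_eq_0; auto. }
    rewrite H. nra.
  - destruct (avoid_list (map (fun z => - h1 z) l) e He) as (t & Ht & N).
    exists t, 0. rewrite Rabs_R0, Rabs_pos_eq by lra. repeat split; try lra. intros z Hz.
    destruct (Req_dec (h2 z) 0) as [E|E].
    2:{ rewrite Rplus_0_r. pose proof (Rle_0_sqr (h1 z + t)). pose proof (Rsqr_pos_lt _ E). unfold Rsqr in *; lra. }
    assert (I : In z l). { apply Hl. rewrite <- Hp, E by auto. ring. }
    assert (h1 z + t <> 0). { intros A. apply N. apply in_map_iff. exists z; split; auto. lra. }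
    pose proof (Rsqr_pos_lt _ H). pose proof (Rle_0_sqr (h2 z + 0)). unfold Rsqr in *; lra.
Qed.

(* Stereographic projection of [d / |d|], normalized to size [m]; it degenerates only on the third axis. *)
Lemma spin_exact (d1 d2 d3 m : R) : 0 < d1 * d1 + d2 * d2 -> 0 < m ->
  let n := sqrt (d1 * d1 + d2 * d2 + d3 * d3) in
  let k := sqrt (m * / ((n - d3) * (n - d3) + d1 * d1 + d2 * d2)) in
  dotC (RtoC (k * (n - d3))) (k * d1, k * d2) d1 d2 d3 = 0%C /\
  sq2 (RtoC (k * (n - d3))) (k * d1, k * d2) = m.
Proof.
  intros H Hm n k. assert (Hn : n * n = d1 * d1 + d2 * d2 + d3 * d3) by (apply sqrt_sqrt; nra).
  assert (Hq : 0 < (n - d3) * (n - d3) + d1 * d1 + d2 * d2) by nra.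
  assert (Hk : k * k = m * / ((n - d3) * (n - d3) + d1 * d1 + d2 * d2)).
  { apply sqrt_sqrt. apply Rmult_le_pos; [lra|]. left; apply Rinv_0_lt_compat; auto. }
  split.
  - unfold dotC, th1, th2, th3. apply injective_projections; simpl.
    + transitivity (k * k * d1 * (n * n - (d1 * d1 + d2 * d2 + d3 * d3))); [ring|]. rewrite Hn; ring.
    + transitivity (k * k * d2 * (n * n - (d1 * d1 + d2 * d2 + d3 * d3))); [ring|]. rewrite Hn; ring.
  - unfold sq2. rewrite !Cmod_sqr. simpl.
    transitivity (k * k * ((n - d3) * (n - d3) + d1 * d1 + d2 * d2)); [ring|]. rewrite Hk. field. lra.
Qed.

Lemma Cmod_comp_le (z : C) B : Cmod z <= B -> Rabs (fst z) <= B /\ Rabs (snd z) <= B.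
Proof.
  intros H. pose proof (Rmax_Cmod z).
  split; (eapply Rle_trans; [|apply H]; eapply Rle_trans; [|apply H0]); [apply Rmax_l|apply Rmax_r].
Qed.

(** The spinor of [spin_exact] depends continuously on the direction as long as this avoids the
    third axis. So the field is approximated by Laurent polynomials and shifted off the axis, and
    the components of its spinor are approximated in turn. *)
Lemma spin (d1 d2 d3 m : R2 -> R) eta :
  (forall z, Cmod z = 1 -> continuous d1 z /\ continuous d2 z /\ continuous d3 z /\ continuous m z /\ 0 < m z) ->
    0 < eta ->
  exists c e : list C, forall z, Cmod z = 1 ->
    Cmod (dotC (pev c z) (pev e z) (d1 z) (d2 z) (d3 z)) <= eta /\
    Rabs (sq2 (pev c z) (pev e z) - m z) <= eta.
Proof.
  intros Hc He.
  destruct (circle_bound d1 (fun z Hz => proj1 (Hc z Hz))) as (D1 & D10 & HD1).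
  destruct (circle_bound d2 (fun z Hz => proj1 (proj2 (Hc z Hz)))) as (D2 & D20 & HD2).
  destruct (circle_bound d3 (fun z Hz => proj1 (proj2 (proj2 (Hc z Hz))))) as (D3 & D30 & HD3).
  destruct (circle_bound m (fun z Hz => proj1 (proj2 (proj2 (proj2 (Hc z Hz)))))) as (Mm & Mm0 & HMm).
  (* Three coordinates, each off by at most [2 * e1] (approximation and shift) and weighted by a
     null vector of size at most [Mm], give [eta / 2]. *)
  set (e1 := eta / (12 * Mm)).
  assert (e10 : 0 < e1) by (apply Rdiv_lt_0_compat; lra).
  destruct (trig_approx d1 e1 (fun z Hz => proj1 (Hc z Hz)) e10) as (h1 & L1 & C1 & A1).
  destruct (trig_approx d2 e1 (fun z Hz => proj1 (proj2 (Hc z Hz))) e10) as (h2 & L2 & C2 & A2).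
  destruct (trig_approx d3 e1 (fun z Hz => proj1 (proj2 (proj2 (Hc z Hz)))) e10) as (h3 & L3 & C3 & A3).
  destruct (planar_shift h1 h2 e1 L2 e10) as (t1 & t2 & T1 & T2 & Hpos).
  set (g1 := fun z : R2 => h1 z + t1). set (g2 := fun z : R2 => h2 z + t2).
  assert (G1 : forall z, continuous g1 z) by (intros; unfold g1; cont; auto).
  assert (G2 : forall z, continuous g2 z) by (intros; unfold g2; cont; auto).
  set (n := fun z => sqrt (g1 z * g1 z + g2 z * g2 z + h3 z * h3 z)).
  assert (Cn : forall z, continuous n z) by (intros; unfold n; cont; auto).
  set (k := fun z => sqrt (m z * / ((n z - h3 z) * (n z - h3 z) + g1 z * g1 z + g2 z * g2 z))).
  assert (Ck : forall z, Cmod z = 1 -> continuous k z).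
  { intros z Hz. unfold k. cont; try apply Hc; auto. apply continuous_inv_fun.
    - cont; auto. - specialize (Hpos z Hz). pose proof (Rle_0_sqr (n z - h3 z)) as Q. unfold Rsqr in Q.
      unfold g1, g2. lra. }
  set (s1 := fun z => RtoC (k z * (n z - h3 z))). set (s2 := fun z => (k z * g1 z, k z * g2 z) : C).
  assert (Ex : forall z, Cmod z = 1 -> dotC (s1 z) (s2 z) (g1 z) (g2 z) (h3 z) = 0%C /\ sq2 (s1 z) (s2 z) = m z).
  { intros z Hz. apply spin_exact; [apply (Hpos z Hz)|apply Hc; auto]. }
  set (B := Mm + 1).
  assert (HB : forall z, Cmod z = 1 -> Cmod (s1 z) <= B /\ Cmod (s2 z) <= B).
  { intros z Hz. destruct (Ex z Hz) as [_ Q]. specialize (HMm z Hz). apply Rabs_le_between in HMm.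
    unfold sq2 in Q. pose proof (Cmod_ge_0 (s1 z)). pose proof (Cmod_ge_0 (s2 z)). unfold B. split; nra. }
  set (D := D1 + D2 + D3).
  set (K := 2 * (2 * B + 1)).
  assert (K0 : 0 < K) by (unfold K, B; lra).
  assert (D0 : 0 < D) by (unfold D; lra).
  set (t := Rmin 1 (Rmin (eta / K) (eta / (2 * D * K)))).
  assert (t0 : 0 < t).
  { unfold t. repeat apply Rmin_pos; [lra| |]; apply Rdiv_lt_0_compat; auto. nra. }
  assert (tl1 : t <= 1) by apply Rmin_l.
  assert (tl2 : t * K <= eta).
  { apply Rle_trans with (eta / K * K); [|right; field; lra]. apply Rmult_le_compat_r; [lra|].
    eapply Rle_trans; [apply Rmin_r|apply Rmin_l]. }
  assert (tl3 : t * K * D <= eta / 2).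
  { apply Rle_trans with (eta / (2 * D * K) * K * D); [|right; field; lra]. apply Rmult_le_compat_r; [lra|].
    apply Rmult_le_compat_r; [lra|]. eapply Rle_trans; [apply Rmin_r|apply Rmin_r]. }
  assert (t20 : 0 < t / 2) by lra.
  destruct (trig_approx (fun z => k z * (n z - h3 z)) (t / 2)) as (f1 & F1 & _ & B1); auto.
  { intros z Hz. cont; auto. }
  destruct (trig_approx (fun z => k z * g1 z) (t / 2)) as (f2 & F2 & _ & B2); auto.
  { intros z Hz. cont; auto. }
  destruct (trig_approx (fun z => k z * g2 z) (t / 2)) as (f3 & F3 & _ & B3); auto.
  { intros z Hz. cont; auto. }
  assert (F23 : laurent (fun z => (f2 z, f3 z))).
  { apply (laurent_ext (fun z => RtoC (f2 z) + Ci * RtoC (f3 z))%C).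
    - intros z _. apply injective_projections; simpl; ring.
    - apply laurent_plus; auto. apply laurent_mult; auto. apply laurent_const. }
  destruct F1 as (p1 & M1 & P1). destruct F23 as (p2 & M2 & P2).
  (* Both components get the same factor [z ^ (M1 + M2)]. It has modulus one on the circle, so [sq2]
     is unchanged and [dotC] is only rotated. *)
  exists (pshift M2 p1), (pshift M1 p2). intros z Hz.
  rewrite !pev_pshift, <- P1, <- P2 by auto. clear P1 P2.
  set (w := (z ^ M1 * z ^ M2)%C).
  assert (Hw : Cmod w = 1) by (unfold w; rewrite Cmod_mult, !Cmod_pow, Hz, !pow1; ring).
  replace (z ^ M2 * (z ^ M1 * RtoC (f1 z)))%C with (w * RtoC (f1 z))%C by (unfold w; ring).
  replace (z ^ M1 * (z ^ M2 * (f2 z, f3 z)))%C with (w * (f2 z, f3 z))%C by (unfold w; ring).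
  set (r1 := RtoC (f1 z)). set (r2 := (f2 z, f3 z) : C).
  assert (Er1 : Cmod (r1 - s1 z) <= t).
  { unfold r1, s1. rewrite <- RtoC_minus, Cmod_R. specialize (B1 z Hz). lra. }
  assert (Er2 : Cmod (r2 - s2 z) <= t).
  { eapply Rle_trans; [apply Cmod_le_sum|]. unfold r2, s2; simpl. specialize (B2 z Hz). specialize (B3 z Hz).
    unfold Rminus in *. lra. }
  destruct (HB z Hz) as [Hs1 Hs2]. destruct (Ex z Hz) as [E0 Em].
  split.
  - replace (dotC (w * r1) (w * r2) (d1 z) (d2 z) (d3 z)) with (w * w * dotC r1 r2 (d1 z) (d2 z) (d3 z))%C by (unfold
      dotC, th1, th2, th3; ring).
    rewrite !Cmod_mult, Hw, !Rmult_1_l.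
    destruct (th_diff _ _ _ _ B t Hs1 Hs2 Er1 Er2 tl1) as (X1 & X2 & X3).
    destruct (Cmod_th (s1 z) (s2 z)) as (Y1 & Y2 & Y3). rewrite Em in Y1, Y2, Y3.
    replace (dotC r1 r2 (d1 z) (d2 z) (d3 z)) with
      ((th1 r1 r2 - th1 (s1 z) (s2 z)) * d1 z + (th2 r1 r2 - th2 (s1 z) (s2 z)) * d2 z + (th3 r1 r2 - th3 (s1 z) (s2
        z)) * d3 z
       + (th1 (s1 z) (s2 z) * RtoC (d1 z - g1 z) + th2 (s1 z) (s2 z) * RtoC (d2 z - g2 z) + th3 (s1 z) (s2 z) * RtoC
           (d3 z - h3 z)))%C.
    2:{ transitivity (dotC r1 r2 (d1 z) (d2 z) (d3 z) - dotC (s1 z) (s2 z) (g1 z) (g2 z) (h3 z))%C; [|rewrite E0;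
      ring].
        unfold dotC. rewrite !RtoC_minus. ring. }
    assert (Tri : forall a b c d e f : C, Cmod (a + b + c + (d + e + f)) <= Cmod a + Cmod b + Cmod c + Cmod d + Cmod
      e + Cmod f).
    { intros. eapply Rle_trans; [apply Cmod_triangle|].
      pose proof (Cmod_triangle (a + b) c). pose proof (Cmod_triangle a b).
      pose proof (Cmod_triangle (d + e) f). pose proof (Cmod_triangle d e). lra. }
    eapply Rle_trans; [apply Tri|]. rewrite !Cmod_mult, !Cmod_R.
    specialize (A1 z Hz). specialize (A2 z Hz). specialize (A3 z Hz).
    assert (U1 : Rabs (d1 z - g1 z) <= 2 * e1).
    { apply Rabs_le_between in A1. apply Rabs_le_between in T1. unfold g1. apply Rabs_le; lra. }
    assert (U2 : Rabs (d2 z - g2 z) <= 2 * e1).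
    { apply Rabs_le_between in A2. apply Rabs_le_between in T2. unfold g2. apply Rabs_le; lra. }
    assert (U3 : Rabs (d3 z - h3 z) <= 2 * e1).
    { rewrite Rabs_minus_sym. lra. }
    specialize (HMm z Hz). specialize (HD1 z Hz). specialize (HD2 z Hz). specialize (HD3 z Hz).
    assert (HM' : m z <= Mm) by (apply Rabs_le_between in HMm; lra).
    assert (Q : forall a b A B, 0 <= a -> 0 <= b -> a <= A -> b <= B -> a * b <= A * B) by (intros;
      apply Rmult_le_compat; auto).
    assert (V1 := Q _ _ _ _ (Cmod_ge_0 _) (Rabs_pos _) X1 HD1).
    assert (V2 := Q _ _ _ _ (Cmod_ge_0 _) (Rabs_pos _) X2 HD2).
    assert (V3 := Q _ _ _ _ (Cmod_ge_0 _) (Rabs_pos _) X3 HD3).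
    assert (W1 := Q _ _ _ _ (Cmod_ge_0 _) (Rabs_pos _) (Rle_trans _ _ _ Y1 HM') U1).
    assert (W2 := Q _ _ _ _ (Cmod_ge_0 _) (Rabs_pos _) (Rle_trans _ _ _ Y2 HM') U2).
    assert (W3 := Q _ _ _ _ (Cmod_ge_0 _) (Rabs_pos _) (Rle_trans _ _ _ Y3 HM') U3).
    assert (S1 : 2 * (t * (2 * B + 1)) * D1 + 2 * (t * (2 * B + 1)) * D2 + 2 * (t * (2 * B + 1)) * D3 = t * K * D) by
      (unfold K, D; ring).
    assert (S2 : Mm * (2 * e1) + Mm * (2 * e1) + Mm * (2 * e1) = eta / 2) by (unfold e1; field; lra).
    lra.
  - replace (sq2 (w * r1) (w * r2)) with (sq2 r1 r2) by (unfold sq2; rewrite !Cmod_mult, Hw; ring).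
    rewrite <- Em. eapply Rle_trans; [apply (sq2_diff _ _ _ _ B t); auto|]. unfold K in tl2. lra.
Qed.

(** * Adding a rapidly oscillating null term *)

(* A surface is given by spinors [a], [b] and a null curve with [F' = (a^2 - b^2, i (a^2 + b^2), 2 a b)]; it is [Re
   F], with conformal factor [lam]. *)
Record state := St { sa : list C; sb : list C; sF1 : list C; sF2 : list C; sF3 : list C }.
Definition lam (S : state) (z : R2) : R := sq2 (pev (sa S) z) (pev (sb S) z).
Definition surf (S : state) (z : R2) : R3 := mk3 (Re (pev (sF1 S) z)) (Re (pev (sF2 S) z)) (Re (pev (sF3 S) z)).
(** Positivity of [lam] says that the two spinors have no common zero in the open disk, which is the
    immersion property. *)
Definition good (S : state) : Prop :=
  (forall z, pev (pder (sF1 S)) z = th1 (pev (sa S) z) (pev (sb S) z) /\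
             pev (pder (sF2 S)) z = th2 (pev (sa S) z) (pev (sb S) z) /\
             pev (pder (sF3 S)) z = th3 (pev (sa S) z) (pev (sb S) z)) /\
  forall z, Cmod z < 1 -> 0 < lam S z.
(** Majorants of differences rather than distances of points, because these are the terms of the
    telescoping series whose sum is the limit. *)
Definition near (r eta : R) (S S' : state) : Prop :=
  nrm r (psub (sF1 S') (sF1 S)) <= eta /\ nrm r (psub (sF2 S') (sF2 S)) <= eta /\
    nrm r (psub (sF3 S') (sF3 S)) <= eta.

Lemma cont_pev p (z : R2) : continuous (fun w : R2 => fst (pev p w)) z /\ continuous (fun w : R2 => snd (pev p w)) z.
Proof.
  assert (H : forall e, 0 < e -> exists d, 0 < d /\ forall w : R2, Cmod (w - z) < d -> Cmod (pev p w - pev p z) < e).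
  { intros e e0. set (r := Cmod z + 1). pose proof (Cmod_ge_0 z).
    set (L := nrmd1 r p + 1). assert (0 < L) by (unfold L; pose proof (nrmd1_pos r p); unfold r in *; lra).
    exists (Rmin 1 (e / L)). split; [apply Rmin_pos; [lra|apply Rdiv_lt_0_compat; auto]|].
    intros w Hw. assert (W1 : Cmod (w - z) < 1) by (eapply Rlt_le_trans; [apply Hw|apply Rmin_l]).
    assert (W2 : Cmod (w - z) < e / L) by (eapply Rlt_le_trans; [apply Hw|apply Rmin_r]).
    eapply Rle_lt_trans; [apply (pev_lip r); unfold r; [|lra]|].
    - pose proof (Cmod_diff w z) as Q. apply Rabs_le_between in Q. lra.
    - fold r. apply (Rmult_lt_compat_r L) in W2; auto. unfold Rdiv in W2.
      rewrite Rmult_assoc, Rinv_l, Rmult_1_r in W2 by lra. pose proof (Cmod_ge_0 (w - z)). unfold L in *. nra. }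
  split; apply continuous_R2; intros e e0; destruct (H e e0) as (d & d0 & Hd); exists d; split; auto; intros w Hw;
    specialize (Hd w Hw); pose proof (Cmod_comp_le _ _ (Rle_refl (Cmod (pev p w - pev p z)))) as [A B]; simpl in A,
      B; unfold Rminus; lra.
Qed.

Lemma cont_Re p (z : R2) : continuous (fun w : R2 => Re (pev p w)) z.
Proof. exact (proj1 (cont_pev p z)). Qed.

Lemma cont_sq2 p q (z : R2) : continuous (fun w : R2 => sq2 (pev p w) (pev q w)) z.
Proof.
  apply (continuous_ext (fun w : R2 => fst (pev p w) * fst (pev p w) + snd (pev p w) * snd (pev p w) + (fst (pev q w)
    * fst (pev q w) + snd (pev q w) * snd (pev q w)))).
  - intros w. unfold sq2. rewrite !Cmod_sqr. auto.
  - destruct (cont_pev p z) as [A B]. destruct (cont_pev q z) as [A' B'].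
    apply continuous_add; apply continuous_add; apply continuous_mul; assumption.
Qed.

Lemma lam_metric S : metric (lam S).
Proof. intros z _. split; [apply cont_sq2|apply sq2_pos]. Qed.

Lemma cont_surf S (z : R2) : continuous (fun w => x1 (surf S w)) z /\ continuous (fun w => x2 (surf S w)) z /\
  continuous (fun w => x3 (surf S w)) z.
Proof. repeat split; apply cont_Re. Qed.

Lemma good_null S : good S -> forall z, null3 (pev (pder (sF1 S)) z) (pev (pder (sF2 S)) z) (pev (pder (sF3 S)) z) /\
  lam S z = norm3 (mk3 (Re (pev (pder (sF1 S)) z)) (Re (pev (pder (sF2 S)) z)) (Re (pev (pder (sF3 S)) z))).
Proof.
  intros [H _] z. destruct (H z) as (A & B & D). rewrite A, B, D. split; [apply th_null|].
  pose proof (norm3_rot (RtoC 1) (pev (sa S) z) (pev (sb S) z)) as Q. unfold rot in Q.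
  rewrite !Cmult_1_l, Cmod_1, Rmult_1_l in Q. rewrite Q. reflexivity.
Qed.

Lemma near_surf r eta S S' z : near r eta S S' -> Cmod z <= r -> dist3 (surf S' z) (surf S z) <= 3 * eta.
Proof.
  intros (A & B & D) Hz. rewrite dist3_norm. eapply Rle_trans; [apply norm3_sum|].
  assert (Q : forall p q, nrm r (psub p q) <= eta -> Rabs (Re (pev p z) - Re (pev q z)) <= eta).
  { intros p q H. rewrite <- Re_minus, <- pev_psub. eapply Rle_trans; [apply Re_le_Cmod|].
    eapply Rle_trans; [apply pev_le, Hz|auto]. }
  pose proof (Q _ _ A). pose proof (Q _ _ B). pose proof (Q _ _ D).
  unfold surf, vsub, mk3, x1, x2, x3 in *; simpl in *. lra.
Qed.

Lemma near_mono r eta r' eta' S S' : 0 <= r' <= r -> eta <= eta' -> near r eta S S' -> near r' eta' S S'.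
Proof.
  intros Hr He (A & B & D). repeat split; (eapply Rle_trans; [apply (nrm_mono r' r)|]; lra).
Qed.

Lemma psub_cons c p d q : psub (c :: p) (d :: q) = (c - d)%C :: psub p q.
Proof. unfold psub. simpl. f_equal. ring. Qed.
Lemma psub_nil_r p : psub p nil = p.
Proof. destruct p; auto. Qed.
Lemma nrm_psub_nil_l r q : nrm r (psub nil q) = nrm r q.
Proof. unfold psub. change (padd nil (pscal (- (1)) q)) with (pscal (- (1)) q). rewrite nrm_pscal, Cmod_m1. ring. Qed.

Lemma nrm_psub_self r p : nrm r (psub p p) = 0.
Proof.
  induction p; auto. rewrite psub_cons. cbn [nrm]. rewrite IHp.
  replace (a - a)%C with (RtoC 0) by ring. rewrite Cmod_0. ring.
Qed.

Lemma nrm_psub_padd r p q : nrm r (psub (padd p q) p) = nrm r q.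
Proof.
  revert q; induction p; intros [|d q]; cbn [padd].
  - auto. - rewrite psub_nil_r; auto. - apply nrm_psub_self.
  - rewrite psub_cons. cbn [nrm]. rewrite IHp. replace (a + d - a)%C with d by ring. auto.
Qed.

Lemma nrm_psub_ge r p q : 0 <= r -> nrm r p <= nrm r (psub p q) + nrm r q /\ nrm r q <= nrm r p + nrm r (psub p q).
Proof.
  intros Hr. revert q; induction p; intros [|d q].
  - simpl; lra.
  - rewrite nrm_psub_nil_l. change (nrm r nil) with 0. pose proof (nrm_pos r (d :: q) Hr). lra.
  - rewrite psub_nil_r. change (nrm r nil) with 0. pose proof (nrm_pos r (a :: p) Hr). lra.
  - rewrite psub_cons. cbn [nrm]. destruct (IHp q).
    pose proof (Cmod_triangle (a - d) d) as T. replace (a - d + d)%C with a in T by ring.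
    pose proof (Cmod_triangle (d - a) a) as T'. replace (d - a + a)%C with d in T' by ring.
    rewrite (Cmod_sub_sym d a) in T'.
    split; nra.
Qed.

Lemma nrm_psub_triangle r p q s : 0 <= r -> nrm r (psub p s) <= nrm r (psub p q) + nrm r (psub q s).
Proof.
  intros Hr. revert q s; induction p; intros q s.
  - rewrite !nrm_psub_nil_l. apply (nrm_psub_ge r q s); auto.
  - destruct q as [|d q]; [rewrite psub_nil_r, nrm_psub_nil_l; apply nrm_psub; auto|].
    destruct s as [|f s]; [rewrite !psub_nil_r; apply (nrm_psub_ge r (a :: p) (d :: q)); auto|].
    rewrite !psub_cons. cbn [nrm]. specialize (IHp q s).
    pose proof (Cmod_triangle (a - d) (d - f)) as T. replace (a - d + (d - f))%C with (a - f)%C in T by ring. nra.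
Qed.

Lemma near_trans r e1 e2 S1 S2 S3 : 0 <= r -> near r e1 S1 S2 -> near r e2 S2 S3 -> near r (e1 + e2) S1 S3.
Proof.
  intros Hr (A & B & D) (A' & B' & D'). repeat split.
  - eapply Rle_trans; [apply (nrm_psub_triangle r _ (sF1 S2)); auto|]. lra.
  - eapply Rle_trans; [apply (nrm_psub_triangle r _ (sF2 S2)); auto|]. lra.
  - eapply Rle_trans; [apply (nrm_psub_triangle r _ (sF3 S2)); auto|]. lra.
Qed.

Lemma near_refl r S : near r 0 S S.
Proof. repeat split; rewrite nrm_psub_self; lra. Qed.

Lemma pow_01 r n : 0 <= r <= 1 -> 0 <= r ^ n <= 1.
Proof. intros H. split; [apply pow_le; lra|]. pose proof (pow_incr r 1 n H) as Q. rewrite pow1 in Q. auto. Qed.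

Lemma bernoulli x n : 0 <= x -> 1 + INR n * x <= (1 + x) ^ n.
Proof.
  intros; induction n; [simpl; lra|]. rewrite S_INR. cbn [pow].
  pose proof (pos_INR n). nra.
Qed.

Lemma bernoulli_sub x n : 0 <= x <= 1 -> 1 - INR n * x <= (1 - x) ^ n.
Proof.
  intros; induction n; [simpl; lra|]. rewrite S_INR. cbn [pow].
  pose proof (pos_INR n). assert (0 <= (1 - x) ^ n <= 1) by (apply pow_01; lra). nra.
Qed.

Lemma pow_small r eta : 0 <= r < 1 -> 0 < eta -> exists N0, forall N, (N0 <= N)%nat -> r ^ N <= eta.
Proof.
  intros Hr He. destruct (pow_lt_1_zero r) with (y := eta) as [N0 H]; auto.
  { rewrite Rabs_pos_eq; lra. }
  exists N0. intros N HN. specialize (H N HN). pose proof (Rle_abs (r ^ N)). lra.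
Qed.

Lemma pow_small_lin r eta : 0 <= r < 1 -> 0 < eta ->
  exists N0, forall N, (N0 <= N)%nat -> INR (S (2 * N)) * r ^ (2 * N) <= eta.
Proof.
  intros Hr He. destruct (Req_dec r 0) as [->|R0].
  { exists 1%nat. intros N HN. rewrite pow_i by lia. lra. }
  set (x := / r - 1). assert (Hx : 0 < x).
  { unfold x. assert (1 < / r); [|lra]. rewrite <- Rinv_1 at 1. apply Rinv_lt_contravar; lra. }
  destruct (pow_small r (eta / (1 + 2 * / x)) Hr) as [N0 HN0].
  { apply Rdiv_lt_0_compat; auto. assert (0 < / x) by (apply Rinv_0_lt_compat; auto). lra. }
  exists N0. intros N HN. specialize (HN0 N HN).
  assert (B : INR N * r ^ N <= / x).
  { pose proof (bernoulli x N ltac:(lra)) as Q. replace (1 + x) with (/ r) in Q by (unfold x; ring).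
    rewrite pow_inv in Q. assert (0 < r ^ N) by (apply pow_lt; lra).
    apply (Rmult_le_compat_r (r ^ N)) in Q; [|lra]. rewrite Rinv_l in Q by lra.
    apply (Rmult_le_reg_l x); auto. rewrite Rinv_r by lra. nra. }
  rewrite S_INR, mult_INR. change (INR 2) with (1 + 1). replace (2 * N)%nat with (N + N)%nat by lia. rewrite pow_add.
  assert (0 <= r ^ N <= 1) by (apply pow_01; lra).
  assert (0 < / x) by (apply Rinv_0_lt_compat; auto).
  apply Rle_trans with ((1 + 2 * / x) * r ^ N).
  { replace (((1 + 1) * INR N + 1) * (r ^ N * r ^ N)) with (2 * (INR N * r ^ N * r ^ N) + r ^ N * r ^ N) by ring.
    assert (INR N * r ^ N * r ^ N <= / x * r ^ N) by (apply Rmult_le_compat_r; lra).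
    assert (r ^ N * r ^ N <= 1 * r ^ N) by (apply Rmult_le_compat_r; lra). lra. }
  apply (Rmult_le_compat_l (1 + 2 * / x)) in HN0; [|lra].
  replace ((1 + 2 * / x) * (eta / (1 + 2 * / x))) with eta in HN0 by (field; split; lra). lra.
Qed.

Lemma inv_small K eta : 0 < eta -> exists N0, forall N, (N0 <= N)%nat -> K / INR (S N) <= eta.
Proof.
  intros He. destruct (Rle_dec K 0) as [k|k].
  - exists O. intros N _. assert (0 < / INR (S N)) by (apply Rinv_0_lt_compat, lt_0_INR; lia). unfold Rdiv. nra.
  - destruct (archimed_cor1 (eta / K)) as (n & Hn & n0); [apply Rdiv_lt_0_compat; lra|].
    exists n. intros N HN. assert (0 < INR n) by (apply lt_0_INR; auto).
    assert (INR n <= INR (S N)) by (apply le_INR; lia).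
    assert (/ INR (S N) <= / INR n) by (apply Rinv_le_contravar; lra).
    apply Rle_trans with (K * (eta / K)); [|right; field; lra]. apply Rmult_le_compat_l; lra.
Qed.

Lemma sqrt_small K eta : 0 <= K -> 0 < eta ->
  exists N0, forall N, (N0 <= N)%nat -> K * sqrt (INR (S (2 * N))) / INR (S N) <= eta.
Proof.
  intros HK He. destruct (inv_small (2 * (K * K)) (eta * eta)) as [N0 H]; [nra|].
  exists N0. intros N HN. specialize (H N HN).
  assert (P : 0 < INR (S N)) by (apply lt_0_INR; lia).
  assert (Q : INR (S (2 * N)) <= 2 * INR (S N)).
  { rewrite !S_INR, mult_INR. change (INR 2) with (1 + 1). lra. }
  assert (s0 := sqrt_pos (INR (S (2 * N)))). assert (ss := sqrt_sqrt (INR (S (2 * N))) (pos_INR _)).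
  assert (0 < / INR (S N)) by (apply Rinv_0_lt_compat; auto).
  apply Rsqr_incr_0_var; [|lra]. unfold Rsqr, Rdiv in *.
  replace (K * sqrt (INR (S (2 * N))) * / INR (S N) * (K * sqrt (INR (S (2 * N))) * / INR (S N)))
    with (K * K * (sqrt (INR (S (2 * N))) * sqrt (INR (S (2 * N)))) * (/ INR (S N) * / INR (S N))) by ring.
  rewrite ss. eapply Rle_trans; [|apply H].
  apply Rle_trans with (K * K * (2 * INR (S N)) * (/ INR (S N) * / INR (S N))); [|right; field; lra].
  apply Rmult_le_compat_r; [nra|]. apply Rmult_le_compat_l; nra.
Qed.

Lemma eventually_list {A} (l : list A) (P : A -> nat -> Prop) :
  (forall a, In a l -> exists N0, forall N, (N0 <= N)%nat -> P a N) ->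
  exists N0, forall N, (N0 <= N)%nat -> forall a, In a l -> P a N.
Proof.
  induction l as [|a l IH]; intros H; [exists O; simpl; tauto|].
  destruct (H a) as [N1 H1]; [left; auto|]. destruct IH as [N2 H2]; [intros; apply H; right; auto|].
  exists (Nat.max N1 N2). intros N HN b [<-|Hb]; [apply H1; lia|apply H2; auto; lia].
Qed.

Section Step.
Variables (S0 : state) (c e : list C).
Let a := sa S0.
Let b := sb S0.

(* [(a, b) + s z^N (c, e)] with [s^2 = 2N + 1]: the quadratic terms contribute [(2N + 1) z^(2N) th c e], whose
   primitive is about [z^(2N+1) th c e], and the mixed terms integrate to [O(1 / sqrt N)]. *)
Definition step (N : nat) : state :=
  let s := RtoC (sqrt (INR (S (2 * N)))) in
  let upd F B T := padd F (padd (pscal (2 * s)%C (pshift (S N) (pint N B)))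
                                (pscal (RtoC (INR (S (2 * N)))) (pshift (S (2 * N)) (pint (2 * N) T)))) in
  St (padd a (pscal s (pshift N c))) (padd b (pscal s (pshift N e)))
     (upd (sF1 S0) (psub (pmul a c) (pmul b e)) (psub (pmul c c) (pmul e e)))
     (upd (sF2 S0) (pscal Ci (padd (pmul a c) (pmul b e))) (pscal Ci (padd (pmul c c) (pmul e e))))
     (upd (sF3 S0) (padd (pmul a e) (pmul b c)) (pscal 2%C (pmul c e))).

Lemma step_holo N : good S0 -> forall z,
  pev (pder (sF1 (step N))) z = th1 (pev (sa (step N)) z) (pev (sb (step N)) z) /\
  pev (pder (sF2 (step N))) z = th2 (pev (sa (step N)) z) (pev (sb (step N)) z) /\
  pev (pder (sF3 (step N))) z = th3 (pev (sa (step N)) z) (pev (sb (step N)) z).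
Proof.
  intros [H _] z. destruct (H z) as (A1 & A2 & A3).
  assert (Q : (RtoC (sqrt (INR (S (2 * N)))) * RtoC (sqrt (INR (S (2 * N)))))%C = RtoC (INR (S (2 * N)))).
  { rewrite <- RtoC_mult. f_equal. apply sqrt_sqrt, pos_INR. }
  unfold step. cbv zeta. cbn [sa sb sF1 sF2 sF3]. set (s := RtoC (sqrt (INR (S (2 * N))))) in *.
  rewrite !pev_pder_padd, !pev_pder_pscal, !pev_pder_shift_int, A1, A2, A3, <- Q.
  rewrite !pev_psub, !pev_padd, !pev_pscal, !pev_pshift, !pev_padd, !pev_pmul.
  replace (z ^ (2 * N))%C with (z ^ N * z ^ N)%C by (rewrite <- Cpow_add_r; f_equal; lia).
  fold a b. unfold th1, th2, th3. repeat split; ring.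
Qed.

(** The first term is the primitive of the mixed part, small on the whole closed disk; the second
    comes from the quadratic part and is small only where [r] stays below 1. *)
Lemma upd_near r N F B T : 0 <= r <= 1 ->
  nrm r (psub (padd F (padd (pscal (2 * RtoC (sqrt (INR (S (2 * N)))))%C (pshift (S N) (pint N B)))
    (pscal (RtoC (INR (S (2 * N)))) (pshift (S (2 * N)) (pint (2 * N) T))))) F)
  <= 2 * nrm 1 B * sqrt (INR (S (2 * N))) / INR (S N) + nrm 1 T * r ^ (S (2 * N)).
Proof.
  intros Hr. rewrite nrm_psub_padd. eapply Rle_trans; [apply nrm_padd; lra|].
  rewrite !nrm_pscal, !nrm_pshift, Cmod_mult, !Cmod_R, (Rabs_pos_eq 2), !Rabs_pos_eq by (try apply sqrt_pos;
    try apply pos_INR; lra).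
  assert (P : 0 < INR (S N)) by (apply lt_0_INR; lia). assert (P2 : 0 < INR (S (2 * N))) by (apply lt_0_INR; lia).
  pose proof (sqrt_pos (INR (S (2 * N)))).
  assert (R1 : 0 <= r ^ S N <= 1) by (apply pow_01; lra).
  assert (R2 : 0 <= r ^ S (2 * N)) by (apply pow_le; lra).
  pose proof (nrm_pint r N B ltac:(lra)) as X. pose proof (nrm_pint r (2 * N) T ltac:(lra)) as Y.
  pose proof (nrm_mono r 1 B Hr). pose proof (nrm_mono r 1 T Hr).
  pose proof (nrm_pos r (pint N B) ltac:(lra)).
  assert (X' : nrm r (pint N B) <= nrm 1 B / INR (S N)).
  { eapply Rle_trans; [apply X|]. apply Rmult_le_compat_r; auto. left; apply Rinv_0_lt_compat; auto. }
  assert (Y' : nrm r (pint (2 * N) T) <= nrm 1 T / INR (S (2 * N))).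
  { eapply Rle_trans; [apply Y|]. apply Rmult_le_compat_r; auto. left; apply Rinv_0_lt_compat; auto. }
  apply Rplus_le_compat.
  - replace (2 * nrm 1 B * sqrt (INR (S (2 * N))) / INR (S N)) with (2 * sqrt (INR (S (2 * N))) * (nrm 1 B / INR (S
      N))) by (field; lra).
    apply Rmult_le_compat_l; [lra|]. nra.
  - replace (nrm 1 T * r ^ S (2 * N)) with (INR (S (2 * N)) * (r ^ S (2 * N) * (nrm 1 T / INR (S (2 * N))))) by
      (field; lra).
    apply Rmult_le_compat_l; [lra|]. apply Rmult_le_compat_l; auto.
Qed.

(** Valid up to the boundary circle: the quadratic part is not small there but is known explicitly
    up to [O(1 / N)] by [pint_scaled]. *)
Lemma upd_close N F B T z : Cmod z <= 1 ->
  Cmod (pev (padd F (padd (pscal (2 * RtoC (sqrt (INR (S (2 * N)))))%C (pshift (S N) (pint N B)))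
    (pscal (RtoC (INR (S (2 * N)))) (pshift (S (2 * N)) (pint (2 * N) T))))) z - (pev F z + z ^ (S (2 * N)) * pev T
      z))%C
  <= 2 * nrm 1 B * sqrt (INR (S (2 * N))) / INR (S N) + wnrm 0 T / INR (S (2 * N)).
Proof.
  intros Hz. rewrite !pev_padd, !pev_pscal, !pev_pshift.
  replace (pev F z + (2 * RtoC (sqrt (INR (S (2 * N)))) * (z ^ S N * pev (pint N B) z) + RtoC (INR (S (2 * N))) * (z
    ^ S (2 * N) * pev (pint (2 * N) T) z)) - (pev F z + z ^ S (2 * N) * pev T z))%C
    with (2 * RtoC (sqrt (INR (S (2 * N)))) * (z ^ S N * pev (pint N B) z) + z ^ S (2 * N) * (RtoC (INR (S (2 * N)))
      * pev (pint (2 * N + 0) T) z - pev T z))%C by (rewrite Nat.add_0_r; ring).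
  eapply Rle_trans; [apply Cmod_triangle|].
  rewrite !Cmod_mult, !Cmod_pow, !Cmod_R, (Rabs_pos_eq 2), Rabs_pos_eq by (try apply sqrt_pos; lra).
  assert (P : 0 < INR (S N)) by (apply lt_0_INR; lia).
  pose proof (Cmod_ge_0 z). pose proof (sqrt_pos (INR (S (2 * N)))).
  assert (Zp : forall n, 0 <= Cmod z ^ n <= 1) by (intros n; apply pow_01; lra).
  pose proof (pint_scaled (2 * N) 0 T z Hz) as Y.
  assert (X : Cmod (pev (pint N B) z) <= nrm 1 B / INR (S N)).
  { eapply Rle_trans; [apply (pev_le 1 _ _ Hz)|]. apply nrm_pint; lra. }
  pose proof (Cmod_ge_0 (pev (pint N B) z)).
  apply Rplus_le_compat.
  - replace (2 * nrm 1 B * sqrt (INR (S (2 * N))) / INR (S N)) with (2 * sqrt (INR (S (2 * N))) * (nrm 1 B / INR (S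
      N))) by (field; lra).
    apply Rmult_le_compat_l; [lra|]. specialize (Zp (S N)). nra.
  - specialize (Zp (S (2 * N))). pose proof (Cmod_ge_0 (RtoC (INR (S (2 * N))) * pev (pint (2 * N + 0) T) z - pev T
      z)). nra.
Qed.

Lemma step_close_near r eta : 0 <= r < 1 -> 0 < eta -> exists N0, forall N, (N0 <= N)%nat ->
  near r eta S0 (step N) /\ forall z, Cmod z <= 1 ->
    dist3 (surf (step N) z) (vadd (surf S0 z) (rot (z ^ (S (2 * N)))%C (pev c z) (pev e z))) <= eta.
Proof.
  intros Hr He.
  set (B1 := psub (pmul a c) (pmul b e)). set (T1 := psub (pmul c c) (pmul e e)).
  set (B2 := pscal Ci (padd (pmul a c) (pmul b e))). set (T2 := pscal Ci (padd (pmul c c) (pmul e e))).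
  set (B3 := padd (pmul a e) (pmul b c)). set (T3 := pscal 2%C (pmul c e)).
  assert (Hp : forall p, 0 <= nrm 1 p) by (intros; apply nrm_pos; lra).
  set (K := 2 * (nrm 1 B1 + nrm 1 B2 + nrm 1 B3)).
  assert (HK : 0 <= K) by (unfold K; pose proof (Hp B1); pose proof (Hp B2); pose proof (Hp B3); lra).
  assert (Wp : forall p k, 0 <= wnrm k p).
  { induction p; intros k; simpl; [lra|]. specialize (IHp (S k)). pose proof (pos_INR k). pose proof (Cmod_ge_0 a0).
    nra. }
  set (W := wnrm 0 T1 + wnrm 0 T2 + wnrm 0 T3).
  set (M := nrm 1 T1 + nrm 1 T2 + nrm 1 T3 + 1).
  assert (M0 : 0 < M) by (unfold M; pose proof (Hp T1); pose proof (Hp T2); pose proof (Hp T3); lra).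
  destruct (sqrt_small K (eta / 6) HK ltac:(lra)) as [N1 H1].
  destruct (inv_small W (eta / 6) ltac:(lra)) as [N2 H2].
  destruct (pow_small r (eta / (6 * M)) Hr) as [N3 H3]; [apply Rdiv_lt_0_compat; lra|].
  exists (N1 + N2 + N3)%nat. intros N HN.
  specialize (H1 N ltac:(lia)). specialize (H2 (2 * N)%nat ltac:(lia)). specialize (H3 (S (2 * N)) ltac:(lia)).
  assert (s0 := sqrt_pos (INR (S (2 * N)))).
  assert (P : 0 < / INR (S N)) by (apply Rinv_0_lt_compat, lt_0_INR; lia).
  assert (P2 : 0 < / INR (S (2 * N))) by (apply Rinv_0_lt_compat, lt_0_INR; lia).
  set (q := sqrt (INR (S (2 * N))) * / INR (S N)) in *.
  assert (q0 : 0 <= q) by (unfold q; nra).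
  assert (Hq : forall B, 2 * nrm 1 B <= K -> 2 * nrm 1 B * sqrt (INR (S (2 * N))) / INR (S N) <= eta / 6).
  { intros B HB. unfold Rdiv in *. rewrite Rmult_assoc in H1 |- *. fold q in H1 |- *. nra. }
  assert (Hw : forall T, wnrm 0 T <= W -> wnrm 0 T / INR (S (2 * N)) <= eta / 6).
  { intros T HT. eapply Rle_trans; [|apply H2]. apply Rmult_le_compat_r; lra. }
  assert (Hm : forall T, nrm 1 T <= M -> nrm 1 T * r ^ S (2 * N) <= eta / 6).
  { intros T HT. apply Rle_trans with (M * (eta / (6 * M))); [|right; field; lra].
    apply Rmult_le_compat; auto. apply pow_le; lra. }
  assert (KB : 2 * nrm 1 B1 <= K /\ 2 * nrm 1 B2 <= K /\ 2 * nrm 1 B3 <= K) by (unfold K; pose proof (Hp B1);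
    pose proof (Hp B2); pose proof (Hp B3); repeat split; lra).
  assert (WT : wnrm 0 T1 <= W /\ wnrm 0 T2 <= W /\ wnrm 0 T3 <= W) by (unfold W; pose proof (Wp T1 O);
    pose proof (Wp T2 O); pose proof (Wp T3 O); repeat split; lra).
  assert (MT : nrm 1 T1 <= M /\ nrm 1 T2 <= M /\ nrm 1 T3 <= M) by (unfold M; pose proof (Hp T1); pose proof (Hp T2);
    pose proof (Hp T3); repeat split; lra).
  split.
  - repeat split; (eapply Rle_trans; [apply upd_near; lra|]).
    + pose proof (Hq B1 (proj1 KB)). pose proof (Hm T1 (proj1 MT)). unfold B1, T1 in *. lra.
    + pose proof (Hq B2 (proj1 (proj2 KB))). pose proof (Hm T2 (proj1 (proj2 MT))). unfold B2, T2 in *. lra.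
    + pose proof (Hq B3 (proj2 (proj2 KB))). pose proof (Hm T3 (proj2 (proj2 MT))). unfold B3, T3 in *. lra.
  - intros z Hz. rewrite dist3_norm. eapply Rle_trans; [apply norm3_sum|].
    assert (E : forall F F' B T th, 2 * nrm 1 B <= K -> wnrm 0 T <= W ->
      F' = padd F (padd (pscal (2 * RtoC (sqrt (INR (S (2 * N)))))%C (pshift (S N) (pint N B)))
        (pscal (RtoC (INR (S (2 * N)))) (pshift (S (2 * N)) (pint (2 * N) T)))) -> pev T z = th ->
      Rabs (Re (pev F' z) - (Re (pev F z) + Re (z ^ S (2 * N) * th))) <= eta / 3).
    { intros F F' B T th HB HT -> <-.
      eapply Rle_trans; [|eapply Rle_trans; [apply (upd_close N F B T z Hz)|]].
      - eapply Rle_trans; [|apply Re_le_Cmod]. right. reflexivity.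
      - pose proof (Hq B HB). pose proof (Hw T HT). lra. }
    pose proof (E (sF1 S0) (sF1 (step N)) B1 T1 (th1 (pev c z) (pev e z)) (proj1 KB) (proj1 WT) eq_refl) as E1.
    pose proof (E (sF2 S0) (sF2 (step N)) B2 T2 (th2 (pev c z) (pev e z)) (proj1 (proj2 KB)) (proj1 (proj2 WT))
      eq_refl) as E2.
    pose proof (E (sF3 S0) (sF3 (step N)) B3 T3 (th3 (pev c z) (pev e z)) (proj2 (proj2 KB)) (proj2 (proj2 WT))
      eq_refl) as E3.
    assert (X1 := E1 ltac:(unfold T1, th1; rewrite pev_psub, !pev_pmul; ring)).
    assert (X2 := E2 ltac:(unfold T2, th2; rewrite pev_pscal, pev_padd, !pev_pmul; ring)).
    assert (X3 := E3 ltac:(unfold T3, th3; rewrite pev_pscal, !pev_pmul; ring)).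
    unfold surf, vsub, vadd, rot, mk3, x1, x2, x3; cbn [fst snd]. lra.
Qed.
End Step.

(** From [2 |u| |p| <= t |u|^2 + |p|^2 / t]. It serves with either summand as the dominant one: the
    old spinors on an inner disk, the new term near the circle. *)
Lemma sq2_lower u v p q t : 0 < t < 1 -> (1 - t) * sq2 u v - / t * sq2 p q <= sq2 (u + p) (v + q).
Proof.
  intros Ht. unfold sq2.
  assert (P : forall u p : C, (1 - t) * (Cmod u * Cmod u) - / t * (Cmod p * Cmod p) <= Cmod (u + p) * Cmod (u + p)).
  { intros x y. pose proof (Cmod_diff x (- y)%C) as D. replace (x - - y)%C with (x + y)%C in D by ring.
    rewrite Cmod_opp in D. apply Rabs_le_between in D.
    pose proof (Cmod_ge_0 x). pose proof (Cmod_ge_0 y). pose proof (Cmod_ge_0 (x + y)).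
    assert (L : (Cmod x - Cmod y) * (Cmod x - Cmod y) <= Cmod (x + y) * Cmod (x + y)) by nra.
    eapply Rle_trans; [|apply L].
    assert (0 < / t) by (apply Rinv_0_lt_compat; lra).
    set (k := / t) in *. assert (k * t = 1) by (unfold k; field; lra).
    assert (0 <= k * ((t * Cmod x - Cmod y) * (t * Cmod x - Cmod y))) by (apply Rmult_le_pos; [lra|apply Rle_0_sqr]).
    replace (k * ((t * Cmod x - Cmod y) * (t * Cmod x - Cmod y))) with (t * (k * t) * (Cmod x * Cmod x) - 2 * (k * t)
      * (Cmod x * Cmod y) + k * (Cmod y * Cmod y)) in H4 by ring.
    rewrite H3 in H4. nra. }
  pose proof (P u p). pose proof (P v q). lra.
Qed.

Lemma sq2_scal w s1 s2 : sq2 (w * s1) (w * s2) = Cmod w * Cmod w * sq2 s1 s2.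
Proof. unfold sq2. rewrite !Cmod_mult. ring. Qed.

Lemma Cmod_osc N z : Cmod (RtoC (sqrt (INR (S (2 * N)))) * z ^ N) * Cmod (RtoC (sqrt (INR (S (2 * N)))) * z ^ N) =
  INR (S (2 * N)) * Cmod z ^ (2 * N).
Proof.
  rewrite Cmod_mult, Cmod_R, Cmod_pow, Rabs_pos_eq by apply sqrt_pos.
  replace (Cmod z ^ (2 * N)) with (Cmod z ^ N * Cmod z ^ N) by (rewrite <- pow_add; f_equal; lia).
  transitivity (sqrt (INR (S (2 * N))) * sqrt (INR (S (2 * N))) * (Cmod z ^ N * Cmod z ^ N)); [ring|].
  rewrite sqrt_sqrt by apply pos_INR. auto.
Qed.

Lemma continuous_pow_nat n (x : R) : continuous (fun y : R => y ^ n) x.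
Proof.
  apply (ex_derive_continuous (K := R_AbsRing) (V := R_NormedModule)). auto_derive. auto.
Qed.

Section StepMetric.
Variables (S0 : state) (c e : list C).

Lemma lam_step N z : lam (step S0 c e N) z =
  sq2 (pev (sa S0) z + (RtoC (sqrt (INR (S (2 * N)))) * z ^ N) * pev c z)
      (pev (sb S0) z + (RtoC (sqrt (INR (S (2 * N)))) * z ^ N) * pev e z).
Proof. unfold lam, step; cbn [sa sb]. rewrite !pev_padd, !pev_pscal, !pev_pshift. f_equal; ring. Qed.

Lemma sq2_bounded p q : exists M, 0 < M /\ forall z, Cmod z <= 1 -> sq2 (pev p z) (pev q z) <= M.
Proof.
  destruct (compact_bounded (fun z : R2 => Cmod z <= 1) (fun z => sq2 (pev p z) (pev q z)) (compact_closed_disk 1))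
    as (M & M0 & H).
  { intros; apply cont_sq2. }
  exists M; split; auto.
Qed.

(** On a compact disk the added spinor has squared size of order [(2N+1) r^(2N)], which tends to 0,
    whereas [lam] has a positive minimum there. *)
Lemma step_lam r eta : good S0 -> 0 <= r < 1 -> 0 < eta -> exists N0, forall N, (N0 <= N)%nat ->
  forall z, Cmod z <= r -> (1 - eta) * lam S0 z <= lam (step S0 c e N) z.
Proof.
  intros [_ Hg] Hr He.
  destruct (compact_pos_min (fun z : R2 => Cmod z <= r) (lam S0) (compact_closed_disk r)) as (m & m0 & Hm).
  { intros; apply cont_sq2. } { intros z Hz; apply Hg; lra. }
  destruct (sq2_bounded c e) as (M & M0 & HM).
  set (t := Rmin (1 / 2) (eta / 2)).
  assert (t0 : 0 < t) by (apply Rmin_pos; lra). assert (t1 : t <= 1 / 2) by apply Rmin_l.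
  assert (t2 : t <= eta / 2) by apply Rmin_r.
  destruct (pow_small_lin r (t * t * m / M) Hr) as [N0 HN0].
  { apply Rdiv_lt_0_compat; auto. apply Rmult_lt_0_compat; auto; nra. }
  exists N0. intros N HN z Hz. specialize (HN0 N HN). rewrite lam_step.
  eapply Rle_trans; [|apply (sq2_lower _ _ _ _ t); lra]. fold (lam S0 z).
  rewrite sq2_scal, Cmod_osc. specialize (Hm z Hz). specialize (HM z ltac:(lra)).
  pose proof (Cmod_ge_0 z). pose proof (sq2_pos (pev c z) (pev e z)).
  assert (Q : INR (S (2 * N)) * Cmod z ^ (2 * N) * sq2 (pev c z) (pev e z) <= t * t * m / M * M).
  { apply Rmult_le_compat; auto. - apply Rmult_le_pos; [apply pos_INR|apply pow_le; auto].
    - eapply Rle_trans; [|apply HN0]. apply Rmult_le_compat_l; [apply pos_INR|apply pow_incr; lra]. }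
  replace (t * t * m / M * M) with (t * t * m) in Q by (field; lra).
  apply (Rmult_le_compat_l (/ t)) in Q; [|left; apply Rinv_0_lt_compat; auto].
  replace (/ t * (t * t * m)) with (t * m) in Q by (field; lra). nra.
Qed.

(** A common zero of [a + w c] and [b + w e] annihilates [a e - b c], which does not involve [N]. At
    each of its finitely many zeros in the open disk, [step_lam] with loss [1 / 2] keeps the
    conformal factor positive for large [N]. *)
Lemma step_good : good S0 -> (exists z, (pev (sa S0) z * pev e z - pev (sb S0) z * pev c z)%C <> 0%C) ->
  exists N0, forall N, (N0 <= N)%nat -> good (step S0 c e N).
Proof.
  intros G [z0 Hz0].
  destruct (poly_roots (psub (pmul (sa S0) e) (pmul (sb S0) c))) as [Z|[l Hl]].
  { elim Hz0. rewrite <- (Z z0), pev_psub, !pev_pmul. ring. }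
  destruct (eventually_list l (fun z N => Cmod z < 1 -> 0 < lam (step S0 c e N) z)) as [N0 HN0].
  { intros z _. destruct (Rlt_dec (Cmod z) 1) as [L|L]; [|exists O; intros; lra].
    pose proof (Cmod_ge_0 z).
    destruct (step_lam (Cmod z) (1 / 2) G) as [N0 HN0]; try lra.
    exists N0. intros N HN _. specialize (HN0 N HN z (Rle_refl _)). destruct G as [_ G]. specialize (G z L). lra. }
  exists N0. intros N HN. split; [apply step_holo; auto|].
  intros z Hz. destruct (classic (In z l)) as [I|I]; [apply HN0; auto|].
  pose proof (sq2_pos (pev (sa (step S0 c e N)) z) (pev (sb (step S0 c e N)) z)) as P.
  fold (lam (step S0 c e N) z) in P.
  destruct P as [P|P]; auto. elim I. apply Hl. rewrite pev_psub, !pev_pmul.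
  rewrite lam_step in P. set (w := (RtoC (sqrt (INR (S (2 * N)))) * z ^ N)%C) in *.
  assert (A : (pev (sa S0) z + w * pev c z)%C = 0%C).
  { apply Cmod_eq_0. unfold sq2 in P. pose proof (Cmod_ge_0 (pev (sa S0) z + w * pev c z)).
    pose proof (Cmod_ge_0 (pev (sb S0) z + w * pev e z)). nra. }
  assert (B : (pev (sb S0) z + w * pev e z)%C = 0%C).
  { apply Cmod_eq_0. unfold sq2 in P. pose proof (Cmod_ge_0 (pev (sa S0) z + w * pev c z)).
    pose proof (Cmod_ge_0 (pev (sb S0) z + w * pev e z)). nra. }
  transitivity ((pev (sa S0) z + w * pev c z) * pev e z - (pev (sb S0) z + w * pev e z) * pev c z)%C; [ring|].
  rewrite A, B. ring.
Qed.

(** Near the circle the metric is about [(2N+1) |z|^(2N)] times the [sq2] of the new spinor, and the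
    radial integral of [(2N+1) |z|^(2N)] over the unit interval is 1. It concentrates at the circle,
    hence the gain close to [kap] beyond any fixed [r]. *)
Lemma step_gain r kap eta : 0 <= r < 1 -> 0 < kap -> 0 < eta ->
  (forall z, r <= Cmod z <= 1 -> kap <= sq2 (pev c z) (pev e z)) ->
  exists N0, forall N, (N0 <= N)%nat -> exists R', r < R' < 1 /\ crossing (lam (step S0 c e N)) r R' (kap - eta).
Proof.
  intros Hr Hk He Hce.
  destruct (sq2_bounded (sa S0) (sb S0)) as (A & A0 & HA).
  (* Three factors are lost: [1 - t] from the degree of the potential and twice [1 - 2 * t], from
     the old spinors and from the ends of the annulus. Together they cost at most [5 * t * kap]. *)
  set (t := Rmin (1 / 10) (eta / (5 * kap))).
  assert (t0 : 0 < t) by (apply Rmin_pos; [lra|apply Rdiv_lt_0_compat; lra]).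
  assert (t1 : t <= 1 / 10) by apply Rmin_l.
  assert (t2 : 5 * t * kap <= eta).
  { apply Rle_trans with (5 * (eta / (5 * kap)) * kap); [|right; field; lra].
    apply Rmult_le_compat_r; [lra|]. apply Rmult_le_compat_l; [lra|apply Rmin_r]. }
  (* The level of [(2N+1) |z|^(2N)] above which the new term dominates the old spinors with relative
     error [t]; [rho] will be the radius where it is reached. *)
  set (Bd := A / (t * t * kap)).
  assert (tk : 0 < t * t * kap) by (apply Rmult_lt_0_compat; nra).
  assert (Bd0 : 0 < Bd) by (apply Rdiv_lt_0_compat; auto).
  destruct (pow_small_lin r Bd Hr Bd0) as [N1 H1].
  destruct (inv_small (Bd + 1) t t0) as [N2 H2]. destruct (inv_small 1 t t0) as [N3 H3].
  destruct (inv_small (Bd + 1) (1 / 2) ltac:(lra)) as [N4 H4].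
  exists (N1 + N2 + N3 + N4)%nat. intros N HN.
  specialize (H1 N ltac:(lia)). specialize (H2 (2 * N)%nat ltac:(lia)). specialize (H3 (S (2 * N)) ltac:(lia)).
  specialize (H4 (2 * N)%nat ltac:(lia)).
  set (n := INR (S (2 * N))) in *.
  assert (n0 : 0 < n) by (apply lt_0_INR; lia).
  assert (Hn : Bd < n).
  { apply (Rmult_le_compat_r n) in H4; [|lra]. unfold Rdiv in H4. rewrite Rmult_assoc, Rinv_l in H4 by lra. lra. }
  destruct (first_hit (fun x => n * x ^ (2 * N)) r 1 Bd) as (rho & Hrho & Erho & _); try lra.
  { intros x _. apply continuous_mul; [apply continuous_cst|apply continuous_pow_nat]. }
  { rewrite pow1; lra. }
  assert (rho1 : rho < 1).
  { destruct (Req_dec rho 1) as [E|E]; [|lra]. rewrite E, pow1 in Erho. lra. }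
  set (R' := 1 - Rmin (t / INR (2 * S N)) ((1 - rho) / 2)).
  assert (p0 : 0 < INR (2 * S N)) by (apply lt_0_INR; lia).
  assert (m0 : 0 < Rmin (t / INR (2 * S N)) ((1 - rho) / 2)) by (apply Rmin_pos; [apply Rdiv_lt_0_compat; auto|lra]).
  pose proof (Rmin_l (t / INR (2 * S N)) ((1 - rho) / 2)) as m1.
  pose proof (Rmin_r (t / INR (2 * S N)) ((1 - rho) / 2)) as m2.
  assert (HR : rho < R' < 1) by (unfold R'; lra).
  assert (HRp : 1 - t <= R' ^ (2 * S N)).
  { unfold R'. eapply Rle_trans; [|apply bernoulli_sub; lra].
    apply (Rmult_le_compat_l (INR (2 * S N))) in m1; [|lra].
    replace (INR (2 * S N) * (t / INR (2 * S N))) with t in m1 by (field; lra). lra. }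
  assert (Hrp : rho ^ (2 * S N) <= t).
  { apply Rle_trans with (rho ^ (2 * N)).
    - replace (2 * S N)%nat with (2 * N + 2)%nat by lia. rewrite pow_add.
      pose proof (pow_01 rho (2 * N) ltac:(lra)). pose proof (pow_01 rho 2 ltac:(lra)). nra.
    - apply (Rmult_le_reg_l n); auto. rewrite Erho.
      apply (Rmult_le_compat_r n) in H2; [|lra]. unfold Rdiv in H2. rewrite Rmult_assoc, Rinv_l in H2 by lra. lra. }
  set (k := (1 - 2 * t) * kap * n / (2 * INR (S N))).
  assert (q0 : 0 < INR (S N)) by (apply lt_0_INR; lia).
  assert (Hk0 : 0 <= k) by (unfold k; apply Rmult_le_pos; [apply Rmult_le_pos; [nra|lra]|left;
    apply Rinv_0_lt_compat; lra]).
  exists R'. split; [lra|].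
  apply (crossing_mono _ rho R' (k * (R' ^ (2 * S N) - rho ^ (2 * S N)))); try lra.
  - assert (Hkk : (1 - t) * ((1 - 2 * t) * kap) <= k).
    { unfold k. replace ((1 - 2 * t) * kap * n / (2 * INR (S N))) with (n / (2 * INR (S N)) * ((1 - 2 * t) * kap)) by
        (field; lra).
      apply Rmult_le_compat_r; [nra|].
      assert (En : 2 * INR (S N) = n + 1). { unfold n. rewrite !S_INR, mult_INR. change (INR 2) with (1 + 1). ring. }
      rewrite En. replace (n / (n + 1)) with (1 - 1 / (n + 1)) by (field; lra).
      replace (INR (S (S (2 * N)))) with (n + 1) in H3 by (unfold n; rewrite (S_INR (S (2 * N))); auto). lra. }
    assert (D : 1 - 2 * t <= R' ^ (2 * S N) - rho ^ (2 * S N)) by lra.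
    apply Rle_trans with ((1 - t) * ((1 - 2 * t) * kap) * (1 - 2 * t)).
    + assert (kap - 5 * t * kap <= (1 - t) * ((1 - 2 * t) * kap) * (1 - 2 * t)); [|lra].
      replace ((1 - t) * ((1 - 2 * t) * kap) * (1 - 2 * t)) with (kap - 5 * t * kap + t * t * kap * (8 - 4 * t)) by
        ring.
      assert (0 <= t * t * kap * (8 - 4 * t)) by (apply Rmult_le_pos; lra). lra.
    + apply Rmult_le_compat; try lra. apply Rmult_le_pos; [lra|nra].
  - apply crossing_potential; try lra; [apply lam_metric|].
    intros z Hz. rewrite lam_step.
    set (w := (RtoC (sqrt (INR (S (2 * N)))) * z ^ N)%C).
    rewrite (Cplus_comm (pev (sa S0) z)), (Cplus_comm (pev (sb S0) z)).
    eapply Rle_trans; [|apply (sq2_lower _ _ _ _ t); lra].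
    rewrite sq2_scal. unfold w. rewrite Cmod_osc. fold n.
    specialize (HA z ltac:(lra)). specialize (Hce z ltac:(lra)).
    assert (Hz2 : Bd <= n * Cmod z ^ (2 * N)).
    { rewrite <- Erho. apply Rmult_le_compat_l; [lra|]. apply pow_incr. lra. }
    replace (k * (2 * INR (S N) * Cmod z ^ (2 * N))) with ((1 - 2 * t) * (n * Cmod z ^ (2 * N)) * kap) by (unfold k;
      field; lra).
    set (y := n * Cmod z ^ (2 * N)) in *.
    assert (Ha : / t * sq2 (pev (sa S0) z) (pev (sb S0) z) <= t * kap * y).
    { apply Rle_trans with (/ t * A); [apply Rmult_le_compat_l; [left; apply Rinv_0_lt_compat; auto|auto]|].
      apply Rle_trans with (t * kap * Bd); [right; unfold Bd; field; lra|]. apply Rmult_le_compat_l; [nra|auto]. }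
    assert ((1 - t) * (y * kap) <= (1 - t) * (y * sq2 (pev c z) (pev e z))).
    { apply Rmult_le_compat_l; [lra|]. apply Rmult_le_compat_l; lra. }
    nra.
Qed.
End StepMetric.

(* A nonzero polynomial [a e - b c] has finitely many zeros, so that for large [N] the spinors of [step] have no
   common zero. *)
Lemma perturb_generic (S0 : state) (c e : list C) t : good S0 -> 0 < t ->
  exists c' e', (exists z, (pev (sa S0) z * pev e' z - pev (sb S0) z * pev c' z)%C <> 0%C) /\
    forall z, Cmod (pev c' z - pev c z) <= t /\ Cmod (pev e' z - pev e z) <= t.
Proof.
  intros G t0.
  assert (T0 : Cmod (RtoC t) <= t) by (rewrite Cmod_R, Rabs_pos_eq; lra).
  assert (Z0 : forall p z, Cmod (pev p z - pev p z) <= t) by (intros p z;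
    replace (pev p z - pev p z)%C with (RtoC 0) by ring; rewrite Cmod_0; lra).
  assert (Z1 : forall p z, Cmod (pev (padd p (RtoC t :: nil)) z - pev p z) <= t).
  { intros p z. rewrite pev_padd. cbn [pev]. replace (pev p z + (RtoC t + z * 0) - pev p z)%C with (RtoC t) by ring.
    auto. }
  destruct (classic (exists z, (pev (sa S0) z * pev e z - pev (sb S0) z * pev c z)%C <> 0%C)) as [W|W].
  { exists c, e. split; auto. }
  assert (W0 : (pev (sa S0) 0 * pev e 0 - pev (sb S0) 0 * pev c 0)%C = 0%C) by (apply NNPP; intros N; apply W; eauto).
  assert (tn : RtoC t <> 0%C) by (intros E; apply RtoC_inj in E; lra).
  (* The spinors do not both vanish at 0, so adding the constant [t] to the cofactor of a
     nonvanishing one changes the determinant at 0 by a nonzero amount. *)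
  destruct (classic (pev (sa S0) 0 = 0%C)) as [Za|Za].
  - exists (padd c (RtoC t :: nil)), e. split; [|auto].
    exists 0%C. rewrite pev_padd. cbn [pev]. intros E.
    assert (E' : (pev (sb S0) 0 * RtoC t)%C = 0%C).
    { transitivity (pev (sa S0) 0 * pev e 0 - pev (sb S0) 0 * pev c 0 - (pev (sa S0) 0 * pev e 0 - pev (sb S0) 0 *
        (pev c 0 + (RtoC t + 0 * 0))))%C; [ring|].
      rewrite E, W0. ring. }
    apply (f_equal Cmod) in E'. rewrite Cmod_mult, Cmod_0 in E'. apply Cmod_gt_0 in tn.
    destruct G as [_ G]. specialize (G 0%C ltac:(rewrite Cmod_0; lra)). unfold lam, sq2 in G. rewrite Za, Cmod_0 in G.
    apply Rmult_integral in E'. destruct E' as [E'|E']; [rewrite E' in G; lra|lra].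
  - exists c, (padd e (RtoC t :: nil)). split; [|auto].
    exists 0%C. rewrite pev_padd. cbn [pev]. intros E.
    assert (E' : (pev (sa S0) 0 * RtoC t)%C = 0%C).
    { transitivity (pev (sa S0) 0 * (pev e 0 + (RtoC t + 0 * 0)) - pev (sb S0) 0 * pev c 0 - (pev (sa S0) 0 * pev e 0
        - pev (sb S0) 0 * pev c 0))%C; [ring|].
      rewrite E, W0. ring. }
    apply (f_equal Cmod) in E'. rewrite Cmod_mult, Cmod_0 in E'. apply Cmod_gt_0 in tn. apply Cmod_gt_0 in Za.
    apply Rmult_integral in E'. destruct E' as [E'|E']; lra.
Qed.

Lemma spin_generic (S0 : state) (d1 d2 d3 m : R2 -> R) eta : good S0 ->
  (forall z, Cmod z = 1 -> continuous d1 z /\ continuous d2 z /\ continuous d3 z /\ continuous m z /\ 0 < m z) ->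
    0 < eta ->
  exists c e : list C, (exists z, (pev (sa S0) z * pev e z - pev (sb S0) z * pev c z)%C <> 0%C) /\
    forall z, Cmod z = 1 ->
    Cmod (dotC (pev c z) (pev e z) (d1 z) (d2 z) (d3 z)) <= eta /\
    Rabs (sq2 (pev c z) (pev e z) - m z) <= eta.
Proof.
  intros G Hc He.
  destruct (spin d1 d2 d3 m (eta / 2) Hc ltac:(lra)) as (c & e & H).
  destruct (circle_bound d1 (fun z Hz => proj1 (Hc z Hz))) as (D1 & D10 & HD1).
  destruct (circle_bound d2 (fun z Hz => proj1 (proj2 (Hc z Hz)))) as (D2 & D20 & HD2).
  destruct (circle_bound d3 (fun z Hz => proj1 (proj2 (proj2 (Hc z Hz))))) as (D3 & D30 & HD3).
  destruct (sq2_bounded c e) as (M & M0 & HM).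
  set (B := M + 1). set (D := D1 + D2 + D3 + 1). set (K := 2 * (2 * B + 1)).
  assert (K0 : 0 < K) by (unfold K, B; lra). assert (D0 : 1 < D) by (unfold D; lra).
  set (t := Rmin 1 (eta / (2 * D * K))).
  assert (t0 : 0 < t) by (apply Rmin_pos; [lra|apply Rdiv_lt_0_compat; auto; nra]).
  assert (tl1 : t <= 1) by apply Rmin_l.
  assert (tl3 : t * K * D <= eta / 2).
  { apply Rle_trans with (eta / (2 * D * K) * K * D); [|right; field; lra]. apply Rmult_le_compat_r; [lra|].
    apply Rmult_le_compat_r; [lra|]. apply Rmin_r. }
  assert (tl2 : t * K <= eta / 2) by nra.
  assert (Main : forall c' e', (forall z, Cmod (pev c' z - pev c z) <= t) -> (forall z,
    Cmod (pev e' z - pev e z) <= t) ->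
    forall z, Cmod z = 1 -> Cmod (dotC (pev c' z) (pev e' z) (d1 z) (d2 z) (d3 z)) <= eta /\
      Rabs (sq2 (pev c' z) (pev e' z) - m z) <= eta).
  { intros c' e' Hc' He' z Hz. specialize (Hc' z). specialize (He' z). destruct (H z Hz) as [H1 H2].
    assert (HB : Cmod (pev c z) <= B /\ Cmod (pev e z) <= B).
    { specialize (HM z ltac:(lra)). unfold sq2 in HM. pose proof (Cmod_ge_0 (pev c z)).
      pose proof (Cmod_ge_0 (pev e z)). unfold B; split; nra. }
    destruct HB as [Hs1 Hs2].
    destruct (th_diff _ _ _ _ B t Hs1 Hs2 Hc' He' tl1) as (X1 & X2 & X3).
    pose proof (sq2_diff _ _ _ _ B t Hs1 Hs2 Hc' He' tl1) as X4.
    specialize (HD1 z Hz). specialize (HD2 z Hz). specialize (HD3 z Hz).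
    assert (Q : forall a b A B, 0 <= a -> 0 <= b -> a <= A -> b <= B -> a * b <= A * B) by (intros;
      apply Rmult_le_compat; auto).
    assert (V1 := Q _ _ _ _ (Cmod_ge_0 _) (Rabs_pos _) X1 HD1).
    assert (V2 := Q _ _ _ _ (Cmod_ge_0 _) (Rabs_pos _) X2 HD2).
    assert (V3 := Q _ _ _ _ (Cmod_ge_0 _) (Rabs_pos _) X3 HD3).
    assert (S1 : 2 * (t * (2 * B + 1)) * D1 + 2 * (t * (2 * B + 1)) * D2 + 2 * (t * (2 * B + 1)) * D3 <= t * K * D).
    { assert (0 < t * K) by (apply Rmult_lt_0_compat; auto). unfold D.
      replace (2 * (t * (2 * B + 1))) with (t * K) by (unfold K; ring). lra. }
    split.
    - replace (dotC (pev c' z) (pev e' z) (d1 z) (d2 z) (d3 z)) with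
        (dotC (pev c z) (pev e z) (d1 z) (d2 z) (d3 z) + (th1 (pev c' z) (pev e' z) - th1 (pev c z) (pev e z)) * d1 z
         + (th2 (pev c' z) (pev e' z) - th2 (pev c z) (pev e z)) * d2 z + (th3 (pev c' z) (pev e' z) - th3 (pev c z)
             (pev e z)) * d3 z)%C by (unfold dotC; ring).
      eapply Rle_trans; [apply Cmod_triangle|]. eapply Rle_trans; [apply Rplus_le_compat_r, Cmod_triangle|].
      eapply Rle_trans; [apply Rplus_le_compat_r, Rplus_le_compat_r, Cmod_triangle|].
      rewrite !Cmod_mult, !Cmod_R. lra.
    - apply Rabs_le_between in H2. apply Rabs_le_between in X4. unfold K in tl2. apply Rabs_le. lra. }
  destruct (perturb_generic S0 c e t G t0) as (c' & e' & W & H').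
  exists c', e'. split; auto. apply Main; intros z; apply H'.
Qed.

Lemma continuous_between (f : R2 -> R) z a b : continuous f z -> a < f z < b -> exists e, 0 < e /\ forall w,
  Cmod (w - z) < e -> a < f w < b.
Proof.
  intros Hf H. assert (E : 0 < Rmin (f z - a) (b - f z)) by (apply Rmin_pos; lra).
  destruct (proj1 (continuous_R2 f z) Hf _ E) as (d & d0 & Hd). exists d; split; auto.
  intros w Hw. specialize (Hd w Hw). apply Rabs_def2 in Hd.
  pose proof (Rmin_l (f z - a) (b - f z)). pose proof (Rmin_r (f z - a) (b - f z)). lra.
Qed.

Lemma continuous_Cmod_pair (f g : R2 -> R) z : continuous f z -> continuous g z -> continuous (fun w => Cmod (f w,
  g w)) z.
Proof. intros. unfold Cmod; simpl.
apply continuous_sqrt_fun, continuous_add; apply continuous_mul; auto; apply continuous_mul; auto;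
  apply continuous_cst. Qed.

Lemma cont_dotC c e (d1 d2 d3 : R2 -> R) z : continuous d1 z -> continuous d2 z -> continuous d3 z ->
  continuous (fun w : R2 => Cmod (dotC (pev c w) (pev e w) (d1 w) (d2 w) (d3 w))) z.
Proof.
  intros H1 H2 H3.
  destruct (cont_pev (psub (pmul c c) (pmul e e)) z) as [A1 B1].
  destruct (cont_pev (pscal Ci (padd (pmul c c) (pmul e e))) z) as [A2 B2].
  destruct (cont_pev (pscal 2%C (pmul c e)) z) as [A3 B3].
  apply (continuous_ext (fun w : R2 => Cmod (
    fst (pev (psub (pmul c c) (pmul e e)) w) * d1 w + fst (pev (pscal Ci (padd (pmul c c) (pmul e e))) w) * d2 w +
      fst (pev (pscal 2%C (pmul c e)) w) * d3 w,
    snd (pev (psub (pmul c c) (pmul e e)) w) * d1 w + snd (pev (pscal Ci (padd (pmul c c) (pmul e e))) w) * d2 w +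
      snd (pev (pscal 2%C (pmul c e)) w) * d3 w))).
  - intros w. unfold dotC, th1, th2, th3. f_equal.
    replace (pev c w * pev c w - pev e w * pev e w)%C with (pev (psub (pmul c c) (pmul e e)) w) by (rewrite pev_psub,
      !pev_pmul; ring).
    replace (Ci * (pev c w * pev c w + pev e w * pev e w))%C with (pev (pscal Ci (padd (pmul c c) (pmul e e))) w) by
      (rewrite pev_pscal, pev_padd, !pev_pmul; ring).
    replace (2 * pev c w * pev e w)%C with (pev (pscal 2%C (pmul c e)) w) by (rewrite pev_pscal, !pev_pmul; ring).
    apply injective_projections; simpl; ring.
  - apply continuous_Cmod_pair; cont.
Qed.

(** One oscillation with prescribed direction field and amplitude [m]. The polynomials and the
    annulus are fixed before the frequency, so [N] remains free; the length gained is governed by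
    the lower bound [kap] of the amplitude. *)
Lemma push (S0 : state) (d1 d2 d3 m : R2 -> R) r eta kap : good S0 -> 0 <= r < 1 -> 0 < eta -> 0 < kap ->
  (forall z, Cmod z = 1 -> continuous d1 z /\ continuous d2 z /\ continuous d3 z /\ continuous m z /\ kap <= m z) ->
  exists c e rho N0, r <= rho < 1 /\ 0 < rho /\
    (forall z, rho <= Cmod z <= 1 -> Cmod (dotC (pev c z) (pev e z) (d1 z) (d2 z) (d3 z)) <= eta /\
      Rabs (sq2 (pev c z) (pev e z) - m z) <= eta) /\
    forall N, (N0 <= N)%nat -> exists S1, good S1 /\ near rho eta S0 S1 /\
      (forall z, Cmod z <= 1 -> dist3 (surf S1 z) (vadd (surf S0 z) (rot (z ^ (S (2 * N)))%C (pev c z) (pev e z))) <=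
        eta) /\
      (forall z, Cmod z <= rho -> (1 - eta) * lam S0 z <= lam S1 z) /\
      exists R', rho < R' < 1 /\ crossing (lam S1) rho R' (kap - eta).
Proof.
  intros G Hr He Hk Hc.
  set (t := Rmin (eta / 2) (kap / 2)).
  assert (t0 : 0 < t) by (apply Rmin_pos; lra). assert (t1 : t <= eta / 2) by apply Rmin_l.
  assert (t2 : t <= kap / 2) by apply Rmin_r.
  destruct (spin_generic S0 d1 d2 d3 m (t / 2) G) as (c & e & W & H); [|lra|].
  { intros z Hz. destruct (Hc z Hz) as (A & B & D & E & F). repeat split; auto. lra. }
  destruct (circle_nbhd (fun z => Cmod (dotC (pev c z) (pev e z) (d1 z) (d2 z) (d3 z)) <= t /\
    Rabs (sq2 (pev c z) (pev e z) - m z) <= t /\ kap - t <= sq2 (pev c z) (pev e z))) as (r1 & Hr1 & Hz1).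
  { intros z Hz. destruct (H z Hz) as [A B]. destruct (Hc z Hz) as (c1 & c2 & c3 & cm & km).
    apply Rabs_le_between in B.
    destruct (continuous_between _ z (-1) t (cont_dotC c e d1 d2 d3 z c1 c2 c3)) as (e1 & e10 & E1).
    { pose proof (Cmod_ge_0 (dotC (pev c z) (pev e z) (d1 z) (d2 z) (d3 z))). lra. }
    destruct (continuous_between (fun z => sq2 (pev c z) (pev e z) - m z) z (- t) t) as (e2 & e20 & E2).
    { apply continuous_sub; auto. apply cont_sq2. } { lra. }
    destruct (continuous_between (fun z => sq2 (pev c z) (pev e z)) z (kap - t) (sq2 (pev c z) (pev e z) + 1)) as (e3
      & e30 & E3).
    { apply cont_sq2. } { lra. }
    exists (Rmin e1 (Rmin e2 e3)). split; [repeat apply Rmin_pos; auto|].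
    pose proof (Rmin_l e1 (Rmin e2 e3)). pose proof (Rmin_r e1 (Rmin e2 e3)). pose proof (Rmin_l e2 e3).
    pose proof (Rmin_r e2 e3).
    intros w Hw. specialize (E1 w ltac:(lra)). specialize (E2 w ltac:(lra)). specialize (E3 w ltac:(lra)).
    repeat split; try lra. apply Rabs_le. lra. }
  set (rho := Rmax r r1).
  assert (Hrho : r <= rho < 1) by (split; [apply Rmax_l|apply Rmax_lub_lt; lra]).
  assert (Hrho1 : r1 <= rho) by apply Rmax_r.
  destruct (step_good S0 c e G W) as [N1 H1].
  destruct (step_close_near S0 c e rho eta ltac:(lra) He) as [N2 H2].
  destruct (step_lam S0 c e rho eta G ltac:(lra) He) as [N3 H3].
  destruct (step_gain S0 c e rho (kap - t) (eta / 2)) as [N4 H4]; try lra.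
  { intros z Hz. apply Hz1. lra. }
  exists c, e, rho, (N1 + N2 + N3 + N4)%nat. split; [auto|split; [lra|split]].
  - intros z Hz. destruct (Hz1 z ltac:(lra)) as (A & B & _). split; lra.
  - intros N HN. exists (step S0 c e N). destruct (H2 N ltac:(lia)) as [A B].
    split; [apply H1; lia|]. split; [auto|]. split; [auto|]. split; [apply H3; lia|].
    destruct (H4 N ltac:(lia)) as (R' & HR & Cr). exists R'; split; auto.
    eapply crossing_mono; [| | |apply Cr]; lra.
Qed.

(** * Increasing the intrinsic diameter by a uniformly small deformation *)

Lemma norm3_sqr_add a b : norm3 (vadd a b) * norm3 (vadd a b) = norm3 a * norm3 a + 2 * dot3 b a + norm3 b * norm3 b.
Proof. rewrite !norm3_sqr. vunf. ring. Qed.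

Lemma near_weaken r e e' S S' : e <= e' -> near r e S S' -> near r e' S S'.
Proof. intros H (A & B & D). repeat split; lra. Qed.

Lemma near_radius r r' e S S' : 0 <= r' <= r -> near r e S S' -> near r' e S S'.
Proof. intros. apply (near_mono r e); auto; lra. Qed.

Lemma rot_size N z c e m eta : Cmod z <= 1 -> Rabs (sq2 c e - m) <= eta -> norm3 (rot (z ^ N)%C c e) <= m + eta.
Proof.
  intros Hz H. rewrite norm3_rot, Cmod_pow. apply Rabs_le_between in H.
  pose proof (pow_01 (Cmod z) N (conj (Cmod_ge_0 z) Hz)). pose proof (sq2_pos c e). nra.
Qed.

Lemma rot_dot N z c e d1 d2 d3 eta : Cmod z <= 1 -> Cmod (dotC c e d1 d2 d3) <= eta ->
  Rabs (dot3 (rot (z ^ N)%C c e) (mk3 d1 d2 d3)) <= eta.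
Proof.
  intros Hz H. eapply Rle_trans; [apply dot_rot|]. rewrite Cmod_pow.
  change (x1 (mk3 d1 d2 d3)) with d1. change (x2 (mk3 d1 d2 d3)) with d2. change (x3 (mk3 d1 d2 d3)) with d3.
  pose proof (pow_01 (Cmod z) N (conj (Cmod_ge_0 z) Hz)). pose proof (Cmod_ge_0 (dotC c e d1 d2 d3)). nra.
Qed.

Section Lengthen.
Variables (S0 : state) (r mu eta1 : R) (n : nat).
Hypotheses (G0 : good S0) (Hr : 0 <= r < 1) (Hmu : 0 < mu <= 1) (Heta1 : 0 < eta1).
Hypothesis Hn : 2 * INR n * (mu * mu) <= 1.

(* Each step moves almost orthogonally to the displacement made so far: squared displacements add up like [j mu^2],
   lengths like [j mu]. *)
Definition lengthened (j : nat) (S1 : state) (R1 : R) : Prop :=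
  good S1 /\ r < R1 < 1 /\ near r (INR j * eta1) S0 S1 /\
  (forall z, Cmod z <= 1 -> dist3 (surf S1 z) (surf S0 z) * dist3 (surf S1 z) (surf S0 z) <= 2 * INR j * (mu * mu)) /\
  (forall z, Cmod z <= r -> (1 - INR j * eta1) * lam S0 z <= lam S1 z) /\
  crossing (lam S1) r R1 (INR j * mu / 2).

Lemma lengthen_step j S1 R1 : (j < n)%nat -> lengthened j S1 R1 -> exists S2 R2, lengthened (S j) S2 R2.
Proof.
  intros Hj (G & HR & Nr & D & L & Cr).
  assert (Hj1 : INR (S j) <= INR n) by (apply le_INR; lia). rewrite S_INR in Hj1.
  pose proof (pos_INR j) as j0.
  (* In [e] below, [mu * mu / 16] absorbs the error terms of Pythagoras' theorem, and [mu / K] keeps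
     the length lost on the earlier annuli and in the new one below [mu / 2]. *)
  set (K := 4 * (1 + INR n * mu)).
  assert (K0 : 0 < K) by (unfold K; nra).
  set (e := Rmin eta1 (Rmin (mu * mu / 16) (mu / K))).
  assert (e0 : 0 < e). { unfold e. repeat apply Rmin_pos; try lra; [nra|apply Rdiv_lt_0_compat; lra]. }
  assert (e1 : e <= eta1) by apply Rmin_l.
  assert (e2 : e <= mu * mu / 16) by (eapply Rle_trans; [apply Rmin_r|apply Rmin_l]).
  assert (e3 : e * K <= mu).
  { apply Rle_trans with (mu / K * K); [|right; field; lra]. apply Rmult_le_compat_r; [lra|].
    eapply Rle_trans; [apply Rmin_r|apply Rmin_r]. }
  set (d := fun z => vsub (surf S1 z) (surf S0 z)).
  destruct (push S1 (fun z => x1 (d z)) (fun z => x2 (d z)) (fun z => x3 (d z)) (fun _ => mu) R1 e mu G)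
    as (c & f & rho & N & Hrho & rho0 & Hcf & Hst); try lra.
  { intros z _. unfold d, vsub, mk3. destruct (cont_surf S1 z) as (A1 & A2 & A3).
    destruct (cont_surf S0 z) as (B1 & B2 & B3).
    split; [|split; [|split; [|split]]]; try apply continuous_sub; auto; [apply continuous_cst|lra]. }
  destruct (Hst N (le_n _)) as (S2 & G2 & Nr2 & P2 & L2 & R2 & HR2 & Cr2).
  exists S2, R2. split; [auto|]. split; [lra|]. split; [|split; [|split]].
  - rewrite S_INR. apply near_weaken with (INR j * eta1 + e); [lra|].
    apply near_trans with S1; [lra|auto|]. apply near_radius with rho; auto; lra.
  - intros z Hz. specialize (D z Hz). rewrite S_INR.
    set (a := dist3 (surf S1 z) (surf S0 z)) in *.
    assert (a0 : 0 <= a) by apply dist3_pos.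
    assert (a1 : a <= 1) by nra.
    assert (mm : mu * mu <= 1) by nra. assert (em : e <= 1) by lra.
    assert (b0 := dist3_pos (surf S2 z) (surf S0 z)).
    destruct (Rle_dec (Cmod z) rho) as [Z|Z].
    + pose proof (near_surf rho e S1 S2 z Nr2 Z) as Q.
      pose proof (dist3_triangle (surf S2 z) (surf S1 z) (surf S0 z)) as T. fold a in T.
      assert (dist3 (surf S2 z) (surf S0 z) * dist3 (surf S2 z) (surf S0 z) <= (a + 3 * e) * (a + 3 * e)) by (apply
        Rmult_le_compat; lra).
      assert (a * e <= 1 * e) by (apply Rmult_le_compat_r; lra).
      assert (e * e <= 1 * e) by (apply Rmult_le_compat_r; lra). lra.
    + destruct (Hcf z ltac:(lra)) as [O M].
      set (v := rot (z ^ S (2 * N))%C (pev c z) (pev f z)) in *.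
      pose proof (rot_size (S (2 * N)) z _ _ _ _ Hz M) as V. fold v in V.
      pose proof (rot_dot (S (2 * N)) z _ _ _ _ _ _ Hz O) as W. fold v in W.
      replace (mk3 (x1 (d z)) (x2 (d z)) (x3 (d z))) with (d z) in W by (apply R3_ext; reflexivity).
      apply Rabs_le_between in W. pose proof (norm3_pos v) as v0.
      pose proof (norm3_sqr_add (d z) v) as Q.
      assert (Ea : norm3 (d z) = a) by reflexivity. rewrite Ea in Q.
      set (A := norm3 (vadd (d z) v)) in *.
      assert (A0 : 0 <= A) by apply norm3_pos.
      assert (vm : norm3 v * norm3 v <= (mu + e) * (mu + e)) by nra.
      assert (me : mu * e <= 1 * e) by (apply Rmult_le_compat_r; lra).
      assert (ee : e * e <= 1 * e) by (apply Rmult_le_compat_r; lra).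
      assert (A1 : A * A <= a * a + mu * mu + 5 * e) by lra.
      assert (A3 : A <= 2) by nra.
      assert (T : dist3 (surf S2 z) (surf S0 z) <= A + e).
      { specialize (P2 z Hz). fold v in P2.
        pose proof (dist3_triangle (surf S2 z) (vadd (surf S1 z) v) (surf S0 z)) as T.
        replace (dist3 (vadd (surf S1 z) v) (surf S0 z)) with A in T; [lra|].
        unfold A. rewrite dist3_norm. f_equal. unfold d. apply R3_ext; vunf; ring. }
      assert (dist3 (surf S2 z) (surf S0 z) * dist3 (surf S2 z) (surf S0 z) <= (A + e) * (A + e)) by (apply
        Rmult_le_compat; lra).
      assert (A * e <= 2 * e) by (apply Rmult_le_compat_r; lra).
      assert (e * e <= 1 * e) by (apply Rmult_le_compat_r; lra). lra.
  - intros z Hz. rewrite S_INR. specialize (L z Hz). specialize (L2 z ltac:(lra)).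
    pose proof (sq2_pos (pev (sa S0) z) (pev (sb S0) z)) as l0. fold (lam S0 z) in l0.
    assert ((1 - e) * ((1 - INR j * eta1) * lam S0 z) <= (1 - e) * lam S1 z).
    { apply Rmult_le_compat_l; [nra|auto]. }
    assert (0 <= e * (INR j * eta1) * lam S0 z) by (apply Rmult_le_pos; [apply Rmult_le_pos; [lra|nra]|auto]).
    assert (e * lam S0 z <= eta1 * lam S0 z) by (apply Rmult_le_compat_r; auto). nra.
  - rewrite S_INR.
    apply crossing_mono with (r := r) (R := R2) (L := (1 - e) * (INR j * mu / 2) + (mu - e)); try lra.
    + unfold K in e3. assert (e * (INR j * mu) <= e * (INR n * mu)) by (apply Rmult_le_compat_l; nra). nra.
    + apply crossing_concat with R1; try lra; [apply lam_metric| |].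
      * apply crossing_scale with (lam S1); try lra; try apply lam_metric; auto; [nra|].
        intros z Hz _. apply L2. lra.
      * eapply crossing_mono; [| | |apply Cr2]; lra.
Qed.

Lemma lengthen_iter j : (j <= n)%nat -> exists S1 R1, lengthened j S1 R1.
Proof.
  induction j; intros Hj.
  - exists S0, ((r + 1) / 2). split; [auto|]. split; [lra|]. split; [|split; [|split]].
    + simpl. rewrite Rmult_0_l. apply near_refl.
    + intros. rewrite dist3_refl. simpl. lra.
    + intros. simpl. lra.
    + intros g a b Hg Hab Hd _ _. replace (INR 0 * mu / 2) with 0 by (simpl; field). apply length_pos; auto.
      apply lam_metric.
  - destruct IHj as (S1 & R1 & H); [lia|]. apply (lengthen_step j S1 R1); auto.
Qed.
End Lengthen.

Lemma lengthen (S0 : state) r eta L : good S0 -> 0 <= r < 1 -> 0 < eta -> 0 < L ->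
  exists S1 R1, good S1 /\ r < R1 < 1 /\ near r eta S0 S1 /\
    (forall z, Cmod z <= 1 -> dist3 (surf S1 z) (surf S0 z) <= eta) /\
    (forall z, Cmod z <= r -> (1 - eta) * lam S0 z <= lam S1 z) /\
    crossing (lam S1) r R1 L.
Proof.
  intros G Hr He HL.
  set (e := Rmin 1 eta). assert (e0 : 0 < e) by (apply Rmin_pos; lra).
  assert (e1 : e <= 1) by apply Rmin_l. assert (e2 : e <= eta) by apply Rmin_r.
  destruct (archimed_cor1 (Rmin (1 / (2 * L)) (e * e / (8 * (L * L))))) as (n & Hn & n0).
  { apply Rmin_pos; apply Rdiv_lt_0_compat; nra. }
  assert (p : 0 < INR n) by (apply lt_0_INR; auto).
  (* Then [n] steps yield the length [n mu / 2 = L], while the squared displacement is at most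
     [2 n mu^2 = 8 L^2 / n]. *)
  set (mu := 2 * L * / INR n).
  assert (i0 : 0 < / INR n) by (apply Rinv_0_lt_compat; auto).
  assert (Hmu : 0 < mu <= 1).
  { unfold mu. split; [nra|]. apply Rle_trans with (2 * L * (1 / (2 * L))); [|right; field; lra].
    apply Rmult_le_compat_l; [lra|]. left. eapply Rlt_le_trans; [apply Hn|apply Rmin_l]. }
  assert (Hq : 2 * INR n * (mu * mu) <= e * e).
  { unfold mu. replace (2 * INR n * (2 * L * / INR n * (2 * L * / INR n))) with (8 * (L * L) * / INR n) by (field;
      lra).
    apply Rle_trans with (8 * (L * L) * (e * e / (8 * (L * L)))); [|right; field; nra].
    apply Rmult_le_compat_l; [nra|]. left. eapply Rlt_le_trans; [apply Hn|apply Rmin_r]. }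
  destruct (lengthen_iter S0 r mu (eta / INR n) n G Hr Hmu) with (j := n) as (S1 & R1 & G1 & HR & Nr & D & Lm & Cr);
    auto.
  { apply Rdiv_lt_0_compat; auto. } { nra. }
  replace (INR n * (eta / INR n)) with eta in * by (field; lra).
  replace (INR n * mu / 2) with L in Cr by (unfold mu; field; lra).
  exists S1, R1. split; [auto|split; [auto|split; [auto|split; [|split; auto]]]].
  intros z Hz. specialize (D z Hz). pose proof (dist3_pos (surf S1 z) (surf S0 z)). nra.
Qed.

(** * Second order expansions in space *)

Definition C1_on (U : R3 -> Prop) (f : R3 -> R) : Prop :=
  forall x, U x -> forall e, In e dirs3 -> ex_derive (fun t => f (vadd x (vscal t e))) 0 /\ continuous (pd e f) x.

Lemma Ck_C1 n (U : R3 -> Prop) f : Ck dirs3 (S (S n)) U f ->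
  C1_on U f /\ forall e, In e dirs3 -> Ck dirs3 (S n) U (pd e f).
Proof.
  intros [_ H]. pose proof (proj1 (Forall_forall _ _) H) as H'. clear H.
  split; [|intros e He; apply H'; auto].
  intros x Ux e He. destruct (H' e He) as [A B]. split; [apply A, Ux|]. destruct B as [B _]. apply B, Ux.
Qed.

(* One coordinate at a time, by the mean value theorem. *)
Lemma axis_increment (U : R3 -> Prop) f e x (h L eps : R) : C1_on U f -> In e dirs3 ->
  (forall s, Rabs s <= Rabs h -> U (vadd x (vscal s e)) /\ Rabs (pd e f (vadd x (vscal s e)) - L) <= eps) ->
  Rabs (f (vadd x (vscal h e)) - f x - h * L) <= eps * Rabs h.
Proof.
  intros HU He H.
  set (g := fun s => f (vadd x (vscal s e))).
  assert (D : forall s, Rabs s <= Rabs h -> is_derive g s (pd e f (vadd x (vscal s e)))).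
  { intros s Hs. destruct (H s Hs) as [Us _]. destruct (HU _ Us e He) as [Hd _].
    apply Derive_correct in Hd.
    apply (is_derive_ext (fun y => (fun t => f (vadd (vadd x (vscal s e)) (vscal t e))) (y - s))).
    { intros y. unfold g. f_equal. apply R3_ext; vunf; ring. }
    replace (pd e f (vadd x (vscal s e))) with (1 * pd e f (vadd x (vscal s e))) by ring.
    apply (is_derive_comp (V := R_NormedModule) (fun t => f (vadd (vadd x (vscal s e)) (vscal t e))) (fun y => y -
      s)).
    - replace (s - s) with 0 by ring. exact Hd.
    - auto_derive; auto. }
  destruct (MVT_gen g 0 h (fun s => pd e f (vadd x (vscal s e)))) as (c & Hc & Ec).
  - intros s Hs. apply D. unfold Rmin, Rmax in Hs. unfold Rabs.
    repeat destruct (Rle_dec _ _); repeat destruct (Rcase_abs _); lra.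
  - intros s Hs. apply continuity_pt_filterlim. apply (ex_derive_continuous (K := R_AbsRing) (V := R_NormedModule)).
    eexists. apply D. unfold Rmin, Rmax in Hs. unfold Rabs.
    repeat destruct (Rle_dec _ _); repeat destruct (Rcase_abs _); lra.
  - assert (Hc' : Rabs c <= Rabs h).
    { unfold Rmin, Rmax in Hc. unfold Rabs. repeat destruct (Rle_dec _ _); repeat destruct (Rcase_abs _); lra. }
    destruct (H c Hc') as [_ B]. unfold g in Ec.
    replace (vadd x (vscal 0 e)) with x in Ec by (apply R3_ext; vunf; ring).
    rewrite Ec. replace (pd e f (vadd x (vscal c e)) * (h - 0) - h * L) with ((pd e f (vadd x (vscal c e)) - L) * h)
      by ring.
    rewrite Rabs_mult. apply Rmult_le_compat_r; auto. apply Rabs_pos.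
Qed.

Lemma C1_differentiable (U : R3 -> Prop) f x : open U -> C1_on U f -> U x -> forall eps, 0 < eps -> exists d, 0 < d /\
  forall v, norm3 v < d -> Rabs (f (vadd x v) - f x - dot3 v (grad3 f x)) <= eps * norm3 v.
Proof.
  intros HU HC Ux eps He. destruct (proj1 (open3_dist U) HU x Ux) as (d0 & d00 & Hd0).
  assert (E3 : 0 < eps / 3) by lra.
  assert (Hc : forall e, In e dirs3 -> exists d, 0 < d /\ forall w, dist3 x w < d ->
    Rabs (pd e f w - pd e f x) < eps / 3).
  { intros e Hin. apply (proj1 (continuous_R3 (pd e f) x)); auto. apply HC; auto. }
  destruct (Hc e3_1) as (d1 & d10 & H1); [simpl; auto|].
  destruct (Hc e3_2) as (d2 & d20 & H2); [simpl; auto|].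
  destruct (Hc e3_3) as (d3 & d30 & H3); [simpl; auto|].
  set (d := Rmin (Rmin d0 d1) (Rmin d2 d3)).
  assert (dd : d <= d0 /\ d <= d1 /\ d <= d2 /\ d <= d3).
  { unfold d. pose proof (Rmin_l (Rmin d0 d1) (Rmin d2 d3)). pose proof (Rmin_r (Rmin d0 d1) (Rmin d2 d3)).
    pose proof (Rmin_l d0 d1). pose proof (Rmin_r d0 d1). pose proof (Rmin_l d2 d3). pose proof (Rmin_r d2 d3). lra. }
  exists d. split; [unfold d; repeat apply Rmin_pos; auto|].
  intros v Hv. pose proof (norm3_coord v) as (V1 & V2 & V3).
  assert (W : forall w, Rabs (x1 w) <= Rabs (x1 v) -> Rabs (x2 w) <= Rabs (x2 v) -> Rabs (x3 w) <= Rabs (x3 v) ->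
    dist3 x (vadd x w) < d).
  { intros w A B D. rewrite dist3_sym, dist3_add. apply Rle_lt_trans with (norm3 v); auto.
    apply norm3_le_sqr; [apply norm3_pos|]. rewrite norm3_sqr. unfold dot3.
    assert (Q : forall a b, Rabs a <= Rabs b -> a * a <= b * b).
    { intros a b Hab. pose proof (Rsqr_le_abs_1 _ _ Hab). unfold Rsqr in *. auto. }
    pose proof (Q _ _ A). pose proof (Q _ _ B). pose proof (Q _ _ D). lra. }
  set (y1 := vadd x (vscal (x1 v) e3_1)). set (y2 := vadd y1 (vscal (x2 v) e3_2)).
  assert (I1 : Rabs (f (vadd x (vscal (x1 v) e3_1)) - f x - x1 v * pd e3_1 f x) <= eps / 3 * Rabs (x1 v)).
  { apply (axis_increment U); auto; [simpl; auto|]. intros s Hs.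
    assert (Q : dist3 x (vadd x (vscal s e3_1)) < d).
    { apply W; unfold e3_1; vunf; rewrite ?Rmult_1_r, ?Rmult_0_r, ?Rabs_R0; auto; apply Rabs_pos. }
    split; [apply Hd0; lra|left; apply H1; lra]. }
  assert (I2 : Rabs (f (vadd y1 (vscal (x2 v) e3_2)) - f y1 - x2 v * pd e3_2 f x) <= eps / 3 * Rabs (x2 v)).
  { apply (axis_increment U); auto; [simpl; auto|]. intros s Hs.
    assert (Q : dist3 x (vadd y1 (vscal s e3_2)) < d).
    { replace (vadd y1 (vscal s e3_2)) with (vadd x (mk3 (x1 v) s 0)) by (unfold y1, e3_1, e3_2; apply R3_ext; vunf;
        ring).
      apply W; vunf; rewrite ?Rabs_R0; auto; try lra; apply Rabs_pos. }
    split; [apply Hd0; lra|left; apply H2; lra]. }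
  assert (I3 : Rabs (f (vadd y2 (vscal (x3 v) e3_3)) - f y2 - x3 v * pd e3_3 f x) <= eps / 3 * Rabs (x3 v)).
  { apply (axis_increment U); auto; [simpl; auto|]. intros s Hs.
    assert (Q : dist3 x (vadd y2 (vscal s e3_3)) < d).
    { replace (vadd y2 (vscal s e3_3)) with (vadd x (mk3 (x1 v) (x2 v) s)) by (unfold y2, y1, e3_1, e3_2, e3_3;
        apply R3_ext; vunf; ring).
      apply W; vunf; auto; lra. }
    split; [apply Hd0; lra|left; apply H3; lra]. }
  replace (vadd x v) with (vadd y2 (vscal (x3 v) e3_3)) by (unfold y2, y1, e3_1, e3_2, e3_3; apply R3_ext; vunf;
    ring).
  fold y1 in I1. fold y2 in I2.
  replace (dot3 v (grad3 f x)) with (x1 v * pd e3_1 f x + x2 v * pd e3_2 f x + x3 v * pd e3_3 f x) by reflexivity.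
  apply Rabs_le_between in I1. apply Rabs_le_between in I2. apply Rabs_le_between in I3.
  assert (eps / 3 * Rabs (x1 v) <= eps / 3 * norm3 v) by (apply Rmult_le_compat_l; lra).
  assert (eps / 3 * Rabs (x2 v) <= eps / 3 * norm3 v) by (apply Rmult_le_compat_l; lra).
  assert (eps / 3 * Rabs (x3 v) <= eps / 3 * norm3 v) by (apply Rmult_le_compat_l; lra).
  apply Rabs_le. lra.
Qed.

Lemma C1_line (U : R3 -> Prop) f x v t : open U -> C1_on U f -> U (vadd x (vscal t v)) ->
  is_derive (fun s => f (vadd x (vscal s v))) t (dot3 v (grad3 f (vadd x (vscal t v)))).
Proof.
  intros HU HC Ux. apply is_derive_Reals. intros eps He.
  pose proof (norm3_pos v) as v0.
  assert (E0 : 0 < eps / (norm3 v + 1) / 2) by (repeat apply Rdiv_lt_0_compat; lra).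
  destruct (C1_differentiable U f _ HU HC Ux _ E0) as (d & d0 & Hd).
  assert (P : 0 < d / (norm3 v + 1)) by (apply Rdiv_lt_0_compat; lra).
  exists (mkposreal _ P). intros h h0 Hh. simpl in Hh.
  assert (Hn : norm3 (vscal h v) < d).
  { rewrite norm3_scal. apply (Rmult_lt_compat_r (norm3 v + 1)) in Hh; [|lra]. unfold Rdiv in Hh.
    rewrite Rmult_assoc, Rinv_l, Rmult_1_r in Hh by lra. pose proof (Rabs_pos h). nra. }
  specialize (Hd _ Hn).
  replace (vadd (vadd x (vscal t v)) (vscal h v)) with (vadd x (vscal (t + h) v)) in Hd by (apply R3_ext; vunf; ring).
  set (X := vadd x (vscal t v)) in *. set (g := grad3 f X) in *.
  replace (dot3 (vscal h v) g) with (h * dot3 v g) in Hd by (vunf; ring).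
  rewrite norm3_scal in Hd.
  replace ((f (vadd x (vscal (t + h) v)) - f X) / h - dot3 v g) with ((f (vadd x (vscal (t + h) v)) - f X - h * dot3
    v g) / h) by (field; auto).
  unfold Rdiv at 1. rewrite Rabs_mult, Rabs_inv. pose proof (Rabs_pos_lt h h0).
  apply (Rmult_lt_reg_r (Rabs h)); auto. rewrite Rmult_assoc, Rinv_l, Rmult_1_r by lra.
  eapply Rle_lt_trans; [apply Hd|].
  replace (eps / (norm3 v + 1) / 2 * (Rabs h * norm3 v)) with (eps * Rabs h * (norm3 v / (norm3 v + 1) / 2)) by
    (field; lra).
  assert (norm3 v / (norm3 v + 1) / 2 < 1).
  { apply (Rmult_lt_reg_r (2 * (norm3 v + 1))); [lra|].
    replace (norm3 v / (norm3 v + 1) / 2 * (2 * (norm3 v + 1))) with (norm3 v) by (field; lra). lra. }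
  assert (0 < eps * Rabs h) by (apply Rmult_lt_0_compat; auto). nra.
Qed.

Lemma C2_line (U : R3 -> Prop) f x v t : open U -> (forall e, In e dirs3 -> C1_on U (pd e f)) ->
  U (vadd x (vscal t v)) ->
  is_derive (fun s => dot3 v (grad3 f (vadd x (vscal s v)))) t (hess3 f (vadd x (vscal t v)) v).
Proof.
  intros HU HC Ux.
  assert (D1 := C1_line U (pd e3_1 f) x v t HU (HC e3_1 ltac:(simpl; auto)) Ux).
  assert (D2 := C1_line U (pd e3_2 f) x v t HU (HC e3_2 ltac:(simpl; auto)) Ux).
  assert (D3 := C1_line U (pd e3_3 f) x v t HU (HC e3_3 ltac:(simpl; auto)) Ux).
  apply (is_derive_scal _ _ (x1 v)) in D1. apply (is_derive_scal _ _ (x2 v)) in D2.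
  apply (is_derive_scal _ _ (x3 v)) in D3.
  pose proof (is_derive_plus (V := R_NormedModule) _ _ _ _ _ (is_derive_plus (V := R_NormedModule) _ _ _ _ _ D1 D2)
    D3) as D.
  evar_last; [apply D|]. unfold hess3, dot3, grad3, plus; simpl. unfold mk3, x1, x2, x3; simpl. ring.
Qed.

Lemma taylor2_lower (phi dphi ddphi : R -> R) m :
  (forall t, 0 <= t <= 1 -> is_derive phi t (dphi t)) -> (forall t, 0 <= t <= 1 -> is_derive dphi t (ddphi t)) ->
  (forall t, 0 <= t <= 1 -> m <= ddphi t) -> phi 0 + dphi 0 + m / 2 <= phi 1.
Proof.
  intros H1 H2 Hm.
  assert (A : forall t, 0 <= t <= 1 -> dphi 0 + m * t <= dphi t).
  { intros t Ht. destruct (MVT_gen dphi 0 t ddphi) as (c & Hc & Ec).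
    - rewrite Rmin_left, Rmax_right by lra. intros; apply H2; lra.
    - rewrite Rmin_left, Rmax_right by lra. intros s Hs. apply continuity_pt_filterlim.
      apply (ex_derive_continuous (K := R_AbsRing) (V := R_NormedModule)). eexists. apply H2; lra.
    - rewrite Rmin_left, Rmax_right in Hc by lra. specialize (Hm c ltac:(lra)). nra. }
  set (g := fun t => phi t - (dphi 0 * t + m * (t * t) / 2)).
  assert (B : forall t, 0 <= t <= 1 -> is_derive g t (dphi t - (dphi 0 + m * t))).
  { intros t Ht. apply (is_derive_minus (V := R_NormedModule)); [apply H1; lra|]. auto_derive; auto. field. }
  destruct (MVT_gen g 0 1 (fun t => dphi t - (dphi 0 + m * t))) as (c & Hc & Ec).
  - rewrite Rmin_left, Rmax_right by lra. intros t Ht. apply B; lra.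
  - rewrite Rmin_left, Rmax_right by lra. intros t Ht. apply continuity_pt_filterlim.
    apply (ex_derive_continuous (K := R_AbsRing) (V := R_NormedModule)). eexists. apply B; lra.
  - rewrite Rmin_left, Rmax_right in Hc by lra. specialize (A c Hc). unfold g in Ec. nra.
Qed.

Lemma hess3_scal f x k v : hess3 f x (vscal k v) = k * k * hess3 f x v.
Proof. unfold hess3; cbv zeta. unfold vscal, mk3, x1, x2, x3; simpl. ring. Qed.

Lemma taylor3_lower (U : R3 -> Prop) f x v m : open U -> C1_on U f -> (forall e, In e dirs3 -> C1_on U (pd e f)) ->
  (forall t, 0 <= t <= 1 -> U (vadd x (vscal t v))) -> (forall t, 0 <= t <= 1 ->
    m <= hess3 f (vadd x (vscal t v)) v) ->
  f x + dot3 v (grad3 f x) + m / 2 <= f (vadd x v).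
Proof.
  intros HU H1 H2 Hs Hm.
  pose proof (taylor2_lower (fun t => f (vadd x (vscal t v))) (fun t => dot3 v (grad3 f (vadd x (vscal t v)))) (fun t
    => hess3 f (vadd x (vscal t v)) v) m) as T.
  cbv beta in T. replace (vadd x (vscal 0 v)) with x in T by (apply R3_ext; vunf; ring).
  replace (vadd x (vscal 1 v)) with (vadd x v) in T by (apply R3_ext; vunf; ring).
  apply T; auto; intros t Ht.
  - apply (C1_line U); auto. - apply (C2_line U); auto.
Qed.

Lemma taylor3_upper (U : R3 -> Prop) f x v m : open U -> C1_on U f -> (forall e, In e dirs3 -> C1_on U (pd e f)) ->
  (forall t, 0 <= t <= 1 -> U (vadd x (vscal t v))) -> (forall t, 0 <= t <= 1 ->
    hess3 f (vadd x (vscal t v)) v <= m) ->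
  f (vadd x v) <= f x + dot3 v (grad3 f x) + m / 2.
Proof.
  intros HU H1 H2 Hs Hm.
  pose proof (taylor2_lower (fun t => - f (vadd x (vscal t v))) (fun t => - dot3 v (grad3 f (vadd x (vscal t v))))
    (fun t => - hess3 f (vadd x (vscal t v)) v) (- m)) as T.
  cbv beta in T. replace (vadd x (vscal 0 v)) with x in T by (apply R3_ext; vunf; ring).
  replace (vadd x (vscal 1 v)) with (vadd x v) in T by (apply R3_ext; vunf; ring).
  cut (- f x + - dot3 v (grad3 f x) + - m / 2 <= - f (vadd x v)); [lra|].
  apply T; auto; intros t Ht.
  - apply (is_derive_opp (V := R_NormedModule)), (C1_line U); auto.
  - apply (is_derive_opp (V := R_NormedModule)), (C2_line U); auto.
  - specialize (Hm t Ht). lra.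
Qed.

(** * Geometry of strictly convex domains *)

Lemma compact_sphere : compact_set (fun v : R3 => norm3 v = 1).
Proof.
  apply compact_R3; [exists 1; intros; lra|]. apply open3_dist. intros x Hx.
  exists (Rabs (norm3 x - 1)). split; [apply Rabs_pos_lt; lra|]. intros y Hy E.
  assert (Rabs (norm3 x - norm3 y) <= dist3 x y); [|rewrite E in H; lra].
  rewrite dist3_norm. pose proof (norm3_triangle (vsub x y) y). pose proof (norm3_triangle (vsub y x) x).
  replace (vadd (vsub x y) y) with x in H by (apply R3_ext; vunf; ring).
  replace (vadd (vsub y x) x) with y in H0 by (apply R3_ext; vunf; ring).
  rewrite (norm3_sub_sym y x) in H0. apply Rabs_le; lra.
Qed.

Lemma open_ball3 p r : open (fun x => dist3 p x < r).
Proof.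
  apply open3_dist. intros x Hx. exists (r - dist3 p x). split; [lra|]. intros y Hy.
  pose proof (dist3_triangle p x y). lra.
Qed.

Lemma continuous_x1 {T : UniformSpace} (f : T -> R3) x : continuous f x -> continuous (fun y => x1 (f y)) x.
Proof. intros. apply (continuous_comp f x1); auto. apply continuous_R3. intros e He. exists e; split; auto.
intros w Hw.
  rewrite dist3_sym, dist3_norm in Hw. pose proof (norm3_coord (vsub w (f x))) as (A & _). vunf. lra. Qed.
Lemma continuous_x2 {T : UniformSpace} (f : T -> R3) x : continuous f x -> continuous (fun y => x2 (f y)) x.
Proof. intros. apply (continuous_comp f x2); auto. apply continuous_R3. intros e He. exists e; split; auto.
intros w Hw.
  rewrite dist3_sym, dist3_norm in Hw. pose proof (norm3_coord (vsub w (f x))) as (_ & A & _). vunf. lra. Qed.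
Lemma continuous_x3 {T : UniformSpace} (f : T -> R3) x : continuous f x -> continuous (fun y => x3 (f y)) x.
Proof. intros. apply (continuous_comp f x3); auto. apply continuous_R3. intros e He. exists e; split; auto.
intros w Hw.
  rewrite dist3_sym, dist3_norm in Hw. pose proof (norm3_coord (vsub w (f x))) as (_ & _ & A). vunf. lra. Qed.

Definition R3U : UniformSpace := prod_UniformSpace (prod_UniformSpace R_UniformSpace R_UniformSpace) R_UniformSpace.

(** Continuity jointly in base point and direction, as needed for a compactness argument over the
    unit sphere of directions. *)
Lemma hess_joint (f : R3 -> R) (p v : R3) : (forall e e', In e dirs3 -> In e' dirs3 ->
  continuous (pd e (pd e' f)) p) ->
  continuous (fun w : R3 * R3 => hess3 f (fst w) (snd w)) (p, v).
Proof.
  intros H. unfold hess3; cbv zeta.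
  assert (S : continuous (fun w : R3 * R3 => snd w) (p, v)) by apply (continuous_snd (U := R3U) (V := R3U)).
  assert (F : continuous (fun w : R3 * R3 => fst w) (p, v)) by apply (continuous_fst (U := R3U) (V := R3U)).
  assert (A1 := continuous_x1 _ _ S). assert (A2 := continuous_x2 _ _ S). assert (A3 := continuous_x3 _ _ S).
  assert (Q : forall e e', In e dirs3 -> In e' dirs3 -> continuous (fun w : R3 * R3 => pd e (pd e' f) (fst w)) (p,
    v)).
  { intros e e' He He'. apply (continuous_comp (fun w : R3 * R3 => fst w) (pd e (pd e' f))); [auto|apply H; auto]. }
  cont; apply Q; simpl; auto.
Qed.

Lemma dot_joint (f : R3 -> R) (p v : R3) : (forall e, In e dirs3 -> continuous (pd e f) p) ->
  continuous (fun w : R3 * R3 => dot3 (snd w) (grad3 f (fst w))) (p, v).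
Proof.
  intros H.
  assert (S : continuous (fun w : R3 * R3 => snd w) (p, v)) by apply (continuous_snd (U := R3U) (V := R3U)).
  assert (F : continuous (fun w : R3 * R3 => fst w) (p, v)) by apply (continuous_fst (U := R3U) (V := R3U)).
  assert (A1 := continuous_x1 _ _ S). assert (A2 := continuous_x2 _ _ S). assert (A3 := continuous_x3 _ _ S).
  assert (Q : forall e, In e dirs3 -> continuous (fun w : R3 * R3 => pd e f (fst w)) (p, v)).
  { intros e He. apply (continuous_comp (fun w : R3 * R3 => fst w) (pd e f)); [auto|apply H; auto]. }
  change (continuous (fun w : R3 * R3 => x1 (snd w) * pd e3_1 f (fst w) + x2 (snd w) * pd e3_2 f (fst w) + x3 (snd w)
    * pd e3_3 f (fst w)) (p, v)).
  cont; apply Q; simpl; auto.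
Qed.

Lemma joint_eps (F : R3 * R3 -> R) (p v : R3) eps : continuous F (p, v) -> 0 < eps ->
  exists d, 0 < d /\ forall y w, dist3 p y < d -> ball v d w -> Rabs (F (y, w) - F (p, v)) < eps.
Proof.
  intros H He. destruct (proj1 (filterlim_locally _ _) H (mkposreal _ He)) as [d Hd].
  exists d. split; [apply cond_pos|]. intros y w Hy Hw. apply (Hd (y, w)). split; auto. apply dist3_ball; auto.
Qed.

Lemma normalize3 w : 0 < norm3 w -> exists v, norm3 v = 1 /\ w = vscal (norm3 w) v.
Proof.
  intros H. exists (vscal (/ norm3 w) w). split.
  - rewrite norm3_scal, Rabs_pos_eq; [field; lra|left; apply Rinv_0_lt_compat; auto].
  - apply R3_ext; vunf; field; lra.
Qed.

(** Local control of a defining function with a single constant [e]. The points [q + w] range over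
    the ball of radius [2 * e]. The last clause is strict convexity in usable form: in directions
    nearly tangent to the level set, [rho] grows at least quadratically above its linear part. *)
Definition locdata (D : R3 -> Prop) (p : R3) (e : R) (rho : R3 -> R) (g : R3 -> R3) : Prop :=
  0 < e /\
  (forall x, dist3 p x < 2 * e -> (D x <-> rho x < 0)) /\
  (forall x, dist3 p x < 2 * e -> closure3 D x -> rho x <= 0) /\
  (forall q, dist3 p q < e -> e <= norm3 (g q) <= / e) /\
  (forall q w, dist3 p q < e -> norm3 w < e -> rho (vadd q w) <= rho q + dot3 w (g q) + / e * (norm3 w * norm3 w)) /\
  (forall q w, dist3 p q < e -> norm3 w < e -> rho q + dot3 w (g q) - / e * (norm3 w * norm3 w) <= rho (vadd q w)) /\
  (forall q w, dist3 p q < e -> norm3 w < e -> Rabs (dot3 w (g q)) <= e * norm3 w ->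
     rho q + dot3 w (g q) + e * (norm3 w * norm3 w) <= rho (vadd q w)).

Lemma closure_le (D : R3 -> Prop) rho x d : 0 < d -> continuous rho x -> (forall y, dist3 x y < d -> D y ->
  rho y < 0) ->
  closure3 D x -> rho x <= 0.
Proof.
  intros d0 Hc Hd Hx. apply Rnot_lt_le. intros L.
  destruct (proj1 (continuous_R3 rho x) Hc _ L) as (d' & d'0 & Hd').
  destruct (Hx (Rmin d d') ltac:(apply Rmin_pos; auto)) as (y & Dy & Hy).
  assert (Y1 : dist3 x y < d) by (eapply Rlt_le_trans; [apply Hy|apply Rmin_l]).
  assert (Y2 : dist3 x y < d') by (eapply Rlt_le_trans; [apply Hy|apply Rmin_r]).
  specialize (Hd y Y1 Dy). specialize (Hd' y Y2). apply Rabs_def2 in Hd'. lra.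
Qed.

(** The Hessian is positive at [p] on tangent vectors; by compactness of the unit sphere this
    persists at nearby points and for directions almost orthogonal to nearby gradients. Taylor's
    formula along segments then gives the inequalities. *)
Lemma local_data (D : R3 -> Prop) p : smooth_strictly_convex_boundary D -> boundary3 D p ->
  exists e rho g, locdata D p e rho g.
Proof.
  intros HS Hp. destruct (HS p Hp) as (r & r0 & rho & Hsm & HD & Hg & Hh).
  set (U := fun x => dist3 p x < r) in *.
  assert (OU : open U) by apply open_ball3.
  destruct (Ck_C1 1 U rho (Hsm 3%nat)) as [HC1 HCk].
  assert (HC2 : forall e, In e dirs3 -> C1_on U (pd e rho)) by (intros e He; apply (Ck_C1 0 U _ (HCk e He))).
  assert (Hc0 : forall x, U x -> continuous rho x) by (intros x Ux; apply (Hsm O x Ux)).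
  assert (Up : U p) by (unfold U; rewrite dist3_refl; auto).
  assert (Hcl : forall x, dist3 p x < r -> closure3 D x -> rho x <= 0).
  { intros x Hx Cx. apply (closure_le D rho x (r - dist3 p x)); auto; [lra|].
    intros y Hy Dy. apply HD; auto. pose proof (dist3_triangle p x y). lra. }
  assert (rp : rho p = 0).
  { destruct Hp as [Cp Np]. apply Rle_antisym; [apply Hcl; auto|].
    apply Rnot_lt_le. intros L. apply Np, HD; auto. }
  set (g := grad3 rho).
  assert (jh := fun v => hess_joint rho p v (fun e e' He He' => proj2 (HC2 e' He' p Up e He))).
  assert (jd := fun v => dot_joint rho p v (fun e He => proj2 (HC1 p Up e He))).
  destruct (compact_unif (fun v : R3 => norm3 v = 1) (fun v e => forall y q, dist3 p y < e -> dist3 p q < e ->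
    hess3 rho y v <= / e /\ - / e <= hess3 rho y v /\ (Rabs (dot3 v (g q)) <= e ->
      e <= hess3 rho y v)) compact_sphere) as (E & E0 & HE).
  { intros v d d' Hd H y q Hy Hq. destruct (H y q ltac:(lra) ltac:(lra)) as (A & B & F).
    assert (/ d <= / d') by (apply Rinv_le_contravar; lra). split; [lra|split; [lra|]].
    intros Q. specialize (F ltac:(lra)). lra. }
  { intros v Hv. set (h0 := hess3 rho p v). set (s0 := dot3 v (g p)).
    assert (HM : 0 < / (Rabs h0 + 1)) by (apply Rinv_0_lt_compat; pose proof (Rabs_pos h0); lra).
    assert (B1 : forall e h, 0 < e <= / (Rabs h0 + 1) -> Rabs (h - h0) < 1 -> h <= / e /\ - / e <= h).
    { intros e h He H. assert (Rabs h0 + 1 <= / e).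
      { rewrite <- (Rinv_inv (Rabs h0 + 1)). apply Rinv_le_contravar; lra. }
      apply Rabs_def2 in H. pose proof (Rle_abs h0). pose proof (Rle_abs (- h0)). rewrite Rabs_Ropp in H2. lra. }
    (* A unit vector tangent at [p] has positive Hessian nearby. A transversal one is so far from
       orthogonal to the nearby gradients that the premise of the last clause fails. *)
    destruct (Req_dec s0 0) as [Z|Z].
    - assert (h0p : 0 < h0).
      { apply Hh; auto. - intros E. rewrite E in Hv. change (mk3 0 0 0) with (vscal 0 v) in Hv || idtac.
          unfold norm3, dot3, mk3, x1, x2, x3 in Hv; simpl in Hv.
          replace (0 * 0 + 0 * 0 + 0 * 0) with 0 in Hv by ring. rewrite sqrt_0 in Hv. lra. }
      destruct (joint_eps _ p v (Rmin 1 (h0 / 2)) (jh v)) as (d & d0 & Hd); [apply Rmin_pos; lra|].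
      set (e := Rmin d (Rmin (h0 / 2) (/ (Rabs h0 + 1)))).
      assert (e1 : e <= d) by apply Rmin_l.
      assert (e2 : e <= h0 / 2) by (eapply Rle_trans; [apply Rmin_r|apply Rmin_l]).
      assert (e3 : e <= / (Rabs h0 + 1)) by (eapply Rle_trans; [apply Rmin_r|apply Rmin_r]).
      assert (e0 : 0 < e) by (unfold e; repeat apply Rmin_pos; lra).
      exists e. split; auto. intros w Bw Hw y q Hy Hq.
      assert (Bw' : ball v d w) by (eapply ball_le; [apply e1|auto]).
      specialize (Hd y w ltac:(lra) Bw'). cbn [fst snd] in Hd. fold h0 in Hd.
      pose proof (Rmin_l 1 (h0 / 2)). pose proof (Rmin_r 1 (h0 / 2)).
      destruct (B1 e (hess3 rho y w) ltac:(lra) ltac:(lra)) as [X Y].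
      repeat split; auto. intros _. apply Rabs_def2 in Hd. lra.
    - assert (sp : 0 < Rabs s0) by (apply Rabs_pos_lt; auto).
      destruct (joint_eps _ p v 1 (jh v)) as (d & d0 & Hd); [lra|].
      destruct (joint_eps _ p v (Rabs s0 / 2) (jd v)) as (d' & d'0 & Hd'); [lra|].
      set (e := Rmin (Rmin d d') (Rmin (Rabs s0 / 4) (/ (Rabs h0 + 1)))).
      assert (e1 : e <= d) by (eapply Rle_trans; [apply Rmin_l|apply Rmin_l]).
      assert (e1' : e <= d') by (eapply Rle_trans; [apply Rmin_l|apply Rmin_r]).
      assert (e2 : e <= Rabs s0 / 4) by (eapply Rle_trans; [apply Rmin_r|apply Rmin_l]).
      assert (e3 : e <= / (Rabs h0 + 1)) by (eapply Rle_trans; [apply Rmin_r|apply Rmin_r]).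
      assert (e0 : 0 < e) by (unfold e; repeat apply Rmin_pos; lra).
      exists e. split; auto. intros w Bw Hw y q Hy Hq.
      assert (Bw' : ball v d w) by (eapply ball_le; [apply e1|auto]).
      assert (Bw'' : ball v d' w) by (eapply ball_le; [apply e1'|auto]).
      specialize (Hd y w ltac:(lra) Bw'). cbn [fst snd] in Hd. fold h0 in Hd.
      specialize (Hd' q w ltac:(lra) Bw''). cbn [fst snd] in Hd'. fold s0 in Hd'.
      destruct (B1 e (hess3 rho y w) ltac:(lra) ltac:(lra)) as [X Y].
      assert (Hd2 : Rabs (dot3 w (g q) - s0) < Rabs s0 / 2) by exact Hd'.
      split; [auto|split; [auto|]]. intros Q. exfalso.
      pose proof (Rabs_triang (dot3 w (g q)) (- (dot3 w (g q) - s0))) as T. rewrite Rabs_Ropp in T.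
      replace (dot3 w (g q) + - (dot3 w (g q) - s0)) with s0 in T by ring. lra. }
  assert (gp : 0 < norm3 (g p)).
  { destruct (Rle_lt_or_eq_dec _ _ (norm3_pos (g p))) as [L|L]; auto.
    elim (Hg p Up). apply norm3_0. auto. }
  assert (Hgc : exists d, 0 < d /\ forall q, dist3 p q < d -> dist3 (g q) (g p) < norm3 (g p) / 2).
  { assert (G6 : 0 < norm3 (g p) / 6) by lra.
    destruct (proj1 (continuous_R3 _ _) (proj2 (HC1 p Up e3_1 ltac:(simpl; auto))) _ G6) as (d1 & d10 & H1).
    destruct (proj1 (continuous_R3 _ _) (proj2 (HC1 p Up e3_2 ltac:(simpl; auto))) _ G6) as (d2 & d20 & H2).
    destruct (proj1 (continuous_R3 _ _) (proj2 (HC1 p Up e3_3 ltac:(simpl; auto))) _ G6) as (d3 & d30 & H3).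
    exists (Rmin d1 (Rmin d2 d3)). split; [repeat apply Rmin_pos; auto|]. intros q Hq.
    assert (Q1 : dist3 p q < d1) by (eapply Rlt_le_trans; [apply Hq|apply Rmin_l]).
    assert (Q2 : dist3 p q < d2) by (eapply Rlt_le_trans; [apply Hq|eapply Rle_trans; [apply Rmin_r|apply Rmin_l]]).
    assert (Q3 : dist3 p q < d3) by (eapply Rlt_le_trans; [apply Hq|eapply Rle_trans; [apply Rmin_r|apply Rmin_r]]).
    specialize (H1 q Q1). specialize (H2 q Q2). specialize (H3 q Q3).
    rewrite dist3_norm.
    assert (T : norm3 (vsub (g q) (g p)) <= Rabs (pd e3_1 rho q - pd e3_1 rho p) + Rabs (pd e3_2 rho q - pd e3_2 rho
      p) + Rabs (pd e3_3 rho q - pd e3_3 rho p)) by apply (norm3_sum (vsub (g q) (g p))).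
    lra. }
  destruct Hgc as (dg & dg0 & Hgc).
  set (e := Rmin (Rmin (E / 2) (r / 2)) (Rmin dg (Rmin (norm3 (g p) / 2) (/ (2 * norm3 (g p)))))).
  assert (eE : 2 * e <= E). { assert (e <= E / 2) by (eapply Rle_trans; [apply Rmin_l|apply Rmin_l]). lra. }
  assert (er : 2 * e <= r). { assert (e <= r / 2) by (eapply Rle_trans; [apply Rmin_l|apply Rmin_r]). lra. }
  assert (ed : e <= dg) by (eapply Rle_trans; [apply Rmin_r|apply Rmin_l]).
  assert (eg : e <= norm3 (g p) / 2) by (eapply Rle_trans; [apply Rmin_r|eapply Rle_trans;
    [apply Rmin_r|apply Rmin_l]]).
  assert (eg' : e <= / (2 * norm3 (g p))) by (eapply Rle_trans; [apply Rmin_r|eapply Rle_trans;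
    [apply Rmin_r|apply Rmin_r]]).
  assert (ig : 0 < / (2 * norm3 (g p))) by (apply Rinv_0_lt_compat; lra).
  assert (e0 : 0 < e) by (unfold e; repeat apply Rmin_pos; lra).
  assert (iE : / E <= / (2 * e)) by (apply Rinv_le_contravar; lra).
  assert (i2 : / (2 * e) = / e / 2) by (field; lra).
  assert (ie : 0 < / e) by (apply Rinv_0_lt_compat; auto).
  assert (Seg : forall q w t, dist3 p q < e -> norm3 w < e -> 0 <= t <= 1 -> dist3 p (vadd q (vscal t w)) < 2 * e).
  { intros q w t Hq Hw Ht. pose proof (dist3_triangle p q (vadd q (vscal t w))) as T.
    rewrite (dist3_sym q), dist3_add, norm3_scal, Rabs_pos_eq in T by lra. pose proof (norm3_pos w). nra. }
  assert (HH : forall q w t, dist3 p q < e -> norm3 w < e -> 0 <= t <= 1 ->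
    hess3 rho (vadd q (vscal t w)) w <= / E * (norm3 w * norm3 w) /\ - / E * (norm3 w * norm3 w) <= hess3 rho (vadd q
      (vscal t w)) w /\
    (Rabs (dot3 w (g q)) <= e * norm3 w -> E * (norm3 w * norm3 w) <= hess3 rho (vadd q (vscal t w)) w)).
  { intros q w t Hq Hw Ht. specialize (Seg q w t Hq Hw Ht).
    destruct (Rle_lt_or_eq_dec _ _ (norm3_pos w)) as [L|L].
    - destruct (normalize3 w L) as (v & Hv & Ev).
      destruct (HE v Hv (vadd q (vscal t w)) q ltac:(lra) ltac:(lra)) as (A & B & F).
      assert (Eh : hess3 rho (vadd q (vscal t w)) w = norm3 w * norm3 w * hess3 rho (vadd q (vscal t w)) v).
      { rewrite Ev at 2. apply hess3_scal. }
      rewrite Eh. assert (0 < norm3 w * norm3 w) by nra. repeat split; try nra.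
      intros Q. assert (Rabs (dot3 v (g q)) <= E).
      { assert (Edot : dot3 w (g q) = norm3 w * dot3 v (g q)) by (rewrite Ev at 1; vunf; ring).
        rewrite Edot, Rabs_mult, (Rabs_pos_eq (norm3 w)) in Q by lra.
        assert (Rabs (dot3 v (g q)) <= e) by (apply (Rmult_le_reg_l (norm3 w)); lra). lra. }
      specialize (F H0). nra.
    - assert (w0 : w = vscal 0 w) by (pose proof (norm3_0 w (eq_sym L)) as ->; apply R3_ext; vunf; ring).
      pose proof (hess3_scal rho (vadd q (vscal t w)) 0 w) as Z. rewrite <- w0 in Z.
      rewrite Z, <- L. split; [lra|split; [lra|intros _; lra]]. }
  exists e, rho, g. split; [auto|]. split; [intros x Hx; apply HD; lra|]. split; [intros x Hx; apply Hcl; lra|].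
  split; [|split; [|split]].
  - intros q Hq. specialize (Hgc q ltac:(lra)).
    pose proof (dist3_triangle (g q) (g p) (mk3 0 0 0)) as T1.
    pose proof (dist3_triangle (g p) (g q) (mk3 0 0 0)) as T2.
    rewrite (dist3_sym (g p) (g q)) in T2.
    assert (N0 : forall a, dist3 a (mk3 0 0 0) = norm3 a) by (intros a; rewrite dist3_norm; f_equal; apply R3_ext;
      vunf; ring).
    rewrite !N0 in *. split; [lra|].
    apply Rle_trans with (2 * norm3 (g p)); [lra|]. rewrite <- (Rinv_inv (2 * norm3 (g p))).
    apply Rinv_le_contravar; auto.
  - intros q w Hq Hw. eapply Rle_trans; [apply (taylor3_upper U rho q w (/ E * (norm3 w * norm3 w))); auto|].
    + intros t Ht. unfold U. specialize (Seg q w t Hq Hw Ht). lra.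
    + intros t Ht. apply (HH q w t); auto.
    + pose proof (norm3_pos w). assert (0 <= norm3 w * norm3 w) by nra. fold g. nra.
  - intros q w Hq Hw. eapply Rle_trans; [|apply (taylor3_lower U rho q w (- / E * (norm3 w * norm3 w))); auto].
    + pose proof (norm3_pos w). assert (0 <= norm3 w * norm3 w) by nra. fold g. nra.
    + intros t Ht. unfold U. specialize (Seg q w t Hq Hw Ht). lra.
    + intros t Ht. apply (HH q w t); auto.
  - intros q w Hq Hw Hd. eapply Rle_trans; [|apply (taylor3_lower U rho q w (E * (norm3 w * norm3 w))); auto].
    + pose proof (norm3_pos w). assert (0 <= norm3 w * norm3 w) by nra. fold g. nra.
    + intros t Ht. unfold U. specialize (Seg q w t Hq Hw Ht). lra.
    + intros t Ht. apply (HH q w t); auto.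
Qed.

(** * Global convexity and tangent balls *)

Definition seg (x y : R3) (t : R) : R3 := vadd x (vscal t (vsub y x)).
Definition convex3 (D : R3 -> Prop) := forall x y t, D x -> D y -> 0 <= t <= 1 -> D (seg x y t).

Ltac vring := apply R3_ext; vunf; try (unfold seg; vunf); ring.

Lemma dist3_vadd x u v : dist3 (vadd x u) (vadd x v) = norm3 (vsub u v).
Proof. rewrite dist3_norm. f_equal. vring. Qed.

Lemma seg_dist x y y' t t' : 0 <= t' <= 1 -> dist3 (seg x y t) (seg x y' t') <= Rabs (t - t') * norm3 (vsub y x) +
  dist3 y y'.
Proof.
  intros Ht. rewrite dist3_norm.
  replace (vsub (seg x y t) (seg x y' t')) with (vadd (vscal (t - t') (vsub y x)) (vscal t' (vsub y y'))) by vring.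
  eapply Rle_trans; [apply norm3_triangle|]. rewrite !norm3_scal, (Rabs_pos_eq t') by lra.
  rewrite <- dist3_norm. pose proof (dist3_pos y y'). rewrite <- (dist3_norm y y'). nra.
Qed.

(* The set of points visible from [x] is open and, by strict convexity at a first contact with the boundary,
   relatively closed in the connected domain. *)
Lemma domain_convex (D : R3 -> Prop) : bounded_domain D -> smooth_strictly_convex_boundary D -> convex3 D.
Proof.
  intros (OD & CD & _ & _) HS x y0 t0 Dx Dy0 Ht0.
  set (U := fun y => forall t, 0 <= t <= 1 -> D (seg x y t)).
  set (V := fun y => exists e, 0 < e /\ forall y', dist3 y y' < e -> ~ U y').
  assert (OU : open U).
  { apply open3_dist. intros y Uy.
    destruct (compact_unif (T := R_UniformSpace) (fun t => 0 <= t <= 1) (fun t e => forall y', dist3 y y' < e ->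
      D (seg x y' t)) (compact_interval 0 1)) as (e & e0 & He).
    - intros t d d' Hd H y' Hy'. apply H; lra.
    - intros t Ht. destruct (proj1 (open3_dist D) OD _ (Uy t Ht)) as (d & d0 & Hd).
      pose proof (norm3_pos (vsub y x)) as n0.
      exists (d / 2 / (norm3 (vsub y x) + 1)). split; [repeat apply Rdiv_lt_0_compat; lra|].
      intros t' Bt Ht' y' Hy'. apply Hd. eapply Rle_lt_trans; [apply seg_dist; auto|].
      change (Rabs (t' - t) < d / 2 / (norm3 (vsub y x) + 1)) in Bt. rewrite Rabs_minus_sym in Bt.
      apply (Rmult_lt_compat_r (norm3 (vsub y x) + 1)) in Bt; [|lra].
      replace (d / 2 / (norm3 (vsub y x) + 1) * (norm3 (vsub y x) + 1)) with (d / 2) in Bt by (field; lra).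
      assert (d / 2 / (norm3 (vsub y x) + 1) <= d / 2).
      { apply (Rmult_le_reg_r (norm3 (vsub y x) + 1)); [lra|].
        replace (d / 2 / (norm3 (vsub y x) + 1) * (norm3 (vsub y x) + 1)) with (d / 2) by (field; lra). nra. }
      pose proof (Rabs_pos (t - t')). nra.
    - exists e; split; auto. intros y' Hy' t Ht. apply (He t Ht); auto. }
  assert (OV : open V).
  { apply open3_dist. intros y (e & e0 & He). exists (e / 2). split; [lra|]. intros y' Hy'.
    exists (e / 2). split; [lra|]. intros y'' Hy''. apply He. pose proof (dist3_triangle y y' y''). lra. }
  assert (Cov : forall y, D y -> U y \/ V y).
  { intros y Dy. destruct (classic (V y)) as [Vy|NV]; [right; auto|left].
    intros t Ht. apply NNPP. intros ND. set (z := seg x y t) in *.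
    (* As [y] is not interior to the invisible points, it is a limit of visible ones, so its whole
       segment from [x] lies in the closure of [D]. *)
    assert (Cl : forall s, 0 <= s <= 1 -> closure3 D (seg x y s)).
    { intros s Hs e He. apply NNPP. intros A. apply NV. exists e; split; auto. intros y' Hy' Uy'.
      apply A. exists (seg x y' s). split; [apply Uy'; auto|].
      eapply Rle_lt_trans; [apply seg_dist; auto|]. replace (s - s) with 0 by ring. rewrite Rabs_R0. lra. }
    assert (t0' : t <> 0).
    { intros E. apply ND. unfold z. rewrite E. replace (seg x y 0) with x by vring. auto. }
    assert (t1' : t <> 1).
    { intros E. apply ND. unfold z. rewrite E. replace (seg x y 1) with y by vring. auto. }
    destruct (local_data D z HS (conj (Cl t Ht) ND)) as (e & rho & g & e0 & HD & HC & _ & _ & Hlo & Htan).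
    assert (Z0 : dist3 z z < 2 * e) by (rewrite dist3_refl; lra).
    assert (Z1 : dist3 z z < e) by (rewrite dist3_refl; lra).
    assert (rz : rho z = 0).
    { apply Rle_antisym; [apply HC; auto; apply Cl; auto|]. apply Rnot_lt_le. intros L. apply ND, HD; auto. }
    set (u := vsub y x) in *. pose proof (norm3_pos u) as u0.
    set (al := dot3 u (g z)).
    assert (Hup : forall s, Rabs s <= t -> Rabs s <= 1 - t -> Rabs s * norm3 u < e -> rho (vadd z (vscal s u)) <= 0).
    { intros s H1 H2 H3. apply Rabs_le_between in H1. apply Rabs_le_between in H2. apply HC.
      - rewrite dist3_sym, dist3_add, norm3_scal. lra.
      - replace (vadd z (vscal s u)) with (seg x y (t + s)) by (unfold z, u; vring). apply Cl. lra. }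
    set (k := Rmin (Rmin t (1 - t)) (e / (2 * (norm3 u + 1)))).
    assert (k1 : k <= t) by (eapply Rle_trans; [apply Rmin_l|apply Rmin_l]).
    assert (k2 : k <= 1 - t) by (eapply Rle_trans; [apply Rmin_l|apply Rmin_r]).
    assert (k3 : k * norm3 u < e).
    { assert (k <= e / (2 * (norm3 u + 1))) by apply Rmin_r.
      apply Rle_lt_trans with (e / (2 * (norm3 u + 1)) * norm3 u); [apply Rmult_le_compat_r; auto|].
      apply (Rmult_lt_reg_r (2 * (norm3 u + 1))); [lra|].
      replace (e / (2 * (norm3 u + 1)) * norm3 u * (2 * (norm3 u + 1))) with (e * norm3 u) by (field; lra).
      pose proof (Rmult_le_pos e (norm3 u) ltac:(lra) u0). lra. }
    assert (k0 : 0 < k). { unfold k. repeat apply Rmin_pos; try lra. apply Rdiv_lt_0_compat; lra. }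
    assert (ie : 0 < / e) by (apply Rinv_0_lt_compat; auto).
    (* At the contact point [z] the segment must keep [rho <= 0] on both sides. If it is tangent
       there, strict convexity makes [rho] positive at [z + k u]; if it is transversal, [rho] is
       positive to first order on one side. *)
    destruct (Req_dec al 0) as [Ea|Na].
    - assert (up : 0 < norm3 u).
      { destruct (Rle_lt_or_eq_dec _ _ u0) as [L|L]; auto. exfalso. apply ND. unfold z, seg. fold u.
        rewrite (norm3_0 u (eq_sym L)). replace (vadd x (vscal t (mk3 0 0 0))) with x by vring. auto. }
      pose proof (Hup k) as H1. rewrite (Rabs_pos_eq k) in H1 by lra. specialize (H1 k1 k2 k3).
      pose proof (Htan z (vscal k u) Z1) as H2. rewrite norm3_scal, (Rabs_pos_eq k) in H2 by lra.
      assert (Ed : dot3 (vscal k u) (g z) = 0) by (replace (dot3 (vscal k u) (g z)) with (k * al) by (unfold al;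
        vunf; ring); rewrite Ea; ring).
      rewrite Ed, Rabs_R0, rz in H2. specialize (H2 k3 ltac:(apply Rmult_le_pos; [lra|apply Rmult_le_pos; lra])).
      assert (0 < e * (k * norm3 u * (k * norm3 u))) by (repeat apply Rmult_lt_0_compat; lra). lra.
    - pose proof (Rabs_pos_lt al Na) as pa.
      set (s := Rmin k (e * Rabs al / (2 * (norm3 u * norm3 u + 1)))).
      assert (s1 : s <= k) by apply Rmin_l.
      assert (s2 : s * (norm3 u * norm3 u) < e * Rabs al).
      { assert (s <= e * Rabs al / (2 * (norm3 u * norm3 u + 1))) by apply Rmin_r.
        apply Rle_lt_trans with (e * Rabs al / (2 * (norm3 u * norm3 u + 1)) * (norm3 u * norm3 u));
          [apply Rmult_le_compat_r; nra|].
        apply (Rmult_lt_reg_r (2 * (norm3 u * norm3 u + 1))); [nra|].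
        replace (e * Rabs al / (2 * (norm3 u * norm3 u + 1)) * (norm3 u * norm3 u) * (2 * (norm3 u * norm3 u + 1)))
          with (e * Rabs al * (norm3 u * norm3 u)) by (field; nra).
        assert (0 < e * Rabs al) by nra. nra. }
      assert (s0 : 0 < s). { unfold s. apply Rmin_pos; auto. apply Rdiv_lt_0_compat; nra. }
      assert (Hk : forall sg, Rabs sg = 1 -> sg * al = Rabs al -> False).
      { intros sg Hsg Hal.
        assert (As : Rabs (sg * s) = s) by (rewrite Rabs_mult, Hsg, Rabs_pos_eq by lra; ring).
        pose proof (Hup (sg * s)) as H1. rewrite As in H1. specialize (H1 ltac:(lra) ltac:(lra) ltac:(nra)).
        pose proof (Hlo z (vscal (sg * s) u) Z1) as H2. rewrite norm3_scal, As, rz in H2. specialize (H2 ltac:(nra)).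
        replace (dot3 (vscal (sg * s) u) (g z)) with (s * (sg * al)) in H2 by (unfold al; vunf; ring).
        rewrite Hal in H2.
        assert (s * Rabs al <= / e * (s * norm3 u * (s * norm3 u))) by lra.
        assert (Q : / e * (s * norm3 u * (s * norm3 u)) < s * Rabs al).
        { replace (/ e * (s * norm3 u * (s * norm3 u))) with (/ e * s * (s * (norm3 u * norm3 u))) by ring.
          replace (s * Rabs al) with (/ e * s * (e * Rabs al)) by (field; lra).
          apply Rmult_lt_compat_l; auto. nra. }
        lra. }
      destruct (Rle_dec 0 al).
      + apply (Hk 1); [apply Rabs_R1|rewrite Rabs_pos_eq by lra; ring].
      + apply (Hk (Ropp 1)); [rewrite Rabs_Ropp; apply Rabs_R1|rewrite Rabs_left by lra; ring]. }
  assert (Ux : U x).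
  { intros t Ht. replace (seg x x t) with x by vring. auto. }
  destruct (classic (U y0)) as [H|H]; [apply H; auto|]. exfalso.
  apply (CD U V OU OV Cov).
  - intros y _ Uy (e & e0 & He). apply (He y); auto. rewrite dist3_refl; auto.
  - exists x; auto.
  - exists y0; split; auto. destruct (Cov y0 Dy0); tauto.
Qed.

(** Replace [q] by a nearby point [q'] of [D] and move [x] to [x'] so that the same point divides
    the new segment in the same ratio; the bound [d * t] keeps [x'] in the ball around [x]. *)
Lemma closure_seg (D : R3 -> Prop) q x t : open D -> convex3 D -> closure3 D q -> D x -> 0 < t <= 1 -> D (seg q x t).
Proof.
  intros OD CD Cq Dx Ht. destruct (proj1 (open3_dist D) OD x Dx) as (d & d0 & Hd).
  destruct (Cq (d * t)) as (q' & Dq' & Hq'); [nra|].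
  set (x' := vadd x (vscal ((1 - t) / t) (vsub q q'))).
  replace (seg q x t) with (seg q' x' t) by (unfold x', seg; apply R3_ext; vunf; field; lra).
  apply CD; auto; [|lra]. apply Hd. unfold x'. rewrite dist3_sym, dist3_add, norm3_scal.
  rewrite <- (dist3_norm q q').
  assert (0 <= (1 - t) / t) by (apply Rmult_le_pos; [lra|left; apply Rinv_0_lt_compat; lra]).
  rewrite Rabs_pos_eq by auto.
  apply Rle_lt_trans with (/ t * dist3 q q').
  - apply Rmult_le_compat_r; [apply dist3_pos|]. unfold Rdiv. assert (0 < / t) by (apply Rinv_0_lt_compat; lra). nra.
  - apply (Rmult_lt_reg_l t); [lra|]. rewrite <- Rmult_assoc, Rinv_r, Rmult_1_l by lra. lra.
Qed.

Lemma boundary_compact (D : R3 -> Prop) : bounded_domain D -> compact_set (boundary3 D).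
Proof.
  intros (OD & _ & _ & M & HM). apply compact_R3.
  - exists (M + 1). intros x [Cx _]. destruct (Cx 1) as (y & Dy & Hy); [lra|]. specialize (HM y Dy).
    pose proof (norm3_triangle y (vsub x y)). replace (vadd y (vsub x y)) with x in H by vring.
    rewrite <- dist3_norm in H. lra.
  - apply open3_dist. intros x Hx. destruct (classic (D x)) as [Dx|ND].
    + destruct (proj1 (open3_dist D) OD x Dx) as (d & d0 & Hd). exists d; split; auto. intros y Hy [_ N].
      apply N, Hd; auto.
    + assert (exists e, 0 < e /\ forall y, D y -> e <= dist3 x y).
      { apply NNPP. intros A. apply Hx. split; auto. intros e e0. apply NNPP. intros B. apply A.
        exists e; split; auto.
        intros y Dy. apply Rnot_lt_le. intros L. apply B; eauto. }
      destruct H as (e & e0 & He). exists (e / 2). split; [lra|]. intros y Hy [Cy _].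
      destruct (Cy (e / 2)) as (z & Dz & Hz); [lra|]. specialize (He z Dz). pose proof (dist3_triangle x y z). lra.
Qed.

(** The inequality on [dot3 (vsub x q) n] says that [x] lies in the ball of radius [1 / (2 e)]
    touching at [q], so [D] is locally squeezed between an inner and an outer tangent ball with
    outward normal [n]. The inner one tells how far the surface may move, the outer one turns
    tangential motion into loss of depth. *)
Lemma uniform_balls (D : R3 -> Prop) : bounded_domain D -> smooth_strictly_convex_boundary D ->
  exists e, 0 < e /\ forall q, boundary3 D q -> exists n, norm3 n = 1 /\
    (forall x, D x -> dist3 q x < e -> dot3 (vsub x q) n <= - e * (dist3 q x * dist3 q x)) /\
    (forall w, norm3 (vadd w (vscal e n)) < e -> D (vadd q w)).
Proof.
  intros BD HS. pose proof (domain_convex D BD HS) as CV. pose proof (boundary_compact D BD) as BC.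
  destruct BD as (OD & _ & _ & _).
  apply (compact_unif (boundary3 D) (fun q e => exists n, norm3 n = 1 /\
    (forall x, D x -> dist3 q x < e -> dot3 (vsub x q) n <= - e * (dist3 q x * dist3 q x)) /\
    (forall w, norm3 (vadd w (vscal e n)) < e -> D (vadd q w))) BC).
  - intros q d d' Hd (n & Hn & H1 & H2). exists n. split; [auto|split].
    + intros x Dx Hx. specialize (H1 x Dx ltac:(lra)). pose proof (dist3_pos q x). nra.
    + intros w Hw. apply H2. pose proof (norm3_triangle (vadd w (vscal d' n)) (vscal (d - d') n)) as T.
      replace (vadd (vadd w (vscal d' n)) (vscal (d - d') n)) with (vadd w (vscal d n)) in T by vring.
      rewrite norm3_scal, Hn, Rabs_pos_eq in T by lra. lra.
  - intros p Hp. destruct (local_data D p HS Hp) as (E & rho & g & E0 & HD & HC & Hg & Hup & Hlo & Htan).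
    set (e := Rmin (E * E / 2) (Rmin (E / 4) 1)).
    assert (e1 : e <= E * E / 2) by apply Rmin_l.
    assert (e2 : e <= E / 4) by (eapply Rle_trans; [apply Rmin_r|apply Rmin_l]).
    assert (e3 : e <= 1) by (eapply Rle_trans; [apply Rmin_r|apply Rmin_r]).
    assert (e0 : 0 < e) by (unfold e; repeat apply Rmin_pos; nra).
    assert (iE : 0 < / E) by (apply Rinv_0_lt_compat; auto).
    exists e. split; auto. intros q Bq Hq. apply ball3_dist in Bq.
    assert (Hpq : dist3 p q < E) by lra.
    destruct (Hg q Hpq) as [g1 g2]. set (G := norm3 (g q)) in *.
    assert (rq : rho q = 0).
    { destruct Hq as [Cq Nq]. apply Rle_antisym; [apply HC; auto; lra|]. apply Rnot_lt_le. intros L.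
      apply Nq, HD; auto; lra. }
    assert (iG : 0 < / G) by (apply Rinv_0_lt_compat; lra).
    assert (iGE : E <= / G). { rewrite <- (Rinv_inv E). apply Rinv_le_contravar; lra. }
    exists (vscal (/ G) (g q)). split; [|split].
    + rewrite norm3_scal, Rabs_pos_eq by lra. fold G. field; lra.
    + intros x Dx Hx. set (w := vsub x q).
      assert (Ew : dist3 q x = norm3 w) by (rewrite dist3_sym; reflexivity).
      rewrite Ew in *. pose proof (norm3_pos w) as w0.
      (* Convexity makes the tangent plane a supporting plane: otherwise the segment towards [x]
         would leave [q] with [rho] increasing. *)
      assert (Sup : dot3 w (g q) <= 0).
      { apply Rnot_lt_le. intros L.
        set (t := Rmin 1 (E * dot3 w (g q) / (2 * (norm3 w * norm3 w + 1)))).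
        assert (t1 : t <= 1) by apply Rmin_l.
        assert (t0 : 0 < t). { unfold t. apply Rmin_pos; [lra|]. apply Rdiv_lt_0_compat; nra. }
        assert (t2 : t * (norm3 w * norm3 w) < E * dot3 w (g q)).
        { assert (t <= E * dot3 w (g q) / (2 * (norm3 w * norm3 w + 1))) by apply Rmin_r.
          apply Rle_lt_trans with (E * dot3 w (g q) / (2 * (norm3 w * norm3 w + 1)) * (norm3 w * norm3 w));
            [apply Rmult_le_compat_r; nra|].
          apply (Rmult_lt_reg_r (2 * (norm3 w * norm3 w + 1))); [nra|].
          replace (E * dot3 w (g q) / (2 * (norm3 w * norm3 w + 1)) * (norm3 w * norm3 w) * (2 * (norm3 w * norm3 w +
            1))) with (E * dot3 w (g q) * (norm3 w * norm3 w)) by (field; nra).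
          assert (0 < E * dot3 w (g q)) by nra. nra. }
        assert (Dt : D (vadd q (vscal t w))). { apply (closure_seg D q x t); auto. apply Hq. }
        assert (Nt : norm3 (vscal t w) < E) by (rewrite norm3_scal, Rabs_pos_eq by lra; nra).
        apply HD in Dt. 2:{ pose proof (dist3_triangle p q (vadd q (vscal t w))) as T.
        rewrite (dist3_sym q), dist3_add in T. lra. }
        pose proof (Hlo q (vscal t w) Hpq Nt) as Q. rewrite rq, norm3_scal, Rabs_pos_eq in Q by lra.
        replace (dot3 (vscal t w) (g q)) with (t * dot3 w (g q)) in Q by (vunf; ring).
        assert (/ E * (t * norm3 w * (t * norm3 w)) < t * dot3 w (g q)); [|lra].
        replace (/ E * (t * norm3 w * (t * norm3 w))) with (/ E * t * (t * (norm3 w * norm3 w))) by ring.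
        replace (t * dot3 w (g q)) with (/ E * t * (E * dot3 w (g q))) by (field; lra).
        apply Rmult_lt_compat_l; auto. nra. }
      assert (B : dot3 w (g q) <= - E * (norm3 w * norm3 w)).
      { destruct (Rle_dec (Rabs (dot3 w (g q))) (E * norm3 w)) as [L|L].
        - pose proof (Htan q w Hpq ltac:(lra) L) as Q. rewrite rq in Q.
          assert (rho (vadd q w) < 0); [|lra]. apply HD.
          + pose proof (dist3_triangle p q (vadd q w)) as T. rewrite (dist3_sym q), dist3_add in T. lra.
          + replace (vadd q w) with x by (unfold w; vring). auto.
        - rewrite Rabs_left1 in L by auto. assert (norm3 w * norm3 w <= norm3 w) by nra. nra. }
      replace (dot3 w (vscal (/ G) (g q))) with (/ G * dot3 w (g q)) by (vunf; ring).
      assert (0 <= norm3 w * norm3 w) by nra.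
      apply Rle_trans with (/ G * (- E * (norm3 w * norm3 w))); [apply Rmult_le_compat_l; lra|].
      assert (E * E * (norm3 w * norm3 w) <= / G * E * (norm3 w * norm3 w)) by (apply Rmult_le_compat_r; auto; nra).
      assert (e * (norm3 w * norm3 w) <= E * E * (norm3 w * norm3 w)) by (apply Rmult_le_compat_r; auto; nra). lra.
    + intros w Hw. set (n := vscal (/ G) (g q)) in *.
      assert (nn : norm3 n = 1). { unfold n. rewrite norm3_scal, Rabs_pos_eq by lra. fold G. field; lra. }
      pose proof (norm3_sqr (vadd w (vscal e n))) as Q1. pose proof (norm3_sqr w) as Q2.
      pose proof (norm3_sqr n) as Q3.
      rewrite nn in Q3.
      assert (Q4 : dot3 (vadd w (vscal e n)) (vadd w (vscal e n)) = dot3 w w + 2 * e * dot3 w n + e * e * dot3 n n)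
        by (vunf; ring).
      rewrite Q4, <- Q2, <- Q3 in Q1. pose proof (norm3_pos (vadd w (vscal e n))).
      pose proof (norm3_pos w) as w0.
      assert (Q5 : norm3 w * norm3 w + 2 * e * dot3 w n < 0) by nra.
      assert (W : norm3 w < E).
      { pose proof (dot3_ge w n) as Q6. rewrite nn in Q6. assert (norm3 w < 2 * e); [|lra]. nra. }
      apply HD.
      * pose proof (dist3_triangle p q (vadd q w)) as T. rewrite (dist3_sym q), dist3_add in T. lra.
      * eapply Rle_lt_trans; [apply Hup; auto|]. rewrite rq.
        replace (dot3 w (g q)) with (G * dot3 w n) by (unfold n; vunf; field; lra).
        assert (dot3 w n < 0) by nra.
        assert (G * dot3 w n <= E * dot3 w n) by nra.
        assert (/ E * (norm3 w * norm3 w) < / E * (- (2 * e * dot3 w n))) by (apply Rmult_lt_compat_l; lra).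
        assert (/ E * (- (2 * e * dot3 w n)) <= - (E * dot3 w n)); [|lra].
        replace (- (E * dot3 w n)) with (/ E * (- (E * E * dot3 w n))) by (field; lra).
        apply Rmult_le_compat_l; [lra|]. nra.
Qed.

Lemma closure_norm (D : R3 -> Prop) M x : (forall y, D y -> norm3 y <= M) -> closure3 D x -> norm3 x <= M.
Proof.
  intros HM Cx. apply Rnot_lt_le. intros L. destruct (Cx (norm3 x - M)) as (y & Dy & Hy); [lra|].
  specialize (HM y Dy). pose proof (norm3_triangle y (vsub x y)) as T.
  replace (vadd y (vsub x y)) with x in T by vring. rewrite <- dist3_norm in T. lra.
Qed.

Lemma dist3_continuous q x : continuous (fun y : R3 => dist3 q y) x.
Proof.
  apply continuous_R3. intros e e0. exists e; split; auto. intros w Hw.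
  pose proof (dist3_triangle q x w). pose proof (dist3_triangle q w x). rewrite (dist3_sym w x) in H0.
  apply Rabs_def1; lra.
Qed.

(** The search may be confined to norm at most [3 * M]: points farther out are at distance more than
    [2 * M] from [q], hence farther than the boundary point [p0]. *)
Lemma nearest_outside (D : R3 -> Prop) M p0 q : open D -> (forall y, D y -> norm3 y <= M) -> boundary3 D p0 -> D q ->
  exists p, ~ D p /\ forall x, ~ D x -> dist3 q p <= dist3 q x.
Proof.
  intros OD HM [Cp0 Np0] Dq. pose proof (closure_norm D M p0 HM Cp0) as n0. pose proof (HM q Dq) as nq.
  set (S := fun x => ~ D x /\ norm3 x <= 3 * M).
  assert (M0 : 0 <= M) by (pose proof (norm3_pos q); lra).
  destruct (compact_min_attained S (fun y => dist3 q y)) as (p & [Np _] & Hp).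
  - apply compact_R3; [exists (3 * M); intros x [_ H]; auto|].
    apply open3_dist. intros x Hx. destruct (classic (D x)) as [Dx|ND].
    + destruct (proj1 (open3_dist D) OD x Dx) as (d & d0 & Hd). exists d; split; auto. intros y Hy [N _].
      apply N, Hd; auto.
    + assert (L : 3 * M < norm3 x) by (apply Rnot_le_lt; intros A; apply Hx; split; auto).
      exists (norm3 x - 3 * M). split; [lra|]. intros y Hy [_ A].
      pose proof (norm3_triangle y (vsub x y)) as T. replace (vadd y (vsub x y)) with x in T by vring.
      rewrite <- dist3_norm in T. lra.
  - intros; apply dist3_continuous.
  - exists p0. split; auto. lra.
  - intros; apply dist3_pos.
  - exists p. split; auto. intros x Nx. destruct (Rle_dec (norm3 x) (3 * M)) as [L|L]; [apply Hp; split; auto|].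
    apply Rle_trans with (dist3 q p0); [apply Hp; split; auto; lra|].
    assert (A : dist3 q p0 <= 2 * M).
    { rewrite dist3_norm. pose proof (norm3_triangle q (vscal (Ropp 1) p0)) as T.
      rewrite norm3_scal, Rabs_Ropp, Rabs_R1 in T.
      replace (vadd q (vscal (Ropp 1) p0)) with (vsub q p0) in T by vring. lra. }
    pose proof (norm3_triangle q (vsub x q)) as T. replace (vadd q (vsub x q)) with x in T by vring.
    rewrite <- dist3_norm, (dist3_sym x) in T. lra.
Qed.

(* [dep] is the distance to the complement and [nu] points to the nearest boundary point. *)
Definition foot (dep : R3 -> R) (nu : R3 -> R3) (q : R3) : R3 := vadd q (vscal (dep q) (nu q)).
Definition depth_data (D : R3 -> Prop) (r0 c : R) (dep : R3 -> R) (nu : R3 -> R3) : Prop :=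
  0 < r0 /\ 0 < c /\
  forall q, D q -> 0 < dep q /\ (forall x, ~ D x -> dep q <= dist3 q x) /\ norm3 (nu q) = 1 /\ ~ D (foot dep nu q) /\
    (forall x, D x -> dot3 (vsub x (foot dep nu q)) (nu q) <= - c * (dist3 (foot dep nu q) x * dist3 (foot dep nu q)
      x)) /\
    (forall w, norm3 (vadd w (vscal r0 (nu q))) < r0 -> D (vadd (foot dep nu q) w)).

Lemma depth_exists (D : R3 -> Prop) p0 : bounded_domain D -> smooth_strictly_convex_boundary D -> boundary3 D p0 ->
  exists r0 c dep nu, depth_data D r0 c dep nu.
Proof.
  intros BD HS Hp0. destruct (uniform_balls D BD HS) as (e & e0 & Hball).
  pose proof (domain_convex D BD HS) as CV. destruct BD as (OD & _ & _ & M & HM).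
  assert (M0 : 0 <= M).
  { destruct Hp0 as [Cp _]. destruct (Cp 1) as (y & Dy & _); [lra|]. specialize (HM y Dy). pose proof (norm3_pos y).
    lra. }
  (* Points of the closure are at most [2 * (M + 1)] apart; with this [c] the estimate at distance
     [e / 2] scales along segments to all of [D]. *)
  set (c := Rmin e (e * e / (4 * (M + 1)))).
  assert (c0 : 0 < c). { unfold c. apply Rmin_pos; auto. apply Rdiv_lt_0_compat; nra. }
  assert (c1 : c <= e) by apply Rmin_l.
  assert (c2 : c * (2 * (M + 1)) <= e * e / 2).
  { apply Rle_trans with (e * e / (4 * (M + 1)) * (2 * (M + 1))); [|right; field; lra].
    apply Rmult_le_compat_r; [lra|apply Rmin_r]. }
  assert (Hex : forall q, exists tn : R * R3, D q -> let t := fst tn in let n := snd tn in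
    0 < t /\ (forall x, ~ D x -> t <= dist3 q x) /\ norm3 n = 1 /\ ~ D (vadd q (vscal t n)) /\
    (forall x, D x -> dot3 (vsub x (vadd q (vscal t n))) n <= - c * (dist3 (vadd q (vscal t n)) x * dist3 (vadd q
      (vscal t n)) x)) /\
    (forall w, norm3 (vadd w (vscal e n)) < e -> D (vadd (vadd q (vscal t n)) w))).
  { intros q. destruct (classic (D q)) as [Dq|ND]; [|exists (0, q); tauto].
    destruct (nearest_outside D M p0 q OD HM Hp0 Dq) as (p & Np & Hp).
    set (t := dist3 q p) in *.
    assert (t0 : 0 < t).
    { destruct (Rle_lt_or_eq_dec _ _ (dist3_pos q p)) as [L|L]; auto. exfalso. apply Np.
      rewrite <- (dist3_0 q p); auto. }
    assert (Hin : forall x, dist3 q x < t -> D x).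
    { intros x Hx. apply NNPP. intros N. specialize (Hp x N). lra. }
    assert (Cp : closure3 D p).
    { intros d d0. set (s := Rmin (1 / 2) (d / (2 * t))).
      assert (s1 : s <= 1 / 2) by apply Rmin_l.
      assert (s2 : s * t <= d / 2).
      { apply Rle_trans with (d / (2 * t) * t); [apply Rmult_le_compat_r; [lra|apply Rmin_r]|right; field; lra]. }
      assert (s0 : 0 < s) by (apply Rmin_pos; [lra|apply Rdiv_lt_0_compat; lra]).
      exists (seg p q s). split.
      - apply Hin. rewrite dist3_norm. replace (vsub q (seg p q s)) with (vscal (1 - s) (vsub q p)) by vring.
        rewrite norm3_scal, <- dist3_norm, Rabs_pos_eq by lra. fold t. nra.
      - unfold seg. rewrite dist3_sym, dist3_add, norm3_scal, <- dist3_norm, Rabs_pos_eq by lra. fold t. lra. }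
    destruct (Hball p (conj Cp Np)) as (n & nn & Hout & Hinn).
    assert (Hglob : forall x, D x -> dot3 (vsub x p) n <= - c * (dist3 p x * dist3 p x)).
    { intros x Dx. pose proof (dist3_pos p x) as d0. destruct (Rlt_dec (dist3 p x) e) as [L|L].
      - specialize (Hout x Dx L). assert (0 <= dist3 p x * dist3 p x) by nra. nra.
      - set (dd := dist3 p x) in *. set (s := e / (2 * dd)).
        assert (dp : 0 < dd) by lra.
        assert (s0 : 0 < s) by (apply Rdiv_lt_0_compat; lra).
        assert (sd : s * dd = e / 2) by (unfold s; field; lra).
        assert (s1 : s <= 1) by nra.
        pose proof (closure_seg D p x s OD CV Cp Dx ltac:(lra)) as Dy.
        assert (Ey : dist3 p (seg p x s) = e / 2).
        { unfold seg. rewrite dist3_sym, dist3_add, norm3_scal, <- dist3_norm, (dist3_sym x p), Rabs_pos_eq by lra.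
          auto. }
        specialize (Hout _ Dy). rewrite Ey in Hout. specialize (Hout ltac:(lra)).
        replace (dot3 (vsub (seg p x s) p) n) with (s * dot3 (vsub x p) n) in Hout by (unfold seg; vunf; ring).
        assert (Q : dot3 (vsub x p) n <= - (e * e / 2) * dd).
        { apply (Rmult_le_reg_l s); auto. replace (s * (- (e * e / 2) * dd)) with (- (e * e / 2) * (s * dd)) by ring.
          rewrite sd.
          replace (- (e * e / 2) * (e / 2)) with (- e * (e / 2 * (e / 2))) by field. auto. }
        assert (dM : dd <= 2 * (M + 1)).
        { pose proof (closure_norm D M p HM Cp). pose proof (HM x Dx). unfold dd. rewrite dist3_norm.
          pose proof (norm3_triangle p (vscal (Ropp 1) x)) as T. rewrite norm3_scal, Rabs_Ropp, Rabs_R1 in T.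
          replace (vadd p (vscal (Ropp 1) x)) with (vsub p x) in T by vring. lra. }
        assert (c * dd <= e * e / 2) by nra.
        eapply Rle_trans; [apply Q|]. nra. }
    (* The nearest point lies in the normal direction: otherwise some [q + s n] would be inside the
       ball of radius [t] around [q], hence in [D], and at the same time beyond the supporting plane
       at [p]. *)
    assert (Ep : p = vadd q (vscal t n)).
    { assert (T : t <= dot3 (vsub p q) n).
      { apply Rnot_lt_le. intros L. set (s := (dot3 (vsub p q) n + t) / 2).
        assert (lo : - t <= dot3 (vsub p q) n).
        { pose proof (dot3_ge (vsub p q) n) as G. rewrite nn, <- dist3_norm, (dist3_sym p q) in G. fold t in G. lra. }
        assert (Ds : D (vadd q (vscal s n))).
        { apply Hin. rewrite dist3_sym, dist3_add, norm3_scal, nn. unfold s.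
          apply Rle_lt_trans with (Rabs ((dot3 (vsub p q) n + t) / 2)); [lra|].
          apply Rabs_def1; lra. }
        specialize (Hglob _ Ds).
        replace (dot3 (vsub (vadd q (vscal s n)) p) n) with (s * dot3 n n - dot3 (vsub p q) n) in Hglob by (vunf;
          ring).
        rewrite <- norm3_sqr, nn in Hglob. pose proof (dist3_pos p (vadd q (vscal s n))).
        assert (0 <= c * (dist3 p (vadd q (vscal s n)) * dist3 p (vadd q (vscal s n)))) by (apply Rmult_le_pos; nra).
        unfold s in *. lra. }
      apply dist3_0. apply Rle_antisym; [|apply dist3_pos]. rewrite dist3_norm. apply norm3_le_sqr; [lra|].
      replace (dot3 (vsub p (vadd q (vscal t n))) (vsub p (vadd q (vscal t n)))) with
        (dot3 (vsub p q) (vsub p q) - 2 * t * dot3 (vsub p q) n + t * t * dot3 n n) by (vunf; ring).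
      rewrite <- !norm3_sqr, nn, <- dist3_norm, (dist3_sym p q). fold t. nra. }
    exists (t, n). intros _. cbn [fst snd]. rewrite <- Ep. repeat (split; auto). }
  set (ch := fun q => proj1_sig (constructive_indefinite_description _ (Hex q))).
  exists e, c, (fun q => fst (ch q)), (fun q => snd (ch q)). split; [auto|split; [auto|]].
  intros q Dq. unfold foot. unfold ch. destruct (constructive_indefinite_description _ (Hex q)) as [tn H]. simpl.
  apply H; auto.
Qed.

(** * The depth function and the normal field *)

Section Depth.
Variables (D : R3 -> Prop) (r0 c : R) (dep : R3 -> R) (nu : R3 -> R3).
Hypothesis HD : depth_data D r0 c dep nu.

Lemma dep_pos q : D q -> 0 < dep q.
Proof. intros H. apply HD; auto. Qed.

Lemma dep_ball q x : D q -> dist3 q x < dep q -> D x.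
Proof. intros H L. apply NNPP. intros N. destruct HD as (_ & _ & K). destruct (K q H) as (_ & A & _).
specialize (A x N). lra. Qed.

Lemma dep_lip q q' : D q -> D q' -> dep q <= dep q' + dist3 q q'.
Proof.
  intros Dq Dq'. destruct HD as (_ & _ & K). destruct (K q' Dq') as (tx & _ & nx & Nx & _).
  destruct (K q Dq) as (_ & A & _). specialize (A _ Nx).
  pose proof (dist3_triangle q q' (foot dep nu q')) as T. unfold foot in T at 2.
  rewrite (dist3_sym q'), dist3_add, norm3_scal, nx, Rabs_pos_eq in T by lra. lra.
Qed.

(* Moving tangentially by [y] brings the point closer to the boundary by strict convexity. *)
Lemma dep_gain q y : D q -> D (vadd q y) ->
  dep (vadd q y) <= dep q - dot3 y (nu q) - c * (norm3 y * norm3 y - dot3 y (nu q) * dot3 y (nu q)).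
Proof.
  intros Dq Dx. destruct HD as (_ & c0 & K). destruct (K q Dq) as (t0 & _ & nn & Np & Ho & _).
  destruct (K _ Dx) as (tx & Hx & _).
  set (n := nu q) in *. set (p := foot dep nu q) in *. set (x := vadd q y) in *. set (t := dep q) in *.
  assert (Ep : p = vadd q (vscal t n)) by reflexivity.
  pose proof (norm3_sqr n) as N2. rewrite nn in N2.
  set (al := t - dot3 y n). set (be := norm3 y * norm3 y - dot3 y n * dot3 y n).
  assert (be0 : 0 <= be).
  { unfold be. pose proof (dot3_le y n). pose proof (dot3_ge y n). rewrite nn in *. pose proof (norm3_pos y). nra. }
  assert (E1 : forall s, dot3 (vsub (vadd x (vscal s n)) p) n = s - al).
  { intros s. rewrite Ep. unfold x, al.
    transitivity (dot3 y n + (s - t) * dot3 n n); [vunf; ring|rewrite <- N2; ring]. }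
  assert (E2 : forall s, dist3 p (vadd x (vscal s n)) * dist3 p (vadd x (vscal s n)) = be + (s - al) * (s - al)).
  { intros s. rewrite dist3_norm, norm3_sqr. unfold be, al. rewrite norm3_sqr, Ep. unfold x.
    transitivity (dot3 y y + 2 * (s - t) * dot3 y n + (s - t) * (s - t) * dot3 n n); [vunf; ring|rewrite <- N2;
      ring]. }
  assert (A0 : 0 <= al - c * be).
  { pose proof (Ho x Dx) as H. replace x with (vadd x (vscal 0 n)) in H by vring. rewrite E1, E2 in H. nra. }
  apply Rnot_lt_le. intros L. fold al in L.
  fold be in L. assert (tx' : 0 < dep x) by exact tx.
  (* If the claim failed, a point [x + s n] with [al - c * be < s < dep x] would lie in [D] by its
     distance to [x] and violate the quadratic support inequality at [p]. *)
  destruct (exist (fun s => s = (dep x + (al - c * be)) / 2) _ eq_refl) as [s Es].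
  assert (s0 : 0 <= s < dep x) by lra. assert (s1 : al - c * be < s) by lra. clear Es.
  assert (Ds : D (vadd x (vscal s n))).
  { apply (dep_ball x); auto. rewrite dist3_sym, dist3_add, norm3_scal, nn, Rabs_pos_eq by lra. lra. }
  specialize (Ho _ Ds). rewrite E1, E2 in Ho.
  assert (0 <= c * ((s - al) * (s - al))) by (apply Rmult_le_pos; [lra|apply Rle_0_sqr]). nra.
Qed.

(** The hypothesis is the expansion of [norm3 (y + (r0 - dep q) nu) < r0]: the moved point lies in
    the inner tangent ball of radius [r0] at the foot. *)
Lemma stay_inside q y : D q -> dep q <= r0 ->
  2 * (r0 - dep q) * dot3 y (nu q) + norm3 y * norm3 y < dep q * (2 * r0 - dep q) -> D (vadd q y).
Proof.
  intros Dq Ht H. destruct HD as (r00 & c0 & K). destruct (K q Dq) as (t0 & _ & nn & Np & _ & Hi).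
  set (n := nu q) in *. set (t := dep q) in *.
  pose proof (norm3_sqr n) as N2. rewrite nn in N2.
  replace (vadd q y) with (vadd (foot dep nu q) (vadd y (vscal (- t) n))) by (unfold foot; fold t n; vring).
  apply Hi. apply norm3_lt_sqr; [lra|].
  replace (dot3 (vadd (vadd y (vscal (- t) n)) (vscal r0 n)) (vadd (vadd y (vscal (- t) n)) (vscal r0 n))) with
    (dot3 y y + 2 * (r0 - t) * dot3 y n + (r0 - t) * (r0 - t) * dot3 n n) by (vunf; ring).
  rewrite <- N2, <- norm3_sqr. nra.
Qed.

(** The ball of radius [t] about [q] touches the larger inner ball from within at the foot [p];
    since [t <= r0 / 2], a slight enlargement of it leaves the larger ball only near [p]. The foot
    [p'] of a nearby point lies in this part, and normals are recovered from points and their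
    feet. *)
Lemma nu_continuous q eps : D q -> dep q <= r0 / 2 -> 0 < eps -> exists d, 0 < d /\ forall q', D q' ->
  dist3 q q' < d -> dist3 (nu q) (nu q') < eps.
Proof.
  intros Dq Ht He. destruct HD as (r00 & c0 & K). destruct (K q Dq) as (t0 & _ & nn & Np & Ho & Hi).
  set (n := nu q) in *. set (p := foot dep nu q) in *. set (t := dep q) in *.
  pose proof (norm3_sqr n) as N2. rewrite nn in N2.
  set (a := Rmin (eps * t / 4) 1).
  assert (a0 : 0 < a) by (apply Rmin_pos; [apply Rdiv_lt_0_compat; [apply Rmult_lt_0_compat; assumption|lra]|lra]).
  assert (a1 : a <= eps * t / 4) by apply Rmin_l. assert (a2 : a <= 1) by apply Rmin_r.
  set (d := Rmin (Rmin a t) (a * a / (40 * (t + 1)))).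
  assert (d1 : d <= a) by (eapply Rle_trans; [apply Rmin_l|apply Rmin_l]).
  assert (d2 : d <= t) by (eapply Rle_trans; [apply Rmin_l|apply Rmin_r]).
  assert (d3 : d * (40 * (t + 1)) <= a * a).
  { apply Rle_trans with (a * a / (40 * (t + 1)) * (40 * (t + 1))); [apply Rmult_le_compat_r;
      [lra|apply Rmin_r]|right; field; lra]. }
  assert (d0 : 0 < d). { unfold d.
  apply Rmin_pos; [apply Rmin_pos; [exact a0|exact t0]|apply Rdiv_lt_0_compat; [nra|]]. assert (0 < t) by exact t0.
  lra. }
  exists d. split; auto. intros q' Dq' Hq'.
  destruct (K q' Dq') as (t0' & _ & nn' & Np' & _ & _).
  set (n' := nu q') in *. set (p' := foot dep nu q') in *. set (t' := dep q') in *.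
  pose proof (dep_lip q q' Dq Dq') as L1. pose proof (dep_lip q' q Dq' Dq) as L2. rewrite (dist3_sym q' q) in L2.
  fold t t' in L1, L2.
  set (w := vsub p' p).
  assert (W1 : 0 <= norm3 w * norm3 w + 2 * r0 * dot3 w n).
  { apply Rnot_lt_le. intros L. apply Np'. replace p' with (vadd p w) by (unfold w; vring). apply Hi.
    apply norm3_lt_sqr; [lra|]. rewrite norm3_sqr in L.
    replace (dot3 (vadd w (vscal r0 n)) (vadd w (vscal r0 n))) with (dot3 w w + 2 * r0 * dot3 w n + r0 * r0 * dot3 n
      n) by (vunf; ring).
    rewrite <- N2. nra. }
  assert (W2 : norm3 w * norm3 w + 2 * t * dot3 w n + t * t <= (t + 2 * d) * (t + 2 * d)).
  { assert (Q : dist3 q p' <= t + 2 * d).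
    { pose proof (dist3_triangle q q' p') as T. unfold p' in T at 2. unfold foot in T.
      rewrite (dist3_sym q' (vadd _ _)), dist3_add, norm3_scal in T. fold n' t' in T.
      rewrite nn', Rabs_pos_eq in T by lra. lra. }
    replace (norm3 w * norm3 w + 2 * t * dot3 w n + t * t) with (dist3 q p' * dist3 q p').
    - pose proof (dist3_pos q p'). apply Rmult_le_compat; lra.
    - rewrite dist3_norm, !norm3_sqr.
      transitivity (dot3 w w + 2 * t * dot3 w n + t * t * dot3 n n); [|rewrite <- N2; ring].
      unfold w, p, foot. fold n t. vunf. ring. }
  assert (W3 : norm3 w * norm3 w <= a * a).
  { pose proof (norm3_pos w). assert (t * (norm3 w * norm3 w + 2 * r0 * dot3 w n) >= 0) by nra.
    assert (r0 * (norm3 w * norm3 w + 2 * t * dot3 w n) <= r0 * (4 * t * d + 4 * d * d)) by nra.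
    assert ((r0 - t) * (norm3 w * norm3 w) <= r0 * (4 * t * d + 4 * d * d)) by nra.
    assert (r0 / 2 * (norm3 w * norm3 w) <= (r0 - t) * (norm3 w * norm3 w)) by (apply Rmult_le_compat_r; nra).
    assert (norm3 w * norm3 w <= 8 * t * d + 8 * d * d) by nra.
    assert (d * d <= d * 1) by nra. nra. }
  assert (W4 : norm3 w <= a) by (pose proof (norm3_pos w); nra).
  assert (W5 : t * dist3 n n' <= 3 * a).
  { rewrite dist3_norm. rewrite <- (Rabs_pos_eq t) by lra. rewrite <- norm3_scal.
    replace (vscal t (vsub n n')) with (vadd (vadd (vscal (Ropp 1) w) (vsub q' q)) (vscal (t' - t) n')).
    2:{ unfold w, p, p', foot. fold n t n' t'. vring. }
    eapply Rle_trans; [apply norm3_triangle|]. eapply Rle_trans; [apply Rplus_le_compat_r, norm3_triangle|].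
    rewrite !norm3_scal, nn', Rabs_Ropp, Rabs_R1. rewrite <- (dist3_norm q' q), (dist3_sym q' q).
    assert (Rabs (t' - t) <= d) by (apply Rabs_le; lra). lra. }
  apply (Rmult_lt_reg_l t); auto. nra.
Qed.
End Depth.

(** * Pushing the boundary curve towards the boundary of the domain *)

Lemma surf_cont S (z : R2) eps : 0 < eps -> exists d, 0 < d /\ forall w : R2, Cmod (w - z) < d ->
  dist3 (surf S z) (surf S w) < eps.
Proof.
  intros He. destruct (cont_surf S z) as (A & B & E). assert (E3 : 0 < eps / 3) by lra.
  destruct (proj1 (continuous_R2 _ _) A _ E3) as (d1 & d10 & H1).
  destruct (proj1 (continuous_R2 _ _) B _ E3) as (d2 & d20 & H2).
  destruct (proj1 (continuous_R2 _ _) E _ E3) as (d3 & d30 & H3).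
  exists (Rmin d1 (Rmin d2 d3)). split; [repeat apply Rmin_pos; auto|]. intros w Hw.
  assert (W1 : Cmod (w - z) < d1) by (eapply Rlt_le_trans; [apply Hw|apply Rmin_l]).
  assert (W2 : Cmod (w - z) < d2) by (eapply Rlt_le_trans; [apply Hw|eapply Rle_trans; [apply Rmin_r|apply Rmin_l]]).
  assert (W3 : Cmod (w - z) < d3) by (eapply Rlt_le_trans; [apply Hw|eapply Rle_trans; [apply Rmin_r|apply Rmin_r]]).
  specialize (H1 w W1). specialize (H2 w W2). specialize (H3 w W3).
  rewrite dist3_sym, dist3_norm. eapply Rle_lt_trans; [apply (norm3_sum (vsub (surf S w) (surf S z)))|].
  change (Rabs (x1 (surf S w) - x1 (surf S z)) + Rabs (x2 (surf S w) - x2 (surf S z)) + Rabs (x3 (surf S w) - x3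
    (surf S z)) < eps). lra.
Qed.

Lemma norm3_add_le a b m e : norm3 a <= m -> norm3 b <= e -> norm3 (vadd a b) <= m + e.
Proof. intros. eapply Rle_trans; [apply norm3_triangle|]. lra. Qed.

Lemma norm3_add_ge a b m e : m <= norm3 a -> norm3 b <= e -> m - e <= norm3 (vadd a b).
Proof.
  intros. pose proof (norm3_triangle (vadd a b) (vscal (Ropp 1) b)) as T.
  rewrite norm3_scal, Rabs_Ropp, Rabs_R1 in T. replace (vadd (vadd a b) (vscal (Ropp 1) b)) with a in T by vring. lra.
Qed.

Lemma dot3_add_unit a b n e1 e2 : norm3 n = 1 -> Rabs (dot3 a n) <= e1 -> norm3 b <= e2 ->
  Rabs (dot3 (vadd a b) n) <= e1 + e2.
Proof.
  intros Hn Ha Hb. pose proof (dot3_le b n). pose proof (dot3_ge b n). rewrite Hn in *.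
  apply Rabs_le_between in Ha. replace (dot3 (vadd a b) n) with (dot3 a n + dot3 b n) by (vunf; ring).
  apply Rabs_le; lra.
Qed.

Section PushOut.
Variables (D : R3 -> Prop) (r0 c : R) (dep : R3 -> R) (nu : R3 -> R3).
Hypothesis HD : depth_data D r0 c dep nu.

(** A tangential move of squared length [r0 * dep / 2] lowers the depth by [c] times that, a
    fraction [c * r0 / 2] of it; the minimum with 1 keeps the fraction at most [1 / 2]. *)
Definition kap : R := Rmin 1 (c * r0) / 2.

Lemma kap_bounds : 0 < kap <= 1 / 2.
Proof.
  destruct HD as (A & B & _). unfold kap. assert (0 < Rmin 1 (c * r0)) by (apply Rmin_pos; nra).
  pose proof (Rmin_l 1 (c * r0)). lra.
Qed.

Lemma dep_surf_cont S (z : R2) : D (surf S z) -> continuous (fun w => dep (surf S w)) z.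
Proof.
  intros Dz. apply continuous_R2. intros e e0.
  destruct (surf_cont S z (Rmin e (dep (surf S z)))) as (d & d0 & Hd).
  { apply Rmin_pos; auto. apply (dep_pos D r0 c dep nu HD); auto. }
  exists d; split; auto. intros w Hw. specialize (Hd w Hw).
  assert (H1 : dist3 (surf S z) (surf S w) < e) by (eapply Rlt_le_trans; [apply Hd|apply Rmin_l]).
  assert (Dw : D (surf S w)).
  { apply (dep_ball D r0 c dep nu HD (surf S z)); auto. eapply Rlt_le_trans; [apply Hd|apply Rmin_r]. }
  pose proof (dep_lip D r0 c dep nu HD _ _ Dz Dw). pose proof (dep_lip D r0 c dep nu HD _ _ Dw Dz) as Q.
  rewrite (dist3_sym (surf S w)) in Q. apply Rabs_def1; lra.
Qed.

Lemma nu_surf_cont S (z : R2) : D (surf S z) -> dep (surf S z) <= r0 / 2 ->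
  continuous (fun w => x1 (nu (surf S w))) z /\ continuous (fun w => x2 (nu (surf S w))) z /\
    continuous (fun w => x3 (nu (surf S w))) z.
Proof.
  intros Dz Hz.
  assert (H : forall e, 0 < e -> exists d, 0 < d /\ forall w : R2, Cmod (w - z) < d ->
    dist3 (nu (surf S z)) (nu (surf S w)) < e).
  { intros e e0. destruct (nu_continuous D r0 c dep nu HD _ e Dz Hz e0) as (d & d0 & Hd).
    destruct (surf_cont S z (Rmin d (dep (surf S z)))) as (d' & d'0 & Hd').
    { apply Rmin_pos; auto. apply (dep_pos D r0 c dep nu HD); auto. }
    exists d'; split; auto. intros w Hw. specialize (Hd' w Hw). apply Hd.
    - apply (dep_ball D r0 c dep nu HD (surf S z)); auto. eapply Rlt_le_trans; [apply Hd'|apply Rmin_r].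
    - eapply Rlt_le_trans; [apply Hd'|apply Rmin_l]. }
  assert (Q : forall a b, Rabs (x1 b - x1 a) <= dist3 a b /\ Rabs (x2 b - x2 a) <= dist3 a b /\
    Rabs (x3 b - x3 a) <= dist3 a b).
  { intros a b. rewrite dist3_sym. apply (norm3_coord (vsub b a)). }
  split; [|split]; apply continuous_R2; intros e e0; destruct (H e e0) as (d & d0 & Hd); exists d; split; auto;
    intros w Hw; specialize (Hd w Hw); pose proof (Q (nu (surf S z)) (nu (surf S w))) as (A1 & A2 & A3); lra.
Qed.

(* Oscillate orthogonally to [nu] with amplitude [sqrt (r0 * dep / 2)], small enough to be allowed by the inner
   tangent ball. *)
Lemma push_out S0 T r eta : good S0 -> (forall z, Cmod z <= 1 -> D (surf S0 z)) -> 0 < T <= r0 / 2 ->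
  (forall z, Cmod z = 1 -> dep (surf S0 z) <= T) -> 0 <= r < 1 -> 0 < eta ->
  exists S1, good S1 /\ near r eta S0 S1 /\ (forall z, Cmod z <= r -> (1 - eta) * lam S0 z <= lam S1 z) /\
    (forall z, Cmod z <= 1 -> D (surf S1 z) /\ dist3 (surf S1 z) (surf S0 z) <= sqrt (r0 * T) + eta /\
      dep (surf S1 z) <= dep (surf S0 z) + eta) /\
    (forall z, Cmod z = 1 -> dep (surf S1 z) <= (1 - kap) * T + eta).
Proof.
  intros G HDz HT HdT Hr He. pose proof kap_bounds as Hkap.
  assert (r00 : 0 < r0) by apply HD. assert (c0 : 0 < c) by apply HD.
  destruct (compact_pos_min (fun z : R2 => Cmod z <= 1) (fun z => dep (surf S0 z)) (compact_closed_disk 1)) as (tm &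
    tm0 & Htm).
  { intros z Hz. apply dep_surf_cont; auto. } { intros z Hz. apply (dep_pos D r0 c dep nu HD); auto. }
  (* With depth below [2 * T] in the collar, the amplitude [sqrt (r0 * dep / 2)] stays below
     [sqrt (r0 * T)]. *)
  destruct (circle_nbhd (fun z => dep (surf S0 z) < 2 * T)) as (r1 & Hr1 & Hz1).
  { intros z Hz. destruct (continuous_between (fun w => dep (surf S0 w)) z (-1) (2 * T)) as (e & e0 & E).
    - apply dep_surf_cont. apply HDz; lra. - specialize (HdT z Hz). specialize (Htm z ltac:(lra)). lra.
    - exists e; split; auto. intros w Hw. apply (E w Hw). }
  set (rr := Rmax r r1).
  assert (Hrr : 0 <= rr < 1) by (split; [pose proof (Rmax_l r r1); unfold rr; lra|apply Rmax_lub_lt; lra]).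
  (* [C0] collects the coefficients of [h] in the test of [stay_inside], and [C1] those in the depth
     estimate on the circle. *)
  set (C0 := 8 * r0 + 4).
  set (C1 := 2 + 4 * c * r0 + 4 * c).
  assert (C00 : 0 < C0) by (unfold C0; lra). assert (C10 : 0 < C1) by (unfold C1; nra).
  set (h := Rmin (Rmin (eta / 4) 1) (Rmin (Rmin (r0 * tm / (4 * C0)) (eta / C1)) (tm / 4))).
  assert (h1 : h <= eta / 4) by (eapply Rle_trans; [apply Rmin_l|apply Rmin_l]).
  assert (h2 : h <= 1) by (eapply Rle_trans; [apply Rmin_l|apply Rmin_r]).
  assert (h3 : h * C0 <= r0 * tm / 4).
  { apply Rle_trans with (r0 * tm / (4 * C0) * C0); [|right; field; lra]. apply Rmult_le_compat_r; [lra|].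
    eapply Rle_trans; [apply Rmin_r|eapply Rle_trans; [apply Rmin_l|apply Rmin_l]]. }
  assert (h4 : h * C1 <= eta).
  { apply Rle_trans with (eta / C1 * C1); [|right; field; lra]. apply Rmult_le_compat_r; [lra|].
    eapply Rle_trans; [apply Rmin_r|eapply Rle_trans; [apply Rmin_l|apply Rmin_r]]. }
  assert (h5 : h <= tm / 4) by (eapply Rle_trans; [apply Rmin_r|apply Rmin_r]).
  assert (h0 : 0 < h).
  { unfold h. repeat apply Rmin_pos; try lra; apply Rdiv_lt_0_compat; try lra. nra. }
  set (m := fun z => sqrt (r0 * dep (surf S0 z) * / 2)).
  assert (Hm : forall z, Cmod z <= 1 -> 0 < m z /\ m z * m z = r0 * dep (surf S0 z) / 2).
  { intros z Hz. specialize (Htm z Hz). split.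
    - apply sqrt_lt_R0. nra. - unfold m. rewrite sqrt_sqrt by nra. field. }
  set (kp := sqrt (r0 * tm * / 2)).
  assert (kp0 : 0 < kp) by (apply sqrt_lt_R0; nra).
  destruct (push S0 (fun z => x1 (nu (surf S0 z))) (fun z => x2 (nu (surf S0 z))) (fun z => x3 (nu (surf S0 z))) m rr
    h kp G Hrr h0 kp0)
    as (f & g & rho & N & Hrho & rho0 & Hfg & Hst).
  { intros z Hz. pose proof (HdT z Hz). destruct (nu_surf_cont S0 z) as (A1 & A2 & A3); [apply HDz; lra|lra|].
    repeat (split; [assumption|]). split.
    - unfold m. apply continuous_sqrt_fun.
      apply continuous_mul; [apply continuous_mul; [apply continuous_cst|]|apply continuous_cst].
      apply dep_surf_cont, HDz; lra.
    - unfold kp, m. apply sqrt_le_1_alt. specialize (Htm z ltac:(lra)). nra. }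
  destruct (Hst N (le_n _)) as (S1 & G1 & Nr & P1 & L1 & _).
  assert (rrr : r <= rr) by apply Rmax_l. assert (rr1 : r1 <= rr) by apply Rmax_r.
  assert (sT : forall t, t <= 2 * T -> sqrt (r0 * t * / 2) <= sqrt (r0 * T)).
  { intros t Ht. apply sqrt_le_1_alt. nra. }
  assert (Ann : forall z, rho <= Cmod z <= 1 -> exists y, surf S1 z = vadd (surf S0 z) y /\
    Rabs (dot3 y (nu (surf S0 z))) <= 2 * h /\
     norm3 y <= m z + 2 * h /\ (Cmod z = 1 -> m z - 2 * h <= norm3 y)).
  { intros z Hz. destruct (Hfg z Hz) as [O M]. specialize (P1 z ltac:(lra)).
    set (v := rot (z ^ S (2 * N))%C (pev f z) (pev g z)) in *.
    set (er := vsub (surf S1 z) (vadd (surf S0 z) v)).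
    assert (Her : norm3 er <= h) by exact P1.
    pose proof (rot_size (S (2 * N)) z _ _ _ _ (proj2 Hz) M) as V. fold v in V.
    pose proof (rot_dot (S (2 * N)) z _ _ _ _ _ _ (proj2 Hz) O) as W. fold v in W.
    replace (mk3 (x1 (nu (surf S0 z))) (x2 (nu (surf S0 z))) (x3 (nu (surf S0 z)))) with (nu (surf S0 z)) in W by
      (apply R3_ext; reflexivity).
    destruct (proj2 (proj2 HD) (surf S0 z) (HDz z ltac:(lra))) as (_ & _ & nn & _).
    exists (vadd v er). split; [unfold er; vring|]. split; [|split].
    - replace (2 * h) with (h + h) by ring. apply dot3_add_unit; auto.
    - replace (m z + 2 * h) with (m z + h + h) by ring. apply norm3_add_le; auto.
    - intros E1. replace (m z - 2 * h) with (m z - h - h) by ring. apply norm3_add_ge; auto.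
      unfold v. rewrite norm3_rot, Cmod_pow, E1, pow1. apply Rabs_le_between in M. lra. }
  assert (Inn : forall z, Cmod z <= rho -> D (surf S1 z) /\ dist3 (surf S1 z) (surf S0 z) <= 3 * h /\
    dep (surf S1 z) <= dep (surf S0 z) + 3 * h).
  { intros z Hz. pose proof (near_surf rho h S0 S1 z Nr Hz) as Q. specialize (Htm z ltac:(lra)).
    specialize (HDz z ltac:(lra)).
    assert (Dz : D (surf S1 z)) by (apply (dep_ball D r0 c dep nu HD (surf S0 z)); auto; rewrite dist3_sym; lra).
    split; auto. split; auto. pose proof (dep_lip D r0 c dep nu HD _ _ Dz HDz). lra. }
  assert (Out : forall z, rho <= Cmod z <= 1 -> D (surf S1 z) /\ dist3 (surf S1 z) (surf S0 z) <= sqrt (r0 * T) + eta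
    /\ dep (surf S1 z) <= dep (surf S0 z) + eta
     /\ (Cmod z = 1 -> dep (surf S1 z) <= (1 - kap) * T + eta)).
  { intros z Hz. destruct (Ann z Hz) as (y & Ey & Y1 & Y2 & Y3). destruct (Hm z ltac:(lra)) as [m0 mm].
    pose proof (HDz z ltac:(lra)) as Dq. pose proof (Htm z ltac:(lra)) as tq. pose proof (Hz1 z ltac:(lra)) as t2.
    set (q := surf S0 z) in *. set (t := dep q) in *.
    apply Rabs_le_between in Y1. pose proof (norm3_pos y) as y0.
    assert (tr : t <= r0) by lra.
    assert (mr : m z <= r0) by nra.
    assert (yy : norm3 y * norm3 y <= m z * m z + 4 * r0 * h + 4 * h).
    { assert (norm3 y * norm3 y <= (m z + 2 * h) * (m z + 2 * h)) by (apply Rmult_le_compat; lra).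
      assert (m z * h <= r0 * h) by (apply Rmult_le_compat_r; lra).
      assert (h * h <= 1 * h) by (apply Rmult_le_compat_r; lra). lra. }
    assert (Dx : D (vadd q y)).
    { apply (stay_inside D r0 c dep nu HD); auto. fold t.
      assert ((r0 - t) * dot3 y (nu q) <= r0 * (2 * h)).
      { apply Rle_trans with ((r0 - t) * (2 * h)); [apply Rmult_le_compat_l; lra|apply Rmult_le_compat_r; lra]. }
      assert (r0 * tm <= r0 * t) by (apply Rmult_le_compat_l; lra).
      assert (t * t <= r0 * t) by (apply Rmult_le_compat_r; lra).
      unfold C0 in h3. assert (0 < r0 * tm) by (apply Rmult_lt_0_compat; lra). nra. }
    rewrite Ey. split; [auto|split; [|split]].
    - rewrite dist3_add. assert (m z <= sqrt (r0 * T)) by (apply sT; fold q t; lra). lra.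
    - pose proof (dep_gain D r0 c dep nu HD q y Dq Dx) as Q. fold t in Q.
      assert (0 <= norm3 y * norm3 y - dot3 y (nu q) * dot3 y (nu q)).
      { destruct (proj2 (proj2 HD) q Dq) as (_ & _ & nn & _). pose proof (dot3_le y (nu q)).
        pose proof (dot3_ge y (nu q)). rewrite nn in *. nra. }
      assert (0 <= c * (norm3 y * norm3 y - dot3 y (nu q) * dot3 y (nu q))) by (apply Rmult_le_pos; lra). lra.
    - intros E1. specialize (Y3 E1). pose proof (dep_gain D r0 c dep nu HD q y Dq Dx) as Q. fold t in Q.
      assert (tT : t <= T) by (apply HdT; auto).
      assert (B1 : m z * m z - 4 * r0 * h <= norm3 y * norm3 y).
      { destruct (Rle_dec 0 (m z - 2 * h)) as [L|L].
        - assert ((m z - 2 * h) * (m z - 2 * h) <= norm3 y * norm3 y) by (apply Rmult_le_compat; lra).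
          assert (m z * h <= r0 * h) by (apply Rmult_le_compat_r; lra). nra.
        - assert (m z * m z <= 2 * h * m z) by nra. assert (m z * h <= r0 * h) by (apply Rmult_le_compat_r; lra).
          nra. }
      assert (B2 : dot3 y (nu q) * dot3 y (nu q) <= 4 * h) by nra.
      assert (B3 : c * (m z * m z - 4 * r0 * h - 4 * h) <= c * (norm3 y * norm3 y - dot3 y (nu q) * dot3 y (nu q)))
        by (apply Rmult_le_compat_l; lra).
      rewrite mm in B3. fold q t in B3.
      assert (B4 : kap * t <= c * (r0 * t / 2)).
      { unfold kap. replace (c * (r0 * t / 2)) with (c * r0 / 2 * t) by field. apply Rmult_le_compat_r; [lra|].
        pose proof (Rmin_r 1 (c * r0)). lra. }
      assert (B5 : (1 - kap) * t <= (1 - kap) * T) by (apply Rmult_le_compat_l; lra).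
      unfold C1 in h4. nra. }
  exists S1. split; [auto|]. split; [apply near_mono with rho h; auto; lra|]. split; [|split].
  - intros z Hz. specialize (L1 z ltac:(lra)). eapply Rle_trans; [|apply L1].
    apply Rmult_le_compat_r; [apply sq2_pos|lra].
  - intros z Hz. pose proof (sqrt_pos (r0 * T)). destruct (Rle_dec (Cmod z) rho) as [L|L].
    + destruct (Inn z L) as (A & B & E). split; auto. split; lra.
    + destruct (Out z ltac:(lra)) as (A & B & E & _). auto.
  - intros z Hz. apply (Out z); auto. lra.
Qed.

(** Lengthening comes after the push because its displacement can be made smaller than any quantity
    known by then, in particular than half the least depth [tm] of the pushed surface. Half of the
    relative gain [kap] is given up to the errors. *)
Lemma macro_step S0 T r eta : good S0 -> (forall z, Cmod z <= 1 -> D (surf S0 z)) -> 0 < T <= r0 / 2 ->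
  (forall z, Cmod z = 1 -> dep (surf S0 z) <= T) -> 0 <= r < 1 -> 0 < eta ->
  exists S1 R', good S1 /\ r < R' < 1 /\ near r eta S0 S1 /\ (forall z, Cmod z <= r ->
    (1 - eta) * lam S0 z <= lam S1 z) /\
    (forall z, Cmod z <= 1 -> D (surf S1 z) /\ dist3 (surf S1 z) (surf S0 z) <= sqrt (r0 * T) + eta /\
      dep (surf S1 z) <= dep (surf S0 z) + eta) /\
    (forall z, Cmod z = 1 -> dep (surf S1 z) <= (1 - kap / 2) * T) /\ crossing (lam S1) r R' 1.
Proof.
  intros G HDz HT HdT Hr He. pose proof kap_bounds as Hkap.
  set (e1 := Rmin (Rmin (eta / 2) 1) (kap * T / 4)).
  assert (kT : 0 < kap * T) by nra.
  assert (e11 : e1 <= eta / 2) by (eapply Rle_trans; [apply Rmin_l|apply Rmin_l]).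
  assert (e12 : e1 <= 1) by (eapply Rle_trans; [apply Rmin_l|apply Rmin_r]).
  assert (e13 : e1 <= kap * T / 4) by apply Rmin_r.
  assert (e10 : 0 < e1) by (unfold e1; repeat apply Rmin_pos; lra).
  destruct (push_out S0 T r e1 G HDz HT HdT Hr e10) as (S1 & G1 & N1 & L1 & H1 & B1).
  destruct (compact_pos_min (fun z : R2 => Cmod z <= 1) (fun z => dep (surf S1 z)) (compact_closed_disk 1)) as (tm &
    tm0 & Htm).
  { intros z Hz. apply dep_surf_cont, H1; auto. } { intros z Hz. apply (dep_pos D r0 c dep nu HD), H1; auto. }
  set (e2 := Rmin e1 (tm / 2)).
  assert (e21 : e2 <= e1) by apply Rmin_l. assert (e22 : e2 <= tm / 2) by apply Rmin_r.
  assert (e20 : 0 < e2) by (apply Rmin_pos; lra).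
  destruct (lengthen S1 r e2 1 G1 Hr e20 ltac:(lra)) as (S2 & R2 & G2 & HR2 & N2 & D2 & L2 & Cr).
  assert (In2 : forall z, Cmod z <= 1 -> D (surf S2 z) /\ dep (surf S2 z) <= dep (surf S1 z) + e2).
  { intros z Hz. specialize (D2 z Hz). specialize (Htm z Hz). destruct (H1 z Hz) as [Dz _].
    assert (D (surf S2 z)) by (apply (dep_ball D r0 c dep nu HD (surf S1 z)); auto; rewrite dist3_sym; lra).
    split; auto. pose proof (dep_lip D r0 c dep nu HD (surf S2 z) (surf S1 z) H Dz). lra. }
  exists S2, R2. split; [auto|]. split; [auto|]. split; [|split; [|split; [|split]]].
  - apply near_weaken with (e1 + e2); [lra|]. apply near_trans with S1; auto; lra.
  - intros z Hz. specialize (L1 z Hz). specialize (L2 z Hz).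
    pose proof (sq2_pos (pev (sa S0) z) (pev (sb S0) z)) as l0. fold (lam S0 z) in l0.
    assert ((1 - e2) * ((1 - e1) * lam S0 z) <= (1 - e2) * lam S1 z) by (apply Rmult_le_compat_l; lra).
    assert (0 <= e1 * e2 * lam S0 z) by (apply Rmult_le_pos; nra).
    assert ((e1 + e2) * lam S0 z <= eta * lam S0 z) by (apply Rmult_le_compat_r; lra). nra.
  - intros z Hz. destruct (H1 z Hz) as (A & B & E). destruct (In2 z Hz) as [A' E']. specialize (D2 z Hz).
    pose proof (dist3_triangle (surf S2 z) (surf S1 z) (surf S0 z)). split; [auto|split; lra].
  - intros z Hz. specialize (B1 z Hz). destruct (In2 z ltac:(lra)) as [_ E']. lra.
  - auto.
Qed.
End PushOut.

(** * Guiding the boundary curve along a connected set *)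

Definition cis (t : R) : C := (cos t, sin t).

Lemma cis_mult s t : (cis s * cis t)%C = cis (s + t).
Proof. unfold cis. apply injective_projections; simpl; [rewrite cos_plus|rewrite sin_plus]; ring. Qed.

Lemma cis_pow t n : (cis t ^ n)%C = cis (INR n * t).
Proof.
  induction n.
  - simpl. unfold cis. rewrite Rmult_0_l, cos_0, sin_0. reflexivity.
  - rewrite Cpow_S, IHn, cis_mult, S_INR. f_equal. ring.
Qed.

Lemma Cmod_cis t : Cmod (cis t) = 1.
Proof.
  unfold Cmod, cis; simpl. replace (cos t * (cos t * 1) + sin t * (sin t * 1)) with 1; [apply sqrt_1|].
  pose proof (sin2_cos2 t). unfold Rsqr in H. lra.
Qed.

Lemma cis_lip t : Cmod (cis t - 1) <= 2 * Rabs t.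
Proof.
  assert (L : forall f df : R -> R, (forall x, is_derive f x (df x)) -> (forall x, Rabs (df x) <= 1) ->
    Rabs (f t - f 0) <= Rabs t).
  { intros f df Hf Hd. destruct (MVT_gen f 0 t df) as (x & _ & E).
    - intros; apply Hf. - intros x _. apply continuity_pt_filterlim.
      apply (ex_derive_continuous (K := R_AbsRing) (V := R_NormedModule)). eexists; apply Hf.
    - rewrite E, Rabs_mult, Rminus_0_r. pose proof (Rabs_pos t). specialize (Hd x). pose proof (Rabs_pos (df x)).
      nra. }
  eapply Rle_trans; [apply Cmod_le_sum|]. simpl.
  assert (A : Rabs (cos t - cos 0) <= Rabs t).
  { apply (L cos (fun x => - sin x)); intros x; [apply is_derive_cos|rewrite Rabs_Ropp; apply Rabs_le, SIN_bound]. }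
  assert (B : Rabs (sin t - sin 0) <= Rabs t).
  { apply (L sin cos); intros x; [apply is_derive_sin|apply Rabs_le, COS_bound]. }
  rewrite cos_0 in A. rewrite sin_0 in B. unfold Rminus in *. rewrite Ropp_0 in *. lra.
Qed.

Lemma polar w : Cmod w = 1 -> exists t, Rabs t <= PI /\ w = cis t.
Proof.
  intros H. pose proof (Cmod1_sqr w H) as Q. destruct w as [x y]. simpl in Q.
  assert (Hx : -1 <= x <= 1) by nra.
  pose proof (acos_bound x) as B. pose proof (cos_acos x Hx) as Ec. pose proof (sin_acos x Hx) as Es.
  assert (Hs : sqrt (1 - x²) = Rabs y) by (rewrite <- sqrt_Rsqr_abs; f_equal; unfold Rsqr; lra).
  rewrite Hs in Es. destruct (Rle_dec 0 y) as [Y|Y].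
  - exists (acos x). split; [rewrite Rabs_pos_eq; lra|]. unfold cis. rewrite Ec, Es, Rabs_pos_eq by lra. auto.
  - exists (- acos x). split; [rewrite Rabs_Ropp, Rabs_pos_eq; lra|]. unfold cis.
    rewrite cos_neg, sin_neg, Ec, Es, Rabs_left by lra.
    f_equal. ring.
Qed.

(** The solutions of [z ^ (n+1) = w] are spaced by the angle [2 PI / (n+1)], so one of them is near
    [zp]. It provides a boundary point where the fast oscillation has a prescribed phase. *)
Lemma root_near zp w n : Cmod zp = 1 -> Cmod w = 1 -> exists z, Cmod z = 1 /\ (z ^ S n)%C = w /\
  Cmod (z - zp) <= 8 / INR (S n).
Proof.
  intros Hz Hw. assert (nz : zp <> 0%C) by (apply Cmod_gt_0; lra).
  assert (nzp : (zp ^ S n)%C <> 0%C) by (apply Cpow_nz; auto).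
  assert (M : Cmod (w / zp ^ S n) = 1) by (rewrite Cmod_div, Cmod_pow, Hz, Hw, pow1 by auto; field).
  destruct (polar _ M) as (t & Ht & E).
  assert (p : 0 < INR (S n)) by (apply lt_0_INR; lia).
  exists (zp * cis (t / INR (S n)))%C. split; [|split].
  - rewrite Cmod_mult, Cmod_cis, Hz; ring.
  - rewrite Cpow_mult_l, cis_pow. replace (INR (S n) * (t / INR (S n))) with t by (field; lra).
    rewrite <- E. field. auto.
  - replace (zp * cis (t / INR (S n)) - zp)%C with (zp * (cis (t / INR (S n)) - 1))%C by ring.
    rewrite Cmod_mult, Hz, Rmult_1_l. eapply Rle_trans; [apply cis_lip|].
    unfold Rdiv. rewrite Rabs_mult, Rabs_inv, (Rabs_pos_eq (INR (S n))) by lra.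
    assert (0 < / INR (S n)) by (apply Rinv_0_lt_compat; auto). pose proof PI_4. nra.
Qed.

Lemma orthogonal_span (X Y d w : R3) m : 0 < m -> dot3 X X = m * m -> dot3 Y Y = m * m -> dot3 X Y = 0 ->
  dot3 X d = 0 -> dot3 Y d = 0 -> dot3 d d = 1 -> dot3 w d = 0 ->
  vscal (m * m) w = vadd (vscal (dot3 w X) X) (vscal (dot3 w Y) Y).
Proof.
  intros m0 HX HY HXY HXd HYd Hd Hw.
  set (r := vsub (vscal (m * m) w) (vadd (vscal (dot3 w X) X) (vscal (dot3 w Y) Y))).
  assert (rX : dot3 r X = 0).
  { replace (dot3 r X) with (m * m * dot3 w X - dot3 w X * dot3 X X - dot3 w Y * dot3 X Y) by (unfold r; vunf; ring).
    rewrite HX, HXY; ring. }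
  assert (rY : dot3 r Y = 0).
  { replace (dot3 r Y) with (m * m * dot3 w Y - dot3 w X * dot3 X Y - dot3 w Y * dot3 Y Y) by (unfold r; vunf; ring).
    rewrite HY, HXY; ring. }
  assert (rd : dot3 r d = 0).
  { replace (dot3 r d) with (m * m * dot3 w d - dot3 w X * dot3 X d - dot3 w Y * dot3 Y d) by (unfold r; vunf; ring).
    rewrite HXd, HYd, Hw; ring. }
  (* The difference [r] is orthogonal to [X], [Y] and [d]. The square of their determinant [de] is
     the Gram determinant [m^4], so Cramer's rule gives [r = 0]. *)
  set (de := dot3 X (cross3 Y d)).
  assert (d2 : de * de = m * m * (m * m)).
  { transitivity (dot3 X X * (dot3 Y Y * dot3 d d - dot3 Y d * dot3 Y d) - dot3 X Y * (dot3 X Y * dot3 d d - dot3 Y d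
      * dot3 X d)
      + dot3 X d * (dot3 X Y * dot3 Y d - dot3 Y Y * dot3 X d)); [unfold de, cross3; vunf; ring|].
    rewrite HX, HY, HXY, HXd, HYd, Hd. ring. }
  assert (dn : de <> 0). { intros E. rewrite E in d2.
  assert (0 < m * m * (m * m)) by (repeat apply Rmult_lt_0_compat; auto). lra. }
  assert (id : vscal de r = vadd (vadd (vscal (dot3 r X) (cross3 Y d)) (vscal (dot3 r Y) (cross3 d X))) (vscal (dot3
    r d) (cross3 X Y))).
  { unfold de. generalize r. intros s. apply R3_ext; unfold cross3; vunf; ring. }
  rewrite rX, rY, rd in id.
  assert (r1 : x1 r = 0 /\ x2 r = 0 /\ x3 r = 0).
  { pose proof (f_equal x1 id) as A. pose proof (f_equal x2 id) as B. pose proof (f_equal x3 id) as F.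
    unfold vscal, vadd, mk3 in A, B, F.
    change (de * x1 r = 0 * x1 (cross3 Y d) + 0 * x1 (cross3 d X) + 0 * x1 (cross3 X Y)) in A.
    change (de * x2 r = 0 * x2 (cross3 Y d) + 0 * x2 (cross3 d X) + 0 * x2 (cross3 X Y)) in B.
    change (de * x3 r = 0 * x3 (cross3 Y d) + 0 * x3 (cross3 d X) + 0 * x3 (cross3 X Y)) in F.
    repeat split; apply (Rmult_eq_reg_l de); auto; lra. }
  destruct r1 as (A & B & F). unfold r in A, B, F. apply R3_ext; vunf; lra.
Qed.

(** The last condition keeps [d] off the third axis, where [spin_exact] degenerates. *)
Lemma perp_exists w : exists d, dot3 d d = 1 /\ dot3 w d = 0 /\ 0 < x1 d * x1 d + x2 d * x2 d.
Proof.
  assert (N : forall u, 0 < dot3 u u -> dot3 w u = 0 -> 0 < x1 u * x1 u + x2 u * x2 u ->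
    exists d, dot3 d d = 1 /\ dot3 w d = 0 /\ 0 < x1 d * x1 d + x2 d * x2 d).
  { intros u H1 H2 H3. assert (n0 : 0 < norm3 u) by (apply sqrt_lt_R0; auto).
    assert (i0 : 0 < / norm3 u) by (apply Rinv_0_lt_compat; auto).
    exists (vscal (/ norm3 u) u). split; [|split].
    - replace (dot3 (vscal (/ norm3 u) u) (vscal (/ norm3 u) u)) with (/ norm3 u * / norm3 u * dot3 u u) by (vunf;
        ring).
      rewrite <- norm3_sqr. field. lra.
    - replace (dot3 w (vscal (/ norm3 u) u)) with (/ norm3 u * dot3 w u) by (vunf; ring). rewrite H2. ring.
    - replace (x1 (vscal (/ norm3 u) u) * x1 (vscal (/ norm3 u) u) + x2 (vscal (/ norm3 u) u) * x2 (vscal (/ norm3 u)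
        u))
        with (/ norm3 u * / norm3 u * (x1 u * x1 u + x2 u * x2 u)) by (vunf; ring).
      apply Rmult_lt_0_compat; auto. nra. }
  destruct (Req_dec (x1 w) 0) as [E1|E1].
  - destruct (Req_dec (x2 w) 0) as [E2|E2].
    + apply (N (mk3 1 0 0)); vunf; lra.
    + pose proof (Rsqr_pos_lt _ E2) as Q. unfold Rsqr in Q.
      apply (N (mk3 (x2 w) (- x1 w) 0)); unfold dot3, mk3, x1, x2, x3 in *; simpl in *; [|ring|]; nra.
  - pose proof (Rsqr_pos_lt _ E1) as Q. unfold Rsqr in Q.
    apply (N (mk3 (x2 w) (- x1 w) 0)); unfold dot3, mk3, x1, x2, x3 in *; simpl in *; [|ring|]; nra.
Qed.

(** The null vector is taken orthogonal to some [d] perpendicular to [w], with size [norm3 w]; its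
    circle in the plane orthogonal to [d] then passes through [w] at some phase [om]. *)
Lemma null_with_real_part w : 0 < norm3 w -> exists c e om, Cmod om = 1 /\ rot om c e = w /\ sq2 c e = norm3 w.
Proof.
  intros H. destruct (perp_exists w) as (d & d1 & dw & dp). set (m := norm3 w) in *.
  destruct (spin_exact (x1 d) (x2 d) (x3 d) m dp H) as [Z Sq]. cbv zeta in Z, Sq.
  match type of Sq with sq2 ?a ?b = _ => set (c := a) in *; set (e := b) in * end.
  set (X := rot 1%C c e). set (Y := rot Ci c e).
  assert (RX : norm3 X = m) by (unfold X; rewrite norm3_rot, Sq, Cmod_1; ring).
  assert (RY : norm3 Y = m) by (unfold Y; rewrite norm3_rot, Sq, Cmod_Ci; ring).
  assert (XX : dot3 X X = m * m) by (rewrite <- norm3_sqr, RX; auto).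
  assert (YY : dot3 Y Y = m * m) by (rewrite <- norm3_sqr, RY; auto).
  assert (XY : dot3 X Y = 0).
  { pose proof (proj2 (null3_real _ _ _ (th_null c e))) as Q. unfold X, Y, rot, dot3, mk3, x1, x2, x3; simpl.
    unfold Re, Im in Q.
    revert Q. generalize (th1 c e), (th2 c e), (th3 c e). intros [a1 a2] [b1 b2] [g1 g2]. simpl. intros. lra. }
  assert (Xd : dot3 X d = 0).
  { pose proof (dot_rot 1%C c e d) as Q. rewrite Z, Cmod_0, Rmult_0_r in Q.
    pose proof (Rabs_pos (dot3 (rot 1%C c e) d)). apply Rabs_eq_0. unfold X. lra. }
  assert (Yd : dot3 Y d = 0).
  { pose proof (dot_rot Ci c e d) as Q. rewrite Z, Cmod_0, Rmult_0_r in Q.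
    pose proof (Rabs_pos (dot3 (rot Ci c e) d)). apply Rabs_eq_0. unfold Y. lra. }
  pose proof (orthogonal_span X Y d w m H XX YY XY Xd Yd d1 dw) as Span.
  assert (mm : 0 < m * m) by nra.
  set (om := (dot3 w X / (m * m), dot3 w Y / (m * m)) : C).
  assert (Er : rot om c e = w).
  { assert (E : vscal (m * m) (rot om c e) = vscal (m * m) w).
    { rewrite Span. unfold om. generalize (dot3 w X) (dot3 w Y). intros a b. unfold X, Y, rot.
      generalize (th1 c e), (th2 c e), (th3 c e). intros [a1 a2] [b1 b2] [g1 g2].
      apply R3_ext; unfold vscal, vadd, mk3, x1, x2, x3, Re; simpl; field; lra. }
    pose proof (f_equal x1 E) as A. pose proof (f_equal x2 E) as B. pose proof (f_equal x3 E) as F.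
    apply R3_ext; apply (Rmult_eq_reg_l (m * m)); try lra; auto. }
  exists c, e, om. split; [|split; auto].
  pose proof (norm3_rot om c e) as Q. rewrite Er, Sq in Q. fold m in Q. apply (Rmult_eq_reg_r m); lra.
Qed.

(** * Peak polynomials and spikes *)

Fixpoint ppow (p : list C) (n : nat) : list C := match n with O => RtoC 1 :: nil | S n => pmul p (ppow p n) end.
Lemma pev_ppow p n z : pev (ppow p n) z = (pev p z ^ n)%C.
Proof. induction n; simpl; [ring|]. rewrite pev_pmul, IHn. auto. Qed.

(** The polynomial [(1 + Cconj zp * z) / 2], equal to 1 at [zp] and of smaller modulus elsewhere on
    the closed disk when [zp] is on the circle, so that its powers concentrate at [zp]. *)
Definition peak (zp : C) : list C := RtoC (/ 2) :: (RtoC (/ 2) * Cconj zp)%C :: nil.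

(** Parallelogram law: the squared moduli of [z + zp] and [z - zp] add up to at most 4. *)
Lemma peak_bound zp z : Cmod zp = 1 -> Cmod z <= 1 -> Cmod (pev (peak zp) z) ^ 2 <= 1 - Cmod (z - zp) ^ 2 / 4.
Proof.
  intros H1 H2. pose proof (Cmod1_sqr zp H1) as Q. assert (Cmod z * Cmod z <= 1) by (pose proof (Cmod_ge_0 z); nra).
  rewrite Cmod_sqr in H. rewrite !Cmod2_alt. unfold peak, Re, Im. destruct z as [a b], zp as [p q]. simpl in *.
  match goal with |- ?l <= ?r => assert (E : r - l = (2 - (a * a + b * b) - (p * p + q * q) + (1 - (a * a + b * b) *
    (p * p + q * q))) / 4) by field end.
  rewrite Q in E. nra.
Qed.

Lemma peak_at zp : Cmod zp = 1 -> pev (peak zp) zp = 1%C.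
Proof.
  intros H. pose proof (Cmod1_sqr zp H) as Q. destruct zp as [p q]. unfold peak. simpl in *.
  apply injective_projections; simpl; nra.
Qed.

Lemma rot_scal k w c e : rot w (k * c)%C (k * e)%C = rot (w * (k * k))%C c e.
Proof.
  unfold rot. f_equal; f_equal; unfold th1, th2, th3; ring.
Qed.

Lemma rot_diff w w' c e : dist3 (rot w c e) (rot w' c e) = Cmod (w - w') * sq2 c e.
Proof.
  rewrite <- norm3_rot, dist3_norm. f_equal. unfold rot. apply R3_ext; unfold vsub, mk3, x1, x2, x3, Re; simpl; ring.
Qed.

Lemma rot_perturb w c e c' e' B t : Cmod w <= 1 -> Cmod c <= B -> Cmod e <= B -> Cmod (c' - c) <= t ->
  Cmod (e' - e) <= t -> t <= 1 ->
  dist3 (rot w c' e') (rot w c e) <= 6 * (t * (2 * B + 1)).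
Proof.
  intros Hw H1 H2 H3 H4 Ht. destruct (th_diff c e c' e' B t H1 H2 H3 H4 Ht) as (A1 & A2 & A3).
  rewrite dist3_norm. eapply Rle_trans; [apply norm3_sum|].
  assert (Q : forall a b, Cmod (a - b) <= 2 * (t * (2 * B + 1)) -> Rabs (Re (w * a) - Re (w * b)) <= 2 * (t * (2 * B
    + 1))).
  { intros a b Hab. rewrite <- Re_minus. replace (w * a - w * b)%C with (w * (a - b))%C by ring.
    eapply Rle_trans; [apply Re_le_Cmod|]. rewrite Cmod_mult. pose proof (Cmod_ge_0 (a - b)).
    apply Rle_trans with (1 * Cmod (a - b)); [apply Rmult_le_compat_r; lra|lra]. }
  pose proof (Q _ _ A1). pose proof (Q _ _ A2). pose proof (Q _ _ A3).
  unfold rot, vsub, mk3, x1, x2, x3; cbn [fst snd]. lra.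
Qed.

(** The spinor of a null vector through [w], multiplied by a power [P] of the peak, moves the
    surface by about [rot (z^(2N+1) P^2)]: negligible away from [zp], of size at most [norm3 w], and
    close to [w] at a circle point near [zp] where [z^(2N+1)] has the phase [om]. *)
Lemma spike S0 zp w del eta : good S0 -> Cmod zp = 1 -> 0 < del -> 0 < eta ->
  exists S1, good S1 /\ (forall z, Cmod z <= 1 -> dist3 (surf S1 z) (surf S0 z) <= norm3 w + eta) /\
    (forall z, Cmod z <= 1 -> del <= Cmod (z - zp) -> dist3 (surf S1 z) (surf S0 z) <= eta) /\
    exists z, Cmod z = 1 /\ Cmod (z - zp) <= del /\ dist3 (surf S1 z) (vadd (surf S0 z) w) <= eta.
Proof.
  intros G Hzp Hd He. pose proof (norm3_pos w) as w0.
  destruct (Rle_lt_or_eq_dec _ _ w0) as [wp|wz].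
  2:{ exists S0. split; [auto|]. split; [|split].
      - intros; rewrite dist3_refl; lra. - intros; rewrite dist3_refl; lra.
      - exists zp. split; [auto|]. replace (zp - zp)%C with (RtoC 0) by ring. rewrite Cmod_0. split; [lra|].
        rewrite (norm3_0 w (eq_sym wz)). replace (vadd (surf S0 zp) (mk3 0 0 0)) with (surf S0 zp) by vring.
        rewrite dist3_refl; lra. }
  set (m := norm3 w) in *.
  destruct (null_with_real_part w wp) as (c0 & e0 & om & Hom & Hrot & Hsq). fold m in Hsq.
  set (d1 := Rmin del 1). assert (d10 : 0 < d1 <= 1) by (split; [apply Rmin_pos; lra|apply Rmin_r]).
  assert (d1d : d1 <= del) by apply Rmin_l.
  destruct (pow_small (1 - d1 ^ 2 / 4) (eta / (3 * m))) as [M HM].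
  { simpl; nra. } { apply Rdiv_lt_0_compat; lra. }
  specialize (HM M (le_n _)).
  set (P := ppow (peak zp) M). set (c := pscal c0 P). set (e := pscal e0 P).
  assert (Hc : forall z, pev c z = (pev P z * c0)%C) by (intros; unfold c; rewrite pev_pscal; ring).
  assert (Hee : forall z, pev e z = (pev P z * e0)%C) by (intros; unfold e; rewrite pev_pscal; ring).
  assert (HP : forall z, Cmod z <= 1 -> Cmod (pev P z * pev P z) <= (1 - Cmod (z - zp) ^ 2 / 4) ^ M).
  { intros z Hz. unfold P. rewrite pev_ppow, Cmod_mult, Cmod_pow.
    replace (Cmod (pev (peak zp) z) ^ M * Cmod (pev (peak zp) z) ^ M) with ((Cmod (pev (peak zp) z) ^ 2) ^ M).
    - apply pow_incr. split; [apply pow_le, Cmod_ge_0|]. apply peak_bound; auto.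
    - rewrite <- pow_mult. replace (2 * M)%nat with (M + M)%nat by lia. apply pow_add. }
  assert (HP1 : forall z, Cmod z <= 1 -> Cmod (pev P z) <= 1).
  { intros z Hz. unfold P. rewrite pev_ppow, Cmod_pow. apply pow_01. split; [apply Cmod_ge_0|].
    pose proof (peak_bound zp z Hzp Hz) as Q. pose proof (Cmod_ge_0 (pev (peak zp) z)).
    pose proof (pow2_ge_0 (Cmod (z - zp))). nra. }
  set (B := m + 1).
  assert (HB : Cmod c0 <= B /\ Cmod e0 <= B).
  { unfold sq2 in Hsq. pose proof (Cmod_ge_0 c0). pose proof (Cmod_ge_0 e0). unfold B. split; nra. }
  set (t := Rmin 1 (eta / (18 * (2 * B + 1)))).
  assert (B0 : 0 < 2 * B + 1) by (unfold B; lra).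
  assert (t0 : 0 < t) by (apply Rmin_pos; [lra|apply Rdiv_lt_0_compat; lra]).
  assert (t1 : t <= 1) by apply Rmin_l.
  assert (t2 : 6 * (t * (2 * B + 1)) <= eta / 3).
  { apply Rle_trans with (6 * (eta / (18 * (2 * B + 1)) * (2 * B + 1))); [|right; field; lra].
    apply Rmult_le_compat_l; [lra|]. apply Rmult_le_compat_r; [lra|apply Rmin_r]. }
  destruct (perturb_generic S0 c e t G t0) as (c' & e' & W & Hce).
  destruct (step_good S0 c' e' G W) as [N1 H1].
  destruct (step_close_near S0 c' e' 0 (eta / 3) ltac:(lra) ltac:(lra)) as [N2 H2].
  destruct (continuous_between (fun z => Cmod (fst (pev P z * pev P z - 1)%C,
    snd (pev P z * pev P z - 1)%C)) zp (-1) (eta / (3 * m))) as (d2 & d20 & Hd2).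
  { destruct (cont_pev (psub (pmul P P) (RtoC 1 :: nil)) zp) as [A A'].
    apply (continuous_ext (fun z => Cmod (fst (pev (psub (pmul P P) (RtoC 1 :: nil)) z),
      snd (pev (psub (pmul P P) (RtoC 1 :: nil)) z)))).
    - intros z. rewrite pev_psub, pev_pmul. cbn [pev]. f_equal. apply injective_projections; simpl; ring.
    - apply continuous_Cmod_pair; auto. }
  { assert (E : pev P zp = 1%C) by (unfold P; rewrite pev_ppow, peak_at, Cpow_1_l; auto).
    rewrite E. replace (1 * 1 - 1)%C with (RtoC 0) by ring. change (fst (RtoC 0), snd (RtoC 0)) with (RtoC 0).
    rewrite Cmod_0.
    split; [lra|apply Rdiv_lt_0_compat; lra]. }
  (* [N] must be so large that a point with phase [om] lies within [del] of [zp] and where [P]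
     squared is still close to 1. *)
  destruct (inv_small 8 (Rmin (d2 / 2) del)) as [N3 H3]; [apply Rmin_pos; lra|].
  set (N := (N1 + N2 + N3)%nat).
  specialize (H1 N ltac:(unfold N; lia)). destruct (H2 N ltac:(unfold N; lia)) as [_ H2'].
  specialize (H3 (2 * N)%nat ltac:(unfold N; lia)).
  exists (step S0 c' e' N). set (S1 := step S0 c' e' N) in *.
  assert (Key : forall z, Cmod z <= 1 -> dist3 (surf S1 z) (vadd (surf S0 z) (rot (z ^ S (2 * N) * (pev P z * pev P
    z))%C c0 e0)) <= 2 * eta / 3).
  { intros z Hz. specialize (H2' z Hz).
    assert (Q : dist3 (rot (z ^ S (2 * N))%C (pev c' z) (pev e' z)) (rot (z ^ S (2 * N))%C (pev c z) (pev e z)) <=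
      eta / 3).
    { eapply Rle_trans; [apply (rot_perturb _ _ _ _ _ B t)|]; auto.
      - rewrite Cmod_pow. apply pow_01. split; [apply Cmod_ge_0|auto].
      - rewrite Hc, Cmod_mult. specialize (HP1 z Hz). pose proof (Cmod_ge_0 c0). pose proof (Cmod_ge_0 (pev P z)).
        nra.
      - rewrite Hee, Cmod_mult. specialize (HP1 z Hz). pose proof (Cmod_ge_0 e0). pose proof (Cmod_ge_0 (pev P z)).
        nra.
      - apply Hce. - apply Hce. }
    rewrite Hc, Hee, rot_scal in Q.
    pose proof (dist3_triangle (surf S1 z) (vadd (surf S0 z) (rot (z ^ S (2 * N))%C (pev c' z) (pev e' z))) (vadd
      (surf S0 z) (rot (z ^ S (2 * N) * (pev P z * pev P z))%C c0 e0))) as T.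
    rewrite dist3_vadd, <- dist3_norm in T. lra. }
  assert (Size : forall z, Cmod z <= 1 -> dist3 (surf S1 z) (surf S0 z) <= 2 * eta / 3 + Cmod (pev P z * pev P z) *
    m).
  { intros z Hz. specialize (Key z Hz).
    pose proof (dist3_triangle (surf S1 z) (vadd (surf S0 z) (rot (z ^ S (2 * N) * (pev P z * pev P z))%C c0 e0))
      (surf S0 z)) as T.
    rewrite dist3_add, norm3_rot, Cmod_mult, Cmod_pow, Hsq in T.
    pose proof (pow_01 (Cmod z) (S (2 * N)) (conj (Cmod_ge_0 z) Hz)). pose proof (Cmod_ge_0 (pev P z * pev P z)).
    assert (Cmod z ^ S (2 * N) * Cmod (pev P z * pev P z) * m <= 1 * Cmod (pev P z * pev P z) * m) by (apply
      Rmult_le_compat_r; [lra|apply Rmult_le_compat_r; lra]). lra. }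
  split; [auto|]. split; [|split].
  - intros z Hz. specialize (Size z Hz). specialize (HP1 z Hz). pose proof (Cmod_ge_0 (pev P z)).
    rewrite Cmod_mult in Size.
    assert (Cmod (pev P z) * Cmod (pev P z) <= 1) by nra. nra.
  - intros z Hz Hf. specialize (Size z Hz). specialize (HP z Hz).
    assert (Cmod (pev P z * pev P z) <= eta / (3 * m)).
    { eapply Rle_trans; [apply HP|]. eapply Rle_trans; [|apply HM]. apply pow_incr. split.
      - assert (Cmod (z - zp) <= 2). { eapply Rle_trans; [apply Cmod_triangle|]. rewrite Cmod_opp. lra. }
        pose proof (Cmod_ge_0 (z - zp)). simpl. nra.
      - assert (d1 ^ 2 <= Cmod (z - zp) ^ 2) by (apply pow_incr; lra). lra. }
    apply (Rmult_le_compat_r m) in H; [|lra]. replace (eta / (3 * m) * m) with (eta / 3) in H by (field; lra). lra.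
  - destruct (root_near zp om (2 * N) Hzp Hom) as (z & Hz & Ez & Dz).
    assert (Dz1 : Cmod (z - zp) <= d2 / 2) by (eapply Rle_trans; [apply Dz|eapply Rle_trans;
      [apply H3|apply Rmin_l]]).
    assert (Dz2 : Cmod (z - zp) <= del) by (eapply Rle_trans; [apply Dz|eapply Rle_trans; [apply H3|apply Rmin_r]]).
    exists z. split; [auto|split; [auto|]]. specialize (Key z ltac:(lra)). rewrite Ez in Key.
    specialize (Hd2 z ltac:(lra)). rewrite <- surjective_pairing in Hd2.
    pose proof (rot_diff (om * (pev P z * pev P z))%C om c0 e0) as Q. rewrite Hrot, Hsq in Q.
    replace (om * (pev P z * pev P z) - om)%C with (om * (pev P z * pev P z - 1))%C in Q by ring.
    rewrite Cmod_mult, Hom, Rmult_1_l in Q.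
    assert (Cmod (pev P z * pev P z - 1) * m <= eta / 3).
    { apply Rle_trans with (eta / (3 * m) * m); [apply Rmult_le_compat_r; lra|right; field; lra]. }
    pose proof (dist3_triangle (surf S1 z) (vadd (surf S0 z) (rot (om * (pev P z * pev P z))%C c0 e0)) (vadd (surf S0
      z) w)) as T.
    rewrite dist3_vadd, <- dist3_norm, Q in T. lra.
Qed.

(** The real part of [p + t (z, i z, 0)], a flat disk of radius [t], with constant spinors
    [(sqrt t, 0)]. *)
Lemma flat_disk p t : 0 < t -> exists S, good S /\ forall z, Cmod z <= 1 -> dist3 (surf S z) p <= 2 * t.
Proof.
  intros Ht.
  exists (St (RtoC (sqrt t) :: nil) nil (RtoC (x1 p) :: RtoC t :: nil) (RtoC (x2 p) :: (Ci * RtoC t)%C :: nil) (RtoC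
    (x3 p) :: nil)).
  assert (Q : (RtoC (sqrt t) * RtoC (sqrt t))%C = RtoC t) by (rewrite <- RtoC_mult, sqrt_sqrt by lra; auto).
  split; [split|].
  - intros z. cbn [sa sb sF1 sF2 sF3 pder padd pev]. unfold th1, th2, th3. repeat split.
    + rewrite <- Q. ring. + rewrite <- Q. ring. + ring.
  - intros z _. unfold lam, sq2. cbn [sa sb pev].
    replace (RtoC (sqrt t) + z * 0)%C with (RtoC (sqrt t)) by ring. rewrite Cmod_0, Cmod_R.
    pose proof (sqrt_lt_R0 t Ht). rewrite Rabs_pos_eq by lra. nra.
  - intros z Hz. rewrite dist3_norm. eapply Rle_trans; [apply norm3_sum|].
    destruct (Cmod_comp_le z 1 Hz) as [A B]. destruct z as [a b]. unfold surf, vsub, mk3, x1, x2, x3, Re; simpl in *.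
    replace (fst (fst p) + (a * (t + (a * 0 - b * 0)) - b * (0 + (a * 0 + b * 0))) - fst (fst p)) with (t * a) by
      ring.
    match goal with |- _ + Rabs ?u + Rabs ?v <= _ => replace u with (- (t * b)) by ring; replace v with 0 by ring end.
    rewrite Rabs_Ropp, Rabs_R0, !Rabs_mult, (Rabs_pos_eq t) by lra. nra.
Qed.

(** Rotation by the angle with chord [d], whose cosine is [1 - d^2 / 2] and whose sine is
    [d * sqrt (1 - d^2 / 4)]. *)
Lemma rotate_away zp d : Cmod zp = 1 -> 0 < d <= 1 -> exists z, Cmod z = 1 /\ Cmod (z - zp) = d.
Proof.
  intros Hz Hd. set (s := sqrt (1 - d * d / 4)).
  assert (ss : s * s = 1 - d * d / 4) by (apply sqrt_sqrt; nra).
  set (g := (1 - d * d / 2, d * s) : C).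
  assert (Q : forall z : C, forall r, 0 <= r -> fst z * fst z + snd z * snd z = r * r -> Cmod z = r).
  { intros z r Hr H. pose proof (Cmod_sqr z). pose proof (Cmod_ge_0 z). nra. }
  exists (zp * g)%C. split.
  - rewrite Cmod_mult, Hz, Rmult_1_l. apply Q; [lra|]. unfold g; simpl.
    replace (d * s * (d * s)) with (d * d * (s * s)) by ring. rewrite ss. field.
  - replace (zp * g - zp)%C with (zp * (g - 1))%C by ring. rewrite Cmod_mult, Hz, Rmult_1_l. apply Q; [lra|].
    unfold g; simpl.
    replace ((d * s + - 0) * (d * s + - 0)) with (d * d * (s * s)) by ring. rewrite ss. field.
Qed.

Section Guide.
Variables (K : R3 -> Prop) (pt : R3 -> R3) (sig : R).
Hypothesis Hsig : 0 < sig.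
Hypothesis Hpt : forall x y, dist3 (pt x) (pt y) <= dist3 x y.

(* [pt] is meant to move [K] slightly into the domain, where the surface can follow it. *)
Definition guided (S : state) (l : list R3) (k : R) : Prop :=
  0 < k /\ good S /\ (forall z, Cmod z <= 1 -> exists x, K x /\ dist3 (surf S z) (pt x) <= 4 * sig - k) /\
  forall x, In x l -> exists z, Cmod z = 1 /\ dist3 (surf S z) (pt x) <= sig - k.

(** A boundary point within [sig] of [pt x] is dragged to [pt y] by less than [2 * sig], so on the
    spike the surface stays within [4 * sig] of [pt x]. The slack [k] pays for the errors of one
    spike and is halved. *)
Lemma guide_extend S l k x y : guided S l k -> In x l -> K x -> dist3 x y < sig -> exists S' k',
  guided S' (y :: l) k'.
Proof.
  intros (k0 & G & Hn & Hv) Hx Kx Hxy. destruct (Hv x Hx) as (zp & Hzp & Dzp).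
  assert (ks : k <= sig) by (pose proof (dist3_pos (surf S zp) (pt x)); lra).
  set (w := vsub (pt y) (surf S zp)).
  assert (Hw : norm3 w <= 2 * sig - k).
  { unfold w. rewrite <- dist3_norm. pose proof (dist3_triangle (pt y) (pt x) (surf S zp)) as T.
    rewrite (dist3_sym (pt y) (pt x)), (dist3_sym (pt x) (surf S zp)) in T. specialize (Hpt x y). lra. }
  destruct (surf_cont S zp (k / 8)) as (d & d0 & Hd); [lra|].
  set (dl := Rmin (d / 2) 1). assert (dl0 : 0 < dl <= 1) by (split; [apply Rmin_pos; lra|apply Rmin_r]).
  assert (dld : dl <= d / 2) by apply Rmin_l.
  destruct (spike S zp w dl (k / 8) G Hzp (proj1 dl0) ltac:(lra)) as (S' & G' & Hall & Hfar & (z' & Hz' & Dz' & Hit)).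
  exists S', (k / 2). split; [lra|]. split; [auto|]. split.
  - intros z Hz. destruct (Rle_dec dl (Cmod (z - zp))) as [F|F].
    + destruct (Hn z Hz) as (u & Ku & Hu). exists u. split; auto. specialize (Hfar z Hz F).
      pose proof (dist3_triangle (surf S' z) (surf S z) (pt u)). lra.
    + exists x. split; auto. specialize (Hall z Hz). specialize (Hd z ltac:(lra)). rewrite dist3_sym in Hd.
      pose proof (dist3_triangle (surf S' z) (surf S z) (pt x)).
      pose proof (dist3_triangle (surf S z) (surf S zp) (pt x)). lra.
  - intros u [<-|Hu].
    + exists z'. split; auto.
      pose proof (dist3_triangle (surf S' z') (vadd (surf S z') w) (pt y)) as T.
      assert (E : dist3 (vadd (surf S z') w) (pt y) = dist3 (surf S z') (surf S zp)).
      { rewrite !dist3_norm. f_equal. unfold w. vring. }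
      rewrite E in T. specialize (Hd z' ltac:(lra)). rewrite dist3_sym in Hd. lra.
    + destruct (Hv u Hu) as (zu & Hzu & Du). destruct (Rle_dec dl (Cmod (zu - zp))) as [F|F].
      * exists zu. split; auto. specialize (Hfar zu ltac:(lra) F).
        pose proof (dist3_triangle (surf S' zu) (surf S zu) (pt u)). lra.
      (* The witness of an earlier target may be carried off by the spike. A point at distance
         exactly [dl] from [zp] replaces it, as the old surface is nearly constant at this scale and
         the spike is negligible there. *)
      * destruct (rotate_away zp dl Hzp dl0) as (z2 & Hz2 & Dz2). exists z2. split; auto.
        specialize (Hfar z2 ltac:(lra) ltac:(lra)). pose proof (Hd zu ltac:(lra)) as A.
        pose proof (Hd z2 ltac:(lra)) as B.
        rewrite dist3_sym in B.
        pose proof (dist3_triangle (surf S' z2) (surf S z2) (pt u)).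
        pose proof (dist3_triangle (surf S z2) (surf S zp) (pt u)).
        pose proof (dist3_triangle (surf S zp) (surf S zu) (pt u)). lra.
Qed.

(** Connectedness is used through chains of steps below [sig]. [Ext] speaks of all guided surfaces
    at once, so that the targets in [l] persist while the chain is followed; if it failed somewhere,
    the [sig]-neighbourhoods of the points with and without it would disconnect [K]. *)
Lemma guide_reach p0 : connected_set K -> K p0 -> forall x, K x ->
  forall S l k, guided S l k -> In p0 l -> exists S' k', guided S' (x :: l) k'.
Proof.
  intros HC K0 x Kx.
  set (Ext := fun x => forall S l k, guided S l k -> In p0 l -> exists S' k', guided S' (x :: l) k').
  assert (E0 : Ext p0).
  { intros S l k (k0 & G & Hn & Hv) Hin. exists S, k. split; [auto|split; [auto|split; [auto|]]].
    intros u [<-|Hu]; apply Hv; auto. }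
  assert (Step : forall a b, K a -> Ext a -> dist3 a b < sig -> Ext b).
  { intros a b Ka Ea Hab S l k Hg Hin. destruct (Ea S l k Hg Hin) as (S1 & k1 & Hg1).
    destruct (guide_extend S1 (a :: l) k1 a b Hg1 (or_introl eq_refl) Ka Hab) as (S2 & k2 & (q0 & G & Hn & Hv)).
    exists S2, k2. split; [auto|split; [auto|split; [auto|]]]. intros u [<-|Hu]; apply Hv; simpl; auto. }
  change (Ext x). apply NNPP. intros NE.
  apply (HC (fun y => exists a, K a /\ Ext a /\ dist3 a y < sig) (fun y => exists a, K a /\ ~ Ext a /\
    dist3 a y < sig)).
  - apply open3_dist. intros y (a & Ka & Ea & Hy). exists (sig - dist3 a y). split; [lra|]. intros y' Hy'.
    exists a. split; [auto|split; auto]. pose proof (dist3_triangle a y y'). lra.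
  - apply open3_dist. intros y (a & Ka & Ea & Hy). exists (sig - dist3 a y). split; [lra|]. intros y' Hy'.
    exists a. split; [auto|split; auto]. pose proof (dist3_triangle a y y'). lra.
  - intros y Ky. destruct (classic (Ext y)) as [E|E]; [left|right]; exists y; rewrite dist3_refl; auto.
  - intros y Ky (a & Ka & Ea & Ha) (b & Kb & Eb & Hb). apply Eb.
    apply (Step y b); auto; [apply (Step a y); auto|rewrite dist3_sym; auto].
  - exists p0. split; auto. exists p0. rewrite dist3_refl; auto.
  - exists x. split; auto. exists x. rewrite dist3_refl; auto.
Qed.

Lemma guide_all p0 : connected_set K -> K p0 -> forall l, (forall x, In x l -> K x) -> exists S k,
  guided S (l ++ p0 :: nil) k.
Proof.
  intros HC K0 l. induction l as [|x l IH]; intros Hl.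
  - destruct (flat_disk (pt p0) (sig / 8)) as (S & G & HS); [lra|].
    exists S, (sig / 2). split; [lra|split; [auto|split]].
    + intros z Hz. exists p0. split; auto. specialize (HS z Hz). lra.
    + intros x [<-|[]]. exists 1%C. rewrite Cmod_1. split; auto. specialize (HS 1%C ltac:(rewrite Cmod_1; lra)). lra.
  - destruct IH as (S & k & Hg); [intros; apply Hl; right; auto|].
    apply (guide_reach p0 HC K0 x (Hl x (or_introl eq_refl)) S (l ++ p0 :: nil) k Hg).
    apply in_or_app; right; left; auto.
Qed.
End Guide.

Lemma guide (D K : R3 -> Prop) x0 M eps : open D -> convex3 D -> (forall x, D x -> norm3 x <= M) -> D x0 ->
  (forall x, K x -> boundary3 D x) -> (exists x, K x) -> connected_set K -> compact_set K -> 0 < eps ->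
  exists S, good S /\ (forall z, Cmod z <= 1 -> D (surf S z)) /\
    (forall z, Cmod z = 1 -> exists x, K x /\ dist3 (surf S z) x < eps) /\
    (forall x, K x -> exists z, Cmod z = 1 /\ dist3 (surf S z) x < eps).
Proof.
  intros OD CV HM D0 HK [p0 K0] HC HP He.
  destruct (proj1 (open3_dist D) OD x0 D0) as (d0 & d00 & Hd0).
  assert (M0 : 0 <= M) by (pose proof (norm3_pos x0); pose proof (HM x0 D0); lra).
  set (h := Rmin (1 / 2) (eps / (8 * (M + 1)))).
  assert (h0 : 0 < h) by (apply Rmin_pos; [lra|apply Rdiv_lt_0_compat; lra]).
  assert (h1 : h <= 1 / 2) by apply Rmin_l.
  assert (h2 : h * (2 * M) <= eps / 4).
  { apply Rle_trans with (eps / (8 * (M + 1)) * (2 * (M + 1))); [|right; field; lra].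
    apply Rmult_le_compat; try lra. apply Rmin_r. }
  (* Contracting towards [x0] by the factor [1 - h] puts a ball of radius [h * d0] around each
     [pt x] inside [D], more than the distance [4 * sig] allowed to the surface; the contraction
     moves points of [K] by at most [eps / 4]. *)
  set (sig := Rmin (h * d0 / 8) (eps / 16)).
  assert (s0 : 0 < sig) by (apply Rmin_pos; nra).
  assert (s1 : sig <= h * d0 / 8) by apply Rmin_l. assert (s2 : sig <= eps / 16) by apply Rmin_r.
  set (pt := fun x => seg x x0 h).
  assert (Hpt : forall x y, dist3 (pt x) (pt y) <= dist3 x y).
  { intros x y. rewrite !dist3_norm.
    replace (vsub (pt x) (pt y)) with (vscal (1 - h) (vsub x y)) by (unfold pt; vring).
    rewrite norm3_scal, Rabs_pos_eq by lra. pose proof (norm3_pos (vsub x y)). nra. }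
  assert (Hptx : forall x, K x -> dist3 (pt x) x <= eps / 4).
  { intros x Kx. unfold pt, seg. rewrite dist3_add, norm3_scal, Rabs_pos_eq by lra.
    pose proof (closure_norm D M x HM (proj1 (HK x Kx))). pose proof (HM x0 D0).
    pose proof (norm3_triangle x0 (vscal (Ropp 1) x)) as T. rewrite norm3_scal, Rabs_Ropp, Rabs_R1 in T.
    replace (vadd x0 (vscal (Ropp 1) x)) with (vsub x0 x) in T by vring.
    eapply Rle_trans; [|apply h2]. apply Rmult_le_compat_l; lra. }
  assert (Hin : forall x y, K x -> dist3 y (pt x) < h * d0 -> D y).
  { intros x y Kx Hy. set (x' := vadd x0 (vscal (/ h) (vsub y (pt x)))).
    replace y with (seg x x' h) by (unfold x', pt, seg; apply R3_ext; vunf; field; lra).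
    apply closure_seg; auto; [apply HK; auto| |lra]. apply Hd0. unfold x'.
    rewrite dist3_sym, dist3_add, norm3_scal, <- dist3_norm.
    assert (i0 : 0 < / h) by (apply Rinv_0_lt_compat; auto). rewrite Rabs_pos_eq by lra.
    apply (Rmult_lt_reg_l h); auto. rewrite <- Rmult_assoc, Rinv_r, Rmult_1_l by lra. lra. }
  destruct (HP {x | K x} (fun i y => dist3 (proj1_sig i) y < sig)) as [L HL].
  { intros i. apply open_ball3. }
  { intros x Kx. exists (exist _ x Kx). simpl. rewrite dist3_refl; auto. }
  destruct (guide_all K pt sig s0 Hpt p0 HC K0 (map (fun i => proj1_sig i) L)) as (S & k & k0 & G & Hn & Hv).
  { intros x Hx. apply in_map_iff in Hx. destruct Hx as ([y Ky] & <- & _). auto. }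
  exists S. split; [auto|split; [|split]].
  - intros z Hz. destruct (Hn z Hz) as (x & Kx & Hx). apply (Hin x); auto. lra.
  - intros z Hz. destruct (Hn z ltac:(lra)) as (x & Kx & Hx). exists x. split; auto.
    pose proof (dist3_triangle (surf S z) (pt x) x). specialize (Hptx x Kx). lra.
  - intros x Kx. destruct (HL x Kx) as (i & Hi & Di). destruct (Hv (proj1_sig i)) as (z & Hz & Dz).
    { apply in_or_app. left. apply (in_map (fun i => proj1_sig i)); auto. }
    exists z. split; auto. destruct i as [y Ky]; simpl in *.
    pose proof (dist3_triangle (surf S z) (pt y) x). pose proof (dist3_triangle (pt y) y x). specialize (Hptx y Ky).
    lra.
Qed.

(** * The limit surface *)

Lemma half_pow k : 0 < (1 / 2) ^ k <= 1.
Proof. split; [apply pow_lt; lra|apply pow_01; lra]. Qed.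

Section Sequence.
Variables (D : R3 -> Prop) (r0 c : R) (dep : R3 -> R) (nu : R3 -> R3).
Hypothesis HD : depth_data D r0 c dep nu.
Variables (T0 E0 : R).
Hypotheses (HT0 : 0 < T0 <= r0 / 2) (HE0 : 0 < E0 <= 1).

Let q := 1 - kap r0 c / 2.
Let T (k : nat) := T0 * q ^ k.

Lemma q_bounds : 0 < q < 1.
Proof. pose proof (kap_bounds D r0 c dep nu HD). unfold q. lra. Qed.

Lemma T_bounds k : 0 < T k <= T0.
Proof.
  pose proof q_bounds. unfold T. pose proof (pow_lt q k ltac:(lra)). pose proof (pow_01 q k ltac:(lra)). split; nra.
Qed.

Lemma T_antitone j k : (k <= j)%nat -> T j <= T k.
Proof.
  intros H. pose proof q_bounds. unfold T. apply Rmult_le_compat_l; [lra|].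
  replace j with (k + (j - k))%nat by lia. rewrite pow_add.
  pose proof (pow_01 q k ltac:(lra)). pose proof (pow_01 q (j - k) ltac:(lra)). nra.
Qed.

Record node := Nd { nst : state; nrad : R; ntol : R }.
(** [nrad] is the radius of the disk on which later stages are controlled, and [ntol] bounds all
    later motion there. Being at most half the least depth, it keeps the limit inside [D]; the
    collar beyond [nrad] already has depth of order [T k]. *)
Definition admissible (k : nat) (n : node) : Prop :=
  good (nst n) /\ (forall z, Cmod z <= 1 -> D (surf (nst n) z)) /\
  (forall z, Cmod z = 1 -> dep (surf (nst n) z) <= T k) /\
  0 <= nrad n < 1 /\ 1 - nrad n <= (1 / 2) ^ k /\
  (forall z, nrad n <= Cmod z <= 1 -> dep (surf (nst n) z) <= 2 * T k) /\
  0 < ntol n <= E0 * (1 / 2) ^ k /\ ntol n <= T k /\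
  (forall z, Cmod z <= 1 -> 2 * ntol n <= dep (surf (nst n) z)).
(** Three coordinates at [ntol / 8] each give a motion of [3 / 8 * ntol], and halving the tolerance
    from stage to stage makes the total less than [ntol]. *)
Definition succ_node (k : nat) (n n' : node) : Prop :=
  near (nrad n) (ntol n / 8) (nst n) (nst n') /\
  (forall z, Cmod z <= nrad n -> (1 - ntol n / 8) * lam (nst n) z <= lam (nst n') z) /\
  (forall z, Cmod z <= 1 -> dist3 (surf (nst n') z) (surf (nst n) z) <= sqrt (r0 * T k) + ntol n / 8 /\
     dep (surf (nst n') z) <= dep (surf (nst n) z) + ntol n / 8) /\
  crossing (lam (nst n')) (nrad n) (nrad n') 1 /\ nrad n <= nrad n' /\ ntol n' <= ntol n / 2.

(** Radius and tolerance are chosen after the surface, since they depend on its collar and its least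
    depth. *)
Lemma node_close k S r : good S -> (forall z, Cmod z <= 1 -> D (surf S z)) -> (forall z, Cmod z = 1 ->
  dep (surf S z) <= T k) ->
  0 <= r < 1 -> forall t, 0 < t -> exists n, admissible k n /\ nst n = S /\ r <= nrad n /\ ntol n <= t.
Proof.
  intros G HDz HdT Hr t t0. pose proof (T_bounds k) as Tk.
  destruct (compact_pos_min (fun z : R2 => Cmod z <= 1) (fun z => dep (surf S z)) (compact_closed_disk 1)) as (tm &
    tm0 & Htm).
  { intros z Hz. apply (dep_surf_cont D r0 c dep nu HD); auto. } { intros z Hz.
    apply (dep_pos D r0 c dep nu HD); auto. }
  destruct (circle_nbhd (fun z => dep (surf S z) < 2 * T k)) as (r1 & Hr1 & Hz1).
  { intros z Hz. destruct (continuous_between (fun w => dep (surf S w)) z (-1) (2 * T k)) as (e & e0 & E).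
    - apply (dep_surf_cont D r0 c dep nu HD). apply HDz; lra. - specialize (HdT z Hz). specialize (Htm z ltac:(lra)).
      lra.
    - exists e; split; auto. intros w Hw. apply (E w Hw). }
  set (rad := Rmax (Rmax r r1) (1 - (1 / 2) ^ k)).
  pose proof (half_pow k) as hk.
  assert (A1 : Rmax r r1 <= rad) by apply Rmax_l. assert (A2 : 1 - (1 / 2) ^ k <= rad) by apply Rmax_r.
  assert (A3 : r <= Rmax r r1) by apply Rmax_l. assert (A4 : r1 <= Rmax r r1) by apply Rmax_r.
  assert (A5 : rad < 1) by (unfold rad; repeat apply Rmax_lub_lt; lra).
  set (tol := Rmin (Rmin t (E0 * (1 / 2) ^ k)) (Rmin (T k) (tm / 2))).
  assert (B1 : tol <= t) by (eapply Rle_trans; [apply Rmin_l|apply Rmin_l]).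
  assert (B2 : tol <= E0 * (1 / 2) ^ k) by (eapply Rle_trans; [apply Rmin_l|apply Rmin_r]).
  assert (B3 : tol <= T k) by (eapply Rle_trans; [apply Rmin_r|apply Rmin_l]).
  assert (B4 : tol <= tm / 2) by (eapply Rle_trans; [apply Rmin_r|apply Rmin_r]).
  assert (B0 : 0 < tol) by (unfold tol; repeat apply Rmin_pos; try lra; nra).
  exists (Nd S rad tol). split; [|split; [auto|split; simpl; lra]].
  unfold admissible. cbn [nst nrad ntol].
  split; [auto|split; [auto|split; [auto|split; [lra|split; [lra|split; [|split; [lra|split; [lra|]]]]]]]].
  - intros z Hz. specialize (Hz1 z ltac:(lra)). lra.
  - intros z Hz. specialize (Htm z Hz). lra.
Qed.

Lemma node_next k n : admissible k n -> exists n', admissible (S k) n' /\ succ_node k n n'.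
Proof.
  intros (G & HDz & HdT & Hr & Hr2 & Hann & Htol & HtT & Hmin).
  pose proof (T_bounds k) as Tk.
  destruct (macro_step D r0 c dep nu HD (nst n) (T k) (nrad n) (ntol n / 8)) as (S1 & R' & G1 & HR & N1 & L1 & H1 &
    B1 & Cr); auto; try lra.
  destruct (node_close (S k) S1 R' G1) with (t := ntol n / 2) as (n' & I' & E' & Er & Et); try lra.
  { intros z Hz. apply H1; auto. }
  { intros z Hz. specialize (B1 z Hz). unfold T in *. simpl. unfold q in *. lra. }
  exists n'. split; auto. unfold succ_node. rewrite E'. split; [auto|split; [auto|split; [|split; [|split; lra]]]].
  - intros z Hz. apply H1; auto.
  - eapply crossing_mono; [| | |apply Cr]; lra.
Qed.

Variable S0 : state.
Hypotheses (G0 : good S0) (HS0 : forall z, Cmod z <= 1 -> D (surf S0 z)) (HT : forall z, Cmod z = 1 ->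
  dep (surf S0 z) <= T0).

Lemma node_seq : exists u : nat -> node, nst (u O) = S0 /\ forall k, admissible k (u k) /\
  succ_node k (u k) (u (S k)).
Proof.
  destruct (node_close O S0 0 G0 HS0) with (t := 1) as (n0 & I0 & E0' & _); try lra.
  { intros z Hz. unfold T. simpl. rewrite Rmult_1_r. auto. }
  pose (next := fun k (n : {n | admissible k n}) => constructive_indefinite_description _ (node_next k (proj1_sig n)
    (proj2_sig n))).
  (* Dependent choice: the admissibility proof is carried along, as [next] needs it. *)
  pose (sq := fix sq k : {n | admissible k n} := match k with O => exist _ n0 I0 | S k => exist _ (proj1_sig (next k
    (sq k))) (proj1 (proj2_sig (next k (sq k)))) end).
  exists (fun k => proj1_sig (sq k)). split; auto.
  intros k. split; [apply (proj2_sig (sq k))|]. simpl. apply (proj2 (proj2_sig (next k (sq k)))).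
Qed.

Section Limit.
Variable u : nat -> node.
Hypothesis Hu0 : nst (u O) = S0.
Hypothesis Hu : forall k, admissible k (u k) /\ succ_node k (u k) (u (S k)).

Let st k := nst (u k).
Let rad k := nrad (u k).
Let tol k := ntol (u k).
Let psi := psi_lim (fun k => sF1 (st k)) (fun k => sF2 (st k)) (fun k => sF3 (st k)).

Lemma rad_mono j k : (k <= j)%nat -> rad k <= rad j.
Proof.
  induction 1; [lra|]. eapply Rle_trans; [apply IHle|]. apply (Hu m).
Qed.

Lemma rad_bounds k : 0 <= rad k < 1 /\ 1 - rad k <= (1 / 2) ^ k.
Proof. destruct (Hu k) as [I _]. unfold rad. split; apply I. Qed.

Lemma tol_bounds k : 0 < tol k <= E0 * (1 / 2) ^ k /\ tol k <= T k.
Proof. destruct (Hu k) as [I _]. unfold tol. split; apply I. Qed.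

Lemma tol_decay k j : tol (k + j) <= tol k * (1 / 2) ^ j.
Proof.
  induction j; [rewrite Nat.add_0_r; simpl; lra|]. rewrite Nat.add_succ_r.
  destruct (Hu (k + j)) as [_ N]. assert (tol (S (k + j)) <= tol (k + j) / 2) by apply N. simpl. lra.
Qed.

Lemma rad_exhausts r : r < 1 -> exists k, r < rad k.
Proof.
  intros Hr. destruct (pow_small (1 / 2) ((1 - r) / 2)) as [k Hk]; try lra. exists k.
  specialize (Hk k (le_n _)). pose proof (rad_bounds k). lra.
Qed.

(** A disk of radius [r] is contained in all the disks of radius [rad k] from some stage on, and
    there the terms decay like the tolerances. *)
Lemma st_summ (F : state -> list C) : (forall k, nrm (rad k) (psub (F (st (S k))) (F (st k))) <= tol k / 8) ->
  summ (tele (fun k => F (st k))).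
Proof.
  intros HF r Hr. destruct (rad_exhausts r ltac:(lra)) as [k0 Hk0].
  apply (ex_series_incr_n _ (S k0)).
  apply (ex_series_major _ (fun n => (1 / 2) ^ n)).
  - intros n. rewrite Rabs_pos_eq by (apply nrm_pos; lra). change (S k0 + n)%nat with (S (k0 + n)). cbn [tele].
    eapply Rle_trans; [apply (nrm_mono r (rad (k0 + n)))|].
    + pose proof (rad_mono (k0 + n) k0 ltac:(lia)). lra.
    + eapply Rle_trans; [apply HF|]. pose proof (tol_decay k0 n). pose proof (tol_bounds k0) as [[_ Q] _].
      pose proof (half_pow n). pose proof (half_pow k0). assert (tol k0 <= 1) by nra. nra.
  - apply ex_series_geom. rewrite Rabs_pos_eq; lra.
Qed.

Lemma st_near k : near (rad k) (tol k / 8) (st k) (st (S k)).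
Proof. apply (Hu k). Qed.

Lemma summ1 : summ (tele (fun k => sF1 (st k))).
Proof. apply (st_summ sF1). intros k. apply (st_near k). Qed.
Lemma summ2 : summ (tele (fun k => sF2 (st k))).
Proof. apply (st_summ sF2). intros k. apply (st_near k). Qed.
Lemma summ3 : summ (tele (fun k => sF3 (st k))).
Proof. apply (st_summ sF3). intros k. apply (st_near k). Qed.

Lemma st_good k : good (st k).
Proof. apply (Hu k). Qed.

Lemma st_null n z : null3 (pev (pder (sF1 (st n))) z) (pev (pder (sF2 (st n))) z) (pev (pder (sF3 (st n))) z).
Proof. apply good_null, st_good. Qed.

Lemma surf_lim z e : Cmod z < 1 -> 0 < e -> exists N, forall n, (N <= n)%nat -> dist3 (psi z) (surf (st n) z) < e.
Proof.
  intros Hz He. assert (e3 : 0 < e / 3) by lra.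
  assert (Q : forall F, summ (tele F) -> exists N, forall n, (N <= n)%nat ->
    Rabs (Re (pev (F n) z) - hser (tele F) z) < e / 3).
  { intros F HF. pose proof (hser_lim F z HF Hz) as L. apply is_lim_seq_spec in L. exact (L (mkposreal _ e3)). }
  destruct (Q _ summ1) as [N1 H1]. destruct (Q _ summ2) as [N2 H2]. destruct (Q _ summ3) as [N3 H3].
  exists (N1 + N2 + N3)%nat. intros n Hn. rewrite dist3_sym, dist3_norm. eapply Rle_lt_trans; [apply norm3_sum|].
  specialize (H1 n ltac:(lia)). specialize (H2 n ltac:(lia)). specialize (H3 n ltac:(lia)).
  change (Rabs (Re (pev (sF1 (st n)) z) - hser (tele (fun k => sF1 (st k))) z) + Rabs (Re (pev (sF2 (st n)) z) - hser
    (tele (fun k => sF2 (st k))) z)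
    + Rabs (Re (pev (sF3 (st n)) z) - hser (tele (fun k => sF3 (st k))) z) < e). lra.
Qed.

Lemma psi_close k z : Cmod z <= rad k -> dist3 (psi z) (surf (st k) z) <= tol k.
Proof.
  intros Hz. pose proof (rad_bounds k) as [Rk _].
  (* Partial sums of the geometric series [3 / 8 * tol k * (1 / 2) ^ i], whose total is
     [3 / 4 * tol k]. *)
  assert (H : forall j, dist3 (surf (st (k + j)) z) (surf (st k) z) <= 3 / 4 * tol k * (1 - (1 / 2) ^ j)).
  { induction j.
    - rewrite Nat.add_0_r, dist3_refl. simpl. lra.
    - rewrite Nat.add_succ_r. pose proof (rad_mono (k + j) k ltac:(lia)).
      pose proof (near_surf _ _ _ _ z (st_near (k + j)) ltac:(lra)) as Q. pose proof (tol_decay k j).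
      pose proof (dist3_triangle (surf (st (S (k + j))) z) (surf (st (k + j)) z) (surf (st k) z)). simpl. lra. }
  apply Rnot_lt_le. intros L. pose proof (tol_bounds k) as [[t0 _] _].
  destruct (surf_lim z (tol k / 4) ltac:(lra) ltac:(lra)) as [N HN]. specialize (HN (k + N)%nat ltac:(lia)).
  specialize (H N).
  pose proof (dist3_triangle (psi z) (surf (st (k + N)) z) (surf (st k) z)). pose proof (half_pow N). nra.
Qed.

Lemma psi_in z : Cmod z < 1 -> D (psi z).
Proof.
  intros Hz. destruct (rad_exhausts (Cmod z) Hz) as [k Hk]. pose proof (psi_close k z ltac:(lra)) as Q.
  destruct (Hu k) as [(_ & HDz & _ & _ & _ & _ & _ & _ & Hmin) _]. pose proof (tol_bounds k) as [[t0 _] _].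
  specialize (Hmin z ltac:(lra)). fold (st k) (tol k) in Hmin.
  apply (dep_ball D r0 c dep nu HD (surf (st k) z)); [apply HDz; lra|]. rewrite dist3_sym. lra.
Qed.

(** A point between [rad j] and [rad (S j)] is in the collar of stage [j], where the depth is at
    most [2 * T j]. The next step adds at most [tol j / 8], and from then on the point belongs to
    the controlled disk and moves by at most [tol (S j)]; both tolerances are at most [T k]. *)
Lemma psi_dep k z : rad k <= Cmod z < 1 -> dep (psi z) <= 4 * T k.
Proof.
  intros Hz.
  assert (Hj : exists j, (k <= j)%nat /\ rad j <= Cmod z <= rad (S j)).
  { destruct (rad_exhausts (Cmod z) ltac:(lra)) as [m Hm].
    assert (km : (k < m)%nat). { apply Nat.nle_gt. intros L. pose proof (rad_mono k m L). lra. }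
    clear - Hz Hm km. induction m; [lia|].
    destruct (Rlt_dec (Cmod z) (rad m)) as [L|L].
    - destruct (Nat.eq_dec k m) as [->|N]; [lra|]. apply IHm; [auto|lia].
    - exists m. split; [lia|lra]. }
  destruct Hj as (j & Hkj & Hzj). pose proof (rad_bounds (S j)) as [RS _].
  destruct (Hu j) as [(_ & _ & _ & _ & _ & Hann & _) (_ & _ & Hd & _)].
  specialize (Hann z ltac:(unfold rad in *; lra)). destruct (Hd z ltac:(lra)) as [_ Hd'].
  pose proof (psi_close (S j) z ltac:(lra)) as Q. pose proof (tol_bounds (S j)) as [_ t2].
  pose proof (tol_bounds j) as [[t0 _] t1].
  fold (st j) (st (S j)) (tol j) in *. pose proof (T_antitone (S j) j ltac:(lia)). pose proof (T_antitone j k Hkj).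
  assert (D1 : D (surf (st (S j)) z)) by (apply (Hu (S j)); lra).
  pose proof (dep_lip D r0 c dep nu HD (psi z) (surf (st (S j)) z) (psi_in z ltac:(lra)) D1).
  pose proof (T_bounds k). pose proof (T_bounds j). lra.
Qed.

(** The product of the factors [1 - tol / 8] is at least one minus the sum of a geometric series
    with total [tol k / 4]; as [tol k <= 1], the limit retains more than half of the metric. *)
Lemma lam_growth k j z : Cmod z <= rad k -> (1 - tol k / 4 * (1 - (1 / 2) ^ j)) * lam (st k) z <= lam (st (k + j)) z.
Proof.
  intros Hz. pose proof (sq2_pos (pev (sa (st k)) z) (pev (sb (st k)) z)) as l0. fold (lam (st k) z) in l0.
  pose proof (tol_bounds k) as [[t0 t1] _]. pose proof (half_pow k). assert (tk : tol k <= 1) by nra.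
  induction j; [rewrite Nat.add_0_r; simpl; lra|]. rewrite Nat.add_succ_r.
  destruct (Hu (k + j)) as [_ (_ & L & _)]. pose proof (rad_mono (k + j) k ltac:(lia)) as Rm.
  specialize (L z ltac:(unfold rad in *; lra)). fold (st (k + j)) (st (S (k + j))) (tol (k + j)) in L.
  pose proof (tol_decay k j) as Td. pose proof (tol_bounds (k + j)) as [[u0 _] _]. pose proof (half_pow j) as hj.
  set (h := (1 / 2) ^ j) in *. simpl pow. fold h.
  assert (A : (1 - tol (k + j) / 8) * ((1 - tol k / 4 * (1 - h)) * lam (st k) z) <= (1 - tol (k + j) / 8) * lam (st
    (k + j)) z).
  { apply Rmult_le_compat_l; auto. nra. }
  assert (B : 1 - tol k / 4 * (1 - 1 / 2 * h) <= (1 - tol (k + j) / 8) * (1 - tol k / 4 * (1 - h))).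
  { assert (0 <= tol (k + j) / 8 * (tol k / 4 * (1 - h))) by (apply Rmult_le_pos; [lra|apply Rmult_le_pos; lra]).
    lra. }
  apply (Rmult_le_compat_r (lam (st k) z)) in B; auto. lra.
Qed.

Lemma psi_lam k z : Cmod z <= rad k -> 1 / 2 * lam (st k) z <= norm3 (pdv eu psi z).
Proof.
  intros Hz. pose proof (rad_bounds k) as [Rk _].
  destruct (psi_lim_conformal (fun k => sF1 (st k)) (fun k => sF2 (st k)) (fun k => sF3 (st k)) (fun n z => lam (st
    n) z)
    summ1 summ2 summ3 st_null (fun n z => proj2 (good_null _ (st_good n) z)) z (proj2 (disk_Cmod z) ltac:(lra))) as
      (_ & _ & L).
  apply (is_lim_seq_incr_n _ k) in L.
  pose proof (is_lim_seq_le (fun _ => 1 / 2 * lam (st k) z) (fun n => lam (st (n + k)) z) (1 / 2 * lam (st k) z)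
    (norm3 (pdv eu psi z))) as Q.
  apply Q; auto; [|apply is_lim_seq_const]. intros n. rewrite Nat.add_comm.
  eapply Rle_trans; [|apply (lam_growth k n z Hz)].
  pose proof (sq2_pos (pev (sa (st k)) z) (pev (sb (st k)) z)) as l0. fold (lam (st k) z) in l0.
  pose proof (tol_bounds k) as [[t0 t1] _]. pose proof (half_pow k). pose proof (half_pow n).
  apply Rmult_le_compat_r; auto. assert (tol k <= 1) by nra. nra.
Qed.

Lemma psi_pos z : Cmod z < 1 -> 0 < norm3 (pdv eu psi z).
Proof.
  intros Hz. destruct (rad_exhausts (Cmod z) Hz) as [k Hk]. pose proof (psi_lam k z ltac:(lra)).
  pose proof (proj2 (st_good k) z Hz). lra.
Qed.

Lemma psi_minimal : minimal_immersion psi.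
Proof.
  apply (psi_lim_minimal _ _ _ (fun n z => lam (st n) z) summ1 summ2 summ3 st_null (fun n z => proj2 (good_null _
    (st_good n) z))).
  intros z Hz. apply psi_pos, disk_Cmod, Hz.
Qed.

Lemma psi_metric : metric (fun z => norm3 (pdv eu psi z)).
Proof. apply (psi_lim_metric _ _ _ summ1 summ2 summ3). Qed.

Lemma psi_crossing k : crossing (fun z => norm3 (pdv eu psi z)) (rad k) (rad (S k)) (1 / 2).
Proof.
  destruct (Hu k) as [_ (_ & _ & _ & Cr & Hrr & _)].
  replace (1 / 2) with (1 / 2 * 1) by ring.
  apply crossing_scale with (lam (st (S k))); auto; try lra; [apply lam_metric|apply psi_metric|].
  intros z Hz _. apply psi_lam. auto.
Qed.

Lemma psi_complete : complete_immersion psi.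
Proof.
  apply (complete_of_crossing psi (fun z => norm3 (pdv eu psi z))).
  - intros g t Hg Ht. apply (psi_lim_speed _ _ _ summ1 summ2 summ3 st_null); auto.
  - apply psi_metric.
  - apply psi_pos.
  (* Each annulus between consecutive radii costs at least [1 / 2] in the limit metric, so two of
     them give 1. *)
  - intros r Hr. destruct (rad_exhausts r Hr) as [k Hk]. exists (rad (S (S k))).
    pose proof (rad_mono (S k) k ltac:(lia)). pose proof (rad_mono (S (S k)) (S k) ltac:(lia)).
    pose proof (rad_bounds (S (S k))) as [RS _].
    split; [lra|]. replace 1 with (1 / 2 + 1 / 2) by field.
    apply crossing_mono with (rad k) (rad (S (S k))) (1 / 2 + 1 / 2); try lra.
    apply crossing_concat with (rad (S k)); auto; try apply psi_metric; apply psi_crossing.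
Qed.

Lemma sqrt_T k : sqrt (r0 * T k) = sqrt (r0 * T0) * sqrt q ^ k.
Proof.
  pose proof q_bounds. assert (r00 : 0 < r0) by apply HD. unfold T.
  induction k; [simpl; rewrite !Rmult_1_r; auto|]. simpl.
  replace (r0 * (T0 * (q * q ^ k))) with (r0 * (T0 * q ^ k) * q) by ring.
  assert (0 <= q ^ k) by (apply pow_le; lra).
  rewrite sqrt_mult, IHk; [ring| |lra]. apply Rmult_le_pos; [lra|]. apply Rmult_le_pos; lra.
Qed.

(** The displacement at stage [n] is governed by [sqrt (r0 * T n)], a geometric sequence of ratio
    [sqrt q]; the hypothesis on [B] says that [B] bounds its sum. The tolerances contribute less
    than [2 * E0]. *)
Lemma psi_displacement z B : Cmod z < 1 -> sqrt (r0 * T0) <= (1 - sqrt q) * B ->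
  dist3 (psi z) (surf S0 z) <= B + 2 * E0.
Proof.
  intros Hz HB. pose proof q_bounds as Hq.
  assert (sq : 0 <= sqrt q < 1).
  { split; [apply sqrt_pos|]. rewrite <- sqrt_1. apply sqrt_lt_1_alt. lra. }
  assert (B0 : 0 <= B). { pose proof (sqrt_pos (r0 * T0)). nra. }
  assert (H : forall n, dist3 (surf (st n) z) (surf S0 z) <= B * (1 - sqrt q ^ n) + E0 / 4 * (1 - (1 / 2) ^ n)).
  { induction n.
    - unfold st. rewrite Hu0, dist3_refl. simpl. lra.
    - destruct (Hu n) as [_ (_ & _ & Hd & _)]. destruct (Hd z ltac:(lra)) as [Hd' _].
      fold (st n) (st (S n)) (tol n) in Hd'.
      rewrite sqrt_T in Hd'. pose proof (tol_bounds n) as [[_ t1] _].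
      pose proof (dist3_triangle (surf (st (S n)) z) (surf (st n) z) (surf S0 z)).
      assert (0 <= sqrt q ^ n) by (apply pow_le; lra).
      assert (sqrt (r0 * T0) * sqrt q ^ n <= (1 - sqrt q) * B * sqrt q ^ n) by (apply Rmult_le_compat_r; auto).
      simpl. nra. }
  destruct (rad_exhausts (Cmod z) Hz) as [k Hk]. pose proof (psi_close k z ltac:(lra)). specialize (H k).
  pose proof (dist3_triangle (psi z) (surf (st k) z) (surf S0 z)). pose proof (tol_bounds k) as [[_ t1] _].
  pose proof (half_pow k). assert (0 <= sqrt q ^ k) by (apply pow_le; lra). nra.
Qed.

Lemma psi_boundary_layer m : 0 < m -> exists r, r < 1 /\ forall z, r <= Cmod z < 1 -> dep (psi z) <= m.
Proof.
  intros Hm. pose proof q_bounds. destruct (pow_small q (m / (4 * T0))) as [k Hk]; [lra|apply Rdiv_lt_0_compat; lra|].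
  specialize (Hk k (le_n _)). exists (rad k). split; [apply rad_bounds|]. intros z Hz.
  eapply Rle_trans; [apply (psi_dep k z Hz)|].
  unfold T. apply Rle_trans with (4 * (T0 * (m / (4 * T0)))); [|right; field; lra].
  apply Rmult_le_compat_l; [lra|]. apply Rmult_le_compat_l; lra.
Qed.

Lemma psi_continuous z e : Cmod z < 1 -> 0 < e -> exists d, 0 < d /\ forall w : R2, Cmod (w - z) < d ->
  dist3 (psi z) (psi w) < e.
Proof.
  intros Hz He. assert (E3 : 0 < e / 3) by lra.
  destruct (proj1 (continuous_R2 _ _) (hser_continuous _ z summ1 Hz) _ E3) as (d1 & d10 & H1).
  destruct (proj1 (continuous_R2 _ _) (hser_continuous _ z summ2 Hz) _ E3) as (d2 & d20 & H2).
  destruct (proj1 (continuous_R2 _ _) (hser_continuous _ z summ3 Hz) _ E3) as (d3 & d30 & H3).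
  exists (Rmin d1 (Rmin d2 d3)). split; [repeat apply Rmin_pos; auto|]. intros w Hw.
  assert (W1 : Cmod (w - z) < d1) by (eapply Rlt_le_trans; [apply Hw|apply Rmin_l]).
  assert (W2 : Cmod (w - z) < d2) by (eapply Rlt_le_trans; [apply Hw|eapply Rle_trans; [apply Rmin_r|apply Rmin_l]]).
  assert (W3 : Cmod (w - z) < d3) by (eapply Rlt_le_trans; [apply Hw|eapply Rle_trans; [apply Rmin_r|apply Rmin_r]]).
  specialize (H1 w W1). specialize (H2 w W2). specialize (H3 w W3).
  rewrite dist3_sym, dist3_norm. eapply Rle_lt_trans; [apply (norm3_sum (vsub (psi w) (psi z)))|].
  match goal with |- ?l < _ => change (Rabs (hser (tele (fun k => sF1 (st k))) w - hser (tele (fun k => sF1 (st k)))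
    z)
    + Rabs (hser (tele (fun k => sF2 (st k))) w - hser (tele (fun k => sF2 (st k))) z)
    + Rabs (hser (tele (fun k => sF3 (st k))) w - hser (tele (fun k => sF3 (st k))) z) < e) end. lra.
Qed.
End Limit.

Lemma limit_exists B : sqrt (r0 * T0) <= (1 - sqrt q) * B -> exists psi : R2 -> R3,
  minimal_immersion psi /\ complete_immersion psi /\ (forall z, Cmod z < 1 -> D (psi z)) /\
  (forall m, 0 < m -> exists r, r < 1 /\ forall z, r <= Cmod z < 1 -> dep (psi z) <= m) /\
  (forall z e, Cmod z < 1 -> 0 < e -> exists d, 0 < d /\ forall w : R2, Cmod (w - z) < d ->
    dist3 (psi z) (psi w) < e) /\
  (forall z, Cmod z < 1 -> dist3 (psi z) (surf S0 z) <= B + 2 * E0).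
Proof.
  intros HB. destruct node_seq as (u & Hu0 & Hu).
  exists (psi_lim (fun k => sF1 (nst (u k))) (fun k => sF2 (nst (u k))) (fun k => sF3 (nst (u k)))).
  split; [apply psi_minimal; auto|split; [apply psi_complete; auto|split; [apply psi_in; auto|split;
    [apply psi_boundary_layer; auto|split; [apply psi_continuous; auto|]]]]].
  intros z Hz. apply psi_displacement; auto.
Qed.
End Sequence.

(** * Properness and the limit set *)

Lemma Cmod_sub_triangle (z w : C) : Cmod z <= Cmod w + Cmod (w - z).
Proof.
  rewrite <- (Cmod_opp (w - z)). eapply Rle_trans; [|apply Cmod_triangle]. right. f_equal. ring.
Qed.

Section LimitSet.
Variables (D : R3 -> Prop) (r0 c M : R) (dep : R3 -> R) (nu : R3 -> R3) (psi : R2 -> R3).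
Hypotheses (OD : open D) (HM : forall x, D x -> norm3 x <= M) (HD : depth_data D r0 c dep nu).
Hypothesis Hin : forall z, Cmod z < 1 -> D (psi z).
Hypothesis Hlayer : forall m, 0 < m -> exists r, r < 1 /\ forall z, r <= Cmod z < 1 -> dep (psi z) <= m.
Hypothesis Hcont : forall z e, Cmod z < 1 -> 0 < e ->
  exists d, 0 < d /\ forall w : R2, Cmod (w - z) < d -> dist3 (psi z) (psi w) < e.

Lemma disk_separated x r : r < 1 -> (forall z, Cmod z <= r -> psi z <> x) ->
  exists e, 0 < e /\ forall z, Cmod z <= r -> e <= dist3 x (psi z).
Proof.
  intros Hr Hx. apply (compact_pos_min (fun z : R2 => Cmod z <= r) (fun z => dist3 x (psi z)) (compact_closed_disk
    r)).
  - intros z Hz. apply continuous_R2. intros e He. destruct (Hcont z e ltac:(lra) He) as (d & d0 & Hd).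
    exists d; split; auto.
    intros w Hw. specialize (Hd w Hw). pose proof (dist3_triangle x (psi z) (psi w)).
    pose proof (dist3_triangle x (psi w) (psi z)).
    rewrite (dist3_sym (psi w) (psi z)) in *. apply Rabs_def1; lra.
  - intros z Hz. destruct (dist3_pos x (psi z)) as [L|L]; auto. exfalso. apply (Hx z Hz). symmetry. apply dist3_0.
    auto.
Qed.

Lemma compact_separated (A : R3 -> Prop) x : compact_set A -> ~ A x -> exists e, 0 < e /\ forall y, A y ->
  e <= dist3 x y.
Proof.
  intros HA Nx. apply (compact_pos_min A (fun y => dist3 x y) HA).
  - intros y _. apply dist3_continuous.
  - intros y Ay. destruct (dist3_pos x y) as [L|L]; auto. exfalso. apply Nx. replace x with y; auto.
    symmetry; apply dist3_0. auto.
Qed.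

(** Depth has a positive minimum on a compact subset of [D], while along the surface it tends to 0
    at the boundary circle; so the preimage is a closed set within a smaller disk. *)
Lemma psi_proper : proper_into psi D.
Proof.
  intros A HA CA.
  destruct (compact_pos_min A dep CA) as (m & m0 & Hm).
  { intros x Ax. apply continuous_R3. intros e He. pose proof (dep_pos D r0 c dep nu HD x (HA x Ax)) as dx.
    exists (Rmin e (dep x)). split; [apply Rmin_pos; auto|]. intros w Hw. pose proof (Rmin_l e (dep x)).
    pose proof (Rmin_r e (dep x)).
    assert (Dw : D w) by (apply (dep_ball D r0 c dep nu HD x); auto; lra).
    pose proof (dep_lip D r0 c dep nu HD x w (HA x Ax) Dw). pose proof (dep_lip D r0 c dep nu HD w x Dw (HA x Ax)).
    rewrite (dist3_sym w x) in *. apply Rabs_def1; lra. }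
  { intros x Ax. apply (dep_pos D r0 c dep nu HD); auto. }
  destruct (Hlayer (m / 2) ltac:(lra)) as (r & r1 & Hr).
  assert (Hsub : forall z, disk z /\ A (psi z) -> Cmod z < r).
  { intros z [Dz Az]. apply disk_Cmod in Dz. apply Rnot_le_lt. intros L. specialize (Hr z ltac:(lra)).
    specialize (Hm _ Az). lra. }
  apply (compact_R2 _ r).
  - intros z Hz. specialize (Hsub z Hz). lra.
  - apply open_R2. intros z Hz. destruct (Rlt_dec r (Cmod z)) as [L|L].
    + exists (Cmod z - r). split; [lra|]. intros w Hw Aw. specialize (Hsub w Aw).
      pose proof (Cmod_sub_triangle z w). lra.
    + assert (Nz : ~ A (psi z)) by (intros Az; apply Hz; split; auto; apply disk_Cmod; lra).
      destruct (compact_separated A (psi z) CA Nz) as (e & e0 & He).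
      destruct (Hcont z e ltac:(lra) e0) as (d & d0 & Hd). exists d; split; auto.
      intros w Hw [_ Aw]. specialize (Hd w Hw). specialize (He _ Aw). lra.
Qed.

Lemma image_in x : image_disk psi x -> D x.
Proof. intros (z & Dz & <-). apply Hin, disk_Cmod, Dz. Qed.

(** Near a point of positive depth only parameters from a fixed compact disk are mapped, and a point
    missed by that disk keeps a positive distance from its image. The limit set is thus the part of
    the closure outside the open set [D], which makes it closed. *)
Lemma limit_set_iff x : limit_set psi x <-> closure3 (image_disk psi) x /\ ~ D x.
Proof.
  split; intros [Cx Nx]; split; auto; [|intros I; apply Nx, image_in, I]. intros Dx.
  pose proof (dep_pos D r0 c dep nu HD x Dx) as dx.
  destruct (Hlayer (dep x / 2) ltac:(lra)) as (r & r1 & Hr).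
  destruct (disk_separated x r r1) as (e & e0 & He).
  { intros z Hz E. apply Nx. exists z. split; auto. apply disk_Cmod. lra. }
  destruct (Cx (Rmin e (dep x / 2))) as (y & (z & Dz & <-) & Hy); [apply Rmin_pos; lra|].
  pose proof (Rmin_l e (dep x / 2)). pose proof (Rmin_r e (dep x / 2)). apply disk_Cmod in Dz.
  destruct (Rle_dec (Cmod z) r) as [L|L].
  - specialize (He z L). lra.
  - specialize (Hr z ltac:(lra)). pose proof (dep_lip D r0 c dep nu HD x (psi z) Dx (Hin z Dz)). lra.
Qed.

Lemma limit_set_compact : compact_set (limit_set psi).
Proof.
  apply compact_R3.
  - exists M. intros x [Cx _]. apply (closure_norm D); auto. intros e He. destruct (Cx e He) as (y & Iy & Hy).
    exists y; split; auto using image_in.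
  - apply open3_dist. intros x Hx. destruct (classic (D x)) as [Dx|ND].
    + destruct (proj1 (open3_dist D) OD x Dx) as (d & d0 & Hd). exists d; split; auto.
      intros y Hy L. apply limit_set_iff in L. apply L, Hd; auto.
    + assert (exists e, 0 < e /\ forall y, image_disk psi y -> e <= dist3 x y) as (e & e0 & He).
      { apply NNPP. intros A. apply Hx, limit_set_iff. split; auto. intros e e0. apply NNPP. intros B. apply A.
        exists e; split; auto.
        intros y Dy. apply Rnot_lt_le. intros L. apply B; eauto. }
      exists (e / 2). split; [lra|]. intros y Hy [Cy _].
      destruct (Cy (e / 2)) as (z & Dz & Hz); [lra|]. specialize (He z Dz). pose proof (dist3_triangle x y z). lra.
Qed.

Variables (S0 : state) (K : R3 -> Prop) (eps : R).
Hypothesis Heps : 0 < eps.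
Hypothesis Hnear : forall z, Cmod z < 1 -> dist3 (psi z) (surf S0 z) <= eps.
Hypothesis HK1 : forall z, Cmod z = 1 -> exists x, K x /\ dist3 (surf S0 z) x < eps.
Hypothesis HK2 : forall x, K x -> exists z, Cmod z = 1 /\ dist3 (surf S0 z) x < eps.

(** Approximants of [x] cannot come from the disk of radius [r], whose compact image misses [x];
    they come from the collar, where the initial surface is close to [K]. *)
Lemma limit_near_target x : limit_set psi x -> exists y, K y /\ dist3 x y < 4 * eps.
Proof.
  intros [Cx Nx].
  destruct (circle_nbhd (fun z => exists y, K y /\ dist3 (surf S0 z) y < 2 * eps)) as (r & Hr & Hz).
  { intros z Hz. destruct (HK1 z Hz) as (y & Ky & Hy). destruct (surf_cont S0 z eps Heps) as (d & d0 & Hd).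
    exists d; split; auto.
    intros w Hw. exists y; split; auto. specialize (Hd w Hw). pose proof (dist3_triangle (surf S0 w) (surf S0 z) y).
    rewrite (dist3_sym (surf S0 w) (surf S0 z)) in *. lra. }
  destruct (disk_separated x r) as (e & e0 & He); [lra| |].
  { intros z Hrz E. apply Nx. exists z. split; auto. apply disk_Cmod. lra. }
  destruct (Cx (Rmin e eps)) as (y & (z & Dz & <-) & Hy); [apply Rmin_pos; lra|].
  pose proof (Rmin_l e eps). pose proof (Rmin_r e eps). apply disk_Cmod in Dz.
  destruct (Rle_dec (Cmod z) r) as [L|L]; [specialize (He z L); lra|].
  destruct (Hz z ltac:(lra)) as (y & Ky & Ey). exists y; split; auto.
  specialize (Hnear z Dz). pose proof (dist3_triangle x (psi z) y).
  pose proof (dist3_triangle (psi z) (surf S0 z) y). lra.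
Qed.

(** Follow the radius ending at a circle point [z] whose image is near [y]: the surface stays
    bounded, so it has a cluster point, which cannot lie in [D] since the depth tends to 0 along the
    radius. *)
Lemma target_near_limit y : K y -> exists x, limit_set psi x /\ dist3 x y < 4 * eps.
Proof.
  intros Ky. destruct (HK2 y Ky) as (z & Hz & Ezy).
  pose (w := fun n : nat => (RtoC (1 - (1 / 2) ^ n / 2) * z)%C).
  assert (Hw : forall n, Cmod (w n) = 1 - (1 / 2) ^ n / 2).
  { intros n. unfold w. rewrite Cmod_mult, Hz, Cmod_R, Rabs_pos_eq; [lra|]. pose proof (half_pow n). lra. }
  assert (Hwz : forall n, Cmod (w n - z) = (1 / 2) ^ n / 2).
  { intros n. unfold w. replace (RtoC (1 - (1 / 2) ^ n / 2) * z - z)%C with (- (RtoC ((1 / 2) ^ n / 2) * z))%C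
      by (rewrite RtoC_minus; ring).
    rewrite Cmod_opp, Cmod_mult, Hz, Cmod_R, Rabs_pos_eq; [lra|]. pose proof (half_pow n). lra. }
  assert (Hw1 : forall n, Cmod (w n) < 1) by (intros n; rewrite Hw; pose proof (half_pow n); lra).
  assert (CB : compact_set (fun x : R3 => norm3 x <= M)).
  { apply compact_R3; [exists M; auto|]. apply open3_dist. intros x Hx. exists (norm3 x - M). split; [lra|].
    intros x' Hx' L. pose proof (norm3_triangle x' (vsub x x')) as T.
    replace (vadd x' (vsub x x')) with x in T by vring.
    rewrite <- dist3_norm in T. lra. }
  destruct (compact_cluster _ (fun n => psi (w n)) CB) as (x & _ & Hx).
  { intros n. apply HM, Hin, Hw1. }
  assert (Hx' : forall e N, 0 < e -> exists n, (N <= n)%nat /\ dist3 x (psi (w n)) < e).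
  { intros e N He. destruct (Hx (e / 3) ltac:(lra) N) as (n & Hn & B). exists n; split; auto. apply ball3_dist in B.
    lra. }
  exists x. split.
  - apply limit_set_iff. split.
    + intros e He. destruct (Hx' e O He) as (n & _ & Hn). exists (psi (w n)). split; auto. exists (w n). split; auto.
      apply disk_Cmod, Hw1.
    + intros Dx. pose proof (dep_pos D r0 c dep nu HD x Dx) as dx.
      destruct (Hlayer (dep x / 2) ltac:(lra)) as (r & r1 & Hr).
      destruct (pow_small (1 / 2) (1 - r)) as [N HN]; try lra.
      destruct (Hx' (dep x / 2) N ltac:(lra)) as (n & Hn & E). specialize (HN n Hn).
      specialize (Hr (w n)). rewrite Hw in Hr. pose proof (half_pow n).
      specialize (Hr ltac:(lra)). pose proof (dep_lip D r0 c dep nu HD x _ Dx (Hin _ (Hw1 n))). lra.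
  - destruct (surf_cont S0 z eps Heps) as (d & d0 & Hd).
    destruct (pow_small (1 / 2) d) as [N HN]; try lra.
    destruct (Hx' eps N Heps) as (n & Hn & E). specialize (HN n Hn).
    specialize (Hd (w n)). rewrite Hwz in Hd. pose proof (half_pow n). specialize (Hd ltac:(lra)).
    specialize (Hnear (w n) (Hw1 n)).
    pose proof (dist3_triangle x (psi (w n)) y). pose proof (dist3_triangle (psi (w n)) (surf S0 (w n)) y).
    pose proof (dist3_triangle (surf S0 (w n)) (surf S0 z) y). rewrite (dist3_sym (surf S0 (w n)) (surf S0 z)) in *.
    lra.
Qed.
End LimitSet.

Theorem theoremB (C K : R3 -> Prop) :
  bounded_domain C ->
  smooth_strictly_convex_boundary C ->
  (forall x, K x -> boundary3 C x) ->
  (exists x, K x) -> connected_set K -> compact_set K ->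
  forall eps, 0 < eps ->
  exists psi : R2 -> R3,
    minimal_immersion psi /\
    (forall p, disk p -> C (psi p)) /\
    complete_immersion psi /\
    proper_into psi C /\
    (exists x, limit_set psi x) /\ compact_set (limit_set psi) /\
    hausdorff_lt (limit_set psi) K eps.
Proof.
  intros BD HS HK (p0 & Kp0) KC KK eps He.
  destruct (depth_exists C p0 BD HS (HK p0 Kp0)) as (r0 & c & dep & nu & HD).
  pose proof (domain_convex C BD HS) as CV. destruct BD as (OD & _ & (x0 & Hx0) & M & HM).
  pose proof (kap_bounds C r0 c dep nu HD) as Hk. assert (r00 : 0 < r0) by apply HD.
  set (s := sqrt (1 - kap r0 c / 2)).
  assert (s1 : 0 <= s < 1).
  { split; [apply sqrt_pos|]. rewrite <- sqrt_1. apply sqrt_lt_1_alt. lra. }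
  (* The limit differs from the initial surface by at most [h + 2 * E0 <= 3 * h], and the comparison
     with [K] costs a factor 4, so the Hausdorff distance is at most [12 * h], less than [eps]. *)
  set (h := eps / 16). set (E0 := Rmin 1 h).
  assert (h0 : 0 < h) by (unfold h; lra).
  assert (E1 : E0 <= 1) by apply Rmin_l. assert (E2 : E0 <= h) by apply Rmin_r.
  assert (E3 : 0 < E0) by (apply Rmin_pos; lra).
  set (b := (1 - s) * h). assert (b0 : 0 < b) by (apply Rmult_lt_0_compat; lra).
  (* Chosen so that the sum of the later displacements, [sqrt (r0 * T0) / (1 - s)], is at most
     [h]. *)
  set (T0 := Rmin (r0 / 2) (b * b / r0)).
  assert (bb : 0 < b * b / r0) by (apply Rdiv_lt_0_compat; auto; nra).
  assert (T1 : T0 <= r0 / 2) by apply Rmin_l. assert (T2 : T0 <= b * b / r0) by apply Rmin_r.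
  assert (T3 : 0 < T0) by (apply Rmin_pos; lra).
  assert (HT : sqrt (r0 * T0) <= b).
  { rewrite <- (sqrt_square b) by lra. apply sqrt_le_1_alt. apply Rmult_le_compat_l with (r := r0) in T2; [|lra].
    replace (r0 * (b * b / r0)) with (b * b) in T2 by (field; lra). auto. }
  (* [K] lies outside [C], so being within [T0] of [K] bounds the depth of the boundary curve by
     [T0]. *)
  destruct (guide C K x0 M (Rmin T0 h)) as (S0 & G0 & I0 & HK1 & HK2); auto; [exists p0; auto|apply Rmin_pos; auto|].
  assert (m1 : Rmin T0 h <= T0) by apply Rmin_l. assert (m2 : Rmin T0 h <= h) by apply Rmin_r.
  destruct (limit_exists C r0 c dep nu HD T0 E0 ltac:(lra) ltac:(lra) S0 G0 I0) with (B := h)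
    as (psi & Pm & Pc & Pin & Player & Pcont & Pnear); auto.
  { intros z Hz. destruct (HK1 z Hz) as (x & Kx & Hx). destruct HD as (_ & _ & HD).
    destruct (HD _ (I0 z ltac:(lra))) as (_ & Hdep & _). specialize (Hdep x (proj2 (HK x Kx))). lra. }
  assert (N1 : forall z, Cmod z < 1 -> dist3 (psi z) (surf S0 z) <= 3 * h) by (intros z Hz; specialize (Pnear z Hz);
    lra).
  assert (N2 : forall z, Cmod z = 1 -> exists x, K x /\ dist3 (surf S0 z) x < 3 * h).
  { intros z Hz. destruct (HK1 z Hz) as (x & Kx & Hx). exists x; split; auto; lra. }
  assert (N3 : forall x, K x -> exists z, Cmod z = 1 /\ dist3 (surf S0 z) x < 3 * h).
  { intros x Kx. destruct (HK2 x Kx) as (z & Hz & Hx). exists z; split; auto; lra. }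
  assert (h3 : 0 < 3 * h) by lra.
  exists psi. split; [auto|split; [|split; [auto|split; [|split; [|split]]]]].
  - intros p Hp. apply Pin, disk_Cmod, Hp.
  - apply (psi_proper C r0 c dep nu); auto.
  - destruct (target_near_limit C r0 c M dep nu psi HM HD Pin Player Pcont S0 K (3 * h) h3 N1 N3 p0 Kp0) as (x & Lx &
      _). eauto.
  - apply (limit_set_compact C r0 c M dep nu); auto.
  - exists (12 * h). split; [unfold h; lra|split].
    + intros x Lx t Ht. destruct (limit_near_target psi Pcont S0 K (3 * h) h3 N1 N2 x Lx) as (y & Ky & Hy).
      exists y; split; auto; lra.
    + intros y Ky t Ht. destruct (target_near_limit C r0 c M dep nu psi HM HD Pin Player Pcont S0 K (3 * h) h3 N1 N3
        y Ky) as (x & Lx & Hx).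
      exists x; split; auto; lra.
Qed.
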